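(* Let $q\in(0,1)$. With the $*$-algebra $\mathbb C[U_q(2)]$, the Hilbert space $\widehat{\mathbf H}$ carrying its representation $\hat\rho$, the operator $\hat D_q$ and the chirality $\gamma$ defined in the context, the data $(\mathbb C[U_q(2)],\hat D_q,\gamma,\widehat{\mathbf H})$ is an even and regular $4$-dimensional spectral triple.
   Context: $[n]:=(q^n-q^{-n})/(q-q^{-1})$. **$SU_q(2)$ data.** $U_q(\mathfrak{su}_2)$ is the Hopf $*$-algebra generated by $e,f,k,k^{-1}$ with $kk^{-1}=1$, $kek^{-1}=qe$, $kfk^{-1}=q^{-1}f$, $[e,f]=\frac{k^2-k^{-2}}{q-q^{-1}}$, coproduct $\triangle_q(k)=k\otimes k$, $\triangle_q(e)=e\otimes k+k^{-1}\otimes e$, $\triangle_q(f)=f\otimes k+k^{-1}\otimes f$, antipode $S_q(e)=-qe$, $S_q(f)=-q^{-1}f$, $S_q(k)=k^{-1}$, and involution $e^*=f$, $k^*=k$. For $l\in\frac12\mathbb N_0$ its irreducible unitary representation $(V_{q,l},\pi_{q,l})$ has orthonormal basis $|l,m\rangle$, $m=-l,\dots,l$, with $\pi_{q,l}(k)|l,m\rangle=q^m|l,m\rangle$, $\pi_{q,l}(e)|l,m\rangle=\sqrt{[l-m][l+m+1]}\,|l,m+1\rangle$, $\pi_{q,l}(f)|l,m\rangle=\sqrt{[l-m+1][l+m]}\,|l,m-1\rangle$. $\mathbb C[SU_q(2)]=\bigoplus_lV_{q,l}^*\otimes V_{q,l}$ is the dual Hopf $*$-algebra spanned by $t^l_{m,n}=\langle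 l,m|\otimes|l,n\rangle$, regarded as functionals $t^l_{m,n}(x)=\langle l,m|\pi_{q,l}(x)|l,n\rangle$, with product $(ts)(x)=t(x')s(x'')$ (where $\triangle_q(x)=x'\otimes x''$), involution $t^*(x)=\overline{t(S_q(x)^* )}$, and Haar state $h(t^l_{m,n})=\delta_{l,0}$. $U_q(\mathfrak{su}_2)$ acts by $\partial(x)(\langle l,m|\otimes v)=\langle l,m|\otimes\pi_{q,l}(x)v$. **The algebra $\mathbb C[U_q(2)]$.** Let $P_+$ be the set of pairs $(l,c)$ with $l\in\frac12\mathbb N_0$, $c\in\frac12\mathbb Z$, and $l,c$ both integers or both half-integers (i.e. $l-c\in\mathbb Z$). $\mathbb C[U_q(2)]$ has linear basis $t^{l,c}_{m,n}$, $(l,c)\in P_+$, $m,n\in\{-l,\dots,l\}$. Its product and involution are those of $\mathbb C[SU_q(2)]$ in the indices $l,m,n$, with the label $c$ additive under products ($c,c'\mapsto c+c'$) and changing sign under $*$; that is, it is the $*$-subalgebra of $\mathbb C[SU_q(2)]\otimes\mathbb C[z^{1/2},z^{-1/2}]$ ($z$ unitary) spanned by $t^{l,c}_{m,n}=t^l_{m,n}\otimes z^c$ with $(l,c)\in P_+$. The Haar state is $\hat h(t^{l,c}_{m,n})=\delta_{c,0}h(t^l_{m,n})$; it is faithful, and $L^2(U_q(2))$ is the completion of $\mathbb C[U_q(2)]$ for $\langle t,s\rangle=\hat h(t^*s)$. **Hilbert space and representation.** The spinor module is $\hat\Sigma=V^+\oplus V^-$ with $V^\pm=V_{q,\frac12}$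 (central charge zero), $\widehat{\mathbf H}=L^2(U_q(2))\otimes\hat\Sigma$, and $\hat\rho$ is the $*$-representation of $\mathbb C[U_q(2)]$ by left multiplication on the first tensor factor, $\hat\rho(t)(s\otimes v)=ts\otimes v$. **Dirac operator.** On $L^2(U_q(2))\otimes V_{q,\frac12}$, for each $(j,c)\in P_+$ the subspace spanned by the $t^{j,c}_{m,n}\otimes v$ is identified with $V_{q,j}^*\otimes(V_{q,j}\otimes V_{q,\frac12})$, which splits under the $U_q(\mathfrak{su}_2)$-action $(\partial\otimes\pi_{q,\frac12})\triangle_q$ into isotypic components $W^\uparrow_{j,c}$ of type $V_{q,j+\frac12}$ and $W^\downarrow_{j,c}$ of type $V_{q,j-\frac12}$ (the latter only if $j\ge\frac12$). $D_q$ (the geometric Dirac operator of $SU_q(2)$) acts as $2j+\frac32$ on $W^\uparrow_{j,c}$ and as $-(2j+2)+\frac32$ on $W^\downarrow_{j,c}$. The central generator $x_0$ of $\mathfrak u_2$ acts by $\partial(x_0)t^{l,c}_{m,n}=c\,t^{l,c}_{m,n}$. With respect to $\hat\Sigma=V^+\oplus V^-$, $$\hat D_q=\begin{pmatrix}0& iD_q+\partial(x_0)\\ -iD_q+\partial(x_0)&0\end{pmatrix},\qquad \gamma=\begin{pmatrix}\mathbf 1&0\\0&-\mathbf 1\end{pmatrix}.$$ **Spectral triples.** A unital spectral triple $(A,D,\mathbf H)$ consists of a unital associative $*$-algebra $A$ with a faithful $*$-representation $\rho$ on a separable Hilbert space $\mathbf H$ and an unbounded self-adjoint, densely defined operator $D$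 on $\mathbf H$ such that $[D,\rho(t)]$, defined on the domain of $D$, extends to a bounded operator for all $t\in A$. Its dimension is the smallest integer $n$ such that $(1+D^2)^{-n/2}\in L_{1+}(\mathbf H)$, the Dixmier ideal of compact operators whose singular values satisfy $\sum_{i\le N}\mu_i=O(\log N)$. It is even if there is a chirality operator $\gamma\in B(\mathbf H)$ ($\gamma=\gamma^*$, $\gamma^2=1$) with $\gamma D+D\gamma=0$ and $[\gamma,\rho(t)]=0$ for all $t\in A$. It is regular if, with $\delta(T)=[|D|,T]$, the algebra generated by $\rho(t)$ and $[D,\rho(t)]$, $t\in A$, is contained in the domain of $\delta^k$ for every $k\ge0$. *)

(* Defs.v *)
(* MathComp, with MathComp-Analysis and the finitely supported functions
   {malg C[K]} of the multinomials library. *)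
From HB Require Import structures.
From mathcomp Require Import all_boot all_order all_algebra.
From mathcomp Require Import complex finmap monalg.
From mathcomp Require Import all_classical all_reals all_analysis.
From mathcomp Require Import ring lra.

Set Implicit Arguments.
Unset Strict Implicit.
Unset Printing Implicit Defensive.

Import Order.TTheory GRing.Theory Num.Theory.
Import numFieldNormedType.Exports.

Local Open Scope classical_set_scope.
Local Open Scope ring_scope.
Local Open Scope complex_scope.

(* Linear span of a subset of a vector space. *)
Definition lin_span (K : nzRingType) (V : lmodType K) (S : set V) : set V :=
  [set x | exists (n : nat) (a : 'I_n -> K) (u : 'I_n -> V),
     (forall k, S (u k)) /\ x = \sum_(k < n) a k *: u k].

(* Inner products are linear in the second argument. *)
Section Hilbert.
Variables (R : realType) (H : lmodType R[i]) (ip : H -> H -> R[i]).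

Definition inner_product : Prop :=
  [/\ forall x a y z, ip x (a *: y + z) = a * ip x y + ip x z,
      forall x y, ip y x = (ip x y)^*
    & forall x, x != 0 -> 0 < ip x x].

Definition hnorm (x : H) : R := Num.sqrt (complex.Re (ip x x)).

Definition hcvg (u : nat -> H) (l : H) : Prop :=
  (fun n => hnorm (u n - l)) @ \oo --> (0 : R).

Definition hcauchy (u : nat -> H) : Prop :=
  forall e : R, 0 < e -> exists N : nat, forall m n : nat,
    (N <= m)%N -> (N <= n)%N -> hnorm (u m - u n) < e.

Definition hilbert_space : Prop :=
  inner_product /\ forall u, hcauchy u -> exists l, hcvg u l.

Definition hdense (S : set H) : Prop :=
  forall (x : H) (e : R), 0 < e -> exists2 y, S y & hnorm (x - y) < e.

Definition hseparable : Prop := exists2 S : set H, countable S & hdense S.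

Definition bounded_op (T : H -> H) : Prop :=
  linear T /\ exists M : R, forall x, hnorm (T x) <= M * hnorm x.

Definition compact_op (T : H -> H) : Prop :=
  bounded_op T /\
  forall u : nat -> H, (exists M : R, forall n, hnorm (u n) <= M) ->
  exists (phi : nat -> nat) (l : H),
    {homo phi : m n / (m < n)%N} /\ hcvg (fun n => T (u (phi n))) l.

(* mu lists the singular values of T, i.e. the eigenvalues of |T| = (T^* T)^1/2,
   in decreasing order with multiplicities: T^* T e_n = mu_n^2 e_n for an
   orthonormal family e, and T vanishes on its orthogonal complement. The
   vectors e_n with mu_n = 0 play no role; the list is padded with zeros when T
   has finite rank. *)
Definition singular_values (T : H -> H) (mu : nat -> R) : Prop :=
  [/\ forall n, 0 <= mu n,
      forall m n : nat, (m <= n)%N -> mu n <= mu m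
    & exists e : nat -> H,
      [/\ forall m n, mu m != 0 -> mu n != 0 -> ip (e m) (e n) = (m == n)%:R,
          forall n, mu n != 0 ->
            forall x, ip (T (e n)) (T x) = (mu n ^+ 2)%:C * ip (e n) x
        & forall x, (forall n, mu n != 0 -> ip (e n) x = 0) -> T x = 0]].

(* The Dixmier ideal L_{1+}. *)
Definition dixmier_ideal (T : H -> H) : Prop :=
  compact_op T /\
  exists2 mu : nat -> R, singular_values T mu &
    (fun N : nat => \sum_(k < N) mu k) =O_\oo (fun N : nat => ln (N%:R : R)).

(* Not necessarily bounded operators; the values of opfun outside opdom are
   irrelevant. *)
Record operator := Operator { opdom : set H; opfun :> H -> H }.

Definition linear_on_dom (D : operator) : Prop :=
  opdom D 0 /\
  forall a x y, opdom D x -> opdom D y ->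
    opdom D (a *: x + y) /\ D (a *: x + y) = a *: D x + D y.

(* D is densely defined and D^* = D, domains included: the left-hand side of the
   equivalence says that y is in the domain of D^* and D^* y = z. *)
Definition self_adjoint (D : operator) : Prop :=
  [/\ hdense (opdom D), linear_on_dom D
    & forall y z, (forall x, opdom D x -> ip y (D x) = ip z x) <->
                  (opdom D y /\ D y = z)].

Definition op_sqr (D : operator) : operator :=
  Operator [set x | opdom D x /\ opdom D (D x)] (fun x => D (D x)).

Definition op_eq (D E : operator) : Prop :=
  opdom D = opdom E /\ forall x, opdom D x -> D x = E x.

(* P = |D|, the positive square root of D^2. *)
Definition is_abs (D P : operator) : Prop :=
  [/\ self_adjoint P, forall x, opdom P x -> 0 <= ip x (P x)
    & op_eq (op_sqr P) (op_sqr D)].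

(* B = (1 + D^2)^{-1/2}: B is the bounded positive operator whose square is
   inverse to 1 + D^2. *)
Definition is_inv_sqrt (D : operator) (B : H -> H) : Prop :=
  [/\ bounded_op B,
      forall x y, ip (B x) y = ip x (B y),
      forall x, 0 <= ip x (B x),
      forall x, opdom (op_sqr D) (B (B x)) /\ B (B x) + op_sqr D (B (B x)) = x
    & forall x, opdom (op_sqr D) x -> B (B (x + op_sqr D x)) = x].

(* T = (1 + D^2)^{-n/2} is a bounded operator. For negative n, T is the inverse
   of the corresponding positive power of (1 + D^2)^{-1/2}. *)
Definition is_neg_power (D : operator) (n : int) (T : H -> H) : Prop :=
  exists2 B, is_inv_sqrt D B &
    match n with
    | Posz m => forall x, T x = iter m B x
    | Negz m => [/\ bounded_op T, forall x, T (iter m.+1 B x) = x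
                  & forall x, iter m.+1 B (T x) = x]
    end.

(* The bounded operator B extends [D, T], defined on the domain of D. *)
Definition commutator_ext (D : operator) (T B : H -> H) : Prop :=
  bounded_op B /\
  forall x, opdom D x -> opdom D (T x) /\ D (T x) - T (D x) = B x.

(* T is in the domain of delta^k, where delta = [P, -]. *)
Fixpoint in_dom_delta (P : operator) (k : nat) (T : H -> H) : Prop :=
  bounded_op T /\
  match k with
  | 0 => True
  | k'.+1 => exists2 T', commutator_ext P T T' & in_dom_delta P k' T'
  end.

End Hilbert.

(* Spectral triples. *)
Section SpectralTriple.
Variables (R : realType).
Variables (A : lmodType R[i]) (mul : A -> A -> A) (one : A) (star : A -> A).
Variables (H : lmodType R[i]) (ip : H -> H -> R[i]).
Variables (rho : A -> H -> H) (D : operator H).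

Definition unital_star_algebra : Prop :=
  [/\ forall x, linear (mul x), forall y, linear (mul^~ y),
      associative mul, left_id one mul & right_id one mul] /\
  [/\ forall a x y, star (a *: x + y) = a^* *: star x + star y,
      involutive star & forall x y, star (mul x y) = mul (star y) (star x)].

Definition faithful_star_representation : Prop :=
  [/\ forall t, bounded_op ip (rho t),
      forall a s t x, rho (a *: s + t) x = a *: rho s x + rho t x,
      forall s t x, rho (mul s t) x = rho s (rho t x),
      forall x, rho one x = x
    & forall t x y, ip (rho (star t) x) y = ip x (rho t y)] /\
  injective rho.

Definition spectral_triple : Prop :=
  [/\ unital_star_algebra,
      hilbert_space ip /\ hseparable ip,
      faithful_star_representation,
      self_adjoint ip D
    & forall t, exists B, commutator_ext ip D (rho t) B].

Definition in_dixmier (n : int) : Prop :=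
  exists2 T, is_neg_power ip D n T & dixmier_ideal ip T.

Definition has_dimension (n : int) : Prop :=
  in_dixmier n /\ forall m : int, in_dixmier m -> n <= m.

Definition is_chirality (gamma : H -> H) : Prop :=
  [/\ bounded_op ip gamma,
      forall x y, ip (gamma x) y = ip x (gamma y),
      forall x, gamma (gamma x) = x,
      forall x, opdom D x ->
        opdom D (gamma x) /\ gamma (D x) + D (gamma x) = 0
    & forall t x, gamma (rho t x) = rho t (gamma x)].

(* The algebra of bounded operators generated by rho t and [D, rho t]. *)
Inductive generated_op : (H -> H) -> Prop :=
| gen_rho t : generated_op (rho t)
| gen_comm t B : commutator_ext ip D (rho t) B -> generated_op B
| gen_lin a S T : generated_op S -> generated_op T ->
    generated_op (fun x => a *: S x + T x)
| gen_comp S T : generated_op S -> generated_op T ->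
    generated_op (fun x => S (T x)).

Definition regular_triple : Prop :=
  exists2 P, is_abs ip D P &
    forall (k : nat) T, generated_op T -> in_dom_delta ip P k T.

Definition even_regular_spectral_triple (n : int) (gamma : H -> H) : Prop :=
  [/\ spectral_triple, has_dimension n, is_chirality gamma & regular_triple].

End SpectralTriple.

(* Half-integers are represented by their doubles: l : nat stands for the spin
   l/2, c : int for the charge c/2, and an index k : 'I_l.+1 for the weight
   k - l/2. *)

(* U_q(su_2) is spanned by the monomials in its generators e, f, k, k^{-1}. A
   functional on U_q(su_2) is therefore determined by its values on monomials,
   and is encoded as a function on words in the generators. The Hopf *-algebra
   structure maps are computed on words from their values on the generators. That
   the t^l_{m,n} vanish on the defining relations of U_q(su_2) is proved at the
   end of this file. *)
Inductive gen := Ge | Gf | Gk | Gkinv.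
Notation word := (seq gen).

(* The coproduct of a word, as the list of the summands x' (x) x''. *)
Definition coprod_gen (x : gen) : seq (word * word) :=
  match x with
  | Ge => [:: ([:: Ge], [:: Gk]); ([:: Gkinv], [:: Ge])]
  | Gf => [:: ([:: Gf], [:: Gk]); ([:: Gkinv], [:: Gf])]
  | Gk => [:: ([:: Gk], [:: Gk])]
  | Gkinv => [:: ([:: Gkinv], [:: Gkinv])]
  end.

Fixpoint coprod (w : word) : seq (word * word) :=
  match w with
  | [::] => [:: ([::], [::])]
  | x :: w' => [seq (a.1 ++ b.1, a.2 ++ b.2) | a <- coprod_gen x, b <- coprod w']
  end.

Definition ustar_gen (x : gen) : gen :=
  match x with Ge => Gf | Gf => Ge | Gk => Gk | Gkinv => Gkinv end.

Definition ustar (w : word) : word := rev (map ustar_gen w).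

Definition antipode_letter (x : gen) : gen :=
  match x with Ge => Ge | Gf => Gf | Gk => Gkinv | Gkinv => Gk end.

Section Uq2.
Variables (R : realType) (q : R).

(* S_q(w) = antipode_coef w * antipode_word w. *)
Definition antipode_coef_gen (x : gen) : R[i] :=
  match x with
  | Ge => (- q)%:C
  | Gf => (- q^-1)%:C
  | Gk => 1
  | Gkinv => 1
  end.

Definition antipode_coef (w : word) : R[i] := \prod_(x <- w) antipode_coef_gen x.
Definition antipode_word (w : word) : word := rev (map antipode_letter w).

Definition qnum (x : R) : R := (q `^ x - q `^ (- x)) / (q - q^-1).

Definition weight (l : nat) (k : 'I_l.+1) : R := (k : nat)%:R - l%:R / 2.

(* The matrix of pi_{q,l/2}(x) in the basis of weight vectors. *)
Definition rep_gen (l : nat) (x : gen) : 'M[R[i]]_l.+1 :=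
  let s : R := l%:R / 2 in
  \matrix_(m, n) (match x with
    | Ge => if (m : nat) == n.+1
            then Num.sqrt (qnum (s - weight n) * qnum (s + weight n + 1)) else 0
    | Gf => if m.+1 == (n : nat)
            then Num.sqrt (qnum (s - weight n + 1) * qnum (s + weight n)) else 0
    | Gk => if m == n then q `^ (weight n) else 0
    | Gkinv => if m == n then q `^ (- weight n) else 0
    end)%:C.

Definition rep (l : nat) (w : word) : 'M[R[i]]_l.+1 :=
  \prod_(x <- w) rep_gen l x.

(* The algebra C[SU_q(2)]: finite combinations of the t^l_{m,n}. *)
Definition su_index : choiceType := {l : nat & ('I_l.+1 * 'I_l.+1)%type}.
Definition sui (l : nat) (m n : 'I_l.+1) : su_index :=
  Tagged (fun l : nat => ('I_l.+1 * 'I_l.+1)%type) (m, n).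

Definition CSU := {malg R[i][su_index]}.

(* The functional on U_q(su_2) defined by an element of C[SU_q(2)]. *)
Definition functional (t : CSU) (w : word) : R[i] :=
  \sum_(k <- msupp t) t@_k * rep (tag k) w (tagged k).1 (tagged k).2.

Definition fun_mul (f g : word -> R[i]) (w : word) : R[i] :=
  \sum_(x <- coprod w) f x.1 * g x.2.

Definition fun_star (f : word -> R[i]) (w : word) : R[i] :=
  ((antipode_coef w)^* * f (ustar (antipode_word w)))^*.

(* The product (resp. the involution) is the element of C[SU_q(2)] whose
   functional is prescribed. *)
Definition su_mul (t s : CSU) : CSU :=
  xget 0 [set u | functional u = fun_mul (functional t) (functional s)].

Definition su_star (t : CSU) : CSU :=
  xget 0 [set u | functional u = fun_star (functional t)].

(* The algebra C[U_q(2)]: the index ((l, m, n), c) is that of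
   t^{l,c}_{m,n} = t^l_{m,n} (x) z^c, restricted to (l, c) in P_+. *)
Definition in_Pplus (l : nat) (c : int) : bool := odd l == odd `|c|%N.

Definition u_index : choiceType :=
  {x : su_index * int | in_Pplus (tag x.1) x.2}.

Definition CU := {malg R[i][u_index]}.

Definition u_su (x : u_index) : su_index := (val x).1.
Definition u_spin (x : u_index) : nat := tag (u_su x).
Definition u_charge (x : u_index) : int := (val x).2.

(* t^l_{m,n} (x) z^c; the default value 0 is used only outside P_+. *)
Definition tz (k : su_index) (c : int) : CU :=
  oapp (fun x : u_index => << x >>) 0 (insub (k, c)).

Definition attach (c : int) (t : CSU) : CU :=
  \sum_(k <- msupp t) t@_k *: tz k c.

Definition u_mul (a b : CU) : CU :=
  \sum_(x <- msupp a) \sum_(y <- msupp b) (a@_x * b@_y) *: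
    attach (u_charge x + u_charge y) (su_mul << u_su x >> << u_su y >>).

Definition u_one : CU := tz (@sui 0 ord0 ord0) 0.

Definition u_star (a : CU) : CU :=
  \sum_(x <- msupp a) (a@_x)^* *: attach (- u_charge x) (su_star << u_su x >>).

Definition haar (a : CU) : R[i] :=
  \sum_(x <- msupp a) a@_x * ((u_spin x == 0%N) && (u_charge x == 0))%:R.

(* The actions of U_q(su_2) and of x_0 on C[U_q(2)]. *)
Definition partial (w : word) (a : CU) : CU :=
  \sum_(x <- msupp a) a@_x *:
    \sum_(n' : 'I_(u_spin x).+1)
      rep (u_spin x) w n' (tagged (u_su x)).2 *:
        tz (sui (tagged (u_su x)).1 n') (u_charge x).

Definition partial_x0 (a : CU) : CU :=
  \sum_(x <- msupp a) (a@_x * ((u_charge x)%:~R / 2)) *: << x >>.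

(* C[U_q(2)] (x) V_{q,1/2}: u stands for the sum over s of u s (x) |1/2, s>. *)
Definition CUV := {ffun 'I_2 -> CU}.

(* The action (partial (x) pi_{q,1/2}) o coproduct. *)
Definition act (w : word) (u : CUV) : CUV :=
  \sum_(x <- coprod w)
    [ffun s' => \sum_(s : 'I_2) rep 1 x.2 s' s *: partial x.1 (u s)].

(* The span of the t^{l,c}_{m,n} (x) v for fixed (l, c). *)
Definition block (l : nat) (c : int) : set CUV :=
  [set u | forall s x, x \in msupp (u s) -> u_spin x = l /\ u_charge x = c].

(* phi is (the image of the basis under) an intertwiner V_{q,r/2} -> block l c. *)
Definition intertwiner (l : nat) (c : int) (r : nat) (phi : 'I_r.+1 -> CUV) :=
  (forall n, block l c (phi n)) /\
  forall w n, act w (phi n) = \sum_(n' : 'I_r.+1) rep r w n' n *: phi n'.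

(* The isotypic component of type V_{q,r/2} of block l c: the sum of the images
   of all intertwiners from the irreducible module V_{q,r/2}. *)
Definition isotypic (l : nat) (c : int) (r : nat) : set CUV :=
  lin_span [set u | exists2 phi, intertwiner l c phi & exists n : 'I_r.+1, u = phi n].

(* With j = l/2: 2j + 3/2 on W^up_{j,c} and - (2j + 2) + 3/2 on W^down_{j,c}. *)
Definition is_dirac (f : CUV -> CUV) : Prop :=
  linear f /\
  forall l c, in_Pplus l c ->
    (forall u, isotypic l c l.+1 u -> f u = (l%:R + 3 / 2) *: u) /\
    ((0 < l)%N ->
     forall u, isotypic l c l.-1 u -> f u = (- (l%:R + 2) + 3 / 2) *: u).

(* The blocks being spanned by W^up and W^down, and C[U_q(2)] (x) V_{q,1/2} by
   the blocks, there is exactly one such operator. *)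
Definition dirac_alg : CUV -> CUV := xget (fun=> 0) [set f | is_dirac f].

(* L^2(U_q(2)) is any completion of C[U_q(2)] for <t, s> = haar (t^* s), given
   as a Hilbert space L with an isometric linear map of dense range. *)
Definition is_L2 (L : lmodType R[i]) (ip : L -> L -> R[i]) (Lam : CU -> L) :=
  [/\ hilbert_space ip, linear Lam,
      forall t s, ip (Lam t) (Lam s) = haar (u_mul (u_star t) s)
    & hdense ip (range Lam)].

(* The closure, in a completion j : V -> H, of the operator f on V. *)
Definition op_closure (V H : lmodType R[i]) (ip : H -> H -> R[i]) (j : V -> H)
    (f : V -> V) : operator H :=
  let graph x y := exists u : nat -> V,
    hcvg ip (j \o u) x /\ hcvg ip (j \o f \o u) y in
  Operator [set x | exists y, graph x y] (fun x => xget 0 [set y | graph x y]).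

Section Module.
Variables (L : lmodType R[i]) (ip : L -> L -> R[i]) (Lam : CU -> L).

(* L^2(U_q(2)) (x) V_{q,1/2}. *)
Definition HV := {ffun 'I_2 -> L}.
Definition ipV (x y : HV) : R[i] := \sum_(s : 'I_2) ip (x s) (y s).
Definition LamV (u : CUV) : HV := [ffun s => Lam (u s)].

Definition dirac : operator HV := op_closure ipV LamV dirac_alg.

Definition charge_op : operator HV :=
  op_closure ipV LamV (fun u : CUV => [ffun s => partial_x0 (u s)]).

(* L^2(U_q(2)) (x) (V^+ (+) V^-). *)
Definition Hhat := (HV * HV)%type.
Definition ip_hat (x y : Hhat) : R[i] := ipV x.1 y.1 + ipV x.2 y.2.

(* Left multiplication by t, extended by continuity to L^2(U_q(2)). *)
Definition left_mul (t : CU) : L -> L := op_closure ip Lam (u_mul t).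

Definition rho_hat (t : CU) (x : Hhat) : Hhat :=
  ([ffun s => left_mul t (x.1 s)], [ffun s => left_mul t (x.2 s)]).

Definition dirac_hat : operator Hhat :=
  Operator
    [set x | [/\ opdom dirac x.1, opdom charge_op x.1,
                 opdom dirac x.2 & opdom charge_op x.2]]
    (fun x => ('i *: dirac x.2 + charge_op x.2,
               - ('i *: dirac x.1) + charge_op x.1)).

Definition gamma_hat (x : Hhat) : Hhat := (x.1, - x.2).

End Module.
End Uq2.

(* pi_{q,l/2} respects the defining relations of U_q(su_2): rep_kkinv, rep_ke,
   rep_kf and rep_ef. *)
Lemma qnum_ge0 (R : realType) (q x : R) : 0 < q < 1 -> 0 <= x -> 0 <= qnum q x.
Proof.
move=> /andP[q0 q1] x0; rewrite /qnum.
have qx : q `^ x <= 1 by rewrite -(powRr0 q) ger_powR // q0 ltW.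
have qx0 : 0 < q `^ x by rewrite powR_gt0.
have hx : q `^ x - q `^ (- x) <= 0.
  rewrite powRN subr_le0; apply: (le_trans qx); by rewrite invf_ge1.
have hq : q - q^-1 <= 0.
  rewrite subr_le0; apply: (le_trans (ltW q1)); by rewrite invf_ge1 // ltW.
by apply: mulr_le0 => //; rewrite invr_le0.
Qed.

Lemma rep_kkinv (R : realType) (q : R) l : 0 < q < 1 ->
  rep q l [:: Gk; Gkinv] = 1.
Proof.
move=> /andP[q0 _]; rewrite /rep !big_cons big_nil mulr1.
apply/matrixP => m n; rewrite !mxE (bigD1 m) //= !mxE eqxx big1; last first.
  by move=> j jm; rewrite !mxE eq_sym (negbTE jm) mul0r.
rewrite addr0; case: eqVneq => [->|]; rewrite /= ?mulr0 //.
by rewrite -rmorphM /= -powRD ?subrr ?powRr0 ?rmorph1 ?(gt_eqF q0) ?implybT.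
Qed.

Lemma rep2 (R : realType) (q : R) l x y m n :
  rep q l [:: x; y] m n = \sum_j rep_gen q l x m j * rep_gen q l y j n.
Proof. by rewrite /rep !big_cons big_nil mulr1 mxE. Qed.

Lemma rep2_kl (R : realType) (q : R) l y m n : rep q l [:: Gk; y] m n =
  (q `^ weight R m)%:C * rep_gen q l y m n.
Proof.
rewrite rep2 (bigD1 m) //= big1 ?addr0 => [|j jm]; first by rewrite [X in X * _]mxE eqxx.
by rewrite [X in X * _]mxE eq_sym (negbTE jm) mul0r.
Qed.

Lemma rep2_kr (R : realType) (q : R) l y m n : rep q l [:: y; Gk] m n =
  rep_gen q l y m n * (q `^ weight R n)%:C.
Proof.
rewrite rep2 (bigD1 n) //= big1 ?addr0 => [|j jm]; first by rewrite [X in _ * X]mxE eqxx.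
by rewrite [X in _ * X]mxE (negbTE jm) mulr0.
Qed.

Lemma rep_ke (R : realType) (q : R) l : 0 < q < 1 ->
  rep q l [:: Gk; Ge] = q%:C *: rep q l [:: Ge; Gk].
Proof.
move=> /andP[q0 _]; apply/matrixP => m n.
rewrite [RHS]mxE rep2_kl rep2_kr !mxE -!rmorphM /=; congr _%:C.
case: eqP => [mn|_]; last by rewrite !(mulr0, mul0r).
have -> : weight R m = weight R n + 1 by rewrite /weight mn -addn1 natrD; ring.
rewrite powRD ?(gt_eqF q0) ?implybT // powRr1 ?(ltW q0) //; ring.
Qed.

Lemma rep_kf (R : realType) (q : R) l : 0 < q < 1 ->
  rep q l [:: Gk; Gf] = (q^-1)%:C *: rep q l [:: Gf; Gk].
Proof.
move=> /andP[q0 _]; apply/matrixP => m n.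
rewrite [RHS]mxE rep2_kl rep2_kr !mxE -!rmorphM /=; congr _%:C.
case: eqP => [mn|_]; last by rewrite !(mulr0, mul0r).
have -> : weight R n = weight R m + 1 by rewrite /weight -mn -addn1 natrD; ring.
rewrite powRD ?(gt_eqF q0) ?implybT // powRr1 ?(ltW q0) //; field.
by rewrite gt_eqF.
Qed.

Lemma rep_ef (R : realType) (q : R) l : 0 < q < 1 ->
  rep q l [:: Ge; Gf] - rep q l [:: Gf; Ge] =
  ((q - q^-1)^-1)%:C *: (rep q l [:: Gk; Gk] - rep q l [:: Gkinv; Gkinv]).
Proof.
move=> hq; have /andP[q0 q1] := hq; apply/matrixP => m n.
set s : R := l%:R / 2.
have w_ge0 (k : 'I_l.+1) : 0 <= s + weight R k.
  by rewrite /weight /s addrC subrK.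
have w_le (k : 'I_l.+1) : 0 <= s - weight R k.
  have : ((k : nat)%:R : R) <= l%:R by rewrite ler_nat -ltnS.
  rewrite /weight /s; lra.
have EF : rep q l [:: Ge; Gf] m n = (m == n)%:R *
   (qnum q (s - weight R n + 1) * qnum q (s + weight R n))%:C.
  rewrite rep2; case: (posnP n) => [n0|n_gt0].
    rewrite big1 => [|j _]; last by rewrite [X in _ * X]mxE n0 mulr0.
    have -> : s + weight R n = 0 by rewrite /weight n0 /s; ring.
    by rewrite {2}/qnum oppr0 subrr mul0r mulr0 mulr0.
  have n1 : (n.-1 < l.+1)%N by rewrite (leq_ltn_trans (leq_pred _)).
  have hn1 : (n.-1.+1)%N = n by rewrite prednK.
  rewrite (bigD1 (Ordinal n1)) //= big1 ?addr0 => [|j jn]; last first.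
    rewrite [X in _ * X]mxE; case: eqP => [jE|]; last by rewrite mulr0.
    by case/negP: jn; apply/eqP/val_inj => /=; rewrite -jE.
  rewrite !mxE /= hn1 eqxx.
  have -> : weight R (Ordinal n1) = weight R n - 1.
    by rewrite /weight /= -[X in X%:R - _ - 1]hn1 -[n.-1.+1]addn1 natrD; ring.
  rewrite -[m == n](inj_eq val_inj) /=.
  case: eqP => [_|_]; last by rewrite !mul0r.
  rewrite mul1r -rmorphM /=; congr _%:C.
  rewrite -/s (_ : s - (weight R n - 1) = s - weight R n + 1); last by ring.
  rewrite (_ : s + (weight R n - 1) + 1 = s + weight R n); last by ring.
  rewrite -expr2 sqr_sqrtr // mulr_ge0 // qnum_ge0 //.
  by rewrite addr_ge0.
have FE : rep q l [:: Gf; Ge] m n = (m == n)%:R *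
   (qnum q (s - weight R n) * qnum q (s + weight R n + 1))%:C.
  rewrite rep2; case: (ltnP n l) => [n_lt|n_ge].
    have n1 : (n.+1 < l.+1)%N by [].
    rewrite (bigD1 (Ordinal n1)) //= big1 ?addr0 => [|j jn]; last first.
      rewrite [X in _ * X]mxE; case: eqP => [jE|]; last by rewrite mulr0.
      by case/negP: jn; apply/eqP/val_inj.
    rewrite !mxE /= eqxx eqSS.
    have -> : weight R (Ordinal n1) = weight R n + 1.
      by rewrite /weight /= -addn1 natrD; ring.
    rewrite -[m == n](inj_eq val_inj) /=.
    case: eqP => [_|_]; last by rewrite !mul0r.
    rewrite mul1r -rmorphM /=; congr _%:C.
    rewrite -/s (_ : s - (weight R n + 1) + 1 = s - weight R n); last by ring.
    rewrite addrA -expr2 sqr_sqrtr // mulr_ge0 // qnum_ge0 //.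
    by rewrite addr_ge0.
  have nl : (n : nat) = l by apply/eqP; rewrite eqn_leq n_ge -ltnS ltn_ord.
  rewrite big1 => [|j _]; last first.
    rewrite [X in _ * X]mxE; case: eqP => [jE|]; last by rewrite mulr0.
    by have := ltn_ord j; rewrite jE nl ltnn.
  have -> : s - weight R n = 0 by rewrite /weight nl /s; field.
  by rewrite {1}/qnum oppr0 subrr mul0r mul0r mulr0.
rewrite !mxE EF FE rep2_kl.
have -> : rep q l [:: Gkinv; Gkinv] m n =
   (m == n)%:R * (q `^ (- weight R n) * q `^ (- weight R n))%:C.
  rewrite rep2 (bigD1 m) //= big1 ?addr0 => [|j jm]; last first.
    by rewrite mxE eq_sym (negbTE jm) mul0r.
  rewrite !mxE eqxx; case: eqP => [->|_]; last by rewrite mulr0 mul0r.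
  by rewrite mul1r rmorphM.
rewrite mxE; case: eqP => [mn|_]; last by rewrite !(mul0r, mulr0) subrr mulr0.
rewrite !mul1r -!(rmorphM, rmorphB) /=; congr _%:C.
rewrite mn /qnum; move: (weight R n) => w; move: s {w_ge0 w_le EF FE} => s.
have qne : forall x, q `^ x != 0 by move=> x; rewrite gt_eqF // powR_gt0.
have D x y : q `^ (x + y) = q `^ x * q `^ y by rewrite powRD // (gt_eqF q0) implybT.
rewrite !opprD !D !opprK !powRN powRr1 ?(ltW q0) //.
have := qne s; have := qne w; set a := q `^ s; set b := q `^ w => b0 a0.
field.
have q2 : q * q - 1 != 0.
  have : q * q < 1 by rewrite mulr_ilt1 // ltW.
  by rewrite -subr_lt0 => /lt_eqF ->.
by rewrite ?a0 ?b0 ?(gt_eqF q0) /= ?expr2 ?q2.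
Qed.

(* Main.v *)
Require Import Defs.
From HB Require Import structures.
From mathcomp Require Import all_boot all_order all_algebra.
From mathcomp Require Import complex finmap monalg.
From mathcomp Require Import all_classical all_reals all_analysis.
From mathcomp Require Import ring lra zify.

Set Implicit Arguments.
Unset Strict Implicit.
Unset Printing Implicit Defensive.

Import Order.TTheory GRing.Theory Num.Theory.
Import numFieldNormedType.Exports.

Local Open Scope classical_set_scope.
Local Open Scope ring_scope.
Local Open Scope complex_scope.

(* The Hilbert space has an explicit orthonormal basis of joint eigenvectors of
   D_q and x_0: the matrix coefficients t^{l,c}_{m,n}, normalized by the Peter-Weyl
   relations, and rotated by the Clebsch-Gordan coefficients of V_l (x) V_{1/2}.
   The operator D^hat_q is then diagonal, with eigenvalues +-sqrt(lambda^2 + c^2)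
   of the growth of a 4-dimensional lattice, whence the dimension. Left
   multiplication by a generator t^{1/2,+-1/2}_{a,b} moves l, c and the weights by
   bounded amounts; its matrix entries between vectors of W^up and W^down, where
   the eigenvalues of D_q differ by about 4l, are at most 1/[2l+1] <= 1/(2l+1) and
   make up for the gap, so that all commutators are bounded. Since generators and
   their commutators are banded with respect to |D^hat_q|, all the iterated
   commutators with |D^hat_q| are bounded, which is regularity. *)

(** * Inner product spaces *)

(** The product and the involution of C[SU_q(2)] are only prescribed by functionals on words. So an
    element with a given functional must be shown to exist (products of matrix coefficients
    decompose by Clebsch-Gordan) and to be unique (suitable words isolate one coefficient). Two
    Clebsch-Gordan rotations meet: left multiplication couples V_{1/2} (x) V_l, the spinor couples
    V_l (x) V_{1/2}, and the second is the first with q inverted. Their composite shows that a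
    generator changes the type of a vector only from W^up while raising the spin, or from W^down
    while lowering it. Both moves preserve |D_q|. Hence generators are banded for |D_q| but not for
    D_q: only [D_q, t] needs an estimate of entries, and commutators with |D^hat_q| need the band
    width alone, since sqrt(lambda^2 + c^2) is Lipschitz in |lambda| and c. Domains are controlled
    by identifying each operator with the maximal diagonal one, whose adjoint and square are read
    off the coefficients. Minimality of 4 must exclude every smaller integer exponent, negative ones
    included; it rests on the min-max principle. *)

Section LinearProp.
Variables (K : nzRingType) (V W : lmodType K) (T : V -> W).
Hypothesis lT : linear T.

Lemma linearE0 : T 0 = 0.
Proof. by have := lT (-1) 0 0; rewrite addr0 scaler0 scaleN1r addNr. Qed.

Lemma linearED x y : T (x + y) = T x + T y.
Proof. by rewrite -[x in LHS]scale1r lT scale1r. Qed.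

Lemma linearEZ a x : T (a *: x) = a *: T x.
Proof. by rewrite -[a *: x]addr0 lT linearE0 addr0. Qed.

Lemma linearEN x : T (- x) = - T x.
Proof. by rewrite -scaleN1r linearEZ scaleN1r. Qed.

Lemma linearEB x y : T (x - y) = T x - T y.
Proof. by rewrite linearED linearEN. Qed.

Lemma linearE2 z z' u v : T (z *: u + z' *: v) = z *: T u + z' *: T v.
Proof. by rewrite lT linearEZ. Qed.

Lemma linearE_sum (I : Type) (r : seq I) (P : pred I) (F : I -> V) :
  T (\sum_(i <- r | P i) F i) = \sum_(i <- r | P i) T (F i).
Proof. exact: (big_morph T linearED linearE0). Qed.

End LinearProp.

Section SquaredModulus.
Variable R : realType.
Implicit Types z w : R[i].

Definition nsqc z : R := complex.Re z ^+ 2 + complex.Im z ^+ 2.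

Lemma mul_conjc z : conjc z * z = (nsqc z)%:C.
Proof. by case: z => a b; rewrite /nsqc; simpc; congr (_ +i* _); ring. Qed.

Lemma conjcM z w : conjc (z * w) = conjc z * conjc w. Proof. exact: rmorphM. Qed.
Lemma conjcN z : conjc (- z) = - conjc z. Proof. exact: rmorphN. Qed.
Lemma conjcD z w : conjc (z + w) = conjc z + conjc w. Proof. exact: rmorphD. Qed.
Lemma RcM (x y : R) : (x * y)%:C = x%:C * y%:C. Proof. exact: rmorphM. Qed.
Lemma RcD (x y : R) : (x + y)%:C = x%:C + y%:C. Proof. exact: rmorphD. Qed.
Lemma RcB (x y : R) : (x - y)%:C = x%:C - y%:C. Proof. exact: rmorphB. Qed.
Lemma RcN (x : R) : (- x)%:C = - x%:C. Proof. exact: rmorphN. Qed.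
Lemma RcX (x : R) n : (x ^+ n)%:C = x%:C ^+ n. Proof. exact: rmorphXn. Qed.
Lemma RcV (x : R) : (x^-1)%:C = x%:C^-1. Proof. exact: fmorphV. Qed.
Lemma Rc1 : 1%:C = 1 :> R[i]. Proof. by []. Qed.
Lemma Rc_eq0 (x : R) : (x%:C == 0) = (x == 0).
Proof. by rewrite eq_complex /= eqxx andbT. Qed.

Lemma conjcR (x : R) : conjc x%:C = x%:C. Proof. by rewrite /conjc /= oppr0. Qed.

Lemma nsqc_ge0 z : 0 <= nsqc z. Proof. by rewrite addr_ge0 ?sqr_ge0. Qed.

Lemma nsqc_eq0 z : (nsqc z == 0) = (z == 0).
Proof.
by case: z => a b; rewrite /nsqc paddr_eq0 ?sqr_ge0 // !sqrf_eq0 eq_complex.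
Qed.

Lemma nsqcM z w : nsqc (z * w) = nsqc z * nsqc w.
Proof. by case: z w => a b [c d]; rewrite /nsqc /=; simpc; ring. Qed.

Lemma nsqcR (x : R) : nsqc x%:C = x ^+ 2.
Proof. by rewrite /nsqc /= expr0n addr0. Qed.

Lemma nsqcJ z : nsqc (conjc z) = nsqc z.
Proof. by case: z => a b; rewrite /nsqc /= sqrrN. Qed.

Lemma nsqcN z : nsqc (- z) = nsqc z.
Proof. by case: z => a b; rewrite /nsqc /= !sqrrN. Qed.

Lemma nsqc0 : nsqc 0 = 0. Proof. by rewrite (nsqcR 0) expr0n. Qed.

Lemma nsqcD_le z w : nsqc (z + w) <= 2 * (nsqc z + nsqc w).
Proof.
case: z w => a b [c d]; rewrite /nsqc /= -subr_ge0.
have -> : 2 * (a ^+ 2 + b ^+ 2 + (c ^+ 2 + d ^+ 2)) - ((a + c) ^+ 2 + (b + d) ^+ 2)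
  = (a - c) ^+ 2 + (b - d) ^+ 2 by ring.
by rewrite addr_ge0 ?sqr_ge0.
Qed.

End SquaredModulus.

Lemma halfr_gt0 (R : realType) (e : R) : 0 < e -> 0 < e / 2.
Proof. by move=> e0; rewrite divr_gt0. Qed.

Section InnerProduct.
Variables (R : realType) (H : lmodType R[i]) (ip : H -> H -> R[i]).
Hypothesis ipP : inner_product ip.
Implicit Types x y z : H.

Let ip_lin x a y z : ip x (a *: y + z) = a * ip x y + ip x z.
Proof. by case: ipP. Qed.

Lemma ip_conj x y : ip y x = conjc (ip x y). Proof. by case: ipP. Qed.

Lemma ipDr x y z : ip x (y + z) = ip x y + ip x z.
Proof. by rewrite -{1}[y]scale1r ip_lin mul1r. Qed.

Lemma ip0r x : ip x 0 = 0.
Proof. by apply: (addrI (ip x 0)); rewrite -ipDr !addr0. Qed.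

Lemma ipZr x a y : ip x (a *: y) = a * ip x y.
Proof. by rewrite -[a *: y]addr0 ip_lin ip0r addr0. Qed.

Lemma ipNr x y : ip x (- y) = - ip x y.
Proof. by rewrite -scaleN1r ipZr mulN1r. Qed.

Lemma ipBr x y z : ip x (y - z) = ip x y - ip x z.
Proof. by rewrite ipDr ipNr. Qed.

Lemma ipDl x y z : ip (x + y) z = ip x z + ip y z.
Proof. by rewrite ip_conj ipDr conjcD -!ip_conj. Qed.

Lemma ip0l x : ip 0 x = 0. Proof. by rewrite ip_conj ip0r conjc0. Qed.

Lemma ipZl a x y : ip (a *: x) y = conjc a * ip x y.
Proof. by rewrite ip_conj ipZr conjcM -ip_conj. Qed.

Lemma ipNl x y : ip (- x) y = - ip x y.
Proof. by rewrite ip_conj ipNr conjcN -ip_conj. Qed.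

Lemma ipBl x y z : ip (x - y) z = ip x z - ip y z.
Proof. by rewrite ipDl ipNl. Qed.

Lemma ip_sumr (I : Type) (r : seq I) (P : pred I) x (F : I -> H) :
  ip x (\sum_(i <- r | P i) F i) = \sum_(i <- r | P i) ip x (F i).
Proof. exact: (big_morph (ip x) (ipDr x) (ip0r x)). Qed.

Lemma ip_suml (I : Type) (r : seq I) (P : pred I) x (F : I -> H) :
  ip (\sum_(i <- r | P i) F i) x = \sum_(i <- r | P i) ip (F i) x.
Proof.
apply: (big_morph (ip^~ x)) => [y z|]; [exact: ipDl | exact: ip0l].
Qed.

Definition nsq x : R := complex.Re (ip x x).

Lemma ipxx x : ip x x = (nsq x)%:C.
Proof.
have := ip_conj x x; rewrite /nsq; case: (ip x x) => a b [/eqP].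
by rewrite -addr_eq0 -mulr2n mulrn_eq0 /= => /eqP ->.
Qed.

Lemma nsq_ge0 x : 0 <= nsq x.
Proof.
have [->|x0] := eqVneq x 0; first by rewrite /nsq ip0r.
by have [_ _ /(_ _ x0)] := ipP; rewrite ipxx ltcR => /ltW.
Qed.

Lemma nsq_eq0 x : (nsq x == 0) = (x == 0).
Proof.
have [->|x0] := eqVneq x 0; first by rewrite /nsq ip0r eqxx.
by have [_ _ /(_ _ x0)] := ipP; rewrite ipxx ltcR => /gt_eqF.
Qed.

Lemma nsq0 : nsq 0 = 0. Proof. by apply/eqP; rewrite nsq_eq0. Qed.

Lemma hnormE x : hnorm ip x = Num.sqrt (nsq x). Proof. by []. Qed.

Lemma sqr_hnorm x : hnorm ip x ^+ 2 = nsq x.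
Proof. by rewrite sqr_sqrtr ?nsq_ge0. Qed.

Lemma hnorm_ge0 x : 0 <= hnorm ip x. Proof. exact: sqrtr_ge0. Qed.

Lemma hnorm_eq0 x : (hnorm ip x == 0) = (x == 0).
Proof. by rewrite -nsq_eq0 -sqr_hnorm sqrf_eq0. Qed.

Lemma hnorm0 : hnorm ip 0 = 0. Proof. by apply/eqP; rewrite hnorm_eq0. Qed.

Lemma nsqZ a x : nsq (a *: x) = nsqc a * nsq x.
Proof. by rewrite /nsq ipZr ipZl mulrA [a * _]mulrC mul_conjc ipxx -RcM. Qed.

Lemma nsqN x : nsq (- x) = nsq x.
Proof. by rewrite /nsq ipNr ipNl opprK. Qed.

Lemma hnormN x : hnorm ip (- x) = hnorm ip x.
Proof. by rewrite !hnormE nsqN. Qed.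

Lemma hnormZ a x : hnorm ip (a *: x) = Num.sqrt (nsqc a) * hnorm ip x.
Proof. by rewrite !hnormE nsqZ sqrtrM ?nsqc_ge0. Qed.

Lemma nsq_orthD x y : ip x y = 0 -> nsq (x + y) = nsq x + nsq y.
Proof.
move=> xy; rewrite /nsq ipDr !ipDl xy [ip y x]ip_conj xy conjc0 addr0 add0r.
by rewrite raddfD.
Qed.

Lemma cauchy_schwarz x y : nsqc (ip x y) <= nsq x * nsq y.
Proof.
have [->|x0] := eqVneq x 0; first by rewrite ip0l nsqc0 nsq0 mul0r.
have xp : 0 < nsq x by rewrite lt_def nsq_eq0 x0 nsq_ge0.
pose a := ip x y / (nsq x)%:C.
have := nsq_ge0 (y - a *: x).
suff -> : nsq (y - a *: x) = nsq y - nsqc (ip x y) / nsq x.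
  by rewrite subr_ge0 ler_pdivrMr // mulrC.
have o : ip (a *: x) (y - a *: x) = 0.
  rewrite ipBr !ipZl ipZr ipxx /a divfK ?subrr //.
  by rewrite eq_complex /= negb_and (gt_eqF xp).
have /eqP := nsq_orthD o; rewrite addrC subrK addrC -subr_eq => /eqP <-.
rewrite nsqZ /a nsqcM -fmorphV /= nsqcR exprVn expr2 invfM -!mulrA.
by rewrite [X in _ * (_ * X)]mulVf ?gt_eqF // mulr1.
Qed.

Lemma cauchy_schwarz_norm x y :
  Num.sqrt (nsqc (ip x y)) <= hnorm ip x * hnorm ip y.
Proof.
by rewrite !hnormE -sqrtrM ?nsq_ge0 // ler_wsqrtr // cauchy_schwarz.
Qed.

Lemma Re_ip_le x y : complex.Re (ip x y) <= hnorm ip x * hnorm ip y.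
Proof.
apply: le_trans (cauchy_schwarz_norm x y).
apply: le_trans (ler_norm _) _; rewrite -sqrtr_sqr ler_wsqrtr //.
by rewrite lerDl sqr_ge0.
Qed.

Lemma hnormD x y : hnorm ip (x + y) <= hnorm ip x + hnorm ip y.
Proof.
rewrite -(ler_pXn2r (n := 2)) ?nnegrE ?addr_ge0 ?hnorm_ge0 //.
rewrite sqr_hnorm sqrrD !sqr_hnorm {1}/nsq ipDr !ipDl !raddfD /= -!/(nsq _).
have -> : complex.Re (ip y x) = complex.Re (ip x y).
  by rewrite ip_conj; case: (ip x y).
have := Re_ip_le x y; rewrite mulr2n; lra.
Qed.

Lemma hnormB x y : hnorm ip (x - y) <= hnorm ip x + hnorm ip y.
Proof. by apply: le_trans (hnormD _ _) _; rewrite hnormN. Qed.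

Lemma hnorm_subC x y : hnorm ip (x - y) = hnorm ip (y - x).
Proof. by rewrite -hnormN opprB. Qed.

Lemma hnorm_sub_le x y z :
  hnorm ip (x - z) <= hnorm ip (x - y) + hnorm ip (y - z).
Proof. by rewrite -[x - z](subrKA y) hnormD. Qed.

Lemma hcvgP (u : nat -> H) l : hcvg ip u l <->
  forall e : R, 0 < e -> exists N, forall n, (N <= n)%N -> hnorm ip (u n - l) < e.
Proof.
split=> [/cvgrPdist_lt h e e0|h].
  have [N _ hN] := h e e0; exists N => n /hN; rewrite sub0r normrN.
  by rewrite ger0_norm ?hnorm_ge0.
apply/cvgrPdist_lt => e e0; have [N hN] := h e e0; exists N => // n /hN.
by rewrite sub0r normrN ger0_norm ?hnorm_ge0.
Qed.

Lemma hcvg_cst x : hcvg ip (fun=> x) x.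
Proof. by apply/hcvgP => e e0; exists 0%N => n _; rewrite subrr hnorm0. Qed.

Lemma hcvgD (u v : nat -> H) x y :
  hcvg ip u x -> hcvg ip v y -> hcvg ip (fun n => u n + v n) (x + y).
Proof.
move=> /hcvgP hu /hcvgP hv; apply/hcvgP => e e0.
have [N1 h1] := hu (e / 2) (halfr_gt0 e0).
have [N2 h2] := hv (e / 2) (halfr_gt0 e0).
exists (maxn N1 N2) => n; rewrite geq_max => /andP[/h1 {}h1 /h2 {}h2].
rewrite opprD addrACA; apply: le_lt_trans (hnormD _ _) _; lra.
Qed.

Lemma hcvg_bounded (T : H -> H) (u : nat -> H) x :
  bounded_op ip T -> hcvg ip u x -> hcvg ip (T \o u) (T x).
Proof.
move=> [lT [M hM]] /hcvgP hu; apply/hcvgP => e e0.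
have M0 : 0 < `|M| + 1 by rewrite ltr_wpDl.
have [N hN] := hu (e / (`|M| + 1)) (divr_gt0 e0 M0).
exists N => n /hN /=; rewrite ltr_pdivlMr // => h.
have -> : T (u n) - T x = T (u n - x).
  by rewrite addrC -scaleN1r -lT scaleN1r addrC.
apply: le_lt_trans (hM _) _; apply: le_lt_trans h.
rewrite mulrC ler_wpM2l ?hnorm_ge0 //.
by apply: le_trans (ler_norm M) _; rewrite lerDl.
Qed.

Lemma small_eq0 (a : R) : (forall e, 0 < e -> a <= e) -> 0 <= a -> a = 0.
Proof.
move=> h a0; apply/eqP; rewrite eq_le a0 andbT; apply/ler_addgt0Pl => e e0.
by rewrite addr0; apply: h.
Qed.

(** Both sides are continuous by Cauchy-Schwarz. The two sequences are independent, so [v] may be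
    the image of [u] under an unbounded operator: this is how relations between coefficients pass to
    closures. *)
Lemma ip_lim_eq (u v : nat -> H) x y g h (c : R[i]) :
  hcvg ip u x -> hcvg ip v y ->
  (forall n, ip g (v n) = c * ip h (u n)) -> ip g y = c * ip h x.
Proof.
move=> /hcvgP hu /hcvgP hv uv; apply/eqP; rewrite -subr_eq0 -nsqc_eq0; apply/eqP.
(* With this [K] the two Cauchy-Schwarz errors, doubled by [nsqcD_le], add up to at most
   [K * (e / K)]. *)
pose K := 2 * (nsq g + nsqc c * nsq h) + 1.
have K0 : 0 < K.
  by rewrite ltr_wpDl // mulr_ge0 // addr_ge0 ?nsq_ge0 // mulr_ge0 ?nsqc_ge0 ?nsq_ge0.
apply: small_eq0 (nsqc_ge0 _) => e e0.
have d0 : 0 < Num.sqrt (e / K) by rewrite sqrtr_gt0 divr_gt0.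
have [N1 h1] := hu _ d0; have [N2 h2] := hv _ d0.
set n := maxn N1 N2.
have sm z : hnorm ip z < Num.sqrt (e / K) -> nsq z <= e / K.
  move=> zl; rewrite -sqr_hnorm -[leRHS]sqr_sqrtr; last by rewrite divr_ge0 ?ltW.
  by rewrite ler_pXn2r ?nnegrE ?hnorm_ge0 ?sqrtr_ge0 // ltW.
have /sm n1 := h1 n (leq_maxl _ _); have /sm n2 := h2 n (leq_maxr _ _).
have -> : ip g y - c * ip h x = - ip g (v n - y) + c * ip h (u n - x).
  by rewrite !ipBr uv; ring.
apply: le_trans (nsqcD_le _ _) _; rewrite nsqcN nsqcM.
have c1 := cauchy_schwarz g (v n - y); have c2 := cauchy_schwarz h (u n - x).
have c1' : nsqc (ip g (v n - y)) <= nsq g * (e / K).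
  by apply: le_trans c1 _; rewrite ler_wpM2l ?nsq_ge0.
have c2' : nsqc c * nsqc (ip h (u n - x)) <= nsqc c * (nsq h * (e / K)).
  rewrite ler_wpM2l ?nsqc_ge0 //; apply: le_trans c2 _.
  by rewrite ler_wpM2l ?nsq_ge0.
have eK : e = K * (e / K) by rewrite mulrC divfK ?gt_eqF.
have eK0 : 0 < e / K by rewrite divr_gt0.
rewrite [leRHS]eK; move: c1' c2' eK0; set E := e / K; rewrite /K; nra.
Qed.

Lemma ip_cvg_eq (u : nat -> H) x g c :
  hcvg ip u x -> (exists N, forall n, (N <= n)%N -> ip g (u n) = c) -> ip g x = c.
Proof.
move=> /hcvgP hu [N hN].
have sh : hcvg ip (fun n => u (n + N)%N) x.
  apply/hcvgP => e /hu[N' h']; exists N' => n hn; apply: h'.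
  exact: leq_trans hn (leq_addr _ _).
(* The eventual value [c] is written as a multiple of the constant [ip g g], which requires [g] to
   be nonzero. *)
have [g0|c0] := eqVneq g 0.
  by rewrite g0 ip0l -(hN N (leqnn N)) g0 ip0l.
have gg : ip g g != 0.
  by rewrite ipxx eq_complex /= eqxx andbT nsq_eq0.
rewrite (@ip_lim_eq (fun=> g) (fun n => u (n + N)%N) g x g g (c / ip g g)) ?divfK //.
  exact: hcvg_cst.
by move=> n; rewrite hN ?leq_addl.
Qed.

Lemma nsq_lim_le (u : nat -> H) x M :
  hcvg ip u x -> (forall n, nsq (u n) <= M) -> nsq x <= M.
Proof.
move=> /hcvgP hu hM; have M0 : 0 <= M by apply: le_trans (hM 0%N); rewrite nsq_ge0.
have : hnorm ip x <= Num.sqrt M.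
  apply/ler_addgt0Pl => e /hu[N /(_ N (leqnn _)) h].
  rewrite -[x](subrK (u N)); apply: le_trans (hnormD _ _) _.
  by rewrite hnorm_subC lerD ?(ltW h) // hnormE ler_wsqrtr.
by rewrite -(ler_pXn2r (n := 2)) ?nnegrE ?hnorm_ge0 ?sqrtr_ge0 // sqr_hnorm sqr_sqrtr.
Qed.

(** By Pythagoras every point of [S] lies at distance at least [hnorm ip x] from [x]. *)
Lemma hdense_orth (S : set H) x : hdense ip S -> (forall y, S y -> ip y x = 0) -> x = 0.
Proof.
move=> dS xS; apply/eqP; rewrite -hnorm_eq0; apply/eqP.
apply: small_eq0 (hnorm_ge0 _) => e e0; have [y Sy xy] := dS x e e0.
apply: ltW; apply: le_lt_trans xy.
rewrite -(ler_pXn2r (n := 2)) ?nnegrE ?hnorm_ge0 // !sqr_hnorm.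
have o : ip x (- y) = 0 by rewrite ipNr ip_conj (xS _ Sy) conjc0 oppr0.
by rewrite nsq_orthD // lerDl nsq_ge0.
Qed.

Lemma bounded_nsq (T : H -> H) : linear T ->
  (exists M, forall x, nsq (T x) <= M * nsq x) -> bounded_op ip T.
Proof.
move=> lT [M hM]; split=> //; exists (Num.sqrt `|M|) => x.
rewrite !hnormE -sqrtrM // ler_wsqrtr //; apply: le_trans (hM x) _.
by rewrite ler_wpM2r ?nsq_ge0 // ler_norm.
Qed.

Lemma bounded_nsqP (T : H -> H) : bounded_op ip T ->
  exists2 M, 0 <= M & forall x, nsq (T x) <= M * nsq x.
Proof.
move=> [_ [M hM]]; exists (M ^+ 2) => [|x]; first exact: sqr_ge0.
rewrite -!sqr_hnorm -exprMn ler_pXn2r ?nnegrE ?hnorm_ge0 ?hM //.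
exact: le_trans (hnorm_ge0 _) (hM x).
Qed.

Lemma bounded_lin a S T : bounded_op ip S -> bounded_op ip T ->
  bounded_op ip (fun x => a *: S x + T x).
Proof.
move=> [lS [M hM]] [lT [N hN]]; split=> [b x y|].
  by rewrite lS lT !scalerDr !scalerA addrACA [a * b]mulrC.
exists (Num.sqrt (nsqc a) * M + N) => x; apply: le_trans (hnormD _ _) _.
by rewrite hnormZ mulrDl -mulrA lerD // ler_wpM2l ?sqrtr_ge0.
Qed.

Lemma bounded_id : bounded_op ip id.
Proof. by split=> //; exists 1 => x; rewrite mul1r. Qed.

Lemma bounded_0 : bounded_op ip (fun=> 0).
Proof.
split=> [a x y|]; first by rewrite scaler0 addr0.
by exists 0 => x; rewrite hnorm0 mul0r.
Qed.

Lemma bounded_comp S T : bounded_op ip S -> bounded_op ip T ->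
  bounded_op ip (fun x => S (T x)).
Proof.
move=> [lS [M hM]] [lT [N hN]]; split=> [b x y|]; first by rewrite lT lS.
exists (`|M| * N) => x; rewrite -mulrA; apply: le_trans (hM _) _.
apply: (le_trans (ler_wpM2r (hnorm_ge0 _) (ler_norm M))).
by rewrite ler_wpM2l.
Qed.

Lemma bounded_D S T : bounded_op ip S -> bounded_op ip T ->
  bounded_op ip (fun x => S x + T x).
Proof.
move=> bS bT; have := bounded_lin 1 bS bT.
by congr bounded_op; apply/funext => x; rewrite scale1r.
Qed.

Lemma bounded_Z a S : bounded_op ip S -> bounded_op ip (fun x => a *: S x).
Proof.
move=> bS; have := bounded_lin a bS bounded_0.
by congr bounded_op; apply/funext => x; rewrite addr0.
Qed.

Lemma bounded_sum (J : Type) (r : seq J) (F : J -> H -> H) :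
  (forall j, bounded_op ip (F j)) -> bounded_op ip (fun x => \sum_(j <- r) F j x).
Proof.
move=> bF; elim: r => [|j r IH].
  by have := bounded_0; congr bounded_op; apply/funext => x; rewrite big_nil.
have := bounded_D (bF j) IH.
by congr bounded_op; apply/funext => x; rewrite big_cons.
Qed.

End InnerProduct.

(** * Orthonormal families *)

(* The vectors e_i are allowed to vanish, which makes it possible to index a
   basis by a simple type such as nat * int. *)
Definition orthonormal (R : realType) (H : lmodType R[i]) (ip : H -> H -> R[i])
    (I : Type) (e : I -> H) : Prop :=
  (forall i j, i <> j -> ip (e i) (e j) = 0) /\
  (forall i, e i = 0 \/ ip (e i) (e i) = 1).

Definition complete_family (R : realType) (H : lmodType R[i])
    (ip : H -> H -> R[i]) (I : Type) (e : I -> H) : Prop :=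
  forall x, (forall i, ip (e i) x = 0) -> x = 0.

Section Prefix.
Variable I : countType.

(** Infinite sums over a countable type are limits along these growing duplicate-free lists; codes
    that encode no element are skipped. *)
Definition prefix_enum n : seq I := pmap (@pickle_inv I) (iota 0 n).

Lemma prefix_enumD m n : exists s, prefix_enum (m + n) = prefix_enum m ++ s.
Proof. by rewrite /prefix_enum iotaD pmap_cat; eexists. Qed.

Lemma prefix_enum_uniq n : uniq (prefix_enum n).
Proof.
by apply: (pmap_uniq (@pickle_invK I)); rewrite iota_uniq.
Qed.

Lemma mem_prefix_enum i n : (choice.pickle i < n)%N -> i \in prefix_enum n.
Proof.
move=> h; rewrite mem_pmap; apply/mapP; exists (choice.pickle i).
  by rewrite mem_iota add0n.
by rewrite pickleK_inv.
Qed.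

End Prefix.

Lemma nsq_sum_orth (R : realType) (H : lmodType R[i]) (ip : H -> H -> R[i])
    (I : eqType) (f : I -> H) (s : seq I) (a : I -> R[i]) :
  inner_product ip -> (forall i j, i != j -> ip (f i) (f j) = 0) -> uniq s ->
  nsq ip (\sum_(i <- s) a i *: f i) = \sum_(i <- s) nsqc (a i) * nsq ip (f i).
Proof.
move=> ipP f_orth; elim: s => [|i s IH] /=; first by rewrite !big_nil (nsq0 ipP).
move=> /andP[is_ us]; rewrite !big_cons (nsq_orthD ipP) ?IH // ?(nsqZ ipP) //.
rewrite (ip_sumr ipP) big1_seq // => j /andP[_ js].
rewrite (ipZl ipP) (ipZr ipP) f_orth ?mulr0 ?mulr0 //.
by apply: contraNneq is_ => ->.
Qed.

Section Orthonormal.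
Variables (R : realType) (H : lmodType R[i]) (ip : H -> H -> R[i]).
Hypothesis ipP : inner_product ip.
Variables (I : choiceType) (e : I -> H).
Hypothesis eON : orthonormal ip e.
Implicit Types (x y : H) (s : seq I).

Lemma on_orth i j : i != j -> ip (e i) (e j) = 0.
Proof. by move=> /eqP; case: eON => h _; apply: h. Qed.

Lemma on_unit i : e i != 0 -> ip (e i) (e i) = 1.
Proof. by case: eON => _ /(_ i)[->|//]; rewrite eqxx. Qed.

Lemma on_nsq i : nsq ip (e i) = (e i != 0)%:R.
Proof.
by have [->|/on_unit u] := eqVneq (e i) 0; rewrite ?(nsq0 ipP) // /nsq u.
Qed.

Lemma on_nsq_le1 i : nsq ip (e i) <= 1.
Proof. by rewrite on_nsq; case: (e i != 0). Qed.

Lemma on_ip i j : e i != 0 -> ip (e i) (e j) = (i == j)%:R.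
Proof. by move=> i0; have [<-|/on_orth ->//] := eqVneq i j; rewrite on_unit. Qed.

Lemma ip_sum_on i s (a : I -> R[i]) : uniq s ->
  ip (e i) (\sum_(j <- s) a j *: e j) = (i \in s)%:R * (a i * ip (e i) (e i)).
Proof.
move=> us; rewrite (ip_sumr ipP).
under eq_bigr do rewrite (ipZr ipP).
have [is_|is_] := boolP (i \in s).
  rewrite (big_rem i) //= mul1r big1_seq ?addr0 // => j.
  rewrite mem_rem_uniq // => /andP[_] /andP[ji _].
  by rewrite on_orth ?mulr0 // eq_sym.
rewrite mul0r big1_seq // => j /andP[_ js].
by rewrite on_orth ?mulr0 //; apply: contraNneq is_ => ->.
Qed.

Lemma nsq_sum_on s (a : I -> R[i]) : uniq s ->
  nsq ip (\sum_(i <- s) a i *: e i) = \sum_(i <- s) nsqc (a i) * nsq ip (e i).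
Proof. by apply: nsq_sum_orth => // i j; exact: on_orth. Qed.

Lemma nsq_sum_on_le s (a : I -> R[i]) : uniq s ->
  nsq ip (\sum_(i <- s) a i *: e i) <= \sum_(i <- s) nsqc (a i).
Proof.
move=> us; rewrite nsq_sum_on //; apply: ler_sum => i _.
by rewrite ler_piMr ?nsqc_ge0 ?on_nsq_le1.
Qed.

Lemma bessel s x : uniq s -> \sum_(i <- s) nsqc (ip (e i) x) <= nsq ip x.
Proof.
move=> us; set y := \sum_(i <- s) ip (e i) x *: e i.
have yE i : i \in s -> ip (e i) y = ip (e i) x.
  move=> is_; rewrite ip_sum_on // is_ mul1r.
  have [->|/on_unit ->] := eqVneq (e i) 0; last by rewrite mulr1.
  by rewrite !(ip0l ipP) mulr0.
have yxy : ip y (x - y) = 0.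
  rewrite {1}/y (ip_suml ipP) big1_seq // => i /andP[_ is_].
  by rewrite (ipZl ipP) (ipBr ipP) yE // subrr mulr0.
have := nsq_orthD ipP yxy; rewrite addrC subrK => ->.
have -> : nsq ip y = \sum_(i <- s) nsqc (ip (e i) x).
  rewrite nsq_sum_on //; apply: eq_bigr => i _; rewrite on_nsq.
  by have [->|] := eqVneq (e i) 0; rewrite ?mulr1 // (ip0l ipP) nsqc0 mul0r.
by rewrite lerDl (nsq_ge0 ipP).
Qed.

End Orthonormal.

Section RieszFischer.
Variables (R : realType) (H : lmodType R[i]) (ip : H -> H -> R[i]).
Hypothesis hH : hilbert_space ip.
Let ipP : inner_product ip. Proof. by case: hH. Qed.
Variables (I : countType) (e : I -> H).
Hypothesis eON : orthonormal ip e.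
Implicit Types (x y : H) (s : seq I).

(** The squared distance of two partial sums is at most the difference of two terms of a bounded
    nondecreasing real sequence. The factor [ip (e i) (e i)] accounts for the vectors [e i] that
    vanish. *)
Lemma riesz_fischer (a : I -> R[i]) (M : R) :
  (forall s, uniq s -> \sum_(i <- s) nsqc (a i) <= M) ->
  exists x, [/\ hcvg ip (fun n => \sum_(i <- prefix_enum I n) a i *: e i) x,
    forall i, ip (e i) x = a i * ip (e i) (e i) & nsq ip x <= M].
Proof.
move=> hM; pose S n := \sum_(i <- prefix_enum I n) nsqc (a i).
have S_nd : nondecreasing_seq S.
  apply/nondecreasing_seqP => n; have [s] := prefix_enumD I n 1.
  rewrite addn1 /S => ->; rewrite big_cat /= lerDl.
  by apply: sumr_ge0 => i _; exact: nsqc_ge0.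
have S_ub : has_ubound (range S).
  by exists M => _ [n _ <-]; apply: hM; exact: prefix_enum_uniq.
have S_cvg := nondecreasing_is_cvgn S_nd S_ub.
have S_cauchy d : 0 < d -> exists N, forall m n, (N <= m)%N -> (m <= n)%N ->
    S n - S m < d.
  move=> d0; have /cvgrPdist_lt/(_ _ (halfr_gt0 d0))[N _ hN] := S_cvg.
  exists N => m n Nm mn; have h1 := hN m Nm; have h2 := hN n (leq_trans Nm mn).
  move: h1 h2 => /=; rewrite !ltr_norml => /andP[h1 h2] /andP[h3 h4]; lra.
pose u n := \sum_(i <- prefix_enum I n) a i *: e i.
have u_dist m n : (m <= n)%N -> nsq ip (u n - u m) <= S n - S m.
  move=> /subnKC <-; have [s hs] := prefix_enumD I m (n - m).
  have us : uniq s.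
    by have := prefix_enum_uniq I (m + (n - m)); rewrite hs cat_uniq => /and3P[].
  rewrite /u /S hs !big_cat /= addrAC subrr add0r addrAC subrr add0r.
  exact: nsq_sum_on_le.
have [|x ux] := hH.2 u.
  move=> d d0; have [N hN] := S_cauchy (d ^+ 2) (exprn_gt0 _ d0).
  have lt_d m n : (N <= m)%N -> (m <= n)%N -> hnorm ip (u n - u m) < d.
    move=> Nm mn; rewrite -(ltr_pXn2r (n := 2)) ?nnegrE ?hnorm_ge0 // ?(ltW d0) //.
    by rewrite (sqr_hnorm ipP); apply: le_lt_trans (u_dist _ _ mn) _; exact: hN.
  exists N => m n Nm Nn; have [mn|/ltnW nm] := leqP m n; last exact: lt_d.
  by rewrite (hnorm_subC ipP); exact: lt_d.
exists x; split=> // [i|].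
  apply: (ip_cvg_eq ipP ux); exists (choice.pickle i).+1 => n hn.
  by rewrite ip_sum_on ?prefix_enum_uniq // mem_prefix_enum // mul1r.
apply: (nsq_lim_le ipP ux) => n.
apply: le_trans (nsq_sum_on_le ipP eON _ (prefix_enum_uniq I n)) _.
by apply: hM; exact: prefix_enum_uniq.
Qed.

Hypothesis eC : complete_family ip e.

Lemma coef_inj x y : (forall i, ip (e i) x = ip (e i) y) -> x = y.
Proof.
move=> h; apply/eqP; rewrite -subr_eq0; apply/eqP/eC => i.
by rewrite (ipBr ipP) h subrr.
Qed.

Lemma fourier x :
  hcvg ip (fun n => \sum_(i <- prefix_enum I n) ip (e i) x *: e i) x.
Proof.
have [|y [hy yE _]] := @riesz_fischer (fun i => ip (e i) x) (nsq ip x).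
  by move=> s us; exact: bessel.
suff xy : x = y by rewrite [X in hcvg _ _ X]xy.
apply: coef_inj => i; rewrite yE.
have [->|i0] := eqVneq (e i) 0; first by rewrite !(ip0l ipP) mul0r.
by rewrite (on_unit eON) // mulr1.
Qed.

Lemma nsq_le_coef x M :
  (forall s, uniq s -> \sum_(i <- s) nsqc (ip (e i) x) <= M) -> nsq ip x <= M.
Proof.
move=> hM; apply: (nsq_lim_le ipP (fourier x)) => n.
apply: le_trans (nsq_sum_on_le ipP eON _ (prefix_enum_uniq I n)) _.
by apply: hM; exact: prefix_enum_uniq.
Qed.

(** This is the source of all bounded operators built from matrices. Row [i] has its only entry in
    column [s i]; since [s] is injective on the support of [c], each coefficient of [x] is used at
    most once and Bessel's inequality bounds the image. *)
Lemma weighted_shift (c : I -> R[i]) (s : I -> I) (M : R) :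
  (forall i, nsqc (c i) <= M) ->
  (forall i j, c i != 0 -> c j != 0 -> s i = s j -> i = j) ->
  exists2 T, bounded_op ip T /\ (forall x, nsq ip (T x) <= M * nsq ip x)
    & forall x i, e i != 0 -> ip (e i) (T x) = c i * ip (e (s i)) x.
Proof.
move=> cM s_inj.
have M0 (i : I) : 0 <= M by exact: le_trans (nsqc_ge0 _) (cM i).
have ex x : exists y, nsq ip y <= M * nsq ip x /\
    forall i, e i != 0 -> ip (e i) y = c i * ip (e (s i)) x.
  have [|y [_ yE yM]] := @riesz_fischer (fun i => c i * ip (e (s i)) x)
      (M * nsq ip x); last first.
    by exists y; split=> // i i0; rewrite yE (on_unit eON) // mulr1.
  (* For the empty list one needs [0 <= M], which is known only when [I] is inhabited; otherwise
     completeness makes the whole space zero. *)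
  case=> [|i0 t] ut; [|move: (i0 :: t) ut => {t} t ut].
    rewrite big_nil; have [[i _]|nI] := pselect (exists i : I, True).
      by rewrite mulr_ge0 ?(nsq_ge0 ipP) // (M0 i).
    suff -> : x = 0 by rewrite (nsq0 ipP) mulr0.
    by apply: eC => i; case: nI; exists i.
  rewrite (bigID (fun i => c i == 0)) /= big1 ?add0r => [|i /eqP ->]; last first.
    by rewrite mul0r nsqc0.
  rewrite -big_filter; set t' := [seq i <- t | c i != 0].
  have ut' : uniq [seq s i | i <- t'].
    rewrite map_inj_in_uniq ?filter_uniq // => i j.
    by rewrite !mem_filter => /andP[ci _] /andP[cj _]; exact: s_inj.
  apply: le_trans (_ : \sum_(i <- t') M * nsqc (ip (e (s i)) x) <= _).
    by apply: ler_sum => i _; rewrite nsqcM ler_wpM2r ?nsqc_ge0.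
  rewrite -mulr_sumr ler_wpM2l ?(M0 i0) //.
  by have := bessel ipP eON x ut'; rewrite big_map.
have [T hT] := choice ex.
exists T => [|x i i0]; last exact: (hT x).2.
split=> [|x]; last exact: (hT x).1.
apply: bounded_nsq => //; last by exists M => x; exact: (hT x).1.
move=> a x y; apply: coef_inj => i.
have [->|i0] := eqVneq (e i) 0; first by rewrite !(ip0l ipP).
by rewrite (ipDr ipP) (ipZr ipP) !(hT _).2 // (ipDr ipP) (ipZr ipP); ring.
Qed.

Lemma diag_op (g : I -> R[i]) (M : R) : (forall i, nsqc (g i) <= M) ->
  exists2 T, bounded_op ip T & forall x i, ip (e i) (T x) = g i * ip (e i) x.
Proof.
move=> /(@weighted_shift g id)[//|T [bT _] hT]; exists T => // x i.
have [->|] := eqVneq (e i) 0; last exact: hT.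
by rewrite !(ip0l ipP) mulr0.
Qed.

Lemma diag_op_basis (g : I -> R[i]) T j :
  (forall x i, ip (e i) (T x) = g i * ip (e i) x) -> T (e j) = g j *: e j.
Proof.
move=> hT; apply: coef_inj => i; rewrite hT (ipZr ipP).
by have [->//|ij] := eqVneq i j; rewrite (on_orth eON) // !mulr0.
Qed.

End RieszFischer.

(** * Diagonal operators *)

(** The equivalence fixes the domain as well: it is the maximal one, so [x] belongs to it as soon as
    the multiplied coefficients are those of some vector [y]. *)
Definition is_diag (R : realType) (H : lmodType R[i]) (ip : H -> H -> R[i])
    (I : Type) (e : I -> H) (lam : I -> R) (D : operator H) : Prop :=
  forall x y, (opdom D x /\ D x = y) <->
    forall i, ip (e i) y = (lam i)%:C * ip (e i) x.

Lemma one_sqr_gt0 (R : realType) (a : R) : 0 < 1 + a ^+ 2.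
Proof. by rewrite ltr_wpDr ?sqr_ge0. Qed.

Lemma quot_sqr_le1 (R : realType) (a : R) : (a / (1 + a ^+ 2)) ^+ 2 <= 1.
Proof.
rewrite exprMn exprVn ler_pdivrMr ?exprn_gt0 ?one_sqr_gt0 // mul1r.
by have := sqr_ge0 a; nra.
Qed.

Lemma sqr_inv_one_sqr (R : realType) (a : R) :
  (a ^+ 2)%:C * ((1 + a ^+ 2)^-1)%:C = 1 - ((1 + a ^+ 2)^-1)%:C :> R[i].
Proof.
rewrite -RcM -Rc1 -RcB; congr _%:C.
by have := one_sqr_gt0 a => /gt_eqF/negbT h; field.
Qed.

Section Diagonal.
Variables (R : realType) (H : lmodType R[i]) (ip : H -> H -> R[i]).
Hypothesis hH : hilbert_space ip.
Let ipP : inner_product ip. Proof. by case: hH. Qed.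
Variables (I : countType) (e : I -> H).
Hypothesis eON : orthonormal ip e.
Hypothesis eC : complete_family ip e.
Implicit Types (x y : H) (lam : I -> R) (D : operator H).

Lemma diag_exists lam : exists D, is_diag ip e lam D.
Proof.
pose G x := [set y | forall i, ip (e i) y = (lam i)%:C * ip (e i) x].
exists (Operator [set x | exists y, G x y] (fun x => xget 0 (G x))) => x y /=.
have Guniq z : G x y -> G x z -> z = y.
  by move=> h h'; apply: (coef_inj hH eC) => i; rewrite h h'.
split=> [[[z Gz] <-]|Gy]; first exact: (xgetPex 0 (ex_intro _ z Gz)).
by split; [exists y | apply: Guniq => //; apply: (xgetPex 0 (ex_intro _ y Gy))].
Qed.

Section Fixed.
Variables (lam : I -> R) (D : operator H).
Hypothesis hD : is_diag ip e lam D.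

Lemma diag_coef x i : opdom D x -> ip (e i) (D x) = (lam i)%:C * ip (e i) x.
Proof. by move=> xD; have /hD := conj xD (erefl (D x)). Qed.

Lemma diagI x y : (forall i, ip (e i) y = (lam i)%:C * ip (e i) x) ->
  opdom D x /\ D x = y.
Proof. by move/hD. Qed.

Lemma diag_basis i : opdom D (e i) /\ D (e i) = (lam i)%:C *: e i.
Proof.
apply: diagI => j; rewrite (ipZr ipP).
by have [->//|ij] := eqVneq j i; rewrite (on_orth eON) // !mulr0.
Qed.

Lemma diag_prefix x n :
  opdom D (\sum_(i <- prefix_enum I n) ip (e i) x *: e i) /\
  D (\sum_(i <- prefix_enum I n) ip (e i) x *: e i) =
  \sum_(i <- prefix_enum I n) ((lam i)%:C * ip (e i) x) *: e i.
Proof.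
apply: diagI => i; rewrite !(ip_sum_on ipP eON) ?prefix_enum_uniq //; ring.
Qed.

Lemma diag_dense : hdense ip (opdom D).
Proof.
move=> x d d0; have /hcvgP/(_ d d0)[N /(_ N (leqnn _)) hN] := fourier hH eON eC x.
exists (\sum_(i <- prefix_enum I N) ip (e i) x *: e i); first exact: (diag_prefix _ _).1.
by rewrite (hnorm_subC ipP).
Qed.

Lemma diag_linear : linear_on_dom D.
Proof.
split=> [|a x y xD yD].
  by apply: (proj1 (diagI (y := 0) _)) => i; rewrite (ip0r ipP) mulr0.
apply: diagI => i; rewrite !(ipDr ipP) !(ipZr ipP) !diag_coef //; ring.
Qed.

Lemma diag_cvg x : opdom D x ->
  hcvg ip (fun n => D (\sum_(i <- prefix_enum I n) ip (e i) x *: e i)) (D x).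
Proof.
move=> xD; have := fourier hH eON eC (D x).
congr (hcvg _ _ _); apply/funext => n; rewrite (diag_prefix _ _).2.
by apply: eq_bigr => i _; rewrite diag_coef.
Qed.

Lemma diag_symmetric x y : opdom D x -> opdom D y -> ip y (D x) = ip (D y) x.
Proof.
move=> xD yD; rewrite -[RHS]mul1r.
apply: (@ip_lim_eq R H ip ipP _ _ _ _ y (D y) 1 (fourier hH eON eC x) (diag_cvg xD)).
move=> n; rewrite mul1r (diag_prefix _ _).2 !(ip_sumr ipP); apply: eq_bigr => i _.
rewrite !(ipZr ipP) [ip y _](ip_conj ipP) [ip (D y) _](ip_conj ipP) diag_coef //.
rewrite conjcM conjcR; ring.
Qed.

(** Testing the adjoint relation on the [e i], which lie in the domain, gives the coefficients of
    [z]; maximality of the domain then puts [y] in it. *)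
Lemma diag_self_adjoint : self_adjoint ip D.
Proof.
split; [exact: diag_dense | exact: diag_linear |] => y z; split=> [h|[yD <-] x xD].
  apply: diagI => i; have [eD De] := diag_basis i.
  have := h _ eD; rewrite De (ipZr ipP) => /(congr1 (@conjc R)).
  by rewrite conjcM conjcR -!(ip_conj ipP) => ->.
exact: diag_symmetric.
Qed.

(** The point is the domain: if the products with [lam i ^+ 2] are coefficients of a vector [y],
    then so are the products with [lam i]. That vector is the image of [x + y] under the bounded
    operator with symbol [lam i / (1 + lam i ^+ 2)]. *)
Lemma diag_sqr : is_diag ip e (fun i => lam i ^+ 2) (op_sqr D).
Proof.
move=> x y /=; split=> [[[xD DxD] <-] i|h].
  by rewrite !diag_coef // mulrA -rmorphM expr2.
have gM i : nsqc (lam i / (1 + lam i ^+ 2))%:C <= 1 by rewrite nsqcR quot_sqr_le1.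
have [T bT hT] := diag_op hH eON eC gM.
have hx i : ip (e i) (T (x + y)) = (lam i)%:C * ip (e i) x.
  have l2 := sqr_inv_one_sqr (lam i).
  rewrite hT (ipDr ipP) h RcM; move: l2.
  set c := (_^-1)%:C; set l2 := (_ ^+ 2)%:C => l2c.
  transitivity ((lam i)%:C * (c + l2 * c) * ip (e i) x); first by ring.
  by rewrite l2c addrCA subrr addr0 mulr1.
have [xD Dx] := diagI hx.
have [DxD DDx] : opdom D (D x) /\ D (D x) = y.
  by apply: diagI => i; rewrite h diag_coef // mulrA -rmorphM expr2.
by [].
Qed.

End Fixed.

Lemma diag_eq D E lam : is_diag ip e lam D -> is_diag ip e lam E -> op_eq D E.
Proof.
move=> hD hE; split.
  by apply/seteqP; split=> x xD;
    [have /hD/hE[]:= conj xD (erefl (D x)) | have /hE/hD[]:= conj xD (erefl (E x))].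
by move=> x xD; have /hD/hE[] := conj xD (erefl (D x)).
Qed.

(** [D] is the square, domain included, of the diagonal operator [S] with entries
    [Num.sqrt (lam i)], so that the form is the squared norm of [S x]. *)
Lemma diag_ge0 lam D x : is_diag ip e lam D -> (forall i, 0 <= lam i) ->
  opdom D x -> 0 <= ip x (D x).
Proof.
move=> hD lam0 xD; pose g i := (Num.sqrt (lam i) / (1 + Num.sqrt (lam i) ^+ 2))%:C.
have gM i : nsqc (g i) <= 1 by rewrite nsqcR quot_sqr_le1.
have [T bT hT] := diag_op hH eON eC gM.
have [S hS] := diag_exists (fun i => Num.sqrt (lam i)).
have hSS := diag_sqr hS.
have /(diag_eq hD)[domD DS] : is_diag ip e lam (op_sqr S).
  by have := hSS; congr is_diag; apply/funext => i; rewrite sqr_sqrtr.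
rewrite DS //; have /= [xS SxS] : opdom (op_sqr S) x by rewrite -domD.
by rewrite (diag_symmetric hS) // (ipxx ipP) lecR (nsq_ge0 ipP).
Qed.

Lemma diag_abs lam D P : is_diag ip e lam D ->
  is_diag ip e (fun i => `|lam i|) P -> is_abs ip D P.
Proof.
move=> hD hP; split; first exact: diag_self_adjoint hP.
  by move=> x; apply: (diag_ge0 hP) => i.
apply: (@diag_eq _ _ (fun i => lam i ^+ 2)); last exact: diag_sqr.
have := diag_sqr hP; congr is_diag.
by apply/funext => i; rewrite real_normK ?num_real.
Qed.

Lemma diag_inv_sqrt lam D B : is_diag ip e lam D -> bounded_op ip B ->
  (forall x i, ip (e i) (B x) = ((Num.sqrt (1 + lam i ^+ 2))^-1)%:C * ip (e i) x) ->
  is_inv_sqrt ip D B.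
Proof.
move=> hD bB hB.
have dB : is_diag ip e (fun i => (Num.sqrt (1 + lam i ^+ 2))^-1)
    (Operator setT B).
  move=> x y; split=> [[_ <-] i|h]; first exact: hB.
  by split=> //; apply: (coef_inj hH eC) => i; rewrite h hB.
have hBB x i : ip (e i) (B (B x)) = ((1 + lam i ^+ 2)^-1)%:C * ip (e i) x.
  rewrite !hB mulrA -rmorphM -expr2 exprVn sqr_sqrtr //.
  by rewrite addr_ge0 ?sqr_ge0.
have hD2 := diag_sqr hD.
split=> //.
- by move=> x y; have := @diag_symmetric _ _ dB y x; rewrite /= => ->.
- by move=> x; apply: (diag_ge0 dB) => // i; rewrite invr_ge0 sqrtr_ge0.
- move=> x; have [|xD Dx] := @diagI _ _ hD2 (B (B x)) (x - B (B x)).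
    by move=> i; rewrite (ipBr ipP) hBB mulrA sqr_inv_one_sqr mulrBl mul1r.
  by split; [exact: xD | rewrite Dx addrC subrK].
move=> x xD; apply: (coef_inj hH eC) => i; rewrite hBB (ipDr ipP).
rewrite (diag_coef hD2) // mulrDr mulrA [X in _ + X * _]mulrC sqr_inv_one_sqr; ring.
Qed.

(** Uniqueness of the positive square root on an eigenvector: the difference [y] between [B (e i)]
    and the expected value satisfies [B y = - b y] with [b] positive, and positivity of [B] forces
    it to vanish. Needed for the lower bound on the dimension, where [B] is arbitrary. *)
Lemma inv_sqrt_basis lam D B i : is_diag ip e lam D -> is_inv_sqrt ip D B ->
  B (e i) = ((Num.sqrt (1 + lam i ^+ 2))^-1)%:C *: e i.
Proof.
move=> hD [[lB _] _ B_ge0 _ BBK]; set b := (Num.sqrt _)^-1.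
have BZ a x : B (a *: x) = a *: B x.
  by rewrite -[a *: x]addr0 lB (linearE0 lB) addr0.
have b_gt0 : 0 < b by rewrite invr_gt0 sqrtr_gt0 one_sqr_gt0.
have bE : (b ^+ 2)%:C * (1 + lam i ^+ 2)%:C = 1.
  rewrite -RcM -Rc1; congr _%:C.
  by rewrite exprVn sqr_sqrtr ?mulVf ?gt_eqF ?one_sqr_gt0 // ltW ?one_sqr_gt0.
have BBe : B (B (e i)) = (b ^+ 2)%:C *: e i.
  have [eD De] := diag_basis (diag_sqr hD) i.
  have := BBK _ eD; rewrite De -{1}[e i]scale1r -scalerDl.
  rewrite (_ : 1 + (lam i ^+ 2)%:C = (1 + lam i ^+ 2)%:C); last by rewrite RcD.
  rewrite !BZ => /(congr1 (fun x => (b ^+ 2)%:C *: x)).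
  by rewrite scalerA bE scale1r.
apply/eqP; rewrite -subr_eq0; set y := _ - _.
have By : B y = (- b)%:C *: y.
  have -> : B y = B (B (e i)) - b%:C *: B (e i).
    by rewrite /y addrC -scaleNr lB scaleNr addrC.
  by rewrite BBe /y RcN scaleNr scalerBr opprB scalerA -RcM -expr2.
have := B_ge0 y; rewrite By (ipZr ipP) (ipxx ipP) -RcM lecR mulNr oppr_ge0.
rewrite pmulr_rle0 // => y_le0.
by rewrite -(nsq_eq0 ipP) eq_le y_le0 (nsq_ge0 ipP).
Qed.

(** The relation on matrix entries is summed over the Fourier partial sums of [x], on which [D]
    converges to [D x], and passed to the limit. Since the domain of [D] is maximal, the limit
    relation also says that [S] preserves it. *)
Lemma commutator_ext_coef lam D S T : is_diag ip e lam D ->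
  bounded_op ip S -> bounded_op ip T ->
  (forall g h, ip (e g) (T (e h)) = (lam g - lam h)%:C * ip (e g) (S (e h))) ->
  commutator_ext ip D S T.
Proof.
move=> hD bS bT ST; split=> // x xD.
have lin_sum (U : H -> H) n (a : I -> R[i]) : bounded_op ip U ->
    U (\sum_(i <- prefix_enum I n) a i *: e i) =
    \sum_(i <- prefix_enum I n) a i *: U (e i).
  move=> [lU _]; elim: (prefix_enum I n) => [|j t IH].
    by rewrite !big_nil (linearE0 lU).
  by rewrite !big_cons lU IH.
have hx := fourier hH eON eC x.
have [] : opdom D (S x) /\ D (S x) = S (D x) + T x.
  apply: (diagI hD) => g.
  apply: (@ip_lim_eq R H ip ipP _ _ _ _ (e g) (e g) _ (hcvg_bounded bS hx)
    (hcvgD ipP (hcvg_bounded bS (diag_cvg hD xD)) (hcvg_bounded bT hx))) => n /=.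
  rewrite (diag_prefix hD _ _).2 !lin_sum // (ipDr ipP) !(ip_sumr ipP).
  rewrite mulr_sumr -big_split; apply: eq_bigr => i _ /=.
  by rewrite !(ipZr ipP) ST rmorphB /=; ring.
by move=> SxD ->; split=> //; rewrite addrC addKr.
Qed.

Lemma commutator_coef lam D S T g h : is_diag ip e lam D -> bounded_op ip S ->
  commutator_ext ip D S T ->
  ip (e g) (T (e h)) = (lam g - lam h)%:C * ip (e g) (S (e h)).
Proof.
move=> hD [lS _] [_ hT]; have [eD De] := diag_basis hD h.
have [SD <-] := hT _ eD; rewrite (ipBr ipP) (diag_coef hD) // De.
by rewrite -[_ *: e h]addr0 lS (linearE0 lS) addr0 (ipZr ipP) RcB mulrBl.
Qed.

(* Modulo 2K+1 the difference of the integer parts of [r g] and [r h] determines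
   the difference itself, as long as the latter is at most K in absolute value;
   hence the commutator is a finite combination of compressions of [S]. *)
Lemma band_commutator (r : I -> R) (N : nat) S : bounded_op ip S ->
  (forall g h, ip (e g) (S (e h)) != 0 -> `|r g - r h| <= N%:R) ->
  exists2 T, bounded_op ip T &
    forall g h, ip (e g) (T (e h)) = (r g - r h)%:C * ip (e g) (S (e h)).
Proof.
move=> bS hS; pose f i : int := Num.floor (r i).
(* Passing to integer parts changes a difference by less than one, hence [N.+1]; the residues modulo
   [2 * K + 1] separate the integers between [- K] and [K]. *)
pose K := N.+1; pose m := (2 * K).+1.
pose t i : 'I_m := inord `|(f i %% m%:Z)%Z|%N.
pose d (i j : 'I_m) : R := let a := (((i : nat)%:Z - (j : nat)%:Z) %% m%:Z)%Z in
  (if a <= K%:Z then a else a - m%:Z)%:~R.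
have tE i : ((t i : nat)%:Z = f i %% m%:Z)%Z.
  rewrite inordK ?gez0_abs ?modz_ge0 // -ltz_nat gez0_abs ?modz_ge0 //.
  exact: ltz_pmod.
have dE g h : `|r g - r h| <= N%:R -> d (t g) (t h) = (f g - f h)%:~R.
  move=> hN; rewrite /d !tE.
  have -> : ((f g %% m%:Z)%Z - (f h %% m%:Z)%Z = f g - f h %[mod m%:Z])%Z.
    by rewrite -[LHS]modzDmr modzNm modzDm.
  have zE (z : int) : (`|z| <= K%:Z)%R ->
      (if ((z %% m%:Z)%Z <= K%:Z)%R then (z %% m%:Z)%Z else (z %% m%:Z)%Z - m%:Z) = z.
    rewrite ler_norml => /andP[z1 z2]; have [z0|z0] := leP 0 z.
      by rewrite modz_small ?z2 // z0 /= /m; lia.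
    have -> : (z %% m%:Z)%Z = z + m%:Z by rewrite -modzDr modz_small // /m; lia.
    by case: ifPn; rewrite /m; lia.
  rewrite zE // -ltzD1 -(ltr_int R) intr_norm intrB.
  have := floor_itv (r g); have := floor_itv (r h).
  move: hN; rewrite ler_norml ltr_norml -/(f g) -/(f h) !intrD => /andP[h5 h6].
  move=> /andP[h1 h2] /andP[h3 h4].
  rewrite /K -!pmulrn !mulrSr; lra.
have hQ (j : 'I_m) : exists Q, bounded_op ip Q /\
    forall x i, ip (e i) (Q x) = (t i == j)%:R * ip (e i) x.
  have [|Q bQ Qc] := @diag_op R H ip hH I e eON eC (fun i => (t i == j)%:R) 1.
    by move=> i; case: (t i == j); rewrite ?nsqc0 ?(nsqcR 1) ?expr1n.
  by exists Q.
have [Q /all_and2[bQ Qc]] := choice hQ.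
(* The fractional parts of [r] form a bounded diagonal operator, whose commutator with [S] supplies
   the rest of [r g - r h]. *)
have [|F bF Fc] := @diag_op R H ip hH I e eON eC (fun i => (r i - (f i)%:~R)%:C) 1.
  move=> i; have := floor_itv (r i); rewrite -/(f i) intrD nsqcR => /andP[h1 h2].
  by rewrite expr_le1 //; lra.
exists (fun x => (F (S x) + (-1) *: S (F x)) +
    \sum_(p : 'I_m * 'I_m) (d p.1 p.2)%:C *: Q p.1 (S (Q p.2 x))).
  apply: bounded_D => //; last first.
    apply: bounded_sum => // p; apply: bounded_Z => //.
    by apply: bounded_comp => //; apply: bounded_comp.
  apply: bounded_D => //; first exact: bounded_comp.
  by apply: bounded_Z => //; exact: bounded_comp.
move=> g h; have SZ a x : S (a *: x) = a *: S x.
  by case: bS => lS _; rewrite -[a *: x]addr0 lS (linearE0 lS) addr0.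
rewrite !(ipDr ipP) (ipZr ipP) Fc (diag_op_basis hH eON eC _ Fc) SZ (ipZr ipP).
rewrite (ip_sumr ipP) (bigD1 (t g, t h)) //= big1 ?addr0 => [|[i j] ij]; last first.
  rewrite (ipZr ipP) Qc (diag_op_basis hH eON eC _ (Qc j)) SZ (ipZr ipP) /=.
  move: ij; rewrite xpair_eqE negb_and [i == _]eq_sym [j == _]eq_sym.
  by case/orP => /negbTE ->; rewrite !(mul0r, mulr0).
rewrite (ipZr ipP) Qc (diag_op_basis hH eON eC _ (Qc _)) SZ (ipZr ipP) !eqxx !mul1r.
have [->|S0] := eqVneq (ip (e g) (S (e h))) 0; first by rewrite !mulr0 !addr0.
rewrite dE ?hS // intrB !RcB; ring.
Qed.

End Diagonal.

(** * Band operators *)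

Section Band.
Variables (R : realType) (H : lmodType R[i]) (ip : H -> H -> R[i]).
Hypothesis hH : hilbert_space ip.
Let ipP : inner_product ip. Proof. by case: hH. Qed.
Variables (I : countType) (e : I -> H).
Hypothesis eON : orthonormal ip e.
Hypothesis eC : complete_family ip e.

Definition band_op (r : I -> R) (S : H -> H) : Prop := bounded_op ip S /\
  exists N : nat, forall g h, ip (e g) (S (e h)) != 0 -> `|r g - r h| <= N%:R.

Lemma band_lin r a S T : band_op r S -> band_op r T ->
  band_op r (fun x => a *: S x + T x).
Proof.
move=> [bS [M hM]] [bT [N hN]]; split; first exact: bounded_lin.
exists (maxn M N) => g h; rewrite (ipDr ipP) (ipZr ipP).
have [S0|/hM S0 _] := eqVneq (ip (e g) (S (e h))) 0.
  by rewrite S0 mulr0 add0r => /hN /le_trans ->; rewrite // ler_nat leq_maxr.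
by apply: le_trans S0 _; rewrite ler_nat leq_maxl.
Qed.

Lemma band_comp r S T : band_op r S -> band_op r T -> band_op r (fun x => S (T x)).
Proof.
move=> [bS [M hM]] [bT [N hN]]; split; first exact: bounded_comp.
exists (M + N)%N => g h; apply: contraNT; rewrite -ltNge natrD => lt_r.
have hT := hcvg_bounded bS (fourier hH eON eC (T (e h))).
apply/eqP/(ip_cvg_eq ipP hT); exists 0%N => n _ /=.
have [lS _] := bS; elim: (prefix_enum I n) => [|k s IH].
  by rewrite big_nil (linearE0 lS) (ip0r ipP).
rewrite big_cons lS (ipDr ipP) (ipZr ipP) IH addr0.
have [->|/hN h1] := eqVneq (ip (e k) (T (e h))) 0; first by rewrite mul0r.
have [->|/hM h2] := eqVneq (ip (e g) (S (e k))) 0; first by rewrite mulr0.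
suff : `|r g - r h| <= M%:R + N%:R by rewrite leNgt lt_r.
by rewrite -(subrKA (r k)); apply: le_trans (ler_normD _ _) _; rewrite lerD.
Qed.

(** The commutator with [P] is bounded and has no entry outside the band of [S], so [delta] can be
    iterated with the same width and no further estimate. *)
Lemma band_in_dom_delta r P S k : is_diag ip e r P -> band_op r S ->
  in_dom_delta ip P k S.
Proof.
move=> hP; elim: k S => [|k IH] S bandS /=; first by case: bandS.
have [bS [N hN]] := bandS; split=> //.
have [T bT hT] := band_commutator hH eON eC bS hN.
exists T; first exact: (commutator_ext_coef hH eON eC hP).
apply: IH; split=> //; exists N => g h; rewrite hT mulf_eq0 negb_or => /andP[_].
exact: hN.
Qed.

End Band.

(** * Singular values of diagonal operators *)

Section Compact.
Variables (R : realType) (H : lmodType R[i]) (ip : H -> H -> R[i]).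
Hypothesis hH : hilbert_space ip.
Let ipP : inner_product ip. Proof. by case: hH. Qed.
Variables (I : countType) (e : I -> H).
Hypothesis eON : orthonormal ip e.
Hypothesis eC : complete_family ip e.

(* Tychonoff: the coefficients of a bounded sequence cluster coordinatewise. *)
Lemma bounded_cluster (u : nat -> H) (M : R) : (forall n, nsq ip (u n) <= M) ->
  exists a : I -> R[i], forall (s : seq I) (d : R) (N : nat), 0 < d ->
    exists2 n, (N <= n)%N & forall i, i \in s -> nsqc (ip (e i) (u n) - a i) <= d.
Proof.
move=> uM; pose part (z : R[i]) (b : bool) := if b then complex.Re z else complex.Im z.
pose U n : I * bool -> R := fun p => part (ip (e p.1) (u n)) p.2.
pose m := M + 1.
have UM n p : U n p \in `[- m, m].
  have M0 : 0 <= M by exact: le_trans (nsq_ge0 ipP _) (uM n).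
  have : nsqc (ip (e p.1) (u n)) <= m ^+ 2.
    apply: le_trans (cauchy_schwarz ipP _ _) _.
    have := on_nsq_le1 ipP eON p.1; have := uM n; rewrite /m.
    have := nsq_ge0 ipP (e p.1); have := nsq_ge0 ipP (u n); nra.
  rewrite /nsqc => hm.
  have : U n p ^+ 2 <= m ^+ 2.
    by apply: le_trans hm; rewrite /U; case: p.2; rewrite /= ?lerDl ?lerDr sqr_ge0.
  rewrite -ler_sqrt ?sqr_ge0 // !sqrtr_sqr [X in _ <= X]ger0_norm; last by rewrite /m; lra.
  by rewrite ler_norml in_itv.
have cptK := @tychonoff (I * bool)%type (fun=> R) (fun=> `[- m, m]%classic)
  (fun=> @segment_compact R _ _).
have [|a [_ aU]] := cptK (U @ \oo) _; first by exists 0%N => // n _ p; exact: UM.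
exists (fun i => a (i, true) +i* a (i, false)) => s d N d0.
have e0 : 0 < Num.sqrt (d / 2) by rewrite sqrtr_gt0 divr_gt0.
have nb : nbhs a [set f | forall i b, i \in s ->
    `|a (i, b) - f (i, b)| < Num.sqrt (d / 2)].
  have nb1 p : nbhs a [set f | `|a p - f p| < Num.sqrt (d / 2)].
    have h : proj p @ a --> (a p : R).
      exact: (@proj_continuous _ (fun=> (R : topologicalType)) p a).
    exact: (h _ (nbhsx_ballx (a p : R) _ e0)).
  elim: s => [|i s IH]; first by apply: filterE => f i b.
  apply: filterS (filterI IH (filterI (nb1 (i, true)) (nb1 (i, false)))).
  move=> f /= [fs [f1 f2]] j b; rewrite inE => /predU1P[->|/fs //].
  by case: b.
have [|f [[n Nn <-] fB]] := aU [set U n | n in [set n | (N <= n)%N]] _ _ nb.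
  by exists N => // n /= Nn; exists n.
exists n => // i is_; have := fB i true is_; have := fB i false is_.
rewrite /U /= /nsqc; case: (ip (e i) (u n)) => x y /=.
have sq (w : R) : `|w| < Num.sqrt (d / 2) -> w ^+ 2 <= d / 2.
  move=> wd; rewrite -[w ^+ 2]real_normK ?num_real // -[leRHS]sqr_sqrtr; last lra.
  by rewrite ler_pXn2r ?nnegrE // ?ltW.
rewrite -[(x - _) ^+ 2]sqrrN opprB -[(y - _) ^+ 2]sqrrN opprB => /sq h1 /sq h2; lra.
Qed.

(** A subsequence whose [k]-th term is within [inv k] of the cluster point on the first [k] labels
    has a Cauchy image: finitely many coordinates converge, and the others are damped by small
    [t i]. *)
Lemma diag_compact (t : I -> R) (T : H -> H) : bounded_op ip T ->
  (forall x i, ip (e i) (T x) = (t i)%:C * ip (e i) x) ->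
  (forall d : R, 0 < d -> exists L, forall i, i \notin prefix_enum I L ->
     e i != 0 -> t i ^+ 2 <= d) ->
  compact_op ip T.
Proof.
move=> bT hT small; split=> // u [M0 uM0].
pose M := M0 ^+ 2; have uM n : nsq ip (u n) <= M.
  rewrite -(sqr_hnorm ipP) ler_pXn2r ?nnegrE ?hnorm_ge0 //.
  exact: le_trans (hnorm_ge0 _ _) (uM0 n).
have M_ge0 : 0 <= M by rewrite sqr_ge0.
have [a ha] := bounded_cluster uM.
have [K K0 TK] := bounded_nsqP ipP bT.
have tK i : e i != 0 -> t i ^+ 2 <= K.
  move=> i0; have := TK (e i).
  have -> : T (e i) = (t i)%:C *: e i := diag_op_basis hH eON eC i hT.
  by rewrite (nsqZ ipP) nsqcR (on_nsq ipP eON) i0 !mulr1.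
pose inv (k : nat) : R := k.+1%:R^-1.
have inv0 k : 0 < inv k by rewrite invr_gt0.
have step (p : nat * nat) : exists n, (p.2 <= n)%N /\
    \sum_(i <- prefix_enum I p.1) nsqc (ip (e i) (u n) - a i) <= inv p.1.
  pose sz : R := (size (prefix_enum I p.1)).+1%:R.
  have sz0 : 0 < sz by [].
  have [n pn hn] := ha (prefix_enum I p.1) (inv p.1 / sz) p.2 (divr_gt0 (inv0 _) sz0).
  exists n; split=> //.
  apply: le_trans (_ : \sum_(i <- prefix_enum I p.1) inv p.1 / sz <= _).
    by rewrite big_seq [leRHS]big_seq; apply: ler_sum => i; exact: hn.
  rewrite big_const_seq count_predT iter_addr_0 -mulr_natr mulrAC ler_pdivrMr //.
  by rewrite ler_wpM2l ?(ltW (inv0 _)) // ler_nat.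
have [next hnext] := choice step.
pose phi := fix phi k := if k is k'.+1 then next (k, (phi k').+1) else next (0, 0).
have phiS : {homo phi : m n / (m < n)%N}.
  by apply: homo_ltn => [x y z|k]; [exact: ltn_trans | exact: (hnext (_, _)).1].
have phi_close k : \sum_(i <- prefix_enum I k) nsqc (ip (e i) (u (phi k)) - a i)
    <= inv k.
  by case: k => [|k]; exact: (hnext (_, _)).2.
have closeL L k : (L <= k)%N ->
    \sum_(i <- prefix_enum I L) nsqc (ip (e i) (u (phi k)) - a i) <= inv k.
  move=> /subnKC Lk; apply: le_trans (phi_close k).
  have [s] := prefix_enumD I L (k - L); rewrite Lk => ->; rewrite big_cat /= lerDl.
  by apply: sumr_ge0 => i _; exact: nsqc_ge0.
(* The first term bounds the coordinates in the prefix, where [t i ^+ 2] is at most [K]; the second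
   one bounds the tail, as a difference of two terms of [u] has squared norm at most [4 * M]. *)
have dist L d p q : (L <= p)%N -> (L <= q)%N ->
    (forall i, i \notin prefix_enum I L -> e i != 0 -> t i ^+ 2 <= d) -> 0 <= d ->
    nsq ip (T (u (phi p)) - T (u (phi q))) <= 2 * K * (inv p + inv q) + d * (4 * M).
  move=> Lp Lq hd d0; have lT := bT.1.
  have -> : T (u (phi p)) - T (u (phi q)) = T (u (phi p) - u (phi q)).
    by rewrite (linearEB lT).
  set x := _ - _; apply: (nsq_le_coef hH eON eC) => s us.
  have xM : nsq ip x <= 4 * M.
    have h1 := uM (phi p); have h2 := uM (phi q).
    have := hnormB ipP (u (phi p)) (u (phi q)); rewrite -/x.
    rewrite -(ler_pXn2r (n := 2)) ?nnegrE ?addr_ge0 ?hnorm_ge0 // (sqr_hnorm ipP).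
    rewrite sqrrD !(sqr_hnorm ipP) => /le_trans; apply.
    have := sqr_ge0 (hnorm ip (u (phi p)) - hnorm ip (u (phi q))).
    rewrite sqrrB !(sqr_hnorm ipP); set w := hnorm _ _ * _; rewrite !mulr2n; lra.
  rewrite (bigID (fun i => i \in prefix_enum I L)) /=; apply: lerD; last first.
    apply: le_trans (_ : \sum_(i <- s | i \notin prefix_enum I L) d * nsqc (ip (e i) x) <= _).
      apply: ler_sum => i iL; rewrite hT nsqcM nsqcR.
      have [->|/(hd _ iL) h] := eqVneq (e i) 0.
        by rewrite (ip0l ipP) nsqc0 !mulr0.
      by rewrite ler_wpM2r ?nsqc_ge0.
    rewrite -mulr_sumr ler_wpM2l // -big_filter; apply: le_trans xM.
    by apply: (bessel ipP eON); rewrite filter_uniq.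
  rewrite -big_filter.
  have sub : \sum_(i <- [seq i <- s | i \in prefix_enum I L]) nsqc (ip (e i) (T x)) <=
      \sum_(i <- prefix_enum I L) nsqc (ip (e i) (T x)).
    rewrite [leRHS](bigID (fun i => i \in s)) /= -[X in X <= _]addr0; apply: lerD.
      rewrite -[in leRHS]big_filter le_eqVlt; apply/orP; left; apply/eqP.
      apply: perm_big; apply: uniq_perm; rewrite ?filter_uniq ?prefix_enum_uniq //.
      by move=> i; rewrite !mem_filter andbC.
    by apply: sumr_ge0 => i _; exact: nsqc_ge0.
  apply: (le_trans sub).
  apply: le_trans (_ : \sum_(i <- prefix_enum I L) (2 * K *
    nsqc (ip (e i) (u (phi p)) - a i) + 2 * K * nsqc (ip (e i) (u (phi q)) - a i)) <= _).
    apply: ler_sum => i _; rewrite hT nsqcM nsqcR -mulrDr.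
    have [->|/tK ti] := eqVneq (e i) 0.
      rewrite (ip0l ipP x) nsqc0 mulr0; apply: mulr_ge0; first exact: mulr_ge0.
      by apply: addr_ge0; exact: nsqc_ge0.
    rewrite [2 * K]mulrC -[leRHS]mulrA; apply: ler_pM; rewrite ?sqr_ge0 ?nsqc_ge0 //.
    rewrite -[X in _ + X]nsqcN; apply: le_trans (nsqcD_le _ _).
    by rewrite (ipBr ipP) opprB addrA subrK.
  rewrite big_split /= -!mulr_sumr -mulrDr ler_wpM2l ?mulr_ge0 //.
  by apply: lerD; exact: closeL.
suff hc : hcauchy ip (fun n => T (u (phi n))) by have [l hl] := hH.2 _ hc; exists phi, l.
(* Then [d' * (4 * M)] equals [d ^+ 2 / 2 - d'], strictly less than half the target; the bound [B]
   below makes each of the two prefix terms at most a quarter of it. *)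
move=> d d0; pose d' := d ^+ 2 / 2 / (4 * M + 1).
have d'0 : 0 < d' by rewrite !divr_gt0 ?exprn_gt0 //; lra.
have [L hL] := small d' d'0.
pose B := 8 * K / d ^+ 2; pose N := maxn L (Num.truncn B).+1.
exists N => p q Np Nq.
rewrite -(ltr_pXn2r (n := 2)) ?nnegrE ?hnorm_ge0 // ?(ltW d0) // (sqr_hnorm ipP).
have Lp := leq_trans (leq_maxl _ _) Np; have Lq := leq_trans (leq_maxl _ _) Nq.
apply: le_lt_trans (dist L d' p q Lp Lq hL (ltW d'0)) _.
have iN k : (N <= k)%N -> 2 * K * inv k <= d ^+ 2 / 4 * 1.
  move=> Nk; rewrite mulr1 ler_pdivrMr //.
  have Bk : B <= k.+1%:R.
    apply: le_trans (ltW (truncnS_gt B)) _; rewrite ler_nat ltnW // ltnS.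
    exact: leq_trans (leq_maxr _ _) Nk.
  have : 2 * K <= d ^+ 2 / 4 * B.
    by rewrite /B le_eqVlt; apply/orP; left; apply/eqP; field; rewrite gt_eqF.
  by move=> /le_trans; apply; rewrite ler_wpM2l // divr_ge0 ?sqr_ge0.
have := iN p Np; have := iN q Nq.
have -> : d' * (4 * M) = d ^+ 2 / 2 - d' by rewrite /d'; field; lra.
have -> : d ^+ 2 / 2 = d ^+ 2 / 4 + d ^+ 2 / 4 by field.
rewrite mulrDr; lra.
Qed.

End Compact.

Lemma seq_argmin (R : realType) (I : eqType) (r : I -> R) (x : I) (s : seq I) :
  x \in s -> exists2 y, y \in s & forall z, z \in s -> r y <= r z.
Proof.
elim: s x => [//|a s IH] x _; case: s IH => [|b s] IH.
  by exists a; rewrite ?mem_head // => z; rewrite inE => /eqP ->.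
have [y ys ymin] := IH b (mem_head _ _).
have [ay|ya] := leP (r a) (r y).
  exists a; first exact: mem_head.
  by move=> z; rewrite inE => /predU1P[->//|/ymin]; exact: le_trans.
exists y; first by rewrite inE ys orbT.
by move=> z; rewrite inE => /predU1P[->|/ymin //]; exact: ltW.
Qed.

(* The greedy enumeration of an infinite set by increasing values of r. *)
Lemma sorted_enumeration (R : realType) (I : eqType) (S : pred I) (r : I -> R) :
  (forall b : R, exists s : seq I, forall i, S i -> r i <= b -> i \in s) ->
  (forall s : seq I, exists2 i, S i & i \notin s) ->
  exists f : nat -> I, [/\ injective f, forall n, S (f n),
    forall i, S i -> exists n, f n = i & forall m n, (m <= n)%N -> r (f m) <= r (f n)].
Proof.
move=> fin infin.
have step (s : seq I) : exists i, [/\ S i, i \notin s &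
    forall j, S j -> j \notin s -> r i <= r j].
  have [i0 Si0 i0s] := infin s; have [t ht] := fin (r i0).
  pose t' := [seq i <- t | S i && (i \notin s)].
  have i0t : i0 \in t' by rewrite mem_filter Si0 i0s ht.
  have [i /[!mem_filter] iP imin] := seq_argmin r i0t.
  move: iP; rewrite -andbA => /and3P[Si is_ it]; exists i; split=> // j Sj js.
  have [ji|/ltW ij] := leP (r j) (r i0); last by apply: le_trans ij; exact: imin.
  by apply: imin; rewrite mem_filter Sj js ht.
have [next hnext] := choice step.
pose pre := fix pre n := if n is n'.+1 then rcons (pre n') (next (pre n')) else [::].
have preS m k : next (pre m) \in pre (m + k.+1)%N.
  elim: k => [|k IH]; first by rewrite addnS addn0 /= mem_rcons mem_head.
  by rewrite addnS /= mem_rcons inE IH orbT.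
have lt_neq m n : (m < n)%N -> next (pre m) <> next (pre n).
  move=> mn eq_mn; have [_ /negP + _] := hnext (pre n); apply.
  by rewrite -eq_mn -(subnKC mn) addSnnS.
have pre_sub m k i : i \in pre m -> i \in pre (m + k)%N.
  elim: k => [|k IH]; rewrite ?addn0 // addnS /= mem_rcons inE => /IH ->.
  by rewrite orbT.
have mono m n : (m <= n)%N -> r (next (pre m)) <= r (next (pre n)).
  move=> mn; have [_ _] := hnext (pre m); apply; first by case: (hnext (pre n)).
  have [_ + _] := hnext (pre n); apply: contra => h.
  by have := pre_sub m (n - m)%N _ h; rewrite subnKC.
have inj : injective (fun n => next (pre n)).
  by move=> m n eq_mn; case: (ltngtP m n) => // /lt_neq; rewrite eq_mn.
exists (fun n => next (pre n)); split=> //; first by move=> n; case: (hnext (pre n)).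
(* If [i] were never chosen, every chosen element would have a value at most [r i], and a finite
   sublevel set would contain infinitely many elements. *)
move=> i Si; apply: contrapT => ni.
have le_i n : r (next (pre n)) <= r i.
  have [_ _] := hnext (pre n); apply=> //.
  elim: n => [//|n IH] /=; rewrite mem_rcons inE negb_or IH andbT.
  by apply/eqP => ii; apply: ni; exists n.
have [s hs] := fin (r i).
have := @uniq_leq_size _ [seq next (pre n) | n <- iota 0 (size s).+1] s.
rewrite map_inj_uniq // iota_uniq size_map size_iota ltnn => /(_ isT).
move=> h; suff: false by []; apply: h => _ /mapP[n _ ->].
by apply: hs; [case: (hnext (pre n)) | exact: le_i].
Qed.

(** Each step is the inequality ln (1 + x) <= x at x = -1/(N+2). *)
Lemma harmonic_le_ln (R : realType) (N : nat) :
  \sum_(k < N.+1) (k.+1%:R^-1 : R) <= 1 + ln (N.+1%:R : R).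
Proof.
elim: N => [|N IH]; first by rewrite big_ord1 invr1 ln1 addr0.
rewrite big_ord_recr /=; apply: le_trans (lerD IH (lexx _)) _.
rewrite -addrA lerD2l.
have p0 : 0 < (N.+1%:R / N.+2%:R : R) by rewrite divr_gt0.
have := @le_ln1Dx R (N.+1%:R / N.+2%:R - 1).
have -> : -1 < N.+1%:R / N.+2%:R - 1 :> R by rewrite ltrBrDl subrr.
move=> /(_ isT); rewrite [1 + _]addrC subrK ln_div ?posrE //.
have -> : N.+1%:R / N.+2%:R - 1 = - N.+2%:R^-1 :> R.
  have -> : N.+1%:R = N.+2%:R - 1 :> R by rewrite -(@natr1 R N.+1) addrK.
  by rewrite mulrBl divff ?pnatr_eq0 // mul1r addrAC subrr add0r.
set a := ln _; set b := ln _; set c := _^-1; lra.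
Qed.

(** * Membership in the Dixmier ideal from a quartic counting bound *)

Section DixmierUpper.
Variables (R : realType) (H : lmodType R[i]) (ip : H -> H -> R[i]).
Hypothesis hH : hilbert_space ip.
Let ipP : inner_product ip. Proof. by case: hH. Qed.
Variables (I : countType) (e : I -> H).
Hypothesis eON : orthonormal ip e.
Hypothesis eC : complete_family ip e.
Variables (lam : I -> R) (D : operator H).
Hypothesis hD : is_diag ip e lam D.

Lemma iter_diag_coef (t : I -> R) B m : bounded_op ip B ->
  (forall x i, ip (e i) (B x) = (t i)%:C * ip (e i) x) ->
  bounded_op ip (iter m B) /\
  forall x i, ip (e i) (iter m B x) = (t i ^+ m)%:C * ip (e i) x.
Proof.
move=> bB hB; elim: m => [|m [bI hI]] /=.
  by split; [exact: bounded_id | move=> x i; rewrite mul1r].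
split; first exact: (bounded_comp (S := B) (T := iter m B)).
by move=> x i; rewrite hB hI exprS RcM mulrA.
Qed.

Variable C : R.
Hypothesis few : forall (L : nat) (s : seq I), uniq s ->
  (forall i, i \in s -> e i != 0 /\ `|lam i| <= L%:R) ->
  (size s)%:R <= C * L.+1%:R ^+ 4.
Hypothesis infin : forall s : seq I, exists2 i, e i != 0 & i \notin s.

(** If at most [C * L.+1%:R ^+ 4] eigenvalues have modulus at most [L], the [n]-th singular value of
    the fourth power of (1 + D^2)^(-1/2) is at most a constant over [n.+1], and the sums grow like
    the harmonic series. *)
Lemma dixmier4 : in_dixmier ip D 4.
Proof.
pose b i : R := (Num.sqrt (1 + lam i ^+ 2))^-1.
have b_ge0 i : 0 <= b i by rewrite invr_ge0 sqrtr_ge0.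
have b_le1 i : nsqc (b i)%:C <= 1.
  rewrite nsqcR exprVn sqr_sqrtr ?(ltW (one_sqr_gt0 _)) //.
  by rewrite invf_le1 ?one_sqr_gt0 // lerDl sqr_ge0.
have [B bB hB] := diag_op hH eON eC b_le1.
have [bT hT] := iter_diag_coef 4 bB hB.
have b4 i : b i ^+ 4 = (1 + lam i ^+ 2) ^- 2.
  by rewrite (exprM _ 2 2) exprVn sqr_sqrtr ?(ltW (one_sqr_gt0 _)) // exprVn.
have t_gt0 i : 0 < b i ^+ 4 by rewrite b4 invr_gt0 exprn_gt0 ?one_sqr_gt0.
exists (iter 4 B); first by exists B => //; exact: (diag_inv_sqrt hH eON eC hD).
(* If no finite list exhausted a sublevel set, arbitrarily long duplicate-free lists would
   contradict the count [few]. *)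
have fin (c : R) : exists s : seq I, forall i, e i != 0 -> `|lam i| <= c -> i \in s.
  apply: contrapT => nofin.
  have [c0|c0] := ltP c 0.
    by apply: nofin; exists [::] => i _ ic; have := le_lt_trans ic c0; rewrite normr_lt0.
  pose L := (Num.truncn c).+1.
  have grow n : exists s : seq I, [/\ uniq s, size s = n &
      forall i, i \in s -> e i != 0 /\ `|lam i| <= L%:R].
    elim: n => [|n [s [us ss hs]]]; first by exists [::].
    have [i [i0 ic is_]] : exists i, [/\ e i != 0, `|lam i| <= c & i \notin s].
      apply: contrapT => h; apply: nofin; exists s => i i0 ic.
      by apply: contrapT => /negP is_; apply: h; exists i.
    exists (i :: s); split=> /=; rewrite ?is_ ?us ?ss //.
    move=> j; rewrite inE => /predU1P[->|/hs //]; split=> //.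
    by apply: le_trans ic _; exact: ltW (truncnS_gt c).
  have [s [us ss hs]] := grow (Num.truncn (C * L.+1%:R ^+ 4)).+1.
  have := few us hs; rewrite ss leNgt => /negP; apply; exact: truncnS_gt.
split.
  apply: (diag_compact hH eON eC bT hT) => d d0.
  have [s hs] := fin (d^-1); exists (\max_(i <- s) (choice.pickle i).+1)%N => i iL i0.
  have : ~~ (`|lam i| <= d^-1).
    apply: contra iL => /(hs i i0) is_; apply: mem_prefix_enum.
    by rewrite (big_rem i is_) /= leq_max leqnn.
  rewrite -ltNge => lamd; have dl : 1 < d * `|lam i|.
    by rewrite -ltr_pdivrMl // mulr1.
  have l2 : `|lam i| <= 1 + lam i ^+ 2.
    by rewrite -[lam i ^+ 2]real_normK ?num_real //; have := normr_ge0 (lam i); nra.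
  rewrite b4 exprVn -exprM invf_ple ?posrE ?exprn_gt0 ?one_sqr_gt0 //.
  apply: le_trans (_ : 1 + lam i ^+ 2 <= _).
    by apply: le_trans l2; exact: ltW.
  by rewrite -[leLHS]expr1 ler_weXn2l // lerDl sqr_ge0.
have [f [f_inj fS f_surj f_mono]] := sorted_enumeration fin infin.
have mono2 m n : (m <= n)%N -> lam (f m) ^+ 2 <= lam (f n) ^+ 2.
  move=> /f_mono; rewrite -(ler_pXn2r (n := 2)) ?nnegrE //.
  by rewrite !real_normK ?num_real.
pose mu n := b (f n) ^+ 4.
exists mu.
  split=> [n|m n mn|]; first exact: (ltW (t_gt0 _)).
    rewrite /mu !b4 lef_pV2 ?posrE ?exprn_gt0 ?one_sqr_gt0 //.
    rewrite ler_pXn2r ?nnegrE ?(ltW (one_sqr_gt0 _)) // lerD2l; exact: mono2.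
  exists (fun n => e (f n)); split=> [m n _ _|n _ x|x hx].
  - by rewrite (on_ip eON) ?fS // (inj_eq f_inj).
  - rewrite (diag_op_basis hH eON eC _ hT) (ipZl ipP) conjcR hT mulrA -RcM.
    by rewrite -expr2.
  - suff -> : x = 0 by case: bT => lT _; rewrite (linearE0 lT).
    apply: eC => i; have [->|/f_surj[n <-]] := eqVneq (e i) 0; first exact: (ip0l ipP).
    by apply: hx; rewrite (gt_eqF (t_gt0 _)).
(* The [n.+1] labels listed so far are counted at a level [L] with [L.+1%:R <= r + 2]. The constant
   is the square of 5 in (r + 2)^2 <= 5 (1 + r^2), which amounts to (2r - 1)^2 >= 0. *)
have mu_le n : mu n <= 25 * C / n.+1%:R.
  pose r : R := `|lam (f n)|; pose L := (Num.truncn r).+1.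
  have rL : r <= L%:R by exact: ltW (truncnS_gt r).
  have Lr : L.+1%:R <= r + 2.
    have := truncn_itv (normr_ge0 (lam (f n)) : 0 <= r); rewrite /L -!natr1 => /andP[]; lra.
  have := @few L [seq f k | k <- iota 0 n.+1].
  rewrite map_inj_uniq // iota_uniq size_map size_iota => /(_ isT) nC.
  have {}nC : n.+1%:R <= C * L.+1%:R ^+ 4.
    apply: nC => i /mapP[k /[!mem_iota]]; rewrite ltnS => /= kn ->; split=> //.
    by apply: le_trans rL; exact: f_mono.
  have C0 : 0 < C.
    have : 0 < C * L.+1%:R ^+ 4 by apply: lt_le_trans nC.
    by rewrite pmulr_lgt0 ?exprn_gt0.
  have r0 : 0 <= r by exact: normr_ge0.
  have r2 : lam (f n) ^+ 2 = r ^+ 2 by rewrite real_normK ?num_real.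
  rewrite /mu b4 r2 ler_pdivlMr // mulrC ler_pdivrMr ?exprn_gt0 //; last by nra.
  apply: le_trans nC _; rewrite [25 * C]mulrC -mulrA ler_pM2l //.
  apply: le_trans (_ : (r + 2) ^+ 4 <= _).
    by rewrite ler_pXn2r ?nnegrE //; lra.
  have -> : 25 * (1 + r ^+ 2) ^+ 2 = (5 * (1 + r ^+ 2)) ^+ 2 by ring.
  have p1 : 0 <= (r + 2) ^+ 2 by exact: sqr_ge0.
  have p2 : 0 <= 5 * (1 + r ^+ 2) by rewrite mulr_ge0 // ltW ?one_sqr_gt0.
  rewrite (exprM _ 2 2) ler_pXn2r ?nnegrE //.
  by have := sqr_ge0 (2 * r - 1); nra.
have C0 : 0 <= C.
  have := mu_le 0%N; have := t_gt0 (f 0%N); rewrite -/(mu 0%N) divr1; lra.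
(* Once the logarithm is at least one, 25 C (1 + ln) is at most 50 C ln; the added 1 makes the
   constant positive. *)
apply/eqO_exP; exists (50 * C + 1); first by lra.
exists (Num.truncn (expR 1 : R)).+1 => // -[//|N] /= hN.
have ln1N : 1 <= ln (N.+1%:R : R).
  rewrite -(ler_expR 1) lnK ?posrE //; apply: ltW; apply: lt_le_trans (truncnS_gt _) _.
  by rewrite ler_nat.
have mu_sum : \sum_(k < N.+1) mu k <= 25 * C * (1 + ln (N.+1%:R : R)).
  apply: le_trans (_ : \sum_(k < N.+1) 25 * C * k.+1%:R^-1 <= _).
    by apply: ler_sum => k _; exact: mu_le.
  by rewrite -mulr_sumr ler_wpM2l ?harmonic_le_ln // mulr_ge0.
rewrite ger0_norm; last by apply: sumr_ge0 => k _; exact: (ltW (t_gt0 _)).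
rewrite ger0_norm; last by lra.
apply: le_trans mu_sum _; nra.
Qed.

End DixmierUpper.

(** * Lower bounds on singular values *)

Section DixmierLower.
Variables (R : realType) (H : lmodType R[i]) (ip : H -> H -> R[i]).
Hypothesis hH : hilbert_space ip.
Let ipP : inner_product ip. Proof. by case: hH. Qed.

(** The first half of the min-max principle: on the orthogonal complement of the first [n] singular
    vectors, [T] is bounded by the [n]-th singular value. The images of the singular vectors are
    orthogonal, with norms [mu k]. *)
Lemma singular_value_decr (T : H -> H) (mu : nat -> R) : bounded_op ip T ->
  (forall n, 0 <= mu n) -> (forall m n : nat, (m <= n)%N -> mu n <= mu m) ->
  forall v : nat -> H,
  (forall m n, mu m != 0 -> mu n != 0 -> ip (v m) (v n) = (m == n)%:R) ->
  (forall n, mu n != 0 ->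
     forall x, ip (T (v n)) (T x) = (mu n ^+ 2)%:C * ip (v n) x) ->
  (forall x, (forall n, mu n != 0 -> ip (v n) x = 0) -> T x = 0) ->
  forall n x, (forall k, (k < n)%N -> mu k != 0 -> ip (v k) x = 0) ->
  nsq ip (T x) <= mu n ^+ 2 * nsq ip x.
Proof.
move=> bT mu0 mu_decr v vON vT vC n x xv.
(* Nothing is known about [v k] when [mu k] vanishes; zero in its place gives an orthonormal family
   in the weak sense used here. *)
pose w k := if mu k == 0 then 0 else v k.
have wON : orthonormal ip w.
  split=> [i j ij|i]; rewrite /w.
    have [_|i0] := eqVneq (mu i) 0; first by rewrite (ip0l ipP).
    have [_|j0] := eqVneq (mu j) 0; first by rewrite (ip0r ipP).
    by rewrite vON // (introF eqP ij).
  by have [_|i0] := eqVneq (mu i) 0; [left | right; rewrite vON // eqxx].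
have wT k y : ip (T (w k)) (T y) = (mu k ^+ 2)%:C * ip (w k) y.
  rewrite /w; have [_|k0] := eqVneq (mu k) 0; last exact: vT.
  by rewrite (linearE0 bT.1) !(ip0l ipP) mulr0.
have wx k : (k < n)%N -> ip (w k) x = 0.
  move=> kn; rewrite /w; have [_|k0] := eqVneq (mu k) 0; last exact: xv.
  exact: (ip0l ipP).
have [|y [hy yE _]] := @riesz_fischer R H ip hH nat w wON (fun k => ip (w k) x) (nsq ip x).
  by move=> s us; exact: bessel.
(* [y] is the projection of [x] on the closed span of the singular vectors, and [T] kills the
   difference. *)
have -> : T x = T y.
  apply/eqP; rewrite -subr_eq0 -(linearEB bT.1); apply/eqP/vC => k k0.
  have := yE k; rewrite /w (negbTE k0) (ipBr ipP) vON // eqxx mulr1 => ->.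
  by rewrite subrr.
apply: (nsq_lim_le ipP (hcvg_bounded bT hy)) => m /=.
rewrite (linearE_sum bT.1); under eq_bigr do rewrite (linearEZ bT.1).
rewrite (@nsq_sum_orth _ _ ip _ (T \o w)) ?prefix_enum_uniq // => [|i j ij]; last first.
  by rewrite /= wT (on_orth wON) // mulr0.
have wTn k : nsq ip (T (w k)) = mu k ^+ 2 * nsq ip (w k).
  by rewrite /nsq wT; case: (ip (w k) (w k)) => a b /=; simpc.
apply: le_trans (_ : \sum_(i <- prefix_enum nat m) mu n ^+ 2 * nsqc (ip (w i) x) <= _).
  apply: ler_sum => k _ /=; rewrite wTn mulrA [_ * mu k ^+ 2]mulrC -mulrA.
  have [kn|nk] := ltnP k n; first by rewrite wx // nsqc0 mul0r !mulr0.
  apply: ler_pM; rewrite ?sqr_ge0 ?mulr_ge0 ?nsqc_ge0 ?(nsq_ge0 ipP) //.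
    by rewrite ler_pXn2r ?nnegrE ?mu_decr.
  by rewrite ler_piMr ?nsqc_ge0 // (on_nsq_le1 ipP wON).
by rewrite -mulr_sumr ler_wpM2l ?sqr_ge0 // (bessel ipP wON) ?prefix_enum_uniq.
Qed.

Variables (I : countType) (e : I -> H).
Hypothesis eON : orthonormal ip e.

(** A homogeneous linear system with more unknowns than equations has a nonzero solution. *)
Lemma exists_orth_comb (n : nat) (v : nat -> H) (s : seq I) : (n < size s)%N ->
  uniq s -> (forall i, i \in s -> e i != 0) ->
  exists a : I -> R[i], (forall k, (k < n)%N ->
    ip (v k) (\sum_(i <- s) a i *: e i) = 0) /\ \sum_(i <- s) a i *: e i != 0.
Proof.
move=> ns us s0.
have [i0 _] : exists i : I, i \in s by case: s ns {us s0} => // i s; exists i; exact: mem_head.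
pose A : 'M[R[i]]_(size s, n) := \matrix_(j, k) ip (v k) (e (nth i0 s j)).
have kA : kermx A != 0.
  rewrite -mxrank_eq0 mxrank_ker subn_eq0 -ltnNge.
  exact: leq_ltn_trans (rank_leq_col A) ns.
have /rowV0Pn[a /sub_kermxP aA a0] := kA.
pose f i := if insub (index i s) is Some j then a 0 j else 0.
have fnth (j : 'I_(size s)) : f (nth i0 s j) = a 0 j.
  rewrite /f index_uniq //; case: insubP => [u _ /val_inj ->//|].
  by rewrite ltn_ord.
exists f; split=> [k kn|].
  have := congr1 (fun B : 'rV_n => B 0 (Ordinal kn)) aA; rewrite !mxE => <-.
  rewrite (ip_sumr ipP) (big_nth i0) big_mkord; apply: eq_bigr => j _.
  by rewrite (ipZr ipP) fnth mxE.
apply: contra a0 => /eqP x0; apply/eqP/rowP => j; rewrite mxE -fnth.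
have js : nth i0 s j \in s by rewrite mem_nth.
have := ip_sum_on ipP eON (nth i0 s j) f us; rewrite x0 (ip0r ipP) js mul1r.
by rewrite (on_unit eON) ?s0 // mulr1.
Qed.

(** The second half of the min-max principle: a space of dimension greater than [n] on which [T] is
    bounded below by [d] contains a nonzero vector orthogonal to the first [n] singular vectors. *)
Lemma singular_value_ge (T : H -> H) (mu : nat -> R) (t : I -> R) (d : R)
    (n : nat) (s : seq I) :
  bounded_op ip T -> singular_values ip T mu -> 0 <= d ->
  (n < size s)%N -> uniq s -> (forall i, i \in s ->
    [/\ e i != 0, T (e i) = (t i)%:C *: e i & d <= t i]) -> d <= mu n.
Proof.
move=> bT [mu0 mu_decr [v [vON vT vC]]] d0 ns us hs.
have [|a [xv x0]] := @exists_orth_comb n v s ns us; first by move=> i /hs[].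
set x := \sum_(i <- s) _ in xv x0.
have up := @singular_value_decr T mu bT mu0 mu_decr v vON vT vC n x (fun k kn _ => xv k kn).
have Tx : T x = \sum_(i <- s) (a i * (t i)%:C) *: e i.
  rewrite (linearE_sum bT.1) big_seq [RHS]big_seq; apply: eq_bigr => i /hs[_ Te _].
  by rewrite (linearEZ bT.1) Te scalerA.
have lo : d ^+ 2 * nsq ip x <= nsq ip (T x).
  rewrite Tx !(nsq_sum_on ipP eON) // mulr_sumr big_seq [leRHS]big_seq.
  apply: ler_sum => i /hs[_ _ dt]; rewrite mulrA nsqcM nsqcR.
  rewrite ler_wpM2r ?(nsq_ge0 ipP) // mulrC ler_wpM2l ?nsqc_ge0 //.
  by rewrite ler_pXn2r ?nnegrE // (le_trans d0).
have x_gt0 : 0 < nsq ip x by rewrite lt_def (nsq_eq0 ipP) x0 (nsq_ge0 ipP).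
have := le_trans lo up; rewrite ler_pM2r // ler_pXn2r ?nnegrE //.
Qed.

Hypothesis eC : complete_family ip e.
Variables (lam : I -> R) (D : operator H).
Hypothesis hD : is_diag ip e lam D.
Variable c : R.
Hypothesis c0 : 0 <= c.
Hypothesis many : forall M : nat, (0 < M)%N -> exists s : seq I,
  [/\ uniq s, size s = (M ^ 4)%N &
      forall i, i \in s -> e i != 0 /\ `|lam i| <= c * M%:R].

(** If [m] is at most 3, the eigenvalues of [T] dominate the cubes [b i ^+ 3]. Then the first M^4
    singular values are at least ((1 + c) M)^(-3), and their sum grows at least like M, not like ln
    M. *)
Lemma dixmier_ge4 (m : int) : in_dixmier ip D m -> (4 <= m)%R.
Proof.
move=> [T [B hB hT] [[bT _] [mu hmu /eqO_exP[K K0 [N0 _ hN0]]]]].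
rewrite leNgt; apply/negP => m4.
pose b i : R := (Num.sqrt (1 + lam i ^+ 2))^-1.
have Be i : B (e i) = (b i)%:C *: e i := inv_sqrt_basis hH eON eC i hD hB.
have b_gt0 i : 0 < b i by rewrite invr_gt0 sqrtr_gt0 one_sqr_gt0.
have b_le1 i : b i <= 1.
  rewrite invf_le1 ?sqrtr_gt0 ?one_sqr_gt0 // -[leLHS]sqrtr1 ler_wsqrtr //.
  by rewrite lerDl sqr_ge0.
have lB : linear B by case: hB => -[].
have iterB k i : iter k B (e i) = (b i ^+ k)%:C *: e i.
  elim: k => [|k IH]; first by rewrite /= scale1r.
  by rewrite iterS IH (linearEZ lB) Be scalerA -RcM -exprSr.
have [t Te] : exists2 t : I -> R, forall i, T (e i) = (t i)%:C *: e i
    & forall i, b i ^+ 3 <= t i.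
  (* For a negative exponent [T] inverts a power of [B]; its eigenvalues are at least 1 and again
     dominate the cubes. *)
  case: m m4 hT => [m m4 hT|m _ [_ hT _]].
    exists (fun i => b i ^+ m) => i; first by rewrite hT iterB.
    by rewrite ler_wiXn2l ?(ltW (b_gt0 i)) //; move: m4; rewrite ltz_nat.
  exists (fun i => b i ^- m.+1) => i.
    have := hT (e i); rewrite iterB (linearEZ bT.1).
    move=> /(congr1 (fun x => (b i ^- m.+1)%:C *: x)).
    by rewrite scalerA -RcM mulVf ?gt_eqF ?exprn_gt0 // scale1r.
  apply: le_trans (_ : 1 <= _); first by rewrite exprn_ile1 ?(ltW (b_gt0 i)).
  by rewrite invf_ge1 ?exprn_gt0 // exprn_ile1 ?(ltW (b_gt0 i)).
move=> bt.
pose d M : R := ((1 + c) * M%:R) ^- 3.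
have d_ge0 M : 0 <= d M by rewrite invr_ge0 exprn_ge0 // mulr_ge0 // addr_ge0.
have muM M n : (0 < M)%N -> (n < M ^ 4)%N -> d M <= mu n.
  move=> M0 nM; have [s [us ss hs]] := many M0.
  apply: (@singular_value_ge T mu t (d M) n s) => //; first by rewrite ss.
  move=> i /hs[i0 li]; split=> //; apply: le_trans (bt i).
  rewrite /d -exprVn ler_pXn2r ?nnegrE ?(ltW (b_gt0 i)) //; last first.
    by rewrite invr_ge0 mulr_ge0 // addr_ge0.
  have M1 : 1 <= M%:R :> R by rewrite ler1n.
  have cM0 : 0 < (1 + c) * M%:R by rewrite mulr_gt0 ?ltr0n // ltr_wpDr.
  rewrite lef_pV2 ?posrE ?sqrtr_gt0 ?one_sqr_gt0 //.
  rewrite -[leRHS]ger0_norm ?(ltW cM0) //.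
  rewrite -sqrtr_sqr ler_wsqrtr // -[lam i ^+ 2]real_normK ?num_real //.
  have := normr_ge0 (lam i); nra.
have sum_ge M : (0 < M)%N -> M%:R / (1 + c) ^+ 3 <= \sum_(k < (M ^ 4)%N) mu k.
  move=> M0; apply: le_trans (_ : \sum_(k < (M ^ 4)%N) d M <= _); last first.
    by apply: ler_sum => k _; exact: muM.
  rewrite sumr_const card_ord -(mulr_natr (d M)) natrX /d.
  have M0' : M%:R != 0 :> R by rewrite pnatr_eq0 -lt0n.
  have c1 : 1 + c != 0 by rewrite gt_eqF // ltr_wpDr.
  by rewrite le_eqVlt; apply/orP; left; apply/eqP; field; rewrite M0' c1.
(* The estimate is used with M^2 in place of M: the sum over M^8 terms is at least M^2 / (1 + c)^3
   and at most 8 K ln M <= 8 K M, so that M <= A. The chosen M exceeds [A]. *)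
pose A := 8 * K * (1 + c) ^+ 3.
pose M := (maxn N0 (Num.truncn A).+1).+1.
have M0 : (0 < M)%N by [].
have AM : A < M%:R.
  apply: lt_le_trans (truncnS_gt A) _; rewrite ler_nat.
  exact: leq_trans (leq_maxr N0 _) (leqnSn _).
have NM : (N0 <= M)%N by exact: leq_trans (leq_maxl _ _) (leqnSn _).
have M2 : (0 < M ^ 2)%N by rewrite expn_gt0.
have MM : (M <= (M ^ 2) ^ 4)%N by rewrite -expnM; have := leq_pexp2l M0 (isT : (1 <= 2 * 4)%N); rewrite expn1.
have := hN0 ((M ^ 2) ^ 4)%N (leq_trans NM MM).
have M1 : 1 <= M%:R :> R by rewrite ler1n.
have s0 : 0 <= \sum_(k < ((M ^ 2) ^ 4)%N) mu k.
  by apply: sumr_ge0 => k _; case: hmu.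
have lnM : ln (((M ^ 2) ^ 4)%N%:R : R) = 8 * ln (M%:R : R).
  by rewrite -expnM natrX lnXn ?ltr0n // mulr_natl.
have ln0 : 0 <= ln (M%:R : R) by rewrite ln_ge0.
have ln_le : ln (M%:R : R) <= M%:R.
  have := @le_ln1Dx R (M%:R - 1); rewrite [1 + _]addrC subrK.
  have -> : -1 < M%:R - 1 :> R by lra.
  move=> /(_ isT); lra.
rewrite ger0_norm // lnM ger0_norm ?mulr_ge0 //.
have c1 : 0 < (1 + c) ^+ 3 by rewrite exprn_gt0 // ltr_wpDr.
have := sum_ge _ M2; rewrite natrX ler_pdivrMr // => h1 h2.
have {}h2 : \sum_(k < ((M ^ 2) ^ 4)%N) mu k <= 8 * K * M%:R.
  by apply: le_trans h2 _; nra.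
have : M%:R ^+ 2 <= A * M%:R.
  by apply: le_trans h1 _; rewrite /A mulrAC ler_wpM2r // ltW.
by rewrite expr2 ler_pM2r ?ltr0n // leNgt AM.
Qed.

End DixmierLower.

(** * Direct sums and closures *)

Section DirectSum.
Variables (R : realType) (L : lmodType R[i]) (ip : L -> L -> R[i]).
Hypothesis hL : hilbert_space ip.
Variable k : nat.

Definition ip_ffun (x y : {ffun 'I_k -> L}) : R[i] := \sum_(s : 'I_k) ip (x s) (y s).

Let ipP : inner_product ip := hL.1.

Lemma ip_ffun_inner : inner_product ip_ffun.
Proof.
split=> [x a y z|x y|x x0].
- rewrite /ip_ffun mulr_sumr -big_split; apply: eq_bigr => s _ /=.
  by rewrite !ffunE (ipDr ipP) (ipZr ipP).
- rewrite /ip_ffun [RHS]raddf_sum; apply: eq_bigr => s _.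
  by rewrite (ip_conj ipP).
have [s xs] : exists s, x s != 0.
  apply: contrapT => h; case/eqP: x0; apply/ffunP => s; rewrite [RHS]ffunE.
  by apply/eqP; apply: contrapT => /negP xs; apply: h; exists s.
rewrite /ip_ffun (bigD1 s) //= ltr_wpDr //; last by case: ipP => _ _; apply.
by apply: sumr_ge0 => j _; rewrite (ipxx ipP) lecR nsq_ge0.
Qed.

Lemma nsq_ffun (x : {ffun 'I_k -> L}) : nsq ip_ffun x = \sum_(s : 'I_k) nsq ip (x s).
Proof. by rewrite /nsq /ip_ffun raddf_sum. Qed.

Lemma hnorm_ffun_ge (x : {ffun 'I_k -> L}) s : hnorm ip (x s) <= hnorm ip_ffun x.
Proof.
rewrite !hnormE ler_wsqrtr // nsq_ffun (bigD1 s) //= lerDl.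
by apply: sumr_ge0 => j _; rewrite nsq_ge0.
Qed.

Lemma hcvg_ffun (u : nat -> {ffun 'I_k -> L}) (x : {ffun 'I_k -> L}) :
  (forall s, hcvg ip (fun n => u n s) (x s)) -> hcvg ip_ffun u x.
Proof.
move=> h; apply/hcvgP => e e0; pose d := e ^+ 2 / k.+1%:R.
have d0 : 0 < d by rewrite divr_gt0 ?exprn_gt0.
have h' s : exists N, forall n, (N <= n)%N -> nsq ip (u n s - x s) < d.
  have sd : 0 < Num.sqrt d by rewrite sqrtr_gt0.
  have /hcvgP/(_ _ sd)[N hN] := h s; exists N => n /hN.
  by rewrite hnormE ltr_sqrt.
have [N hN] := fin_all_exists h'; exists (\max_s N s)%N => n nN.
rewrite -(ltr_pXn2r (n := 2)) ?nnegrE ?hnorm_ge0 ?(ltW e0) // (sqr_hnorm ip_ffun_inner) nsq_ffun.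
have le s : nsq ip ((u n - x) s) <= d.
  rewrite !ffunE ltW // hN // (leq_trans _ nN) //; exact: leq_bigmax.
apply: (@le_lt_trans _ _ (\sum_(s < k) d)); first by apply: ler_sum => s _; exact: le.
rewrite sumr_const card_ord -[ltLHS]mulr_natr /d mulrAC ltr_pdivrMr //.
by rewrite ltr_pM2l ?exprn_gt0 // ltr_nat.
Qed.

Lemma hilbert_ffun : hilbert_space ip_ffun.
Proof.
split=> [|u hu]; first exact: ip_ffun_inner.
have h s : exists l, hcvg ip (fun n => u n s) l.
  apply: hL.2 => e /hu[N hN]; exists N => m n mN nN.
  apply: le_lt_trans (hN m n mN nN).
  by have := hnorm_ffun_ge (u m - u n) s; rewrite !ffunE.
have [l hl] := fin_all_exists h; exists [ffun s => l s].
by apply: hcvg_ffun => s; rewrite ffunE.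
Qed.

Lemma bounded_ffun (T : L -> L) : bounded_op ip T ->
  bounded_op ip_ffun (fun x => [ffun s => T (x s)]).
Proof.
move=> bT; have [lT _] := bT; have [M M0 hM] := bounded_nsqP ipP bT.
apply: (bounded_nsq ip_ffun_inner) => [a x y|].
  by apply/ffunP => s; rewrite !ffunE lT.
exists M => x; rewrite !nsq_ffun mulr_sumr; apply: ler_sum => s _.
by rewrite ffunE.
Qed.

End DirectSum.

Section PairSum.
Variables (R : realType) (L : lmodType R[i]) (ip : L -> L -> R[i]).
Hypothesis hL : hilbert_space ip.

Definition ip_pair (x y : L * L) : R[i] := ip x.1 y.1 + ip x.2 y.2.

Let ipP : inner_product ip := hL.1.

Lemma nsq_pair x : nsq ip_pair x = nsq ip x.1 + nsq ip x.2.
Proof. by rewrite /nsq /ip_pair raddfD. Qed.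

Lemma ip_pair_inner : inner_product ip_pair.
Proof.
split=> [x a y z|x y|[x y] x0].
- by rewrite /ip_pair !(ipDr ipP, ipZr ipP); ring.
- by rewrite /ip_pair [RHS]conjcD -!(ip_conj ipP).
rewrite /ip_pair /= !(ipxx ipP) -RcD ltcR.
have : ~~ ((nsq ip x == 0) && (nsq ip y == 0)).
  by apply: contra x0; rewrite !(nsq_eq0 ipP) => /andP[/eqP -> /eqP ->].
by rewrite -paddr_eq0 ?(nsq_ge0 ipP) // => h; rewrite lt_def h addr_ge0 ?(nsq_ge0 ipP).
Qed.

Lemma hcvg_pair (u : nat -> L * L) x : hcvg ip (fun n => (u n).1) x.1 ->
  hcvg ip (fun n => (u n).2) x.2 -> hcvg ip_pair u x.
Proof.
move=> /hcvgP h1 /hcvgP h2; apply/hcvgP => e /halfr_gt0 e0.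
have [N1 hN1] := h1 _ e0; have [N2 hN2] := h2 _ e0; exists (maxn N1 N2) => n.
rewrite geq_max => /andP[n1 n2].
have t1 := hN1 n n1; have t2 := hN2 n n2.
have a1 := hnorm_ge0 ip ((u n).1 - x.1); have a2 := hnorm_ge0 ip ((u n).2 - x.2).
rewrite -(ltr_pXn2r (n := 2)) ?nnegrE ?hnorm_ge0 //; last by lra.
rewrite (sqr_hnorm ip_pair_inner) nsq_pair /= -!(sqr_hnorm ipP); nra.
Qed.

Lemma hilbert_pair : hilbert_space ip_pair.
Proof.
split=> [|u hu]; first exact: ip_pair_inner.
have le1 x : hnorm ip x.1 <= hnorm ip_pair x.
  by rewrite !hnormE ler_wsqrtr // nsq_pair lerDl (nsq_ge0 ipP).
have le2 x : hnorm ip x.2 <= hnorm ip_pair x.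
  by rewrite !hnormE ler_wsqrtr // nsq_pair lerDr (nsq_ge0 ipP).
have [l1 h1] : exists l, hcvg ip (fun n => (u n).1) l.
  apply: hL.2 => e /hu[N hN]; exists N => m n mN nN.
  exact: le_lt_trans (le1 (u m - u n)) (hN m n mN nN).
have [l2 h2] : exists l, hcvg ip (fun n => (u n).2) l.
  apply: hL.2 => e /hu[N hN]; exists N => m n mN nN.
  exact: le_lt_trans (le2 (u m - u n)) (hN m n mN nN).
by exists (l1, l2); apply: hcvg_pair.
Qed.

Lemma bounded_pair (S T S' T' : L -> L) : bounded_op ip S -> bounded_op ip T ->
  bounded_op ip S' -> bounded_op ip T' ->
  bounded_op ip_pair (fun x => (S x.1 + T x.2, S' x.1 + T' x.2)).
Proof.
move=> bS bT bS' bT'; have [lS _] := bS; have [lT _] := bT; have [lS' _] := bS'; have [lT' _] := bT'.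
have [M1 P1 h1] := bounded_nsqP ipP bS; have [M2 P2 h2] := bounded_nsqP ipP bT.
have [M3 P3 h3] := bounded_nsqP ipP bS'; have [M4 P4 h4] := bounded_nsqP ipP bT'.
apply: (bounded_nsq ip_pair_inner) => [a x y|].
  case: x y => [x1 x2] [y1 y2]; congr (_, _) => /=.
    by rewrite lS lT scalerDr addrACA.
  by rewrite lS' lT' scalerDr addrACA.
have D u v : nsq ip (u + v) <= 2 * (nsq ip u + nsq ip v).
  have := nsq_ge0 ipP (u - v).
  have -> : nsq ip (u - v) = 2 * (nsq ip u + nsq ip v) - nsq ip (u + v).
    rewrite /nsq !(ipDr ipP, ipDl ipP, ipNr ipP, ipNl ipP).
    by case: (ip u u) (ip u v) (ip v u) (ip v v) => [a1 a2] [b1 b2] [c1 c2] [d1 d2] /=; ring.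
  by rewrite subr_ge0.
exists (2 * (M1 + M3) + 2 * (M2 + M4)) => x; rewrite !nsq_pair /=.
have e1 := D (S x.1) (T x.2); have e2 := D (S' x.1) (T' x.2).
have b1 := h1 x.1; have b2 := h2 x.2; have b3 := h3 x.1; have b4 := h4 x.2.
have x1 := nsq_ge0 ipP x.1; have x2 := nsq_ge0 ipP x.2.
have c1 := mulr_ge0 P1 x2; have c2 := mulr_ge0 P2 x1.
have c3 := mulr_ge0 P3 x2; have c4 := mulr_ge0 P4 x1.
rewrite mulrDr !mulrDl !mulrDr !mulrDl; lra.
Qed.

End PairSum.

Section Closure.
Variables (R : realType) (V H : lmodType R[i]) (ip : H -> H -> R[i]) (j : V -> H).
Hypothesis hH : hilbert_space ip.
Hypothesis lj : linear j.

Let ipP : inner_product ip := hH.1.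

(** The norm estimate survives in the closure of the graph. It makes the value there unique, so that
    the choice [xget] is determined; density and completeness make it exist everywhere. *)
Lemma closure_bounded (f : V -> V) (M : R) : hdense ip (range j) -> linear f -> 0 <= M ->
  (forall u, nsq ip (j (f u)) <= M ^+ 2 * nsq ip (j u)) ->
  [/\ bounded_op ip (op_closure ip j f), forall x, nsq ip (op_closure ip j f x) <= M ^+ 2 * nsq ip x
    & forall u, op_closure ip j f (j u) = j (f u)].
Proof.
move=> dj lf M0 hM; have hM' u : hnorm ip (j (f u)) <= M * hnorm ip (j u).
  rewrite !hnormE -[M in leRHS]ger0_norm // -sqrtr_sqr -sqrtrM ?sqr_ge0 //.
  exact: ler_wsqrtr.
pose graph x y := exists u : nat -> V, hcvg ip (j \o u) x /\ hcvg ip (j \o f \o u) y.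
have graph_le x y : graph x y -> hnorm ip y <= M * hnorm ip x.
  move=> [u [/hcvgP hx /hcvgP hy]]; apply/ler_addgt0Pl => d d0.
  have M1 : 0 < M + 1 by lra.
  have e0 : 0 < d / (M + 1) by rewrite divr_gt0.
  have [N1 /(_ (maxn N1 _) (leq_maxl _ _)) h1] := hx _ e0.
  have [N2 /(_ (maxn _ N2) (leq_maxr _ _)) h2] := hy _ e0.
  move: (h1 N2) (h2 N1) => /= {}h1 {}h2; set v := u _ in h1 h2.
  have dE : d = (M + 1) * (d / (M + 1)) by rewrite mulrC divfK // gt_eqF.
  have := hM' v.
  have t1 := hnormD ipP (j (f v)) (y - j (f v)); have t2 := hnormD ipP (j v - x) x.
  rewrite addrC subrK in t1; rewrite subrK in t2; rewrite (hnorm_subC ipP) in h2.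
  move: (hnorm ip (j (f v))) (hnorm ip (j v)) t1 t2 => a b t1 t2 ab.
  have : M * b <= M * (d / (M + 1) + hnorm ip x) by apply: ler_wpM2l => //; lra.
  rewrite {2}dE; move: (d / _) h1 h2 t1 => e h1 h2 t1; nra.
have graph_lin a x y x' y' : graph x y -> graph x' y' -> graph (a *: x + x') (a *: y + y').
  move=> [u [hx hy]] [v [hx' hy']]; exists (fun n => a *: u n + v n).
  split.
    have := hcvgD ipP (hcvg_bounded (bounded_Z ipP a (bounded_id ip)) hx) hx'.
    by congr hcvg; apply/funext => n /=; rewrite lj.
  have := hcvgD ipP (hcvg_bounded (bounded_Z ipP a (bounded_id ip)) hy) hy'.
  by congr hcvg; apply/funext => n /=; rewrite lf lj.
have graph_uniq x y z : graph x y -> graph x z -> y = z.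
  move=> xy xz; have := graph_lin (-1) _ _ _ _ xz xy.
  rewrite !scaleN1r addNr => /graph_le; rewrite (hnorm0 ipP) mulr0 => h.
  apply/eqP; rewrite -subr_eq0 addrC -(hnorm_eq0 ipP) eq_le h hnorm_ge0 //.
have graph_ex x : exists y, graph x y.
  have hu n : exists u, hnorm ip (x - j u) < n.+1%:R^-1.
    have n0 : 0 < n.+1%:R^-1 :> R by rewrite invr_gt0.
    by have [_ [u _ <-] hu] := dj x _ n0; exists u.
  have {hu}[u hu] := choice hu.
  have small (e : R) : 0 < e -> exists N, forall n, (N <= n)%N -> n.+1%:R^-1 < e.
    move=> e0; have [N hN] := ltr_add_invr (y := 0) (x := e) e0; exists N => n nN.
    apply: le_lt_trans (_ : N.+1%:R^-1 < e); last by move: hN; rewrite add0r.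
    by rewrite lef_pV2 ?posrE ?ltr0n // ler_nat.
  have cu : hcvg ip (j \o u) x.
    apply/hcvgP => e /small[N hN]; exists N => n /hN; rewrite (hnorm_subC ipP).
    exact: lt_trans (hu n).
  have [|y hy] := hH.2 (j \o f \o u); last by exists y, u.
  move=> e e0; have M1 : 0 < M + 1 by lra.
  have e1 : 0 < e / (M + 1) / 2 by rewrite !divr_gt0.
  have [N hN] := (hcvgP ip _ _).1 cu _ e1; exists N => m n mN nN /=.
  have lB (T : V -> V) v w : linear T -> T (v - w) = T v - T w by move=> lT; exact: (linearEB lT).
  have -> : j (f (u m)) - j (f (u n)) = j (f (u m - u n)).
    by rewrite (linearEB lf) (linearEB lj).
  apply: le_lt_trans (hM' _) _; rewrite (linearEB lj).
  have t := hnorm_sub_le ipP (j (u m)) x (j (u n)).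
  have hm := hN _ mN; have hn := hN _ nN; rewrite (hnorm_subC ipP) /= in hn.
  have eE : e = (M + 1) * (e / (M + 1)) by rewrite mulrC divfK // gt_eqF.
  rewrite /= in hm; rewrite eE; move: (e / (M + 1)) e1 hm hn => d d0 hm hn.
  move: (hnorm ip (j (u m) - j (u n))) t => a t.
  have : a < d by lra.
  have : M * a <= M * d by apply: ler_wpM2l => //; lra.
  lra.
have val x y : graph x y -> op_closure ip j f x = y.
  move=> xy; apply: (graph_uniq x) => //; exact: (xgetPex 0 (graph_ex x)).
have graph_val x : graph x (op_closure ip j f x) by exact: (xgetPex 0 (graph_ex x)).
split=> [|x|u].
- split=> [a x y|]; first by apply: val; exact: graph_lin.
  by exists M => x; exact: graph_le.
- rewrite -!(sqr_hnorm ipP) -exprMn ler_pXn2r ?nnegrE ?mulr_ge0 ?hnorm_ge0 //.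
  exact: graph_le.
by apply: val; exists (fun=> u); split; exact: hcvg_cst.
Qed.

Section Diagonal.
Variables (I : countType) (e : I -> V) (lam : I -> R) (f : V -> V).
Hypothesis lf : linear f.
Hypothesis eON : orthonormal ip (j \o e).
Hypothesis eC : complete_family ip (j \o e).
Hypothesis e_span : forall g h : V -> R[i]^o, linear g -> linear h ->
  (forall i, g (e i) = h (e i)) -> g =1 h.
Hypothesis fe : forall i, f (e i) = (lam i)%:C *: e i.

(** Closing an operator that is diagonal on the dense subspace gives the maximal diagonal operator,
    because the Fourier partial sums of any vector, and their images, come from [V]. The hypothesis
    [e_span] expresses by linear maps that [e] spans [V]. *)
Lemma closure_diag : is_diag ip (j \o e) lam (op_closure ip j f).
Proof.
have sym i u : ip (j (e i)) (j (f u)) = (lam i)%:C * ip (j (e i)) (j u).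
  move: u; apply: e_span => [z u v|z u v|k].
  - by rewrite lf lj (ipDr ipP) (ipZr ipP).
  - by rewrite lj (ipDr ipP) (ipZr ipP) mulrDr mulrCA.
  rewrite fe (linearEZ lj) (ipZr ipP).
  have [->//|ik] := eqVneq i k.
  by have := on_orth eON ik => /= ->; rewrite !mulr0.
pose graph x y := exists u : nat -> V, hcvg ip (j \o u) x /\ hcvg ip (j \o f \o u) y.
have graphP x y : graph x y <-> forall i, ip (j (e i)) y = (lam i)%:C * ip (j (e i)) x.
  split=> [[u [hx hy]] i|h].
    exact: (ip_lim_eq ipP hx hy (fun n => sym i (u n))).
  exists (fun n => \sum_(i <- prefix_enum I n) ip (j (e i)) x *: e i); split.
    have := fourier hH eON eC x; congr hcvg; apply/funext => n /=.
    by rewrite (linearE_sum lj); apply: eq_bigr => i _; rewrite (linearEZ lj).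
  have := fourier hH eON eC y; congr hcvg; apply/funext => n /=.
  rewrite (linearE_sum lf) (linearE_sum lj); apply: eq_bigr => i _.
  by rewrite (linearEZ lf) fe !(linearEZ lj) scalerA h mulrC.
move=> x y; have uniq_graph z : graph x y -> graph x z -> z = y.
  move=> /graphP h /graphP h'; apply: (coef_inj hH eC) => i /=.
  by rewrite h h'.
split=> [[[z xz] <-]|/graphP xy].
  by apply/graphP; exact: (xgetPex 0 (ex_intro _ z xz)).
split; first by exists y.
by apply: (uniq_graph _ xy); exact: (xgetPex 0 (ex_intro _ y xy)).
Qed.

End Diagonal.
End Closure.

(** The countable dense set consists of the finite combinations of the basis with coefficients in Q
    + iQ. *)
Lemma complete_separable (R : realType) (H : lmodType R[i]) (ip : H -> H -> R[i])
    (I : countType) (e : I -> H) : hilbert_space ip -> orthonormal ip e ->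
  complete_family ip e -> hseparable ip.
Proof.
move=> hH eON eC; have ipP := hH.1.
pose cx (z : rat * rat) : R[i] := (ratr z.1 +i* ratr z.2).
pose F (p : seq (I * (rat * rat))) : H := \sum_(x <- p) cx x.2 *: e x.1.
exists (range F).
  by apply: (sub_countable (card_image_le F setT)); exact: countableP.
move=> x d d0; have d2 := halfr_gt0 d0.
have /hcvgP/(_ _ d2)[N /(_ N (leqnn N))] := fourier hH eON eC x.
move: (prefix_enum I N) => r hr.
have approx (z : R[i]) (t : R) : 0 < t -> exists w, Num.sqrt (nsqc (z - cx w)) <= t.
  move=> t0; case: z => a b; have t2 : a - t / 2 < a + t / 2 by lra.
  have t3 : b - t / 2 < b + t / 2 by lra.
  have [u] := rat_in_itvoo t2; have [v] := rat_in_itvoo t3.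
  rewrite !in_itv /= => /andP[v1 v2] /andP[u1 u2]; exists (u, v).
  rewrite -[leRHS]ger0_norm ?(ltW t0) // -sqrtr_sqr ler_wsqrtr // /nsqc /=.
  by move: (ratr u) (ratr v) u1 u2 v1 v2 => {}u {}v *; nra.
have [p hp] : exists p, hnorm ip (\sum_(i <- r) ip (e i) x *: e i - F p) <= d / 2 * (size r)%:R / (size r).+1%:R.
  have t0 : 0 < d / 2 / (size r).+1%:R by rewrite divr_gt0.
  rewrite mulrAC; move: (d / 2 / _) t0 => t t0.
  elim: r {hr} => [|i r [p hp]] /=.
    by exists [::]; rewrite /F !big_nil subrr (hnorm0 ipP) mulr0.
  have [w hw] := approx (ip (e i) x) t t0; exists ((i, w) :: p).
  rewrite /F !big_cons /= opprD addrACA -scalerBl -natr1 mulrDr mulr1 addrC [leRHS]addrC.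
  rewrite addrC; apply: le_trans (hnormD ipP _ _) _; apply: lerD => //.
  rewrite (hnormZ ipP) -[leRHS]mulr1; apply: ler_pM => //; rewrite ?sqrtr_ge0 ?hnorm_ge0 //.
  by rewrite hnormE -[leRHS]sqrtr1 ler_wsqrtr // (on_nsq_le1 ipP eON).
exists (F p); first by exists p.
apply: le_lt_trans (hnorm_sub_le ipP _ (\sum_(i <- r) ip (e i) x *: e i) _) _.
rewrite (hnorm_subC ipP) in hr.
have : d / 2 * (size r)%:R / (size r).+1%:R <= d / 2.
  by rewrite ler_pdivrMr // ler_wpM2l ?(ltW d2) // ler_nat.
move=> hle; rewrite [ltRHS]splitr; apply: ltr_leD => //; exact: le_trans hp hle.
Qed.

(** * The Hilbert space of square summable families *)

Section ComplexLimit.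
Variable R : realType.
Implicit Types (u v : nat -> R[i]).

Definition ccvg u : Prop :=
  cvgn (fun n => complex.Re (u n)) /\ cvgn (fun n => complex.Im (u n)).

Definition clim u : R[i] :=
  limn (fun n => complex.Re (u n)) +i* limn (fun n => complex.Im (u n)).

Lemma clim_linear (a : R[i]) u v : ccvg u -> ccvg v ->
  ccvg (fun n => a * u n + v n) /\ clim (fun n => a * u n + v n) = a * clim u + clim v.
Proof.
case: a => a b [u1 u2] [v1 v2].
have e1 : (fun n => complex.Re ((a +i* b) * u n + v n)) =
    (fun n => (a * complex.Re (u n) - b * complex.Im (u n)) + complex.Re (v n)).
  by apply/funext => n; case: (u n) (v n) => [x y] [z t].
have e2 : (fun n => complex.Im ((a +i* b) * u n + v n)) =
    (fun n => (a * complex.Im (u n) + b * complex.Re (u n)) + complex.Im (v n)).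
  by apply/funext => n; case: (u n) (v n) => [x y] [z t].
have c1 := cvgD (cvgB (cvgM (cvg_cst a) u1) (cvgM (cvg_cst b) u2)) v1.
have c2 := cvgD (cvgD (cvgM (cvg_cst a) u2) (cvgM (cvg_cst b) u1)) v2.
split.
  split; first by rewrite e1; apply/cvg_ex; eexists; exact: c1.
  by rewrite e2; apply/cvg_ex; eexists; exact: c2.
by rewrite /clim e1 e2 (cvg_lim _ (c1 _ _ _ _ _ _)) // (cvg_lim _ (c2 _ _ _ _ _ _)).
Qed.

Lemma clim_conj u : ccvg u -> clim (fun n => conjc (u n)) = conjc (clim u).
Proof.
move=> [u1 u2].
have e1 : (fun n => complex.Re (conjc (u n))) = (fun n => complex.Re (u n)).
  by apply/funext => n; case: (u n).
have e2 : (fun n => complex.Im (conjc (u n))) = (fun n => - complex.Im (u n)).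
  by apply/funext => n; case: (u n).
by rewrite /clim e1 e2 (cvg_lim _ (cvgN u2)).
Qed.

Lemma cauchy_real (u : nat -> R) : (forall e : R, 0 < e -> exists N, forall m n,
    (N <= m)%N -> (N <= n)%N -> `|u m - u n| < e) -> cvgn u.
Proof.
move=> h; apply/cauchy_cvgP/cauchy_exP => e e0.
have [N hN] := h _ e0; exists (u N); exists N => // n Nn.
exact: hN.
Qed.

End ComplexLimit.

Section SquareSummable.
Variables (R : realType) (I : countType).
Implicit Types (f g : I -> R[i]).

Definition sq_bounded f (M : R) : Prop :=
  forall r : seq I, uniq r -> \sum_(i <- r) nsqc (f i) <= M.

Definition sq_summable f : Prop := exists M, sq_bounded f M.

Definition ell2_pred : {pred (I -> R[i])} := [pred f | `[< sq_summable f >]].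

Lemma ell2_submod_closed : submod_closed ell2_pred.
Proof.
split=> [|a f g /asboolP[M hM] /asboolP[N hN]]; apply/asboolP.
  exists 0 => r _; apply: sumr_le0 => i _.
  by rewrite [X in nsqc X](_ : _ = 0) // nsqc0.
exists (2 * (nsqc a * M + N)) => r ur.
apply: (@le_trans _ _ (\sum_(i <- r) 2 * (nsqc a * nsqc (f i) + nsqc (g i)))).
  apply: ler_sum => i _; rewrite -nsqcM.
  rewrite [X in nsqc X](_ : _ = a * f i + g i) //; exact: nsqcD_le.
rewrite -mulr_sumr ler_pM2l // big_split -mulr_sumr /= lerD ?ler_wpM2l ?nsqc_ge0 ?hM ?hN //.
Qed.

HB.instance Definition _ := GRing.isSubmodClosed.Build _ _ ell2_pred ell2_submod_closed.

Definition ell2 := {f : I -> R[i] | f \in ell2_pred}.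

HB.instance Definition _ := [isSub for (@sval _ _ : ell2 -> (I -> R[i]))].
HB.instance Definition _ := [Choice of ell2 by <:].
HB.instance Definition _ := [SubChoice_isSubLmodule of ell2 by <:].

Implicit Types (x y : ell2).

Definition ell2_coef x : I -> R[i] := val x.
Local Notation cf := ell2_coef.


Let N f n : R := \sum_(i <- prefix_enum I n) nsqc (f i).

Let sum_sub f (r t : seq I) : uniq r -> uniq t -> {subset r <= t} ->
  \sum_(i <- r) nsqc (f i) <= \sum_(i <- t) nsqc (f i).
Proof.
move=> ur ut rt; rewrite [leRHS](bigID (mem r)) /= -[X in X + _]big_filter.
have pE : perm_eq [seq i <- t | i \in r] r.
  apply: uniq_perm; rewrite ?filter_uniq // => i; rewrite mem_filter.
  by apply/andP/idP => [[]//|ir]; split=> //; exact: rt.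
rewrite (perm_big r pE).
by rewrite lerDl sumr_ge0 // => i _; exact: nsqc_ge0.
Qed.

Let N_nd f : nondecreasing_seq (N f).
Proof.
move=> m n mn; apply: sum_sub; rewrite ?prefix_enum_uniq // => i.
by rewrite -(subnKC mn); have [t ->] := prefix_enumD I m (n - m); rewrite mem_cat => ->.
Qed.

Let N_cvg f M : sq_bounded f M -> cvgn (N f) /\ limn (N f) <= M.
Proof.
move=> hM; have ub : ubound (range (N f)) M.
  by move=> _ [n _ <-]; apply: hM; exact: prefix_enum_uniq.
have c : cvgn (N f).
  by apply: nondecreasing_is_cvgn; [exact: N_nd | exists M].
by split=> //; apply: limr_le => //; near=> n; apply: hM; exact: prefix_enum_uniq.
Unshelve. all: by end_near. Qed.

Let N_bound f : sq_summable f -> sq_bounded f (limn (N f)).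
Proof.
move=> [M /N_cvg[c _]] r ur.
pose n := (\max_(i <- r) (choice.pickle i).+1)%N.
apply: (@le_trans _ _ (N f n)); last exact: nondecreasing_cvgn_le.
apply: sum_sub; rewrite ?prefix_enum_uniq // => i ir; apply: mem_prefix_enum.
exact: (@leq_bigmax_seq _ r xpredT (fun i => (choice.pickle i).+1)).
Qed.

Lemma ell2_summable x : sq_summable (cf x). Proof. exact/asboolP/(valP x). Qed.

Lemma ell2_linE (a : R[i]) x y i : cf (a *: x + y) i = a * cf x i + cf y i.
Proof. by []. Qed.

Definition ell2_ip x y : R[i] :=
  clim (fun n => \sum_(i <- prefix_enum I n) conjc (cf x i) * cf y i).

Let sum_ccvg x y : ccvg (fun n => \sum_(i <- prefix_enum I n) conjc (cf x i) * cf y i).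
Proof.
have c (z : ell2) : cvgn (N (cf z)).
  by have [M /N_cvg[]] := ell2_summable z.
(* Polarization: the real and imaginary parts of the partial sums are combinations of the convergent
   sums of squared moduli of [x], [y] and of [x + y] or [x - 'i *: y]. *)
have pol (z : ell2) (u : R[i] -> R) : (forall i, u (conjc (cf x i) * cf y i) =
      (nsqc (cf z i) - nsqc (cf x i) - nsqc (cf y i)) / 2) ->
    {morph u : a b / a + b} -> u 0 = 0 ->
    cvgn (fun n => u (\sum_(i <- prefix_enum I n) conjc (cf x i) * cf y i)).
  move=> hu uD u0.
  have -> : (fun n => u (\sum_(i <- prefix_enum I n) conjc (cf x i) * cf y i)) =
      (fun n => (N (cf z) n - N (cf x) n - N (cf y) n) * 2^-1).
    apply/funext => n; rewrite (big_morph u uD u0) /N -!sumrB mulr_suml.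
    by apply: eq_bigr => i _; rewrite hu.
  apply/cvg_ex; eexists; apply: cvgM; last exact: cvg_cst.
  exact: cvgB (cvgB (c z) (c x)) (c y).
split.
  apply: (pol (x + y)) => [i|a b|//]; last exact: raddfD.
  rewrite -[x in x + y]scale1r ell2_linE mul1r.
  by case: (cf x i) (cf y i) => [a b] [c' d]; rewrite /nsqc /=; field.
apply: (pol ((- 'i) *: y + x)) => [i|a b|//]; last exact: raddfD.
rewrite ell2_linE.
by case: (cf x i) (cf y i) => [a b] [c' d]; rewrite /nsqc /=; field.
Qed.

Let nsq_ell2 x : nsq ell2_ip x = limn (N (cf x)).
Proof.
rewrite /nsq /=; congr (limn _); apply/funext => n.
rewrite raddf_sum; apply: eq_bigr => i _.
by rewrite mul_conjc.
Qed.

Let nsq_ell2_le x M : sq_bounded (cf x) M -> nsq ell2_ip x <= M.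
Proof. by move=> /N_cvg[_]; rewrite nsq_ell2. Qed.

Let coef_le x i : nsqc (cf x i) <= nsq ell2_ip x.
Proof.
by have /N_bound/(_ [:: i] isT) := ell2_summable x; rewrite big_seq1 nsq_ell2.
Qed.

Lemma ell2_inner_product : inner_product ell2_ip.
Proof.
split=> [x a y z|x y|x x0].
- have [_ <-] := clim_linear a (sum_ccvg x y) (sum_ccvg x z).
  congr clim; apply/funext => n; rewrite mulr_sumr -big_split.
  by apply: eq_bigr => i _ /=; rewrite ell2_linE mulrDr mulrCA.
- rewrite -[RHS](clim_conj (sum_ccvg x y)); congr clim; apply/funext => n.
  rewrite raddf_sum; apply: eq_bigr => i _ /=.
  by rewrite conjcM conjcK mulrC.
have [i xi] : exists i, cf x i != 0.
  apply: contrapT => h; case/eqP: x0; apply/val_inj/funext => i.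
  by apply/eqP; apply: contrapT => /negP xi; apply: h; exists i.
have im0 : complex.Im (ell2_ip x x) = 0.
  rewrite /=; have -> : (fun n => complex.Im (\sum_(i <- prefix_enum I n) conjc (cf x i) * cf x i)) = fun=> 0.
    apply/funext => n; rewrite raddf_sum big1 // => j _.
    by rewrite mul_conjc.
  by rewrite lim_cst.
have -> : ell2_ip x x = (nsq ell2_ip x)%:C.
  by rewrite /nsq; move: im0; case: (ell2_ip x x) => a b /= ->.
rewrite ltcR; apply: lt_le_trans (coef_le x i).
by rewrite lt_def nsqc_eq0 xi nsqc_ge0.
Qed.

Lemma ell2_hilbert : hilbert_space ell2_ip.
Proof.
have ipP := ell2_inner_product; split=> // u hu.
have ch e : 0 < e -> exists K, forall m n r, (K <= m)%N -> (K <= n)%N -> uniq r ->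
    \sum_(i <- r) nsqc (cf (u m) i - cf (u n) i) <= e ^+ 2.
  move=> e0; have [K hK] := hu e e0; exists K => m n r mK nK ur.
  have h : nsq ell2_ip (u m - u n) <= e ^+ 2.
    rewrite -(sqr_hnorm ipP) ler_pXn2r ?nnegrE ?hnorm_ge0 ?(ltW e0) //.
    exact/ltW/hK.
  have := N_bound (ell2_summable (u m - u n)) ur; rewrite -nsq_ell2 => h'; exact: le_trans h' h.
have cv (F : R[i] -> R) : (forall z w, `|F z - F w| <= Num.sqrt (nsqc (z - w))) ->
    forall i, cvgn (fun n => F (cf (u n) i)).
  move=> hF i; apply: cauchy_real => e /halfr_gt0 e0; have [K hK] := ch _ e0.
  exists K => m n mK nK; have := hK m n [:: i] mK nK isT; rewrite big_seq1 => h.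
  apply: le_lt_trans (hF _ _) _; apply: (@le_lt_trans _ _ (e / 2)); last by lra.
  by rewrite -[leRHS]ger0_norm ?(ltW e0) // -sqrtr_sqr ler_wsqrtr.
have cR := cv (@complex.Re R).
have {}cR i : cvgn (fun n => complex.Re (cf (u n) i)).
  apply: cR => -[a b] [c d] /=; rewrite -sqrtr_sqr ler_wsqrtr // /nsqc /=.
  by rewrite lerDl sqr_ge0.
have cI i : cvgn (fun n => complex.Im (cf (u n) i)).
  apply: cv => -[a b] [c d] /=; rewrite -sqrtr_sqr ler_wsqrtr // /nsqc /=.
  by rewrite lerDr sqr_ge0.
pose g i : R[i] := clim (fun n => cf (u n) i).
(* The Cauchy estimate holds for every finite set of labels, uniformly, so it passes to the
   coordinatewise limit [g] before the set of labels grows. *)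
have cg e : 0 < e -> exists K, forall m r, (K <= m)%N -> uniq r ->
    \sum_(i <- r) nsqc (cf (u m) i - g i) <= e ^+ 2.
  move=> e0; have [K hK] := ch e e0; exists K => m r mK ur.
  have c : (fun n => \sum_(i <- r) nsqc (cf (u m) i - cf (u n) i)) @ \oo -->
      \sum_(i <- r) nsqc (cf (u m) i - g i).
    elim: r {ur} => [|i r IH].
      rewrite big_nil; under eq_fun do rewrite big_nil; exact: cvg_cst.
    rewrite big_cons; under eq_fun do rewrite big_cons.
    apply: cvgD IH.
    have h1 : (fun n => complex.Re (cf (u m) i) - complex.Re (cf (u n) i)) @ \oo -->
        complex.Re (cf (u m) i) - complex.Re (g i).
      by apply: cvgB; [exact: cvg_cst | exact: cR].
    have h2 : (fun n => complex.Im (cf (u m) i) - complex.Im (cf (u n) i)) @ \oo -->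
        complex.Im (cf (u m) i) - complex.Im (g i).
      by apply: cvgB; [exact: cvg_cst | exact: cI].
    have nE (z w : R[i]) : nsqc (z - w) =
        (complex.Re z - complex.Re w) * (complex.Re z - complex.Re w)
        + (complex.Im z - complex.Im w) * (complex.Im z - complex.Im w).
      by case: z w => [a b] [c d]; rewrite /nsqc /= !expr2.
    rewrite nE; under eq_fun do rewrite nE.
    by apply: cvgD; apply: cvgM.
  rewrite -(cvg_lim _ c) //; apply: limr_le; first by apply/cvg_ex; eexists; exact: c.
  by exists K => // n /= nK; exact: hK.
have gS : sq_summable g.
  have [K hK] := cg 1 ltr01; have [M hM] := ell2_summable (u K).
  exists (2 * (M + 1 ^+ 2)) => r ur.
  apply: (@le_trans _ _ (\sum_(i <- r) 2 * (nsqc (cf (u K) i) + nsqc (- (cf (u K) i - g i))))).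
    apply: ler_sum => i _.
    by rewrite [X in nsqc X](_ : _ = cf (u K) i + - (cf (u K) i - g i)) ?nsqcD_le //; ring.
  rewrite -mulr_sumr ler_pM2l // big_split lerD ?hM //.
  by under eq_bigr do rewrite nsqcN; exact: hK.
have gP : g \in ell2_pred by apply/asboolP.
exists (Sub g gP); apply/hcvgP => e /halfr_gt0 e0; have [K hK] := cg _ e0.
exists K => n nK; rewrite hnormE.
apply: (@le_lt_trans _ _ (e / 2)); last by lra.
rewrite -[leRHS]ger0_norm ?(ltW e0) // -sqrtr_sqr ler_wsqrtr // nsq_ell2_le // => r ur.
exact: hK n r nK ur.
Qed.

Definition ell2_delta_fun (j : I) (i : I) : R[i] := (i == j)%:R.

Lemma ell2_delta_summable j : ell2_delta_fun j \in ell2_pred.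
Proof.
apply/asboolP; exists 1 => r ur; rewrite /ell2_delta_fun.
have [jr|jr] := boolP (j \in r).
  rewrite (bigD1_seq j) //= eqxx big1 ?addr0 => [|i /negbTE ->].
    by rewrite nsqcR expr1n.
  exact: nsqc0.
rewrite big1_seq // => i /andP[_ ir]; have [ij|_] := eqVneq i j; last exact: nsqc0.
by rewrite ij (negbTE jr) in ir.
Qed.

Definition ell2_delta j : ell2 := Sub (ell2_delta_fun j) (ell2_delta_summable j).

Lemma ell2_delta_coef j x : ell2_ip (ell2_delta j) x = cf x j.
Proof.
have lim0 (u : nat -> R) c : (exists K, forall n, (K <= n)%N -> u n = c) -> limn u = c.
  move=> [K hK]; apply: cvg_lim => //; apply: (@cvg_trans _ ((fun=> c) @ \oo)); last exact: cvg_cst.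
  by apply: near_eq_cvg; exists K => // n /= /hK ->.
have dE i : cf (ell2_delta j) i = (i == j)%:R by [].
have main : forall n, ((choice.pickle j).+1 <= n)%N ->
    \sum_(i <- prefix_enum I n) conjc (cf (ell2_delta j) i) * cf x i = cf x j.
  move=> n jn; rewrite (bigD1_seq j) ?prefix_enum_uniq ?mem_prefix_enum //=.
  rewrite dE eqxx conjc1 mul1r big1 ?addr0 // => i ij.
  by rewrite dE (negbTE ij) conjc0 mul0r.
rewrite /ell2_ip /clim; case E : (cf x j) => [a b]; congr (_ +i* _).
  by apply: lim0; exists (choice.pickle j).+1 => n /main ->; rewrite E.
by apply: lim0; exists (choice.pickle j).+1 => n /main ->; rewrite E.
Qed.

End SquareSummable.

(** * Finitely supported functions *)

Section MalgExtension.
Variables (K : nzRingType) (I : choiceType) (V : lmodType K).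
Implicit Types (a b : {malg K[I]}) (f g : {malg K[I]} -> V).

Lemma malgUZ (c : K) (k : I) : << c *g k >> = c *: << k >> :> {malg K[I]}.
Proof.
by apply/malgP => k'; rewrite mcoeffZ !mcoeffU; case: (k == k'); rewrite ?mulr1 ?mulr0.
Qed.

Lemma malg_ind (P : {malg K[I]} -> Prop) : P 0 ->
  (forall c k a, P a -> P (c *: << k >> + a)) -> forall a, P a.
Proof.
move=> P0 PD a; rewrite [a]monalgE; elim: (enum_fset (msupp a)) => [|k s IH].
  by rewrite big_nil.
by rewrite big_cons malgUZ; exact: PD.
Qed.

Lemma malg_eq_linear f g : linear f -> linear g ->
  (forall k, f << k >> = g << k >>) -> f =1 g.
Proof.
move=> lf lg fg; elim/malg_ind => [|c k a IH]; first by rewrite (linearE0 lf) (linearE0 lg).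
by rewrite lf lg fg IH.
Qed.

Section Semilinear.
Variables (sigma : K -> K) (h : I -> V).
Hypothesis sD : {morph sigma : x y / x + y}.
Hypothesis sM : {morph sigma : x y / x * y}.
Hypothesis s0 : sigma 0 = 0.

Lemma malg_sum_fset a (d : {fset I}) : (msupp a `<=` d)%fset ->
  \sum_(k <- msupp a) sigma a@_k *: h k = \sum_(k <- d) sigma a@_k *: h k.
Proof.
move=> ad; apply: (big_fset_incl _ ad) => k _ /mcoeff_outdom ->.
by rewrite s0 scale0r.
Qed.

Lemma malg_semilinear c a b :
  \sum_(k <- msupp (c *: a + b)) sigma (c *: a + b)@_k *: h k =
  sigma c *: (\sum_(k <- msupp a) sigma a@_k *: h k) +
  \sum_(k <- msupp b) sigma b@_k *: h k.
Proof.
pose d := (msupp a `|` msupp b)%fset.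
rewrite !(@malg_sum_fset _ d) ?fsubsetUl ?fsubsetUr //; last first.
  apply: fsubset_trans (msuppD_le _ _) _; apply: fsetSU; exact: msuppZ_le.
rewrite scaler_sumr -big_split; apply: eq_bigr => k _ /=.
by rewrite mcoeffD mcoeffZ sD sM scalerDl scalerA.
Qed.

Lemma malg_semilinearU k : sigma 1 = 1 ->
  \sum_(j <- msupp (<< k >> : {malg K[I]})) sigma (<< k >> : {malg K[I]})@_j *: h j = h k.
Proof.
by move=> s1; rewrite msuppU oner_eq0 big_seq_fset1 mcoeffUU s1 scale1r.
Qed.

End Semilinear.

Lemma malg_linear (h : I -> V) :
  linear (fun a : {malg K[I]} => \sum_(k <- msupp a) a@_k *: h k).
Proof. by move=> c a b; rewrite -(@malg_semilinear id h). Qed.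

Lemma malg_linearU (h : I -> V) k :
  \sum_(j <- msupp (<< k >> : {malg K[I]})) (<< k >> : {malg K[I]})@_j *: h j = h k.
Proof. exact: (@malg_semilinearU id). Qed.

End MalgExtension.

(** * Clebsch-Gordan decomposition *)

(* p plays the role of q^(1/2), and s n that of [n]^(1/2). A string of type r is
   the image of the basis of weight vectors under an intertwiner from V_{q,r/2}. *)
Section ClebschGordan.
Variables (F : fieldType) (p : F) (s : nat -> F).

Definition is_string (M : lmodType F) (op : gen -> M -> M) (r : nat)
    (v : nat -> M) : Prop := forall n k, (n + k = r)%N ->
  [/\ op Ge (v n) = (s k * s n.+1) *: v n.+1,
      op Gf (v n) = (s k.+1 * s n) *: v n.-1,
      op Gk (v n) = (p ^+ n / p ^+ k) *: v n
    & op Gkinv (v n) = (p ^+ k / p ^+ n) *: v n].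

(* P b n behaves like the tensor product of the vector of index b of V_{q,1/2}
   and of the vector of index n of V_{q,l/2}. *)
Definition is_tensor (M : lmodType F) (op : gen -> M -> M) (l : nat)
    (P : bool -> nat -> M) : Prop := forall n k, (n + k = l)%N ->
  [/\ op Ge (P false n) = (p ^+ n / p ^+ k) *: P true n
                          + (p * (s k * s n.+1)) *: P false n.+1
    & op Ge (P true n) = (p^-1 * (s k * s n.+1)) *: P true n.+1] /\
  [/\ op Gf (P true n) = (p ^+ n / p ^+ k) *: P false n
                         + (p^-1 * (s k.+1 * s n)) *: P true n.-1
    & op Gf (P false n) = (p * (s k.+1 * s n)) *: P false n.-1] /\
  [/\ op Gk (P true n) = (p * (p ^+ n / p ^+ k)) *: P true n,
      op Gk (P false n) = (p^-1 * (p ^+ n / p ^+ k)) *: P false n,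
      op Gkinv (P true n) = (p^-1 * (p ^+ k / p ^+ n)) *: P true n
    & op Gkinv (P false n) = (p * (p ^+ k / p ^+ n)) *: P false n].

(** The q-Clebsch-Gordan coefficients of V_{1/2} (x) V_{l/2} for the component of type (l+1)/2: with
    q = p^2, [cgA] is q^(-(l+1-n)/2) ([n]/[l+1])^(1/2) and [cgB] is q^(n/2)
    ([l+1-n]/[l+1])^(1/2). *)
Definition cgA l n : F := s n / (p ^+ (l.+1 - n) * s l.+1).
Definition cgB l n : F := p ^+ n * s (l.+1 - n) / s l.+1.

Definition cg_up (M : lmodType F) l (P : bool -> nat -> M) n : M :=
  cgA l n *: P true n.-1 + cgB l n *: P false n.
(** Orthogonal to [cg_up] at total index [n.+1]: the smaller component starts one weight higher. *)
Definition cg_down (M : lmodType F) l (P : bool -> nat -> M) n : M :=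
  - cgB l n.+1 *: P true n + cgA l n.+1 *: P false n.+1.

Hypothesis p0 : p != 0.
Hypothesis p4 : p ^+ 4 != 1.
Hypothesis s_sqr : forall n,
  s n ^+ 2 = (p ^+ (2 * n) - p ^- (2 * n)) / (p ^+ 2 - p ^- 2).
Hypothesis s_neq0 : forall n, s n.+1 != 0.
Hypothesis s_1 : s 1 = 1.

Lemma cg_s0 : s 0 = 0.
Proof.
by apply/eqP; rewrite -sqrf_eq0 s_sqr muln0 expr0 invr1 subrr mul0r.
Qed.

Let pn n : p ^+ n != 0. Proof. by rewrite expf_neq0. Qed.
Let pp : p ^+ 2 - p ^- 2 != 0.
Proof.
apply: contra p4 => /eqP h; rewrite -subr_eq0; apply/eqP.
transitivity (p ^+ 2 * (p ^+ 2 - p ^- 2)); last by rewrite h mulr0.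
by field.
Qed.

Let sqrE n : s n ^+ 2 = ((p ^+ n) ^+ 2 - (p ^+ n) ^- 2) / (p ^+ 2 - p ^- 2).
Proof. by rewrite s_sqr mulnC exprM. Qed.

Lemma cg_sqrS n : s n.+1 ^+ 2 = p ^- 2 * s n ^+ 2 + (p ^+ n) ^+ 2.
Proof.
rewrite !sqrE [p ^+ n.+1]exprS; move: (pn n) (mulfV pp); set u := p ^+ n => un.
set c := (_ - _)^-1 => pc.
transitivity (p ^- 2 * ((u ^+ 2 - u ^- 2) * c) + u ^+ 2 * ((p ^+ 2 - p ^- 2) * c)).
  by field; rewrite p0 un.
by rewrite pc mulr1.
Qed.

Lemma cg_sqrS' n : s n.+1 ^+ 2 = p ^+ 2 * s n ^+ 2 + (p ^+ n) ^- 2.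
Proof.
rewrite !sqrE [p ^+ n.+1]exprS; move: (pn n) (mulfV pp); set u := p ^+ n => un.
set c := (_ - _)^-1 => pc.
transitivity (p ^+ 2 * ((u ^+ 2 - u ^- 2) * c) + u ^- 2 * ((p ^+ 2 - p ^- 2) * c)).
  by field; rewrite p0 un.
by rewrite pc mulr1.
Qed.

(** The addition formula [n+k] = q^n [k] + q^(-k) [n], which normalizes the Clebsch-Gordan
    coefficients. *)
Lemma cg_sqrD n k :
  s (n + k) ^+ 2 = (p ^+ n) ^+ 2 * s k ^+ 2 + (p ^+ k) ^- 2 * s n ^+ 2.
Proof.
rewrite !sqrE exprD; move: (pn n) (pn k); set u := p ^+ n; set v := p ^+ k => un vn.
by move: (_ - _)^-1 => c; field; rewrite un vn.
Qed.

Lemma cgAE l n k : (n + k = l.+1)%N -> cgA l n = s n / (p ^+ k * s l.+1).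
Proof. by rewrite /cgA => <-; rewrite addKn. Qed.

Lemma cgBE l n k : (n + k = l.+1)%N -> cgB l n = p ^+ n * s k / s l.+1.
Proof. by rewrite /cgB => <-; rewrite addKn. Qed.

Lemma cgA0 l : cgA l 0 = 0. Proof. by rewrite /cgA cg_s0 mul0r. Qed.

Lemma cgB0 l : cgB l 0 = 1.
Proof. by rewrite (@cgBE l 0 l.+1) // mul1r divff. Qed.

Lemma cgB_top l : cgB l l.+1 = 0.
Proof. by rewrite (@cgBE l l.+1 0) ?addn0 // cg_s0 mulr0 mul0r. Qed.

Lemma cg_norm l n : (n <= l.+1)%N -> cgA l n ^+ 2 + cgB l n ^+ 2 = 1.
Proof.
move=> /subnKC nk; rewrite (cgAE nk) (cgBE nk); move: (l.+1 - n)%N nk => k nk.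
have := cg_sqrD n k; have := s_neq0 l; rewrite nk; have := pn k.
set u := p ^+ n; set v := p ^+ k; set z := s l.+1 => v0 z0 e.
transitivity ((u ^+ 2 * s k ^+ 2 + v ^- 2 * s n ^+ 2) / z ^+ 2).
  by field; rewrite z0 v0.
by rewrite -e divff // sqrf_eq0.
Qed.

Section Module.
Variables (M : lmodType F) (op : gen -> M -> M).
Hypothesis op_lin : forall x, linear (op x).
Variables (l : nat) (P : bool -> nat -> M).
Hypothesis tP : is_tensor op l P.

Let opE x a b (u v : M) : op x (a *: u + b *: v) = a *: op x u + b *: op x v.
Proof. by rewrite op_lin (linearEZ (op_lin x)). Qed.

(* The factors s n and s k dispose of the boundary cases n = 0 and k = 0. *)
Let opA n k : (n + k = l.+1)%N ->
  [/\ s n *: op Ge (P true n.-1) = (s n * (p^-1 * (s k * s n))) *: P true n,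
      s n *: op Gf (P true n.-1) = (s n * (p^-1 * (p ^+ n / p ^+ k))) *: P false n.-1
        + (s n * (p^-1 * (s k.+1 * s n.-1))) *: P true n.-2,
      s n *: op Gk (P true n.-1) = (s n * (p ^+ n / p ^+ k)) *: P true n.-1
    & s n *: op Gkinv (P true n.-1) = (s n * (p ^+ k / p ^+ n)) *: P true n.-1].
Proof.
case: n => [|n] nk; first by rewrite cg_s0 !(mul0r, scale0r, addr0).
have nl : (n + k = l)%N by lia.
have [[_ E] [[F' _] [K1 _ K2 _]]] := tP nl; have u0 := pn n; have v0 := pn k.
rewrite /= E F' K1 K2 !scalerDr !scalerA exprS.
by split=> //; [congr (_ *: _ + _) | congr (_ *: _) | congr (_ *: _)]; field;
  rewrite ?p0 ?u0 ?v0.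
Qed.

Let opB n k : (n + k = l.+1)%N ->
  [/\ s k *: op Ge (P false n) = (s k * (p * (p ^+ n / p ^+ k))) *: P true n
        + (s k * (p * (s k.-1 * s n.+1))) *: P false n.+1,
      s k *: op Gf (P false n) = (s k * (p * (s k * s n))) *: P false n.-1,
      s k *: op Gk (P false n) = (s k * (p ^+ n / p ^+ k)) *: P false n
    & s k *: op Gkinv (P false n) = (s k * (p ^+ k / p ^+ n)) *: P false n].
Proof.
case: k => [|k] nk; first by rewrite cg_s0 !(mul0r, scale0r, addr0).
have nl : (n + k = l)%N by lia.
have [[E _] [[_ F'] [_ K1 _ K2]]] := tP nl; have u0 := pn n; have v0 := pn k.
rewrite /= E F' K1 K2 !scalerDr !scalerA exprS.
by split=> //; [congr (_ *: _ + _) | congr (_ *: _) | congr (_ *: _)]; field;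
  rewrite ?p0 ?u0 ?v0.
Qed.

Let cgS n k : (n + k = l.+1)%N ->
  [/\ s k * cgA l n.+1 = s k * (s n.+1 * p / (p ^+ k * s l.+1)),
      s k * cgB l n.+1 = s k * (p * p ^+ n * s k.-1 / s l.+1),
      s k * s k ^+ 2 = s k * (p ^+ 2 * s k.-1 ^+ 2 + p ^+ 2 / (p ^+ k) ^+ 2)
    & s k ^+ 2 * cgB l n.+1 = s k ^+ 2 * (p * p ^+ n * s k.-1 / s l.+1)].
Proof.
case: k => [|k] nk; first by rewrite cg_s0 !expr0n !mul0r.
have sl := s_neq0 l; have u0 := pn n; have v0 := pn k.
have nl : (n.+1 + k = l.+1)%N by lia.
by split; rewrite ?(cgAE nl) ?(cgBE nl) ?cg_sqrS' /= ?[p ^+ _.+1]exprS; field;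
  rewrite ?p0 ?v0 ?sl.
Qed.

Let cgP n k : (n + k = l.+1)%N ->
  [/\ s n * cgA l n.-1 = s n * (s n.-1 / (p * p ^+ k * s l.+1)),
      s n * cgB l n.-1 = s n * (p ^+ n / p * s k.+1 / s l.+1)
    & s n * s n ^+ 2 = s n * (p ^- 2 * s n.-1 ^+ 2 + (p ^+ n) ^+ 2 / p ^+ 2)].
Proof.
case: n => [|n] nk; first by rewrite cg_s0 !mul0r.
have sl := s_neq0 l; have u0 := pn n; have v0 := pn k.
have nl : (n + k.+1 = l.+1)%N by lia.
by split; rewrite ?(cgAE nl) ?(cgBE nl) ?cg_sqrS /= ?[p ^+ _.+1]exprS; field;
  rewrite ?p0 ?v0 ?sl.
Qed.

Lemma cg_up_string : is_string op l.+1 (cg_up l P).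
Proof.
move=> n k nk; rewrite /cg_up !opE !(cgAE nk) !(cgBE nk).
have sl := s_neq0 l; have u0 := pn n; have v0 := pn k.
have [A1 A2 A3 A4] := opA nk; have [B1 B2 B3 B4] := opB nk.
have [S1 S2 _ _] := cgS nk; have [P1 P2 _] := cgP nk.
have splA (X : M) : (s n / (p ^+ k * s l.+1)) *: X = (p ^+ k * s l.+1)^-1 *: (s n *: X).
  by rewrite scalerA mulrC.
have splB (X : M) : (p ^+ n * s k / s l.+1) *: X = (p ^+ n / s l.+1) *: (s k *: X).
  by rewrite scalerA mulrAC.
split.
- rewrite splA splB A1 B1 !scalerDr !scalerA addrA -scalerDl.
  congr (_ *: _ + _ *: _).
    rewrite [RHS]mulrAC S1; transitivity (s k / (p ^+ k * s l.+1) * p * s n.+1 ^+ 2).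
      by rewrite cg_sqrS; field; rewrite p0 v0 sl.
    by field; rewrite v0 sl.
  by rewrite [RHS]mulrAC S2; field.
- rewrite splA splB A2 B2 !scalerDr !scalerA addrAC -scalerDl addrC.
  congr (_ *: _ + _ *: _).
    by rewrite -mulrA P1; field; rewrite p0 v0 sl.
  rewrite -[RHS]mulrA P2; transitivity (s n / s l.+1 * p ^+ n / p * s k.+1 ^+ 2).
    by rewrite cg_sqrS'; field; rewrite p0 v0 sl.
  by field; rewrite ?p0 ?sl.
- by rewrite (splA (op _ _)) (splB (op _ _)) A3 B3 scalerDr !scalerA;
    congr (_ *: _ + _ *: _); field; rewrite v0 sl.
- by rewrite (splA (op _ _)) (splB (op _ _)) A4 B4 scalerDr !scalerA;
    congr (_ *: _ + _ *: _); field; rewrite ?u0 ?v0 sl.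
Qed.

Lemma cg_down_string : (0 < l)%N -> is_string op l.-1 (cg_down l P).
Proof.
move=> l0 n k nk; rewrite /cg_down !opE.
have sl := s_neq0 l; have u0 := pn n; have v0 := pn k.
have nk1 : (n.+1 + k.+1 = l.+1)%N by lia.
have nl1 : (n + k.+1 = l)%N by lia.
have nl2 : (n.+1 + k = l)%N by lia.
have nk2 : (n.+2 + k = l.+1)%N by lia.
have nk0 : (n + k.+2 = l.+1)%N by lia.
rewrite (cgAE nk1) (cgBE nk1) (cgAE nk2) (cgBE nk2).
have [[_ E1] [[F1 _] [K1 _ L1 _]]] := tP nl1.
have [[E2 _] [[_ F2] [_ K2 _ L2]]] := tP nl2.
rewrite ?E1 ?E2 ?F1 ?F2 ?K1 ?K2 ?L1 ?L2 /= !scalerDr !scalerA.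
rewrite ![p ^+ _.+1]exprS; split.
- rewrite addrA -scalerDl; congr (_ *: _ + _ *: _).
    transitivity (p ^+ n * s n.+1 / s l.+1 * (- s k.+1 ^+ 2 + (p ^+ k) ^- 2)).
      by field; rewrite p0 v0 sl.
    by rewrite cg_sqrS'; field; rewrite v0 sl.
  by field; rewrite p0 v0 sl.
(* At [n = 0] the truncated predecessor is harmless: the two contributions to [P false 0] cancel,
   since this is the lowest weight vector of its component. *)
- case: n nk u0 nk1 nl1 nl2 nk2 nk0 E1 F1 K1 L1 E2 F2 K2 L2 => [|n] nk u0 nk1 nl1 nl2 nk2 nk0 _ _ _ _ _ _ _ _.
    rewrite cg_s0 !(mulr0, scale0r, addr0) /= -scalerDl s_1.
    have -> : - (p * p ^+ 0 * s k.+1 / s l.+1) * (p ^+ 0 / (p * p ^+ k)) +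
       1 / (p * p ^+ k * s l.+1) * (p * (s k.+1 * 1)) = 0.
      by rewrite expr0; field; rewrite p0 v0 sl.
    by rewrite !(mul0r, scale0r, addr0).
  have nk3 : (n.+1 + k.+2 = l.+1)%N by lia.
  rewrite /= (cgAE nk3) (cgBE nk3) ![p ^+ _.+1]exprS addrAC -scalerDl addrC.
  congr (_ *: _ + _ *: _); first by field; rewrite ?p0 ?sl.
  transitivity (s k.+1 / (p ^+ k * s l.+1) * (s n.+2 ^+ 2 - (p ^+ n.+1) ^+ 2)).
    by rewrite [p ^+ n.+1]exprS; field; rewrite p0 v0 sl.
  by rewrite cg_sqrS; field; rewrite p0 v0 sl.
- by congr (_ *: _ + _ *: _); field; rewrite ?p0 ?v0 ?sl.
- by congr (_ *: _ + _ *: _); field; rewrite ?p0 ?v0 ?u0 ?sl.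
Qed.

End Module.

Lemma cg_true (M : lmodType F) l (P : bool -> nat -> M) n : (n <= l)%N ->
  P true n = cgA l n.+1 *: cg_up l P n.+1 - cgB l n.+1 *: cg_down l P n.
Proof.
move=> nl; rewrite /cg_up /cg_down /= !scalerDr !scalerA opprD addrACA -!scaleNr -!scalerDl.
rewrite mulrN opprK -!expr2 cg_norm // scale1r.
by rewrite mulrC addrN scale0r addr0.
Qed.

Lemma cg_false (M : lmodType F) l (P : bool -> nat -> M) n : (n <= l)%N ->
  P false n = cgB l n *: cg_up l P n + cgA l n *: cg_down l P n.-1.
Proof.
move=> nl; case: n nl => [|n] nl.
  by rewrite cgA0 scale0r addr0 /cg_up cgA0 scale0r add0r cgB0 !scale1r.
rewrite /cg_up /cg_down /= !scalerDr !scalerA addrACA -!scalerDl.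
rewrite mulrN [cgB _ _ * cgA _ _]mulrC subrr scale0r add0r -!expr2 addrC.
by rewrite cg_norm ?scale1r // ltnW.
Qed.

End ClebschGordan.

(** * Matrix coefficients *)

(** Indices in [nat] with value zero out of range let recurrences shift the spin and the weights
    without changing the type of the indices. *)
HB.lock Definition tsu (R : realType) (l m n : nat) : CSU R :=
  if (m <= l)%N && (n <= l)%N then << @sui l (inord m) (inord n) >> else 0.

Section Coefficients.
Variables (R : realType) (q : R).
Hypothesis hq : 0 < q < 1.

Local Notation tsu := (tsu R).
Let q0 : 0 < q. Proof. by case/andP: hq. Qed.
Let q1 : q < 1. Proof. by case/andP: hq. Qed.

Definition sq_q : R := Num.sqrt q.
Definition sq_num (n : nat) : R := Num.sqrt (qnum q n%:R).
Local Notation p := (sq_q%:C).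
Local Notation s := (fun n : nat => (sq_num n)%:C).

Lemma sq_q_gt0 : 0 < sq_q. Proof. by rewrite sqrtr_gt0. Qed.
Lemma sq_q_lt1 : sq_q < 1. Proof. by rewrite -sqrtr1 ltr_sqrt. Qed.
Lemma sq_q_sqr : sq_q ^+ 2 = q. Proof. by rewrite sqr_sqrtr // ltW. Qed.
Lemma sq_q_neq0 : sq_q != 0. Proof. by rewrite gt_eqF ?sq_q_gt0. Qed.

Lemma sq_q4 : sq_q ^+ 4 != 1.
Proof.
rewrite lt_eqF // (exprM _ 2 2) sq_q_sqr exprn_ilt1 ?(ltW q0) //.
Qed.

Lemma powR_sq_q (m n : nat) : q `^ (m%:R - n%:R) = (sq_q ^+ m / sq_q ^+ n) ^+ 2.
Proof.
rewrite powRD ?(gt_eqF q0) ?implybT // powRN !powR_mulrn ?(ltW q0) //.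
by rewrite expr_div_n -!exprM ![(_ * 2)%N]mulnC !exprM sq_q_sqr.
Qed.

Lemma qnum_nat (n : nat) :
  qnum q n%:R = (sq_q ^+ (2 * n) - sq_q ^- (2 * n)) / (sq_q ^+ 2 - sq_q ^- 2).
Proof.
by rewrite /qnum powRN powR_mulrn ?(ltW q0) // sq_q_sqr !exprM sq_q_sqr.
Qed.

Lemma sq_num_gt0 n : 0 < sq_num n.+1.
Proof.
rewrite sqrtr_gt0 /qnum powRN powR_mulrn ?(ltW q0) //.
have qn : q ^+ n.+1 < 1 by rewrite exprn_ilt1 // ltW.
have qn0 : 0 < q ^+ n.+1 by rewrite exprn_gt0.
rewrite -[X in X / _]opprB -[X in _ / X]opprB invrN mulrNN divr_gt0 // subr_gt0.
  by apply: (lt_trans qn); rewrite invf_gt1.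
by apply: (lt_trans q1); rewrite invf_gt1.
Qed.

Lemma sq_num0 : sq_num 0 = 0.
Proof. by rewrite /sq_num /qnum oppr0 subrr mul0r sqrtr0. Qed.

Lemma sq_num1 : sq_num 1 = 1.
Proof.
rewrite /sq_num /qnum powRN powRr1 ?(ltW q0) // divff ?sqrtr1 //.
by rewrite lt_eqF // subr_lt0; apply: (lt_trans q1); rewrite invf_gt1.
Qed.

Lemma sqr_sq_num n : sq_num n ^+ 2 = qnum q n%:R.
Proof. by rewrite sqr_sqrtr // qnum_ge0. Qed.

Lemma cgp0 : p != 0. Proof. by rewrite Rc_eq0 sq_q_neq0. Qed.
Lemma cgp4 : p ^+ 4 != 1.
Proof. by rewrite -RcX -Rc1 (inj_eq (@complexI R)) sq_q4. Qed.
Lemma cgs_sqr n : s n ^+ 2 = (p ^+ (2 * n) - p ^- (2 * n)) / (p ^+ 2 - p ^- 2).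
Proof. by rewrite -RcX sqr_sq_num qnum_nat RcM RcV !RcB !RcV !RcX. Qed.
Lemma cgs_neq0 n : s n.+1 != 0. Proof. by rewrite Rc_eq0 gt_eqF ?sq_num_gt0. Qed.
Lemma cgs1 : s 1%N = 1. Proof. by rewrite /= sq_num1. Qed.

Section GenAction.
Variables (M : lmodType R[i]).

(** At the ends of the range the factor [s 0], which is zero, multiplies the meaningless terms
    [v l.+1] and [v 0.-1]. *)
Definition gen_act (l : nat) (x : gen) (v : nat -> M) (n : nat) : M :=
  match x with
  | Ge => (s (l - n)%N * s n.+1) *: v n.+1
  | Gf => (s (l - n).+1 * s n) *: v n.-1
  | Gk => (p ^+ n / p ^+ (l - n)) *: v n
  | Gkinv => (p ^+ (l - n) / p ^+ n) *: v n
  end.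

Lemma rep_gen_col l x (v : nat -> M) (n : 'I_l.+1) :
  \sum_(j < l.+1) rep_gen q l x j n *: v j = gen_act l x v n.
Proof.
have nl : (n <= l)%N by rewrite -ltnS.
have hs : (l%:R / 2 - weight R n) = (l - n)%:R :> R.
  by rewrite /weight natrB //; field.
have hs' : (l%:R / 2 + weight R n) = n%:R :> R by rewrite /weight addrC subrK.
have hw : weight R n = (n%:R - (l - n)%:R) / 2.
  by rewrite -hs /weight; field.
(* The weight is a half-integer; both sides are nonnegative, so they are compared through their
   squares, where only integral exponents remain. *)
have kE : q `^ weight R n = sq_q ^+ n / sq_q ^+ (l - n).
  have : (q `^ weight R n) ^+ 2 = (sq_q ^+ n / sq_q ^+ (l - n)) ^+ 2.
    rewrite -powR_mulrn ?powR_ge0 // -powRrM -powR_sq_q; congr (_ `^ _).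
    by rewrite hw; field.
  move/eqP; rewrite eqrXn2 ?powR_ge0 ?divr_ge0 ?exprn_ge0 ?(ltW sq_q_gt0) //.
  by move/eqP.
case: x => /=.
- have [nl'|nl'] := ltnP n l.
    have n1 : (n.+1 < l.+1)%N by [].
    rewrite (bigD1 (Ordinal n1)) //= big1 ?addr0 => [|j jn]; last first.
      rewrite mxE; case: eqP => [jE|_]; last by rewrite scale0r.
      by case/negP: jn; apply/eqP/val_inj.
    rewrite mxE /= eqxx hs hs' natr1 sqrtrM ?qnum_ge0 //.
    by rewrite RcM.
  rewrite big1 => [|j _].
    by rewrite (eqP (_ : (l - n)%N == 0%N)) ?subn_eq0 // sq_num0 mul0r scale0r.
  rewrite mxE; case: eqP => [jE|_]; last by rewrite scale0r.
  by have := ltn_ord j; rewrite jE ltnS ltnNge nl'.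
- case: (posnP n) => [n0|n_gt0].
    rewrite n0 sq_num0 mulr0 scale0r big1 // => j _.
    by rewrite mxE n0 scale0r.
  have n1 : (n.-1 < l.+1)%N by rewrite (leq_ltn_trans (leq_pred _)).
  rewrite (bigD1 (Ordinal n1)) //= big1 ?addr0 => [|j jn]; last first.
    rewrite mxE; case: eqP => [jE|_]; last by rewrite scale0r.
    by case/negP: jn; apply/eqP/val_inj; rewrite /= -jE.
  by rewrite mxE /= prednK // eqxx hs hs' natr1 sqrtrM ?qnum_ge0 // RcM.
- rewrite (bigD1 n) //= big1 ?addr0 => [|j jn]; last first.
    by rewrite mxE (negbTE jn) scale0r.
  by rewrite mxE eqxx kE RcM RcV !RcX.
- rewrite (bigD1 n) //= big1 ?addr0 => [|j jn]; last first.
    by rewrite mxE (negbTE jn) scale0r.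
  by rewrite mxE eqxx powRN kE invf_div RcM RcV !RcX.
Qed.

Variable op : gen -> M -> M.

Lemma is_stringP r v : is_string p s op r v <->
  forall x n, (n <= r)%N -> op x (v n) = gen_act r x v n.
Proof.
split=> [sv x n /subnKC/sv[h1 h2 h3 h4]|h n k nk]; first by case: x.
have nr : (n <= r)%N by rewrite -nk leq_addr.
by have h' x := h x n nr; split; rewrite h' /= -nk addKn.
Qed.

Fixpoint word_act (w : word) (u : M) : M :=
  if w is x :: w' then op x (word_act w' u) else u.

Hypothesis op_lin : forall x, linear (op x).

Lemma word_act_linear w : linear (word_act w).
Proof.
elim: w => [//|x w IH] a u v /=; by rewrite IH op_lin.
Qed.

Lemma word_act_string r v w (n : 'I_r.+1) : is_string p s op r v ->
  word_act w (v n) = \sum_(j < r.+1) rep q r w j n *: v j.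
Proof.
move=> /is_stringP sv; elim: w => [|x w IH] /=.
  rewrite /rep big_nil (bigD1 n) //= big1 ?addr0 => [|j jn].
    by rewrite mxE eqxx scale1r.
  by rewrite mxE (negbTE jn) scale0r.
rewrite IH (linearE_sum (op_lin x)).
transitivity (\sum_(j < r.+1) \sum_(i < r.+1) (rep q r w j n * rep_gen q r x i j) *: v i).
  apply: eq_bigr => j _; rewrite (linearEZ (op_lin x)) sv -1?ltnS //.
  by rewrite -rep_gen_col scaler_sumr; apply: eq_bigr => i _; rewrite scalerA.
rewrite exchange_big /=; apply: eq_bigr => i _.
rewrite /rep big_cons mxE scaler_suml; apply: eq_bigr => j _.
by rewrite mulrC.
Qed.

End GenAction.

(** * The functionals defined by matrix coefficients *)

Lemma big_coprod_cons (V : nmodType) (F : word * word -> V) x w :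
  \sum_(y <- coprod (x :: w)) F y =
  \sum_(a <- coprod_gen x) \sum_(b <- coprod w) F (a.1 ++ b.1, a.2 ++ b.2).
Proof. by rewrite /= big_allpairs_dep. Qed.

Lemma big_coprod_cat (V : nmodType) (F : word * word -> V) u w :
  \sum_(y <- coprod (u ++ w)) F y =
  \sum_(a <- coprod u) \sum_(b <- coprod w) F (a.1 ++ b.1, a.2 ++ b.2).
Proof.
elim: u F => [|x u IH] F; first by rewrite big_seq1; apply: eq_bigr => -[].
rewrite cat_cons !big_coprod_cons; apply: eq_bigr => a _.
by rewrite IH; apply: eq_bigr => b _; apply: eq_bigr => c _ /=; rewrite !catA.
Qed.

Lemma big_coprod1 (V : nmodType) (F : word * word -> V) x :
  \sum_(y <- coprod [:: x]) F y = \sum_(a <- coprod_gen x) F a.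
Proof.
by case: x; rewrite /= !(big_cons, big_nil) /=.
Qed.

(** Coassociativity, tested against an arbitrary function of three words because the coproduct is
    encoded as a list of pairs. *)
Lemma coprod_coassoc (V : nmodType) (F : word -> word -> word -> V) w :
  \sum_(y <- coprod w) \sum_(z <- coprod y.1) F z.1 z.2 y.2 =
  \sum_(y <- coprod w) \sum_(z <- coprod y.2) F y.1 z.1 z.2.
Proof.
elim: w F => [|x w IH] F; first by do 2![rewrite /= ?big_seq1].
rewrite !big_coprod_cons.
transitivity (\sum_(a <- coprod_gen x) \sum_(c <- coprod a.1)
  \sum_(b <- coprod w) \sum_(z <- coprod b.1) F (c.1 ++ z.1) (c.2 ++ z.2) (a.2 ++ b.2)).
  apply: eq_bigr => a _; rewrite exchange_big /=; apply: eq_bigr => b _.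
  by rewrite big_coprod_cat.
transitivity (\sum_(a <- coprod_gen x) \sum_(c <- coprod a.2)
  \sum_(b <- coprod w) \sum_(z <- coprod b.2) F (a.1 ++ b.1) (c.1 ++ z.1) (c.2 ++ z.2)).
  transitivity (\sum_(a <- coprod_gen x) \sum_(c <- coprod a.1)
    \sum_(b <- coprod w) \sum_(z <- coprod b.2) F (c.1 ++ b.1) (c.2 ++ z.1) (a.2 ++ z.2)).
    apply: eq_bigr => a _; apply: eq_bigr => c _.
    exact: (IH (fun z1 z2 z3 => F (c.1 ++ z1) (c.2 ++ z2) (a.2 ++ z3))).
  by case: x; do 8!rewrite /= ?big_cons ?big_nil ?addr0; rewrite ?addrA.
apply: eq_bigr => a _; rewrite exchange_big /=; apply: eq_bigr => b _.
by rewrite big_coprod_cat.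
Qed.

Implicit Types (f g h : word -> R[i]).

Lemma fun_mulA f g h : fun_mul f (fun_mul g h) = fun_mul (fun_mul f g) h.
Proof.
apply/funext => w; rewrite /fun_mul.
transitivity (\sum_(y <- coprod w) \sum_(z <- coprod y.2) f y.1 * (g z.1 * h z.2)).
  by apply: eq_bigr => y _; rewrite mulr_sumr.
rewrite -(coprod_coassoc (fun a b c => f a * (g b * h c))); apply: eq_bigr => y _.
by rewrite mulr_suml; apply: eq_bigr => z _; rewrite mulrA.
Qed.

Lemma fun_mul_linear f : linear (fun_mul f).
Proof.
move=> a g h; apply/funext => w.
transitivity (a * fun_mul f g w + fun_mul f h w); last by [].
rewrite /fun_mul mulr_sumr -big_split; apply: eq_bigr => y _ /=.
by rewrite [RHS](_ : _ = f y.1 * (a * g y.2 + h y.2)) //; ring.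
Qed.

Lemma fun_mul_linearl g : linear (fun f => fun_mul f g).
Proof.
move=> a f h; apply/funext => w.
transitivity (a * fun_mul f g w + fun_mul h g w); last by [].
rewrite /fun_mul mulr_sumr -big_split; apply: eq_bigr => y _ /=.
by rewrite [RHS](_ : _ = (a * f y.1 + h y.1) * g y.2) //; ring.
Qed.

Lemma fun_mul0l g : fun_mul 0 g = 0.
Proof. by apply/funext => w; apply: big1 => y _; exact: mul0r. Qed.

Lemma fun_mul0r f : fun_mul f 0 = 0.
Proof. by apply/funext => w; apply: big1 => y _; exact: mulr0. Qed.

Lemma fun_mulZl (c : R[i]) f g : fun_mul (c *: f) g = c *: fun_mul f g.
Proof. by have := fun_mul_linearl g c f 0; rewrite fun_mul0l !addr0. Qed.

Lemma fun_mulZr (c : R[i]) f g : fun_mul f (c *: g) = c *: fun_mul f g.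
Proof. by have := fun_mul_linear f c g 0; rewrite fun_mul0r !addr0. Qed.

(** Right translation, that is, the action of [x] by ∂ on functionals. It moves the column index of
    a matrix coefficient. *)
Definition rtrans (x : gen) f : word -> R[i] := fun w => f (rcons w x).

Lemma rtrans_linear x : linear (rtrans x).
Proof. by []. Qed.

Lemma rtrans_mul x f g : rtrans x (fun_mul f g) =
  match x with
  | Ge => fun_mul (rtrans Ge f) (rtrans Gk g) + fun_mul (rtrans Gkinv f) (rtrans Ge g)
  | Gf => fun_mul (rtrans Gf f) (rtrans Gk g) + fun_mul (rtrans Gkinv f) (rtrans Gf g)
  | Gk => fun_mul (rtrans Gk f) (rtrans Gk g)
  | Gkinv => fun_mul (rtrans Gkinv f) (rtrans Gkinv g)
  end.
Proof.
apply/funext => w; rewrite {1}/rtrans /fun_mul -cats1 big_coprod_cat.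
under eq_bigr do rewrite big_coprod1.
case: x => /=; rewrite ?fctE -?big_split; apply: eq_bigr => y _;
  by rewrite !(big_cons, big_nil) /= /rtrans !cats1 ?addr0.
Qed.

Definition tfun (l m n : nat) : word -> R[i] := fun w =>
  if (m <= l)%N && (n <= l)%N then rep q l w (inord m) (inord n) else 0.

Lemma tfunE l w (m n : 'I_l.+1) : tfun l m n w = rep q l w m n.
Proof. by rewrite /tfun !leq_ord /= !inord_val. Qed.

Lemma tfun_string l m : is_string p s rtrans l (tfun l m).
Proof.
apply/is_stringP => x n nl; apply/funext => w.
have [ml|ml] := leqP m l; last first.
  rewrite /rtrans /tfun leqNgt ml /=.
  by case: x => /=; apply/esym; apply: mulr0.
have := rep_gen_col x (fun j => tfun l m j w) (inord n : 'I_l.+1).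
rewrite inordK // => h.
transitivity (gen_act l x (fun j => tfun l m j w) n); last by case: x {h}.
rewrite -h /rtrans /tfun ml nl /rep -cats1 big_cat /= big_seq1 mxE.
by apply: eq_bigr => j _; rewrite -ltnS ltn_ord inord_val mulrC.
Qed.

Lemma tfun_nil l m n : tfun l m n [::] = ((m == n) && (n <= l)%N)%:R.
Proof.
rewrite /tfun; case: (leqP m l) => ml; last first.
  by case: eqVneq => // <-; rewrite leqNgt ml.
case: (leqP n l) => nl /=; last by rewrite andbF.
by rewrite andbT /rep big_nil mxE -val_eqE /= !inordK.
Qed.

(** The value of [v n] at a word [w] is the value at the empty word of the translate of [v n] by
    [w], which stays in the string. A string is thus determined by its values at the unit, and
    identities between functionals reduce to evaluations there. *)
Lemma string_rtrans_eq l v : is_string p s rtrans l v -> forall n, (n <= l)%N ->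
  v n = \sum_(i < l.+1) v i [::] *: tfun l i n.
Proof.
move=> sv n nl; apply/funext => w.
have := word_act_string rtrans_linear w (inord n) sv.
have wE (u w' : word) f : word_act rtrans w' f u = f (u ++ w').
  elim: w' u => [|x w' IH] u /=; first by rewrite cats0.
  by rewrite /rtrans IH cat_rcons.
move/(congr1 (fun f => f [::])); rewrite wE /= inordK // => ->.
rewrite !fct_sumE; apply: eq_bigr => i _.
rewrite [RHS](_ : _ = v i [::] * tfun l i n w) // /tfun nl -ltnS ltn_ord /=.
by rewrite inord_val mulrC.
Qed.


Definition tmul1 l a m b n := fun_mul (tfun 1 a b) (tfun l m n).

Lemma tfun_act l m x n : (n <= l)%N -> rtrans x (tfun l m n) = gen_act l x (tfun l m) n.
Proof. by move=> nl; have /is_stringP := @tfun_string l m; apply. Qed.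

Lemma tmul1_tensor l a m : is_tensor p s rtrans l (fun b n => tmul1 l a m b n).
Proof.
move=> n k nk; have nl : (n <= l)%N by rewrite -nk leq_addr.
have kE : (l - n)%N = k by rewrite -nk addKn.
rewrite /tmul1 !rtrans_mul !tfun_act //= kE.
rewrite !(subnn, subn0, expr0, expr1, divr1, mul1r, sq_num0, sq_num1, mul0r, mulr0).
rewrite !(scale0r, scale1r, fun_mulZl, fun_mulZr, fun_mul0l, add0r, addr0, scalerA) ?mulrA.
by [].
Qed.

Local Notation A := (@cgA _ p s).
Local Notation B := (@cgB _ p s).

(* The coefficients of the components of type l+1 and l-1 of the tensor product
   of the vectors of index b of V_{1/2} and n of V_{l/2}. *)
Definition cgU l (b : bool) n : R[i] := if b then A l n.+1 else B l n.
Definition cgD l (b : bool) n : R[i] := if b then - B l n.+1 else A l n.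

Lemma sum_tfun_delta l k (c : R[i]) j :
  \sum_(i < l.+1) (((i : nat) == k)%:R * c) *: tfun l i j = c *: tfun l k j.
Proof.
have [kl|lk] := ltnP k l.+1.
  rewrite (bigD1 (Ordinal kl)) //= eqxx mul1r big1 ?addr0 // => i ik.
  by rewrite -[_ == k]/(i == Ordinal kl) (negbTE ik) mul0r scale0r.
have -> : tfun l k j = 0 by apply/funext => w; rewrite /tfun leqNgt lk.
rewrite scaler0 big1 // => i _; rewrite ltn_eqF ?mul0r ?scale0r //.
exact: leq_trans (ltn_ord i) lk.
Qed.

(** Along the column indices the Clebsch-Gordan combinations of the products are strings, hence
    determined at the empty word. There the products are Kronecker deltas, which leaves the
    Clebsch-Gordan coefficients of the row indices. *)
Lemma tmul1E l (a b : bool) m n : (m <= l)%N -> (n <= l)%N ->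
  tmul1 l a m b n = (cgU l a m * cgU l b n) *: tfun l.+1 (a + m) (b + n)
    + (cgD l a m * cgD l b n) *: tfun l.-1 (a + m).-1 (b + n).-1.
Proof.
move=> ml nl; have tP := @tmul1_tensor l a m.
have upS := cg_up_string cgp0 cgp4 cgs_sqr cgs_neq0 rtrans_linear tP.
have P0 (c : bool) j : tmul1 l a m c j [::] = ((a == c) && ((m == j) && (j <= l)%N))%:R.
  rewrite /tmul1 /fun_mul /= big_seq1 !tfun_nil -natrM mulnb; congr (_%:R).
  by case: a c {tP upS} => -[]; rewrite //= andbT.
have upE j : (j <= l.+1)%N -> cg_up p s l (fun b n => tmul1 l a m b n) j =
    cgU l a m *: tfun l.+1 (a + m) j.
  move=> jl; rewrite (string_rtrans_eq upS jl) -sum_tfun_delta.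
  apply: eq_bigr => i _; congr (_ *: _).
  rewrite [LHS](_ : _ = A l i * tmul1 l a m true i.-1 [::]
      + B l i * tmul1 l a m false i [::]) // !P0.
  case: (a) => /=; rewrite ?mulr0 ?addr0 ?add0r.
    case: (posnP i) => [->|i0]; first by rewrite (cgA0 cgs_sqr) !mul0r.
    rewrite -{1 4}(prednK i0) add1n eqSS eq_sym.
    case: eqVneq => [->|_]; last by rewrite mulr0 mul0r.
    by rewrite ml mulr1 mul1r.
  rewrite add0n eq_sym; case: eqVneq => [->|_]; last by rewrite mulr0 mul0r.
  by rewrite ml mulr1 mul1r.
have downE j : (j < l)%N -> cg_down p s l (fun b n => tmul1 l a m b n) j =
    cgD l a m *: tfun l.-1 (a + m).-1 j.
  move=> jl; have l0 : (0 < l)%N by exact: leq_ltn_trans jl.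
  have dS := cg_down_string cgp0 cgp4 cgs_sqr cgs_neq0 cgs1 rtrans_linear tP l0.
  have jl' : (j <= l.-1)%N by lia.
  rewrite (string_rtrans_eq dS jl') -sum_tfun_delta.
  apply: eq_bigr => i _; congr (_ *: _).
  rewrite [LHS](_ : _ = - B l i.+1 * tmul1 l a m true i [::]
      + A l i.+1 * tmul1 l a m false i.+1 [::]) // !P0.
  have il : (i < l)%N by apply: leq_trans (ltn_ord i) _; rewrite prednK.
  case: (a) => /=; rewrite ?mulr0 ?addr0 ?add0r.
    rewrite add0n eq_sym; case: eqVneq => [mi|_]; last by rewrite mulr0 mul0r.
    by rewrite mi ml mulr1 mul1r.
  rewrite il andbT add0n; case: (posnP m) => [m0|m0].
    by rewrite m0 (cgA0 cgs_sqr) !mulr0.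
  rewrite -{1 3}(prednK m0) eqSS eq_sym.
  case: eqVneq => [->|_]; last by rewrite mulr0 mul0r.
  by rewrite mulr1 mul1r.
case: b => /=.
  rewrite (cg_true cgp0 cgs_sqr cgs_neq0 (fun b n => tmul1 l a m b n) nl) upE //.
  rewrite scalerA add1n [A _ _ * _]mulrC; congr (_ + _).
  rewrite /= mulrN [in RHS]scaleNr; congr (- _).
  move: nl; rewrite leq_eqVlt => /predU1P[->|nl].
    by rewrite (cgB_top cgs_sqr) scale0r mulr0 scale0r.
  by rewrite downE // scalerA mulrC.
rewrite (cg_false cgp0 cgs_sqr cgs_neq0 (fun b n => tmul1 l a m b n) nl) upE ?leqW //.
rewrite scalerA add0n [B _ _ * _]mulrC; congr (_ + _).
case: (posnP n) => [n0|n0]; first by rewrite n0 (cgA0 cgs_sqr) mulr0 !scale0r.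
by rewrite downE ?scalerA 1?[A _ _ * _]mulrC // prednK.
Qed.

(* Inversion of tmul1E: X and Y below are the columns of the orthogonal matrix
   whose other half is given by cgD. *)
Lemma tfun_succ l i j : (i <= l.+1)%N -> (j <= l.+1)%N ->
  tfun l.+1 i j = A l i *: (A l j *: tmul1 l true i.-1 true j.-1
                            + B l j *: tmul1 l true i.-1 false j)
    + B l i *: (A l j *: tmul1 l false i true j.-1
                + B l j *: tmul1 l false i false j).
Proof.
move=> il jl.
have row (a : bool) m : (m <= l)%N ->
    A l j *: tmul1 l a m true j.-1 + B l j *: tmul1 l a m false j =
    cgU l a m *: tfun l.+1 (a + m) j.
  move=> ml.
  have eA (X : word -> R[i]) : A l j *: tmul1 l a m true j.-1 =
      (cgU l a m * A l j ^+ 2) *: tfun l.+1 (a + m) j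
      - (cgD l a m * A l j * B l j) *: tfun l.-1 (a + m).-1 j.-1.
    case: j jl => [|j] jl /=; first by rewrite (cgA0 cgs_sqr) expr0n !(mulr0, mul0r, scale0r) subr0.
    rewrite (@tmul1E l a true m j ml jl) /= scalerDr !scalerA add1n -[in RHS]scaleNr.
    by congr (_ *: _ + _ *: _); ring.
  have eB : B l j *: tmul1 l a m false j =
      (cgU l a m * B l j ^+ 2) *: tfun l.+1 (a + m) j
      + (cgD l a m * A l j * B l j) *: tfun l.-1 (a + m).-1 j.-1.
    move: jl; rewrite leq_eqVlt => /predU1P[->|jl].
      by rewrite (cgB_top cgs_sqr) expr0n !(mulr0, scale0r) addr0.
    rewrite (@tmul1E l a false m j ml jl) /= scalerDr !scalerA add0n.
    by congr (_ *: _ + _ *: _); ring.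
  rewrite (eA 0) eB addrACA addNr addr0 -scalerDl -mulrDr.
  by rewrite (cg_norm cgp0 cgs_sqr cgs_neq0) // mulr1.
have eA : A l i *: (A l j *: tmul1 l true i.-1 true j.-1
    + B l j *: tmul1 l true i.-1 false j) = A l i ^+ 2 *: tfun l.+1 i j.
  case: i il => [|i] il /=; first by rewrite (cgA0 cgs_sqr) expr0n !scale0r.
  by rewrite (row true i il) scalerA add1n.
have eB : B l i *: (A l j *: tmul1 l false i true j.-1
    + B l j *: tmul1 l false i false j) = B l i ^+ 2 *: tfun l.+1 i j.
  move: il; rewrite leq_eqVlt => /predU1P[->|il].
    by rewrite (cgB_top cgs_sqr) expr0n !scale0r.
  by rewrite (row false i il) scalerA add0n.
by rewrite eA eB -scalerDl (cg_norm cgp0 cgs_sqr cgs_neq0) // scale1r.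
Qed.

(** * The product of C[SU_q(2)] *)

(* Only the powers of e of exponent at most l act non-trivially on V_{q,l/2}, and
   f^(l-m) e^l f^n acts there as a multiple of the matrix unit E_{m,n}. *)
Definition unit_word (l m n : nat) : word :=
  nseq (l - m) Gf ++ nseq l Ge ++ nseq n Gf.

Lemma word_act_cat (M : lmodType R[i]) (op : gen -> M -> M) u w x :
  word_act op (u ++ w) x = word_act op u (word_act op w x).
Proof. by elim: u => //= y u ->. Qed.

Section WordString.
Variables (M : lmodType R[i]) (op : gen -> M -> M).
Hypothesis op_lin : forall x, linear (op x).
Variables (l : nat) (v : nat -> M).
Hypothesis vS : is_string p s op l v.

Let actE x n : (n <= l)%N -> op x (v n) = gen_act l x v n.
Proof. by have /is_stringP := vS; apply. Qed.

Lemma word_actZ w a x : word_act op w (a *: x) = a *: word_act op w x.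
Proof. exact: (linearEZ (word_act_linear op_lin w)). Qed.

Lemma lower_string k n : (n <= l)%N ->
  exists2 c : R[i], word_act op (nseq k Gf) (v n) = c *: v (n - k)%N &
    (c != 0) = (k <= n)%N.
Proof.
elim: k n => [|k IH] n nl; first by exists 1; rewrite ?scale1r ?subn0 ?oner_eq0.
have [c hc c0] := IH n nl.
exists (c * (s (l - (n - k)).+1 * s (n - k)%N)).
  rewrite -[nseq k.+1 Gf]/(Gf :: nseq k Gf) /= hc (linearEZ (op_lin Gf)) actE.
    by rewrite /= scalerA -subnS.
  exact: leq_trans (leq_subr _ _) nl.
rewrite mulf_eq0 negb_or c0 mulf_eq0 negb_or (cgs_neq0 (l - (n - k))) /=.
case: (ltnP k n) => kn; last first.
  by rewrite (eqP (_ : (n - k)%N == 0%N)) ?subn_eq0 // sq_num0 eqxx andbF.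
by rewrite (ltnW kn) -(prednK (_ : 0 < n - k)%N) ?subn_gt0 // cgs_neq0.
Qed.

Lemma raise_string k n : (n <= l)%N ->
  exists2 c : R[i], word_act op (nseq k Ge) (v n) = c *: v (n + k)%N &
    (c != 0) = (n + k <= l)%N.
Proof.
move=> nl; elim: k => [|k [c hc c0]].
  by exists 1; rewrite ?scale1r ?addn0 ?oner_eq0.
have [nkl|lnk] := leqP (n + k)%N l; last first.
  exists 0; last by rewrite eqxx addnS ltnNge (ltnW lnk).
  rewrite -[nseq k.+1 Ge]/(Ge :: nseq k Ge) /= hc scale0r.
  have /eqP -> : c == 0 by rewrite -[_ == _]negbK c0 -ltnNge.
  by rewrite scale0r (linearE0 (op_lin Ge)).
exists (c * (s (l - (n + k))%N * s (n + k).+1)).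
  by rewrite -[nseq k.+1 Ge]/(Ge :: nseq k Ge) /= hc (linearEZ (op_lin Ge)) actE //=
    scalerA addnS.
rewrite mulf_eq0 negb_or c0 nkl mulf_eq0 negb_or (cgs_neq0 (n + k)) andbT /=.
rewrite addnS; have [lt|ge] := ltnP (n + k)%N l.
  by rewrite -(prednK (_ : 0 < l - (n + k))%N) ?subn_gt0 // cgs_neq0.
by rewrite (eqP (_ : (l - (n + k))%N == 0%N)) ?subn_eq0 // sq_num0 eqxx.
Qed.

(** Among spins at most [L], the power e^L survives only on the lowest vector of spin exactly [L];
    f^n brings [v j] there only for [j = n]. The final power of f then moves the top vector down to
    index [m]. *)
Lemma unit_word_string L m n j : (l <= L)%N -> (j <= l)%N -> (m <= L)%N ->
  exists2 c : R[i], word_act op (unit_word L m n) (v j) = c *: v m &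
    (c != 0) = (l == L) && (j == n).
Proof.
move=> lL jl mL; rewrite /unit_word !word_act_cat.
have [c1 h1 n1] := lower_string n jl.
have jnl : (j - n <= l)%N by exact: leq_trans (leq_subr _ _) jl.
have [c2 h2 n2] := raise_string L jnl.
have h12 : word_act op (nseq L Ge) (word_act op (nseq n Gf) (v j)) =
  (c1 * c2) *: v (j - n + L)%N by rewrite h1 word_actZ h2 scalerA.
have n12 : (c1 * c2 != 0) = (l == L) && (j == n).
  rewrite mulf_eq0 negb_or n1 n2; apply/andP/andP => [[nj]|[/eqP -> /eqP ->]].
    by move=> le; split; apply/eqP; lia.
  by rewrite leqnn; split=> //; lia.
have [c12|c12] := eqVneq (c1 * c2) 0.
  exists 0; last by rewrite eqxx -n12 c12 eqxx.
  by rewrite h12 c12 !scale0r (linearE0 (word_act_linear op_lin _)).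
move: n12; rewrite c12 => /esym/andP[/eqP lE /eqP jE].
have Ll : (L <= l)%N by rewrite lE.
have [c3 h3 n3] := lower_string (L - m) Ll.
exists (c1 * c2 * c3); last by rewrite mulf_neq0 ?n3 ?leq_subr // lE jE !eqxx.
by rewrite h12 jE subnn add0n word_actZ h3 scalerA subKn.
Qed.

End WordString.

Lemma word_act_rtrans w f u : word_act rtrans w f u = f (u ++ w).
Proof.
elim: w u => [|x w IH] u /=; first by rewrite cats0.
by rewrite /rtrans IH cat_rcons.
Qed.

Lemma tfun_unit_word l a b L m n : (l <= L)%N -> (b <= l)%N -> (a <= l)%N ->
  (m <= L)%N -> (n <= L)%N ->
  (tfun l a b (unit_word L m n) != 0) = [&& l == L, a == m & b == n].
Proof.
move=> lL bl al mL nL.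
have [c hc c0] := unit_word_string rtrans_linear (@tfun_string l a) n lL bl mL.
have := congr1 (fun f => f [::]) hc; rewrite word_act_rtrans /= => ->.
rewrite [X in X != 0](_ : _ = c * tfun l a m [::]) // tfun_nil mulf_eq0 negb_or c0.
case: eqVneq => [lE|//] /=; rewrite lE mL andbT andbC.
by case: (a == m); rewrite ?oner_eq0 ?eqxx.
Qed.

Lemma tsuE (k : su_index) : << k >> = tsu (tag k) (tagged k).1 (tagged k).2.
Proof.
by case: k => l [m n]; rewrite tsu.unlock /= !leq_ord /= !inord_val.
Qed.

Lemma functional_linear : linear (functional q).
Proof.
move=> a t u; apply/funext => w.
exact: (malg_linear (fun k : su_index => rep q (tag k) w (tagged k).1 (tagged k).2)).
Qed.

Lemma functionalZ (a : R[i]) t : functional q (a *: t) = a *: functional q t.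
Proof. exact: (linearEZ functional_linear). Qed.

Lemma functionalD t u : functional q (t + u) = functional q t + functional q u.
Proof. exact: (linearED functional_linear). Qed.

Lemma functionalU k : functional q << k >> = tfun (tag k) (tagged k).1 (tagged k).2.
Proof.
apply/funext => w.
rewrite /functional (malg_linearU
  (fun k : su_index => rep q (tag k) w (tagged k).1 (tagged k).2)).
by rewrite /tfun !leq_ord /= !inord_val.
Qed.

Lemma functional_tsu l m n : functional q (tsu l m n) = tfun l m n.
Proof.
rewrite tsu.unlock; case: ifP => [/andP[ml nl]|h]; first by rewrite functionalU /= !inordK.
by rewrite (linearE0 functional_linear); apply/funext => w; rewrite /tfun h.
Qed.

Lemma functionalE t w : functional q t w =
  \sum_(k <- msupp t) t@_k * tfun (tag k) (tagged k).1 (tagged k).2 w.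
Proof.
by apply: eq_bigr => k _; rewrite /tfun !leq_ord /= !inord_val.
Qed.

(** Linear independence of the matrix coefficients, by descending induction on the largest spin in
    the support: a unit word of that spin detects a single top coefficient and vanishes on all the
    others. *)
Lemma functional_eq0 t : functional q t = 0 -> t = 0.
Proof.
move=> t0; have [N] : exists N, forall k, k \in msupp t -> (tag k < N)%N.
  exists (\max_(k <- msupp t) (tag k).+1)%N => k kt.
  by rewrite (big_rem k kt) /= leq_max leqnn.
elim: N => [|N IH] hN.
  by apply/malgP => k; rewrite mcoeff0; case: (msuppP t k) => // /hN.
apply: IH => k kt; have := hN k kt; rewrite ltnS leq_eqVlt => /predU1P[kN|//].
have := congr1 (fun f => f (unit_word N (tagged k).1 (tagged k).2)) t0.
have le_tag (j : su_index) : ((tagged j).1 <= tag j)%N && ((tagged j).2 <= tag j)%N.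
  by rewrite !leq_ord.
have /andP[k1 k2] := le_tag k.
rewrite /= functionalE (big_fsetD1 k) //= big1_fset ?addr0 => [/eqP|j].
  rewrite mulf_eq0 mcoeff_eq0 kt /= => /negPn.
  by rewrite tfun_unit_word -?kN ?eqxx.
rewrite !inE => /andP[jk jt] _; apply/eqP; rewrite mulf_eq0; apply/orP; right.
have /andP[j1 j2] := le_tag j; have jN := hN _ jt.
apply: contraNT jk; rewrite tfun_unit_word -?kN //; last by rewrite kN -ltnS.
case: j {jt jN} j1 j2 => l [a b] /= j1 j2; case: k {kt kN k1 k2} => l' [a' b'] /=.
by case/and3P => /eqP ll; subst l' => /eqP/val_inj -> /eqP/val_inj ->.
Qed.

Lemma functional_inj t u : functional q t = functional q u -> t = u.
Proof.
move=> tu; apply/eqP; rewrite -subr_eq0; apply/eqP/functional_eq0.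
by rewrite (linearEB functional_linear) tu subrr.
Qed.

(** The spins occurring in [t] must agree in parity with the charge for [attach] not to lose terms
    outside P_+; this congruence is carried through all constructions. *)
Definition parity (b : bool) (t : CSU R) := forall k, k \in msupp t -> odd (tag k) = b.

Lemma parity_lin b a t u : parity b t -> parity b u -> parity b (a *: t + u).
Proof.
move=> ht hu k /(fsubsetP (msuppD_le _ _)); rewrite in_fsetU => /orP[|/hu //].
by move/(fsubsetP (msuppZ_le _ _))/ht.
Qed.

Lemma parity0 b : parity b 0. Proof. by move=> k; rewrite msupp0. Qed.

Lemma parity_tsu l m n : parity (odd l) (tsu l m n).
Proof.
move=> k; rewrite tsu.unlock; case: ifP => _; last by rewrite msupp0.
by rewrite msuppU oner_eq0 in_fset1 => /eqP ->.
Qed.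

Definition coef_span (b : bool) : set (word -> R[i]) :=
  [set f | exists2 t, functional q t = f & parity b t].

Lemma coef_span_lin b a f g : coef_span b f -> coef_span b g -> coef_span b (a *: f + g).
Proof.
move=> [t <- ht] [u <- hu]; exists (a *: t + u); first exact: functional_linear.
exact: parity_lin.
Qed.

Lemma coef_span0 b : coef_span b 0.
Proof. by exists 0; [exact: linearE0 functional_linear | exact: parity0]. Qed.

Lemma coef_spanZ b a f : coef_span b f -> coef_span b (a *: f).
Proof. by move=> hf; rewrite -[_ *: _]addr0; apply: coef_span_lin => //; exact: coef_span0. Qed.

Lemma coef_spanD b f g : coef_span b f -> coef_span b g -> coef_span b (f + g).
Proof. by move=> hf hg; rewrite -[f]scale1r; exact: coef_span_lin. Qed.

Lemma coef_span_tfun l m n : coef_span (odd l) (tfun l m n).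
Proof. by exists (tsu l m n); [exact: functional_tsu | exact: parity_tsu]. Qed.

Lemma coef_span_ind b (S : set (word -> R[i])) : S 0 ->
  (forall a f g, S f -> S g -> S (a *: f + g)) ->
  (forall l m n, odd l = b -> S (tfun l m n)) -> forall f, coef_span b f -> S f.
Proof.
move=> S0 Slin St f [t <- ht].
have -> : functional q t =
    \sum_(k <- msupp t) t@_k *: tfun (tag k) (tagged k).1 (tagged k).2.
  by apply/funext => w; rewrite functionalE fct_sumE.
rewrite big_seq; elim/big_rec: _ => [//|k g /ht kb Sg].
by apply: Slin => //; exact: St.
Qed.

Lemma tfun_out l m n : ~~ ((m <= l)%N && (n <= l)%N) -> tfun l m n = 0.
Proof. by move=> h; apply/funext => w; rewrite /tfun (negbTE h). Qed.

Lemma cgD0 (a : bool) : cgD 0 a 0 = 0.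
Proof.
by case: a; rewrite /= ?(cgB_top cgs_sqr) ?oppr0 ?(cgA0 cgs_sqr).
Qed.

Lemma coef_span_mul1 (a b : bool) c f : coef_span c f ->
  coef_span (~~ c) (fun_mul (tfun 1 a b) f).
Proof.
move: f; apply: coef_span_ind.
- by rewrite /mkset fun_mul0r; exact: coef_span0.
- by move=> x f g hf hg; rewrite /mkset fun_mul_linear; exact: coef_span_lin.
move=> l m n lc; rewrite /mkset.
have [/andP[ml nl]|h] := boolP ((m <= l)%N && (n <= l)%N); last first.
  by rewrite (tfun_out h) fun_mul0r; exact: coef_span0.
rewrite -/(tmul1 l a m b n) tmul1E //; apply: coef_spanD; first apply: coef_spanZ.
  by rewrite -lc -[~~ odd l]/(odd l.+1); exact: coef_span_tfun.
case: l lc ml nl => [|l] lc ml nl; last first.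
  by apply: coef_spanZ; rewrite -lc /= negbK; exact: coef_span_tfun.
move: ml; rewrite leqn0 => /eqP ->; rewrite cgD0 mul0r scale0r; exact: coef_span0.
Qed.

Lemma tfun0_cat u w : tfun 0 0 0 (u ++ w) = tfun 0 0 0 u * tfun 0 0 0 w.
Proof.
have o (i j : 'I_1) : i = j by rewrite !ord1.
by rewrite /tfun /= /rep big_cat mxE big_ord1 (o (inord 0) 0).
Qed.

Lemma tfun0_gen x : tfun 0 0 0 [:: x] = (match x with Gk | Gkinv => true | _ => false end)%:R.
Proof.
have := congr1 (fun f => f [::]) (tfun_act 0 x (leqnn 0)).
rewrite [LHS]/rtrans /= => ->.
case: x; rewrite /= ?sq_num0 ?mul0r ?mulr0 ?scale0r //.
  by rewrite expr0 divr1 scale1r tfun_nil.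
by rewrite expr0 divr1 scale1r tfun_nil.
Qed.

Lemma fun_mul1l f : fun_mul (tfun 0 0 0) f = f.
Proof.
apply/funext => w; rewrite /fun_mul; elim: w f => [|x w IH] f.
  by rewrite /= big_seq1 /= tfun_nil mul1r.
rewrite big_coprod_cons.
transitivity (\sum_(a <- coprod_gen x) tfun 0 0 0 a.1 * f (a.2 ++ w)).
  apply: eq_bigr => a _; rewrite -(IH (fun u => f (a.2 ++ u))) mulr_sumr.
  by apply: eq_bigr => b _; rewrite tfun0_cat mulrA.
by case: x; rewrite /= !(big_cons, big_nil) /= !tfun0_gen ?mul0r ?mul1r ?add0r ?addr0.
Qed.

Lemma fun_mul1r f : fun_mul f (tfun 0 0 0) = f.
Proof.
apply/funext => w; rewrite /fun_mul; elim: w f => [|x w IH] f.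
  by rewrite /= big_seq1 /= tfun_nil mulr1.
rewrite big_coprod_cons.
transitivity (\sum_(a <- coprod_gen x) f (a.1 ++ w) * tfun 0 0 0 a.2).
  apply: eq_bigr => a _; rewrite -(IH (fun u => f (a.1 ++ u))) mulr_suml.
  by apply: eq_bigr => b _; rewrite tfun0_cat mulrAC mulrA.
by case: x; rewrite /= !(big_cons, big_nil) /= !tfun0_gen ?mulr0 ?mulr1 ?add0r ?addr0.
Qed.

(** Induction on the spin of the left factor: [tfun_succ] writes it through products with
    coefficients of V_{1/2}, and associativity reduces the step to [coef_span_mul1]. *)
Lemma coef_span_mul b c f g : coef_span b f -> coef_span c g ->
  coef_span (b (+) c) (fun_mul f g).
Proof.
move=> + hg; move: f; apply: coef_span_ind.
- by rewrite /mkset fun_mul0l; exact: coef_span0.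
- by move=> x f f' hf hf'; rewrite /mkset fun_mul_linearl; exact: coef_span_lin.
move=> l; elim: l b => [|l IH] b m n lb; rewrite /mkset.
  have [/andP[]|h] := boolP ((m <= 0)%N && (n <= 0)%N); last first.
    by rewrite (tfun_out h) fun_mul0l; exact: coef_span0.
  by rewrite !leqn0 => /eqP -> /eqP ->; rewrite fun_mul1l -lb.
have [/andP[ml nl]|h] := boolP ((m <= l.+1)%N && (n <= l.+1)%N); last first.
  by rewrite (tfun_out h) fun_mul0l; exact: coef_span0.
have hm (a a' : bool) i j : coef_span (b (+) c) (fun_mul (tmul1 l a i a' j) g).
  rewrite /tmul1 -fun_mulA -lb -[odd l.+1]/(~~ odd l) addNb.
  by apply: coef_span_mul1; apply: IH.
rewrite (tfun_succ ml nl) !(fun_mul_linearl, fun_mulZl).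
by apply: coef_spanD; apply: coef_spanZ; apply: coef_spanD; apply: coef_spanZ; exact: hm.
Qed.

(** [su_mul] is a choice, meaningful only once an element with the prescribed functional exists;
    closure of the coefficient space under convolution provides it. *)
Lemma functional_mul t u :
  functional q (su_mul q t u) = fun_mul (functional q t) (functional q u).
Proof.
have ex : exists v, functional q v = fun_mul (functional q t) (functional q u).
  elim/malg_ind: t => [|c k t [v hv]].
    by exists 0; rewrite !(linearE0 functional_linear) fun_mul0l.
  have [v' hv'] : exists v, functional q v = fun_mul (functional q << k >>) (functional q u).
    elim/malg_ind: u {v hv} => [|d j u [v hv]].
      by exists 0; rewrite !(linearE0 functional_linear) fun_mul0r.
    have [v' hv' _] : coef_span (odd (tag k) (+) odd (tag j))
        (fun_mul (functional q << k >>) (functional q << j >>)).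
      by rewrite !functionalU; apply: coef_span_mul; exact: coef_span_tfun.
    by exists (d *: v' + v); rewrite !functional_linear hv hv' fun_mul_linear.
  by exists (c *: v' + v); rewrite !functional_linear hv hv' fun_mul_linearl.
exact: (xgetPex 0 ex).
Qed.

Lemma su_mulE t u v :
  functional q v = fun_mul (functional q t) (functional q u) -> su_mul q t u = v.
Proof. by move=> h; apply: functional_inj; rewrite functional_mul. Qed.

Lemma su_mul_linear t : linear (su_mul q t).
Proof.
move=> a u v; apply: su_mulE.
by rewrite !functional_linear !functional_mul fun_mul_linear.
Qed.

Lemma su_mul_linearl u : linear (fun t => su_mul q t u).
Proof.
move=> a t v; apply: su_mulE.
by rewrite !functional_linear !functional_mul fun_mul_linearl.
Qed.

Lemma su_mulA t u v : su_mul q t (su_mul q u v) = su_mul q (su_mul q t u) v.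
Proof. by apply: functional_inj; rewrite !functional_mul fun_mulA. Qed.

Lemma su_mul1 t : su_mul q (tsu 0 0 0) t = t.
Proof. by apply: su_mulE; rewrite functional_tsu fun_mul1l. Qed.

Lemma su_mulr1 t : su_mul q t (tsu 0 0 0) = t.
Proof. by apply: su_mulE; rewrite functional_tsu fun_mul1r. Qed.

Lemma parity_mul b c t u : parity b t -> parity c u -> parity (b (+) c) (su_mul q t u).
Proof.
move=> tb uc.
have [v hv vbc] : coef_span (b (+) c) (fun_mul (functional q t) (functional q u)).
  by apply: coef_span_mul; [exists t | exists u].
by rewrite (su_mulE hv).
Qed.

End Coefficients.

Section Involution.
Variables (R : realType) (q : R).
Hypothesis hq : 0 < q < 1.

Let q0 : 0 < q. Proof. by case/andP: hq. Qed.
Let q1 : q < 1. Proof. by case/andP: hq. Qed.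


Local Notation p := ((sq_q q)%:C).
Local Notation s := (fun n : nat => (sq_num q n)%:C).
Local Notation A := (@cgA _ p s).
Local Notation B := (@cgB _ p s).
Local Notation tsu := (tsu R).
Local Notation tfun := (tfun q).
Local Notation cgU := (cgU q).
Local Notation cgD := (cgD q).
Implicit Types (f g h : word -> R[i]).


Lemma functional_tsu2 (c d : R[i]) l m n l' m' n' :
  functional q (c *: tsu l m n + d *: tsu l' m' n') = c *: tfun l m n + d *: tfun l' m' n'.
Proof. by rewrite functional_linear functionalZ 2!functional_tsu. Qed.

Lemma functional_mul_tsu l m n l' m' n' :
  functional q (su_mul q (tsu l m n) (tsu l' m' n')) = fun_mul (tfun l m n) (tfun l' m' n').
Proof. by rewrite functional_mul // 2!functional_tsu. Qed.

Lemma su_mul1E l (a b : bool) m n : (m <= l)%N -> (n <= l)%N ->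
  su_mul q (tsu 1 a b) (tsu l m n) = (cgU l a m * cgU l b n) *: tsu l.+1 (a + m) (b + n)
    + (cgD l a m * cgD l b n) *: tsu l.-1 (a + m).-1 (b + n).-1.
Proof.
move=> ml nl; apply: (functional_inj hq); rewrite functional_mul_tsu functional_tsu2.
exact: (tmul1E hq a b ml nl).
Qed.

Lemma tsu_succ l i j : (i <= l.+1)%N -> (j <= l.+1)%N ->
  tsu l.+1 i j = A l i *: (A l j *: su_mul q (tsu 1 true true) (tsu l i.-1 j.-1)
                           + B l j *: su_mul q (tsu 1 true false) (tsu l i.-1 j))
    + B l i *: (A l j *: su_mul q (tsu 1 false true) (tsu l i j.-1)
                + B l j *: su_mul q (tsu 1 false false) (tsu l i j)).
Proof.
move=> il jl; apply: (functional_inj hq); rewrite [LHS]functional_tsu (tfun_succ hq il jl).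
have e2 (x y : R[i]) t u : functional q (x *: t + y *: u) = x *: functional q t + y *: functional q u.
  by rewrite functional_linear functionalZ.
have e4 (x y z x' y' z' : R[i]) t u t' u' :
    functional q (x *: (y *: t + z *: u) + x' *: (y' *: t' + z' *: u')) =
    x *: (y *: functional q t + z *: functional q u)
    + x' *: (y' *: functional q t' + z' *: functional q u').
  apply: etrans (e2 _ _ _ _) _; congr (_ *: _ + _ *: _); exact: e2.
apply: esym; apply: etrans (e4 _ _ _ _ _ _ _ _ _ _) _.
by congr (_ *: (_ *: _ + _ *: _) + _ *: (_ *: _ + _ *: _)); exact: functional_mul_tsu.
Qed.

(** * The involution *)

(** The antipode followed by the involution, up to the scalar [antipode_coef]. Both maps reverse
    words, so the composite acts letter by letter. *)
Definition theta (x : gen) : gen :=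
  match x with Ge => Gf | Gf => Ge | Gk => Gkinv | Gkinv => Gk end.

Lemma ustar_antipode w : ustar (antipode_word w) = map theta w.
Proof.
rewrite /ustar /antipode_word map_rev revK -map_comp.
by apply: eq_map => -[].
Qed.

Lemma conj_antipode_coef w : conjc (antipode_coef q w) = antipode_coef q w.
Proof.
rewrite /antipode_coef; elim: w => [|x w IH]; first by rewrite big_nil conjc1.
by rewrite big_cons conjcM IH; case: x; rewrite /= ?oppr0.
Qed.

Lemma fun_starE f w : fun_star q f w = antipode_coef q w * conjc (f (map theta w)).
Proof. by rewrite /fun_star [LHS]conjcM ustar_antipode -[in RHS](conjcK (antipode_coef q w)). Qed.

Lemma antipode_coef_cat u w :
  antipode_coef q (u ++ w) = antipode_coef q u * antipode_coef q w.
Proof. by rewrite /antipode_coef big_cat. Qed.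

Lemma antipode_coef1 x : antipode_coef q [:: x] = antipode_coef_gen q x.
Proof. by rewrite /antipode_coef big_seq1. Qed.

Lemma thetaK : involutive theta. Proof. by case. Qed.

Lemma fun_starK f : fun_star q (fun_star q f) = f.
Proof.
apply/funext => w; rewrite !fun_starE conjcM conjcK conj_antipode_coef mulrA mapK.
  suff -> : antipode_coef q w * antipode_coef q (map theta w) = 1 by rewrite mul1r.
  rewrite /antipode_coef big_map -big_split big1 // => x _.
  case: x => /=; rewrite ?mulr1 // -RcM mulrNN ?mulfV ?mulVf ?gt_eqF //.
exact: thetaK.
Qed.

(** The letter map [theta] reverses the two legs of the coproduct of a word, at the cost of the
    antipode coefficients; this is the identity [key]. *)
Lemma fun_star_mul f g :
  fun_star q (fun_mul f g) = fun_mul (fun_star q g) (fun_star q f).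
Proof.
apply/funext => w; rewrite fun_starE /fun_mul raddf_sum /=.
pose G u v := conjc (f u * g v).
have key (K : word -> word -> R[i]) :
    antipode_coef q w * (\sum_(y <- coprod (map theta w)) K y.1 y.2) =
    \sum_(y <- coprod w) antipode_coef q y.1 * antipode_coef q y.2
      * K (map theta y.2) (map theta y.1).
  elim: w K => [|x w IH] K.
    by rewrite /= !big_seq1 /= /antipode_coef !big_nil !mulr1.
  rewrite map_cons -cat1s antipode_coef_cat !big_coprod_cons antipode_coef1.
  rewrite -mulrA mulr_sumr.
  transitivity (antipode_coef_gen q x * \sum_(a <- coprod_gen (theta x))
    \sum_(b <- coprod w) antipode_coef q b.1 * antipode_coef q b.2 *
      K (a.1 ++ map theta b.2) (a.2 ++ map theta b.1)).
    congr (_ * _); apply: eq_bigr => a _.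
    exact: (IH (fun u v => K (a.1 ++ u) (a.2 ++ v))).
  case: x; rewrite /= !(big_cons, big_nil) /= ?addr0 -?big_split /= mulr_sumr;
    apply: eq_bigr => b _; rewrite -!(cat1s _ b.1) -!(cat1s _ b.2) !antipode_coef_cat ?antipode_coef1 /=; ring.
rewrite (key G); apply: eq_bigr => y _; rewrite /G !fun_starE conjcM; ring.
Qed.


Lemma qN_neq0 : - q%:C != 0 :> R[i].
Proof. by rewrite oppr_eq0 Rc_eq0 gt_eqF. Qed.

Lemma rtrans_fun_star x f :
  rtrans x (fun_star q f) = antipode_coef_gen q x *: fun_star q (rtrans (theta x) f).
Proof.
apply/funext => w; rewrite /rtrans fun_starE -cats1 antipode_coef_cat antipode_coef1.
rewrite [RHS](_ : _ = antipode_coef_gen q x * fun_star q (rtrans (theta x) f) w) //.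
by rewrite fun_starE /rtrans map_cat cats1 mulrA [_ * antipode_coef_gen _ _]mulrC.
Qed.

Lemma fun_star_semilinear (a : R[i]) f g :
  fun_star q (a *: f + g) = conjc a *: fun_star q f + fun_star q g.
Proof.
apply/funext => w; rewrite fun_starE.
rewrite [RHS](_ : _ = conjc a * fun_star q f w + fun_star q g w) // !fun_starE.
rewrite [X in conjc X](_ : _ = a * f (map theta w) + g (map theta w)) //.
by rewrite conjcD conjcM mulrDr mulrCA.
Qed.

Lemma fun_star0 : fun_star q 0 = 0.
Proof. by apply/funext => w; rewrite fun_starE [X in conjc X](_ : _ = 0) // conjc0 mulr0. Qed.

Lemma fun_starZ (a : R[i]) f : fun_star q (a *: f) = conjc a *: fun_star q f.
Proof. by have := fun_star_semilinear a f 0; rewrite fun_star0 !addr0. Qed.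

Lemma gen_act_real l x m n : (m <= l)%N -> (n <= l)%N ->
  fun_star q (rtrans x (tfun l m n)) =
  gen_act q l x (fun j => fun_star q (tfun l m j)) n.
Proof.
move=> ml nl; rewrite tfun_act //.
have sc (a : R) f : fun_star q (a%:C *: f) = a%:C *: fun_star q f.
  by rewrite fun_starZ conjcR.
by case: x => /=; rewrite -?RcX -?RcV -RcM sc.
Qed.

(** [theta] exchanges e and f, so the starred coefficients, listed in the opposite order and
    rescaled by powers of -q, form a string again and are known from their values at the empty
    word. *)
Lemma fun_star_tfun l m n : (m <= l)%N -> (n <= l)%N -> fun_star q (tfun l m n) =
  ((- q%:C) ^+ (l - m) / (- q%:C) ^+ (l - n)) *: tfun l (l - m) (l - n).
Proof.
move=> ml nl; pose v j : word -> R[i] := (- q%:C) ^+ j *: fun_star q (tfun l m (l - j)).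
have vS : is_string p s (fun x => rtrans x) l v.
  apply/is_stringP => x j jl; rewrite /v (linearEZ (rtrans_linear x)) rtrans_fun_star.
  have ljl : (l - j <= l)%N by rewrite leq_subr.
  rewrite gen_act_real // !scalerA; case: x => /=; rewrite ?subKn // !scalerA.
  - have [jl'|jl'] := ltnP j l; last first.
      by rewrite (eqP (_ : (l - j)%N == 0%N)) ?subn_eq0 // sq_num0 !(mulr0, mul0r, scale0r).
    have -> : (l - j).-1 = (l - j.+1)%N by lia.
    by rewrite exprS; congr (_ *: _); rewrite -RcN; ring.
  - case: j jl ljl => [|j] jl ljl.
      by rewrite sq_num0 !(mulr0, mul0r, scale0r).
    rewrite /=; have -> : (l - j.+1).+1 = (l - j)%N by lia.
    rewrite exprS; congr (_ *: _); rewrite RcN RcV.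
    have /eqP q00 := qN_neq0; field; by apply/negP => /eqP h; apply: q00; rewrite h oppr0.
  - by congr (_ *: _); rewrite mulr1 mulrC.
  - by congr (_ *: _); rewrite mulr1 mulrC.
have := string_rtrans_eq hq vS (leq_subr n l).
rewrite {1}/v subKn // => /(congr1 (fun f => ((- q%:C) ^+ (l - n))^-1 *: f)).
rewrite scalerA mulVf ?expf_neq0 ?qN_neq0 // scale1r => ->.
rewrite mulrC -scalerA -(sum_tfun_delta q l (l - m)%N ((- q%:C) ^+ (l - m)) (l - n)%N).
congr (_ *: _).
apply: eq_bigr => i _; congr (_ *: _); rewrite /v.
rewrite [LHS](_ : _ = (- q%:C) ^+ i * fun_star q (tfun l m (l - i)) [::]) //.
rewrite fun_starE tfun_nil /antipode_coef big_nil mul1r leq_subr andbT.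
have il : (i <= l)%N by rewrite -ltnS.
have -> : (m == l - i)%N = (i == l - m :> nat)%N by apply/eqP/eqP; lia.
by case: eqVneq => [->|_]; rewrite ?conjc0 ?conjc1 ?mulr0 ?mul0r ?mulr1 ?mul1r.
Qed.

Lemma coef_span_star b f : coef_span q b f -> coef_span q b (fun_star q f).
Proof.
move: f; apply: coef_span_ind.
- by rewrite /mkset fun_star0; exact: coef_span0.
- by move=> a f g hf hg; rewrite /mkset fun_star_semilinear; exact: coef_span_lin.
move=> l m n lb; rewrite /mkset.
have [/andP[ml nl]|h] := boolP ((m <= l)%N && (n <= l)%N); last first.
  by rewrite (tfun_out q h) fun_star0; exact: coef_span0.
by rewrite fun_star_tfun //; apply: coef_spanZ; rewrite -lb; exact: coef_span_tfun.
Qed.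

Lemma functional_star t : functional q (su_star q t) = fun_star q (functional q t).
Proof.
have ex : exists v, functional q v = fun_star q (functional q t).
  elim/malg_ind: t => [|c k t [v hv]].
    by exists 0; rewrite !(linearE0 (functional_linear q)) fun_star0.
  have [v' hv' _] : coef_span q (odd (tag k)) (fun_star q (functional q << k >>)).
    by rewrite functionalU; apply: coef_span_star; exact: coef_span_tfun.
  by exists (conjc c *: v' + v); rewrite !functional_linear hv hv' fun_star_semilinear.
exact: (xgetPex 0 ex).
Qed.

Lemma su_starE t v : functional q v = fun_star q (functional q t) -> su_star q t = v.
Proof. by move=> h; apply: (functional_inj hq); rewrite functional_star. Qed.

Lemma su_star_semilinear (a : R[i]) t u :
  su_star q (a *: t + u) = conjc a *: su_star q t + su_star q u.
Proof.
apply: su_starE.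
by rewrite !functional_linear !functional_star fun_star_semilinear.
Qed.

Lemma su_starK t : su_star q (su_star q t) = t.
Proof. by apply: su_starE; rewrite functional_star fun_starK. Qed.

Lemma su_star_mul t u : su_star q (su_mul q t u) = su_mul q (su_star q u) (su_star q t).
Proof.
apply: su_starE; rewrite !(functional_mul hq) !functional_star.
by rewrite fun_star_mul.
Qed.

Lemma parity_star b t : parity b t -> parity b (su_star q t).
Proof.
move=> tb; have [v hv vb] : coef_span q b (fun_star q (functional q t)).
  by apply: coef_span_star; exists t.
by rewrite (su_starE hv).
Qed.

Lemma su_star_tsu l m n : (m <= l)%N -> (n <= l)%N -> su_star q (tsu l m n) =
  ((- q%:C) ^+ (l - m) / (- q%:C) ^+ (l - n)) *: tsu l (l - m) (l - n).
Proof.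
move=> ml nl; apply: su_starE; rewrite functionalZ !functional_tsu.
by rewrite fun_star_tfun.
Qed.

(** Unitarity of the columns. Induction on the word from its last letter: translating the sum by a
    letter gives a combination of such sums with shifted column indices, which cancel for e and f
    and reproduce the sum for k and its inverse. *)
Lemma sum_star_tfun l n n' : (n <= l)%N -> (n' <= l)%N ->
  \sum_(m < l.+1) fun_mul (fun_star q (tfun l m n)) (tfun l m n') =
  (n == n')%:R *: tfun 0 0 0.
Proof.
pose g n n' := \sum_(m < l.+1) fun_mul (fun_star q (tfun l m n)) (tfun l m n').
move=> nl nl'; apply/funext => w; rewrite -[LHS]/(g n n' w).
rewrite [RHS](_ : _ = (n == n')%:R * tfun 0 0 0 w) //.
elim/last_ind: w n n' nl nl' => [|w x IH] n n' nl nl'.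
  rewrite /g fct_sumE tfun_nil mulr1.
  transitivity (\sum_(m < l.+1) (m == n :> nat)%:R * (m == n' :> nat)%:R : R[i]).
    apply: eq_bigr => m _; rewrite /fun_mul /= big_seq1 /= fun_starE !tfun_nil.
    rewrite /antipode_coef big_nil mul1r nl nl' !andbT.
    by case: (_ == n); rewrite ?conjc1 ?conjc0.
  rewrite (bigD1 (inord n)) //= inordK // eqxx mul1r big1 ?addr0 // => m mn.
  have -> : (m == n :> nat) = false.
    by apply: contra_neqF mn => /eqP <-; rewrite inord_val.
  by rewrite mul0r.
have cat0 : tfun 0 0 0 (rcons w x) = tfun 0 0 0 w * tfun 0 0 0 [:: x].
  by rewrite -cats1 tfun0_cat.
have rg : g n n' (rcons w x) =
    \sum_(m < l.+1) rtrans x (fun_mul (fun_star q (tfun l m n)) (tfun l m n')) w.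
  by rewrite /g fct_sumE.
have gE i j : g i j w = \sum_(m < l.+1) fun_mul (fun_star q (tfun l m i)) (tfun l m j) w.
  by rewrite /g fct_sumE.
have ZZ (a b : R[i]) f h : fun_mul (a *: f) (b *: h) w = a * b * fun_mul f h w.
  rewrite fun_mulZl fun_mulZr scalerA.
  by rewrite [LHS](_ : _ = a * b * fun_mul f h w).
have ml (m : 'I_l.+1) : (m <= l)%N by rewrite -ltnS.
(* The factors [s] vanish exactly where a shifted column index would leave the range of the
   induction hypothesis. *)
have h1 : s n * g n.-1 n' w = s n * ((n == n'.+1)%:R * tfun 0 0 0 w).
  case: n nl rg => [|n] nl rg; first by rewrite sq_num0 !mul0r.
  by rewrite /= IH ?eqSS // ltnW.
have h2 : s (l - n')%N * g n n'.+1 w = s (l - n')%N * ((n == n'.+1)%:R * tfun 0 0 0 w).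
  have [nl''|nl''] := ltnP n' l; first by rewrite IH.
  by rewrite (eqP (_ : (l - n')%N == 0%N)) ?subn_eq0 // sq_num0 !mul0r.
have h3 : s n' * g n n'.-1 w = s n' * ((n.+1 == n')%:R * tfun 0 0 0 w).
  case: n' nl' rg {h1 h2} => [|n'] nl' rg; first by rewrite sq_num0 !mul0r.
  by rewrite /= IH ?eqSS // ltnW.
have h4 : s (l - n)%N * g n.+1 n' w = s (l - n)%N * ((n.+1 == n')%:R * tfun 0 0 0 w).
  have [nl''|nl''] := ltnP n l; first by rewrite IH.
  by rewrite (eqP (_ : (l - n)%N == 0%N)) ?subn_eq0 // sq_num0 !mul0r.
have pX k : p ^+ k != 0 by rewrite expf_neq0 // cgp0.
have qE : q%:C = p ^+ 2 :> R[i] by rewrite -RcX sq_q_sqr.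
rewrite cat0 tfun0_gen // rg; case: x {cat0 rg} => /=.
- rewrite mulr0 mulr0.
  transitivity (- q%:C * (s (l - n).+1) * (p ^+ n' / p ^+ (l - n')) * (s n * g n.-1 n' w)
     + (p ^+ n / p ^+ (l - n)) * s n'.+1 * (s (l - n')%N * g n n'.+1 w)).
    rewrite !gE !mulr_sumr -big_split; apply: eq_bigr => m _ /=.
    rewrite rtrans_mul [LHS](_ : _ = fun_mul (rtrans Ge (fun_star q (tfun l m n)))
       (rtrans Gk (tfun l m n')) w + fun_mul (rtrans Gkinv (fun_star q (tfun l m n)))
       (rtrans Ge (tfun l m n')) w) //.
    rewrite !rtrans_fun_star !gen_act_real // !tfun_act //= !scalerA !ZZ.
    by rewrite RcN; congr (_ + _); ring.
  rewrite h1 h2; case: eqVneq => [nE|_]; last by rewrite !(mul0r, mulr0) addr0.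
  rewrite nE in nl *; rewrite -(subnKC nl) qE.
  rewrite (_ : n'.+1 + (l - n'.+1) - n'.+1 = l - n'.+1)%N; last by lia.
  rewrite (_ : n'.+1 + (l - n'.+1) - n' = (l - n'.+1).+1)%N; last by lia.
  move: (l - n'.+1)%N => k; rewrite ![p ^+ _.+1]exprS.
  by have := cgp0 hq; have := pX n'; have := pX k => x1 x2 x3; field; rewrite x1 x3.
- rewrite mulr0 mulr0.
  transitivity (- (q^-1)%:C * (s n.+1) * (p ^+ n' / p ^+ (l - n')) * (s (l - n)%N * g n.+1 n' w)
     + (p ^+ n / p ^+ (l - n)) * s (l - n').+1 * (s n' * g n n'.-1 w)).
    rewrite !gE !mulr_sumr -big_split; apply: eq_bigr => m _ /=.
    rewrite rtrans_mul [LHS](_ : _ = fun_mul (rtrans Gf (fun_star q (tfun l m n)))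
       (rtrans Gk (tfun l m n')) w + fun_mul (rtrans Gkinv (fun_star q (tfun l m n)))
       (rtrans Gf (tfun l m n')) w) //.
    rewrite !rtrans_fun_star !gen_act_real // !tfun_act //= !scalerA !ZZ.
    by rewrite RcN; congr (_ + _); ring.
  rewrite h3 h4; case: eqVneq => [nE|_]; last by rewrite !(mul0r, mulr0) addr0.
  rewrite -nE in nl' *; rewrite RcV qE -(subnKC nl').
  rewrite (_ : n.+1 + (l - n.+1) - n.+1 = l - n.+1)%N; last by lia.
  rewrite (_ : n.+1 + (l - n.+1) - n = (l - n.+1).+1)%N; last by lia.
  move: (l - n.+1)%N => k; rewrite ![p ^+ _.+1]exprS.
  by have := cgp0 hq; have := pX n; have := pX k => x1 x2 x3; field; rewrite x1 x3.
- transitivity (p ^+ (l - n) / p ^+ n * (p ^+ n' / p ^+ (l - n')) * g n n' w).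
    rewrite gE mulr_sumr; apply: eq_bigr => m _ /=.
    rewrite rtrans_mul !rtrans_fun_star !gen_act_real // !tfun_act //= !scalerA !ZZ.
    by rewrite mul1r.
  rewrite IH // mulr1; case: eqVneq => [->|_]; last by rewrite !(mul0r, mulr0).
  by have := pX n'; have := pX (l - n')%N => x1 x2; field; rewrite x1 x2.
- transitivity (p ^+ n / p ^+ (l - n) * (p ^+ (l - n') / p ^+ n') * g n n' w).
    rewrite gE mulr_sumr; apply: eq_bigr => m _ /=.
    rewrite rtrans_mul !rtrans_fun_star !gen_act_real // !tfun_act //= !scalerA !ZZ.
    by rewrite mul1r.
  rewrite IH // mulr1; case: eqVneq => [->|_]; last by rewrite !(mul0r, mulr0).
  by have := pX n'; have := pX (l - n')%N => x1 x2; field; rewrite x1 x2.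
Qed.

Lemma sum_star_tsu l n n' : (n <= l)%N -> (n' <= l)%N ->
  \sum_(m < l.+1) su_mul q (su_star q (tsu l m n)) (tsu l m n') = (n == n')%:R *: tsu 0 0 0.
Proof.
move=> nl nl'; apply: (functional_inj hq).
rewrite functionalZ functional_tsu -(sum_star_tfun nl nl') (linearE_sum (functional_linear q)).
by apply: eq_bigr => m _; rewrite (functional_mul hq) functional_star !functional_tsu.
Qed.

End Involution.

(** * The Haar state *)

Section Haar.
Variables (R : realType) (q : R).
Hypothesis hq : 0 < q < 1.

Let q0 : 0 < q. Proof. by case/andP: hq. Qed.
Let q1 : q < 1. Proof. by case/andP: hq. Qed.

Local Notation p := ((sq_q q)%:C).
Local Notation s := (fun n : nat => (sq_num q n)%:C).
Local Notation tsu := (tsu R).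
Local Notation tfun := (tfun q).
Implicit Types (t u : CSU R).

Definition su_haar t : R[i] := \sum_(k <- msupp t) t@_k * (tag k == 0%N)%:R.

Lemma su_haar_linear (a : R[i]) t u : su_haar (a *: t + u) = a * su_haar t + su_haar u.
Proof. exact: (malg_linear (V := R[i]^o) (fun k : su_index => (tag k == 0%N)%:R)). Qed.

Lemma su_haar0 : su_haar 0 = 0.
Proof. by rewrite /su_haar msupp0 big_nil. Qed.

Lemma su_haarZ (a : R[i]) t : su_haar (a *: t) = a * su_haar t.
Proof. by have := su_haar_linear a t 0; rewrite su_haar0 !addr0. Qed.

Lemma su_haarD t u : su_haar (t + u) = su_haar t + su_haar u.
Proof. by have := su_haar_linear 1 t u; rewrite scale1r mul1r. Qed.

Lemma su_haarU (k : su_index) : su_haar << k >> = (tag k == 0%N)%:R.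
Proof. exact: (malg_linearU (V := R[i]^o) (fun k : su_index => (tag k == 0%N)%:R)). Qed.

Lemma su_haar_tsu l m n : (m <= l)%N -> (n <= l)%N -> su_haar (tsu l m n) = (l == 0)%N%:R.
Proof. by move=> ml nl; rewrite tsu.unlock ml nl su_haarU. Qed.

Definition su_act (x : gen) t : CSU R :=
  \sum_(k <- msupp t) t@_k *: gen_act q (tag k) x (tsu (tag k) (tagged k).1) (tagged k).2.

Lemma su_act_linear x : linear (su_act x).
Proof. exact: malg_linear. Qed.

Lemma su_act_tsu x l m n : (m <= l)%N -> (n <= l)%N ->
  su_act x (tsu l m n) = gen_act q l x (tsu l m) n.
Proof.
move=> ml nl; rewrite {1}tsu.unlock ml nl /su_act malg_linearU /=.
by rewrite !inordK.
Qed.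

Lemma functional_gen_act l x m n :
  functional q (gen_act q l x (tsu l m) n) = gen_act q l x (tfun l m) n.
Proof. by case: x => /=; rewrite functionalZ functional_tsu. Qed.

Lemma functional_su_act x t : functional q (su_act x t) = rtrans x (functional q t).
Proof.
move: t; apply: malg_eq_linear => [a t u|a t u|k].
- by rewrite su_act_linear functional_linear.
- by rewrite functional_linear rtrans_linear.
rewrite functionalU tsuE su_act_tsu ?leq_ord // functional_gen_act.
by rewrite tfun_act ?leq_ord.
Qed.

Definition counit_gen (x : gen) : R[i] :=
  match x with Gk | Gkinv => 1 | _ => 0 end.

Lemma su_haar_act_tsu x l m n : (m <= l)%N -> (n <= l)%N ->
  su_haar (gen_act q l x (tsu l m) n) = counit_gen x * su_haar (tsu l m n).
Proof.
case: l => [|l] ml nl.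
  move: ml nl; rewrite !leqn0 => /eqP -> /eqP ->.
  case: x; rewrite /= su_haarZ ?sq_num0 ?(mul0r, mulr0) //.
    by rewrite expr0 divr1.
  by rewrite expr0 divr1.
rewrite (su_haar_tsu ml nl) mulr0; case: x => /=; rewrite su_haarZ.
- have [lt|ge] := ltnP n l.+1; first by rewrite (su_haar_tsu ml lt) mulr0.
  by rewrite (eqP (_ : (l.+1 - n)%N == 0%N)) ?subn_eq0 // sq_num0 !mul0r.
- by rewrite su_haar_tsu ?mulr0 //; apply: leq_trans nl; rewrite leq_pred.
- by rewrite su_haar_tsu ?mulr0.
- by rewrite su_haar_tsu ?mulr0.
Qed.

(** Invariance of the Haar state. Applied to a product through [su_act_mul], it yields the linear
    relations that determine the values of the state on products. *)
Lemma su_haar_act x t : su_haar (su_act x t) = counit_gen x * su_haar t.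
Proof.
have l1 : linear (su_haar \o su_act x : CSU R -> R[i]^o).
  by move=> a u v; exact: etrans (congr1 su_haar (su_act_linear x a u v)) (su_haar_linear _ _ _).
have l2 : linear (fun u => counit_gen x * su_haar u : R[i]^o).
  move=> a u v; apply: (etrans (congr1 (fun z => counit_gen x * z) (su_haar_linear a u v))).
  by rewrite mulrDr mulrCA.
apply: (malg_eq_linear l1 l2 _ t) => k; rewrite [LHS]/= tsuE su_act_tsu ?leq_ord //.
by rewrite su_haar_act_tsu ?leq_ord.
Qed.

Lemma functional_mul_act x y t u : functional q (su_mul q (su_act x t) (su_act y u)) =
  fun_mul (rtrans x (functional q t)) (rtrans y (functional q u)).
Proof. by rewrite (functional_mul hq); congr fun_mul; exact: functional_su_act. Qed.

Lemma su_act_mul x t u : su_act x (su_mul q t u) =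
  match x with
  | Ge => su_mul q (su_act Ge t) (su_act Gk u) + su_mul q (su_act Gkinv t) (su_act Ge u)
  | Gf => su_mul q (su_act Gf t) (su_act Gk u) + su_mul q (su_act Gkinv t) (su_act Gf u)
  | Gk => su_mul q (su_act Gk t) (su_act Gk u)
  | Gkinv => su_mul q (su_act Gkinv t) (su_act Gkinv u)
  end.
Proof.
apply: (functional_inj hq); rewrite functional_su_act (functional_mul hq) rtrans_mul.
have D v w f g : functional q v = f -> functional q w = g -> f + g = functional q (v + w).
  by move=> <- <-; rewrite functionalD.
case: x; first [by apply: D; exact: functional_mul_act | by apply/esym; exact: functional_mul_act].
Qed.

Lemma su_mulZZ (a b : R[i]) t u : su_mul q (a *: t) (b *: u) = (a * b) *: su_mul q t u.
Proof.
by rewrite (linearEZ (su_mul_linear hq (a *: t))) (linearEZ (su_mul_linearl hq u)) scalerA mulrC.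
Qed.

(** * Orthogonality relations for the Haar state *)

Section Orthogonality.
Variables (l l' a a' : nat).
Hypotheses (al : (a <= l)%N) (al' : (a' <= l')%N).

Let Y b b' := su_haar (su_mul q (tsu l a b) (tsu l' a' b')).

Let haarM x y (c c' : R[i]) b b' i i' :
  su_act x (tsu l a b) = c *: tsu l a i -> su_act y (tsu l' a' b') = c' *: tsu l' a' i' ->
  su_haar (su_mul q (su_act x (tsu l a b)) (su_act y (tsu l' a' b'))) = c * c' * Y i i'.
Proof. by move=> -> ->; rewrite su_mulZZ su_haarZ. Qed.

Let YK b b' : (b <= l)%N -> (b' <= l')%N -> (b + b').*2 != (l + l')%N -> Y b b' = 0.
Proof.
move=> bl bl' ne.
have := su_haar_act Gk (su_mul q (tsu l a b) (tsu l' a' b')).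
rewrite su_act_mul mul1r -/(Y b b') (haarM (su_act_tsu Gk al bl) (su_act_tsu Gk al' bl')).
rewrite -[X in _ = X]mul1r => /eqP; rewrite -subr_eq0 -mulrBl mulf_eq0 => /orP[|/eqP //].
rewrite subr_eq0 -?(RcX, RcV) -?RcM -Rc1 (inj_eq (@complexI R)) => /eqP e.
case/negP: ne; apply/eqP.
have p0 : sq_q q != 0 by rewrite sq_q_neq0.
have e' : sq_q q ^+ (b + b').*2 = sq_q q ^+ (l + l').
  rewrite -[RHS]mul1r -e -[in RHS](subnKC bl) -[in RHS](subnKC bl').
  have x1 := expf_neq0 (l - b) p0; have x2 := expf_neq0 (l' - b') p0.
  rewrite -addnn !exprD addKn addKn.
  by field; rewrite x1 x2.
apply: (ieexprIn (sq_q_gt0 hq)) e'.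
by rewrite lt_eqF // sq_q_lt1.
Qed.

(** Invariance under e relates two neighbours on the antidiagonal [b + b'] constant; invariance
    under k leaves only the antidiagonal of total weight zero. *)
Let YE b b' : (b <= l)%N -> (b' <= l')%N ->
  s (l - b)%N * s b.+1 * (p ^+ b' / p ^+ (l' - b')) * Y b.+1 b'
  + p ^+ (l - b) / p ^+ b * (s (l' - b')%N * s b'.+1) * Y b b'.+1 = 0.
Proof.
move=> bl bl'; have := su_haar_act Ge (su_mul q (tsu l a b) (tsu l' a' b')).
rewrite su_act_mul su_haarD mul0r.
move=> e; apply: etrans e; apply/esym; congr (_ + _).
  exact: (haarM (su_act_tsu Ge al bl) (su_act_tsu Gk al' bl')).
exact: (haarM (su_act_tsu Gkinv al bl) (su_act_tsu Ge al' bl')).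
Qed.

Let s0 n : (0 < n)%N -> s n != 0.
Proof. by case: n => // n _; exact: cgs_neq0. Qed.

Let pX n : p ^+ n != 0. Proof. by rewrite expf_neq0 // cgp0. Qed.

Let YE' b b' : (b < l)%N -> (b' < l')%N -> (Y b.+1 b' == 0) = (Y b b'.+1 == 0).
Proof.
move=> bl bl'; have := YE (ltnW bl) (ltnW bl').
set c := _ * _ * (_ / _); set c' := _ * (_ * _) => e.
have c0 : c != 0 by rewrite !mulf_neq0 ?invr_eq0 ?pX ?s0 ?subn_gt0.
have c0' : c' != 0 by rewrite !mulf_neq0 ?invr_eq0 ?pX ?s0 ?subn_gt0.
apply/eqP/eqP => y0; move/eqP: e; rewrite y0 mulr0 ?add0r ?addr0 mulf_eq0.
  by rewrite (negbTE c0') => /eqP.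
by rewrite (negbTE c0) => /eqP.
Qed.

(** Following the recursion up to [b = l], one of its two coefficients vanishes while the other does
    not, since the column of the larger spin has not reached its end. The value there is zero, hence
    so are all the others. *)
Let Y_lt b b' : (l < l')%N -> (b <= l)%N -> (b' <= l')%N -> Y b b' = 0.
Proof.
move=> ll' bl bl'; have [bb|] := eqVneq (b + b').*2 (l + l')%N; last exact: YK.
move: bl b' bl' bb; move: {-1}(l - b)%N (erefl (l - b)%N) => k.
elim: k b => [|k IH] b kb bl [|b'] bl' bb; try lia.
  have := YE bl (ltnW bl'); set c' := _ / _ * (_ * _).
  have c0 : c' != 0 by rewrite !mulf_neq0 ?invr_eq0 ?pX ?s0 ?subn_gt0.
  rewrite (_ : s (l - b)%N = 0); last by rewrite kb sq_num0.
  by rewrite !mul0r add0r => /eqP; rewrite mulf_eq0 (negbTE c0) => /eqP.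
have bl1 : (b < l)%N by lia.
by apply/eqP; rewrite -YE' //; apply/eqP; apply: IH => //; lia.
Qed.

Let Y_gt b b' : (l' < l)%N -> (b <= l)%N -> (b' <= l')%N -> Y b b' = 0.
Proof.
move=> ll' bl bl'; have [bb|] := eqVneq (b + b').*2 (l + l')%N; last exact: YK.
move: bl' b bl bb; move: {-1}(l' - b')%N (erefl (l' - b')%N) => k.
elim: k b' => [|k IH] b' kb bl' [|b] bl bb; try lia.
  have := YE (ltnW bl) bl'; set c := _ * _ * (_ / _).
  have c0 : c != 0 by rewrite !mulf_neq0 ?invr_eq0 ?pX ?s0 ?subn_gt0.
  rewrite (_ : s (l' - b')%N = 0); last by rewrite kb sq_num0.
  by rewrite mul0r mulr0 mul0r addr0 => /eqP; rewrite mulf_eq0 (negbTE c0) => /eqP.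
have bl1 : (b' < l')%N by lia.
by apply/eqP; rewrite YE' //; apply/eqP; apply: IH => //; lia.
Qed.

(** For equal spins both ends of the antidiagonal are reached together, so no value is forced to
    vanish and the ratio of neighbours is -q. *)
Let Y_eq b : l = l' -> (b <= l)%N -> Y b (l - b) = (- q%:C) ^+ b * Y 0 l.
Proof.
move=> ll'; elim: b => [|b IH] bl; first by rewrite subn0 mul1r.
have e1 : (l - b.+1 <= l')%N by lia.
have := YE (ltnW bl) e1; rewrite -ll' (_ : (l - b.+1).+1 = (l - b)%N); last by lia.
have yE : (- q%:C) ^+ b.+1 * Y 0 l = - q%:C * ((- q%:C) ^+ b * Y 0 l) by rewrite exprS mulrA.
rewrite yE -IH ?(ltnW bl) //; move: (Y b (l - b)%N) => y.
have pb := pX b; have pb' := pX (l - b.+1).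
rewrite (_ : l - b = (l - b.+1).+1)%N; last by lia.
rewrite (_ : l - (l - b.+1) = b.+1)%N; last by lia.
have sb := cgs_neq0 hq b; have sb' := cgs_neq0 hq (l - b.+1).
have qE : q%:C = p ^+ 2 :> R[i] by rewrite -RcX sq_q_sqr.
have p0 := cgp0 hq.
set u := s (l - b.+1).+1 in sb' *; set v := s b.+1 in sb *; rewrite qE ![p ^+ _.+1]exprS.
move: (p ^+ b) (p ^+ (l - b.+1)) pb pb' => {}pb pb' b0 b0'.
move: (Y _ _) => z /eqP; rewrite addr_eq0 => /eqP e.
apply: (mulfI (mulf_neq0 (mulf_neq0 sb' sb) (mulf_neq0 b0' (invr_neq0 (mulf_neq0 p0 b0))))).
transitivity (u * v * (pb' / (p * pb)) * z); first by ring.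
by rewrite e; field; rewrite ?b0 ?p0.
Qed.

Lemma su_haar_mul_cols b b' : (b <= l)%N -> (b' <= l')%N ->
  su_haar (su_mul q (tsu l a b) (tsu l' a' b')) =
  ((l == l') && (b + b' == l)%N)%:R
    * ((- q%:C) ^+ b * su_haar (su_mul q (tsu l a 0) (tsu l' a' l))).
Proof.
move=> bl bl'; rewrite -/(Y b b') -/(Y 0 l).
case: (ltngtP l l') => [ll'|ll'|ll'] /=; rewrite ?mul0r.
- exact: Y_lt.
- exact: Y_gt.
case: eqP => [bb'|ne].
  have := @Y_eq b ll'; rewrite mul1r (_ : l - b = b')%N; [apply | ]; lia.
by rewrite mul0r; apply: YK => //; apply/eqP; lia.
Qed.

End Orthogonality.

(** On functionals this is composition with [ustar], which reverses words and respects the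
    coproduct. Transposition is therefore multiplicative, and it carries the relations on columns
    over to rows. *)
Definition su_tr t : CSU R :=
  \sum_(k <- msupp t) t@_k *: tsu (tag k) (tagged k).2 (tagged k).1.

Lemma su_tr_linear : linear su_tr.
Proof. exact: malg_linear. Qed.

Lemma su_trU k : su_tr << k >> = tsu (tag k) (tagged k).2 (tagged k).1.
Proof. by rewrite /su_tr malg_linearU. Qed.

Lemma su_tr_tsu l m n : (m <= l)%N -> (n <= l)%N -> su_tr (tsu l m n) = tsu l n m.
Proof. by move=> ml nl; rewrite {1}tsu.unlock ml nl su_trU /= !inordK. Qed.

Lemma su_haar_tr t : su_haar (su_tr t) = su_haar t.
Proof.
have l1 : linear (su_haar \o su_tr : CSU R -> R[i]^o).
  by move=> a u v; exact: etrans (congr1 su_haar (su_tr_linear a u v)) (su_haar_linear _ _ _).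
have l2 : linear (su_haar : CSU R -> R[i]^o) by move=> a u v; exact: su_haar_linear.
apply: (malg_eq_linear l1 l2) => k.
by rewrite [LHS]/= tsuE su_tr_tsu ?leq_ord // !su_haar_tsu ?leq_ord.
Qed.

Lemma ustar_cons x w : ustar (x :: w) = rcons (ustar w) (ustar_gen x).
Proof. by rewrite /ustar map_cons rev_cons. Qed.

Lemma rep_ustar l w (m n : 'I_l.+1) : rep q l (ustar w) m n = rep q l w n m.
Proof.
have gE x (i j : 'I_l.+1) : rep_gen q l (ustar_gen x) i j = rep_gen q l x j i.
  have step (i' j' : 'I_l.+1) : j' = i'.+1 :> nat ->
      (l%:R / 2 - weight R j' + 1 = l%:R / 2 - weight R i' :> R) /\
      (l%:R / 2 + weight R j' = l%:R / 2 + weight R i' + 1 :> R).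
    by move=> e; rewrite /weight e -natr1; split; ring.
  rewrite !mxE; case: x => /=.
  - rewrite [_ == i.+1]eq_sym; case: eqP => // e.
    by have [-> ->] := step i j (esym e).
  - rewrite [j.+1 == _]eq_sym; case: eqP => // e.
    by have [-> ->] := step j i e.
  - by rewrite eq_sym; case: eqP => // ->.
  - by rewrite eq_sym; case: eqP => // ->.
elim: w m n => [|x w IH] m n; first by rewrite /ustar /rep /= !big_nil !mxE eq_sym.
rewrite ustar_cons /rep -cats1 big_cat big_seq1 big_cons !mxE.
by apply: eq_bigr => j _; rewrite gE mulrC; congr (_ * _); exact: IH.
Qed.

Lemma functional_tr t w : functional q (su_tr t) w = functional q t (ustar w).
Proof.
have l1 : linear (fun t => functional q (su_tr t) w : R[i]^o).
  by move=> a u v; rewrite /= su_tr_linear functional_linear.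
have l2 : linear (fun t => functional q t (ustar w) : R[i]^o).
  by move=> a u v; rewrite /= functional_linear.
apply: (malg_eq_linear l1 l2) => k.
rewrite su_trU functional_tsu functionalU.
by rewrite !tfunE rep_ustar.
Qed.

Lemma big_coprod_ustar (V : nmodType) (F : word -> word -> V) w :
  \sum_(y <- coprod (ustar w)) F y.1 y.2 = \sum_(y <- coprod w) F (ustar y.1) (ustar y.2).
Proof.
have cat (u v : word) : ustar (u ++ v) = ustar v ++ ustar u by rewrite /ustar map_cat rev_cat.
elim: w F => [|x w IH] F; first by rewrite /= !big_seq1.
rewrite ustar_cons -cats1 big_coprod_cat big_coprod_cons /=.
under eq_bigr do rewrite big_coprod1.
rewrite exchange_big /=.
transitivity (\sum_(a <- coprod_gen (ustar_gen x)) \sum_(b <- coprod w)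
  F (ustar b.1 ++ a.1) (ustar b.2 ++ a.2)).
  rewrite exchange_big [RHS]exchange_big /=.
  exact: (IH (fun u v : word => \sum_(a <- coprod_gen (ustar_gen x)) F (u ++ a.1) (v ++ a.2))).
transitivity (\sum_(a <- coprod_gen x) \sum_(b <- coprod w)
  F (ustar b.1 ++ ustar a.1) (ustar b.2 ++ ustar a.2)).
  by case: x; rewrite /= !(big_cons, big_nil).
by apply: eq_bigr => a _; apply: eq_bigr => b _; rewrite !cat.
Qed.

Lemma su_tr_mul t u : su_tr (su_mul q t u) = su_mul q (su_tr t) (su_tr u).
Proof.
apply/esym; apply: (su_mulE hq); apply/funext => w; rewrite functional_tr (functional_mul hq).
rewrite /fun_mul (big_coprod_ustar (fun u' v' : word => functional q t u' * functional q u v')).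
by apply: eq_bigr => y _; congr (_ * _); apply/esym; exact: functional_tr.
Qed.

Lemma su_haar_mul_tr l m n l' m' n' : (m <= l)%N -> (n <= l)%N -> (m' <= l')%N -> (n' <= l')%N ->
  su_haar (su_mul q (tsu l m n) (tsu l' m' n')) = su_haar (su_mul q (tsu l n m) (tsu l' n' m')).
Proof.
move=> ml nl ml' nl'; rewrite -[LHS]su_haar_tr su_tr_mul; congr (su_haar (su_mul q _ _));
  exact: su_tr_tsu.
Qed.

(* The norm of t^l_{m,n} for the inner product of the Haar state. *)
Definition haar_norm (l m : nat) : R := sq_q q ^+ (l - m) / (sq_q q ^+ m * sq_num q l.+1).

Lemma haar_norm_gt0 l m : 0 < haar_norm l m.
Proof.
by rewrite divr_gt0 ?mulr_gt0 ?exprn_gt0 ?sq_num_gt0 //; exact: (sq_q_gt0 hq).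
Qed.

(** The squares are q^(l-2m)/[l+1], and [l+1] is the sum of these powers of q. *)
Lemma sum_haar_norm l : \sum_(m < l.+1) haar_norm l m ^+ 2 = 1.
Proof.
have p0 := sq_q_neq0 hq; have s0 n : sq_num q n.+1 != 0 by rewrite gt_eqF ?sq_num_gt0.
have pX n : sq_q q ^+ n != 0 by rewrite expf_neq0.
suff h : \sum_(m < l.+1) (sq_q q ^+ (l - m) / sq_q q ^+ m) ^+ 2 = sq_num q l.+1 ^+ 2.
  transitivity (\sum_(m < l.+1) (sq_q q ^+ (l - m) / sq_q q ^+ m) ^+ 2 * (sq_num q l.+1) ^- 2).
    apply: eq_bigr => m _; rewrite /haar_norm; have x1 := pX m; have x2 := s0 l.
    by field; rewrite x1 x2.
  by rewrite -mulr_suml h mulfV // expf_neq0.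
have rec n : sq_num q n.+1 ^+ 2 = sq_q q ^- 2 * sq_num q n ^+ 2 + (sq_q q ^+ n) ^+ 2.
  apply/(@complexI R); rewrite !(RcD, RcM, RcV, RcX).
  exact: (cg_sqrS (cgp0 hq) (cgp4 hq) (cgs_sqr hq)).
elim: l => [|l IH]; first by rewrite big_ord1 sq_num1 // divr1.
rewrite big_ord_recl rec -IH subn0 divr1 addrC mulr_sumr; congr (_ + _).
apply: eq_bigr => m _; rewrite /= subSS /bump add1n [sq_q q ^+ m.+1]exprS.
by have x1 := pX m; field; rewrite x1 p0.
Qed.

(** The dependence on rows and on columns is known from [su_haar_mul_cols] and its transpose, up to
    one constant for each spin; unitarity of the first column fixes that constant. *)
Lemma su_haar_orth l m n l' m' n' : (m <= l)%N -> (n <= l)%N -> (m' <= l')%N -> (n' <= l')%N ->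
  su_haar (su_mul q (su_star q (tsu l m n)) (tsu l' m' n')) =
  ([&& l == l', m == m' & n == n']%:R * (haar_norm l m ^+ 2)%:C).
Proof.
have qX k : (- q%:C) ^+ k != 0 :> R[i] by rewrite expf_neq0 // qN_neq0.
have step L M N L' M' N' : (M <= L)%N -> (N <= L)%N -> (M' <= L')%N -> (N' <= L')%N ->
    su_haar (su_mul q (su_star q (tsu L M N)) (tsu L' M' N')) =
    ([&& L == L', M == M' & N == N'])%:R
    * ((q ^+ 2) ^+ (L - M) * 1)%:C * su_haar (su_mul q (tsu L 0 0) (tsu L L L)).
  move=> ML NL ML' NL'; rewrite su_star_tsu //.
  have -> (c : R[i]) t u : su_mul q (c *: t) u = c *: su_mul q t u.
    exact: (linearEZ (su_mul_linearl hq u)).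
  rewrite su_haarZ su_haar_mul_cols ?leq_subr //.
  case: eqP => [LE|_]; last by rewrite !(mul0r, mulr0).
  subst L'; rewrite (_ : (L - N + N' == L)%N = (N == N')); last by apply/eqP/eqP; lia.
  case: (N == N'); last by rewrite !andbF !(mul0r, mulr0).
  rewrite su_haar_mul_tr ?leq_subr // su_haar_mul_cols ?leq_subr // eqxx.
  rewrite (_ : (L - M + M' == L)%N = (M == M')); last by apply/eqP/eqP; lia.
  case: (M == M'); last by rewrite !(mul0r, mulr0).
  rewrite !mul1r mulr1 -exprM mul2n -addnn exprD RcM !RcX.
  have e : q%:C ^+ (L - M) * q%:C ^+ (L - M) = (- q%:C) ^+ (L - M) * (- q%:C) ^+ (L - M) :> R[i].
    by rewrite -!exprMn mulrNN.
  rewrite e.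
  by have x1 := qX (L - N)%N; field; rewrite x1.
move=> ml nl ml' nl'; rewrite step //; case: and3P => [[/eqP le _ _]|_]; last by rewrite !mul0r.
rewrite -mulrA; congr (_ * _); rewrite mulr1.
have := sum_star_tsu hq (leq0n l) (leq0n l) => /(congr1 su_haar).
rewrite eqxx scale1r su_haar_tsu //=.
have hs (F : 'I_l.+1 -> CSU R) : su_haar (\sum_m F m) = \sum_m su_haar (F m).
  by elim/big_rec2: _ => [|i x y _ <-]; rewrite ?su_haar0 ?su_haarD.
rewrite hs; set y := su_haar (su_mul q (tsu l 0 0) _) => ysum.
have {}ysum : (\sum_(i < l.+1) (q ^+ 2) ^+ (l - i))%:C * y = 1.
  apply: etrans ysum; rewrite raddf_sum mulr_suml; apply: eq_bigr => i _.
  by rewrite step ?leq_ord // !eqxx mul1r mulr1.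
have pX k : sq_q q ^+ k != 0 by rewrite expf_neq0 // sq_q_neq0.
have s0 := sq_num_gt0 hq l.
have qE k : q ^+ k = (sq_q q ^+ k) ^+ 2 by rewrite -exprM mulnC exprM sq_q_sqr.
have q2E k : (q ^+ 2) ^+ k = (sq_q q ^+ k) ^+ 4.
  by rewrite -exprM mulnC exprM qE -exprM.
have e : (\sum_(i < l.+1) (q ^+ 2) ^+ (l - i)) = sq_num q l.+1 ^+ 2 * q ^+ l.
  have := sum_haar_norm l => /(congr1 (fun z => sq_num q l.+1 ^+ 2 * q ^+ l * z)).
  rewrite mulr1 mulr_sumr => <-; apply: eq_bigr => i _.
  have ilE : (l = i + (l - i))%N by rewrite subnKC ?leq_ord.
  have plE : sq_q q ^+ l = sq_q q ^+ i * sq_q q ^+ (l - i) by rewrite -exprD -ilE.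
  rewrite q2E qE plE /haar_norm.
  by have x1 := pX i; field; rewrite x1 gt_eqF.
have y0 : y = ((sq_num q l.+1 ^+ 2 * q ^+ l)^-1)%:C.
  apply: (@mulfI _ (sq_num q l.+1 ^+ 2 * q ^+ l)%:C).
    by rewrite Rc_eq0 mulf_neq0 ?expf_neq0 ?gt_eqF.
  by rewrite -{1}e ysum -RcM mulfV // mulf_neq0 ?expf_neq0 ?gt_eqF.
rewrite y0 -RcM; congr _%:C.
have mlE : (l = m + (l - m))%N by rewrite subnKC.
have plE : sq_q q ^+ l = sq_q q ^+ m * sq_q q ^+ (l - m) by rewrite -exprD -mlE.
rewrite q2E qE plE /haar_norm.
by have x1 := pX m; have x2 := pX (l - m)%N;
  field; rewrite x1 x2 gt_eqF.
Qed.


End Haar.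

(** * The algebra C[U_q(2)] *)

Lemma eq_linear (K : nzRingType) (V W : lmodType K) (f g : V -> W) :
  f =1 g -> linear g -> linear f.
Proof. by move=> fg lg z u v; rewrite !fg lg. Qed.

Lemma sum_linear (K : comNzRingType) (V W : lmodType K) (I : Type) (r : seq I) (z : I -> K)
    (f : I -> V -> W) :
  (forall i, linear (f i)) -> linear (fun v => \sum_(i <- r) z i *: f i v).
Proof.
move=> lf a u v; rewrite scaler_sumr -big_split; apply: eq_bigr => i _ /=.
by rewrite lf scalerDr !scalerA mulrC.
Qed.

Lemma comp_linear (K : nzRingType) (U V W : lmodType K) (f : V -> W) (g : U -> V) :
  linear f -> linear g -> linear (fun x => f (g x)).
Proof. by move=> lf lg z u v; rewrite lg lf. Qed.

Section Antilinear.
Variables (R : rcfType) (U V : lmodType R[i]).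

Definition antilinear (f : U -> V) : Prop :=
  forall (z : R[i]) x y, f (z *: x + y) = conjc z *: f x + f y.

Lemma antilinear0 f : antilinear f -> f 0 = 0.
Proof.
move=> lf; have := lf 1 0 0; rewrite conjc1 !scale1r addr0 => /eqP.
by rewrite -subr_eq subrr eq_sym => /eqP.
Qed.

Lemma antilinearZ f z x : antilinear f -> f (z *: x) = conjc z *: f x.
Proof. by move=> lf; have := lf z x 0; rewrite (antilinear0 lf) !addr0. Qed.

End Antilinear.

Section AntilinearComp.
Variables (R : rcfType) (U V W : lmodType R[i]).

Lemma comp_anti_linear (f : V -> W) (g : U -> V) :
  antilinear f -> linear g -> antilinear (fun x => f (g x)).
Proof. by move=> lf lg z u v; rewrite lg lf. Qed.

Lemma comp_linear_anti (f : V -> W) (g : U -> V) :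
  linear f -> antilinear g -> antilinear (fun x => f (g x)).
Proof. by move=> lf lg z u v; rewrite lg lf. Qed.

Lemma comp_anti_anti (f : V -> W) (g : U -> V) :
  antilinear f -> antilinear g -> linear (fun x => f (g x)).
Proof. by move=> lf lg z u v; rewrite lg lf conjcK. Qed.

Lemma malg_eq_antilinear (I : choiceType) (f g : {malg R[i][I]} -> V) :
  antilinear f -> antilinear g -> (forall k, f << k >> = g << k >>) -> f =1 g.
Proof.
move=> lf lg fg; elim/malg_ind => [|c k a IH]; first by rewrite (antilinear0 lf) (antilinear0 lg).
by rewrite lf lg fg IH.
Qed.

End AntilinearComp.

Definition oddz (c : int) := odd `|c|%N.

Lemma oddzD (c d : int) : oddz (c + d) = oddz c (+) oddz d.
Proof. rewrite /oddz; lia. Qed.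

Lemma oddzN (c : int) : oddz (- c) = oddz c.
Proof. by rewrite /oddz abszN. Qed.

Section CUAlgebra.
Variables (R : realType) (q : R).
Hypothesis hq : 0 < q < 1.

Local Notation tsu := (tsu R).
Implicit Types (t u : CSU R) (a b : CU R) (x y : u_index) (c d : int).

Lemma parity_ind (o : bool) (S : CSU R -> Prop) : S 0 ->
  (forall (z : R[i]) k t, odd (tag k) = o -> S t -> S (z *: << k >> + t)) ->
  forall t, parity o t -> S t.
Proof.
move=> S0 Sl t ht; rewrite [t]monalgE.
have : {in enum_fset (msupp t), forall k, odd (tag k) = o} := ht.
elim: (enum_fset (msupp t)) => [|k r IH] h; first by rewrite big_nil.
rewrite big_cons malgUZ; apply: Sl; first by apply: h; rewrite mem_head.
by apply: IH => j jr; apply: h; rewrite in_cons jr orbT.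
Qed.

Lemma parity_eq_linear (V : lmodType R[i]) o (f g : CSU R -> V) : linear f -> linear g ->
  (forall k, odd (tag k) = o -> f << k >> = g << k >>) -> forall t, parity o t -> f t = g t.
Proof.
move=> lf lg fg; apply: parity_ind => [|z k t /fg fgk IH].
  by rewrite (linearE0 lf) (linearE0 lg).
by rewrite lf lg fgk IH.
Qed.

Lemma parity_eq_antilinear (V : lmodType R[i]) o (f g : CSU R -> V) :
  antilinear f -> antilinear g ->
  (forall k, odd (tag k) = o -> f << k >> = g << k >>) -> forall t, parity o t -> f t = g t.
Proof.
move=> lf lg fg; apply: parity_ind => [|z k t /fg fgk IH].
  by rewrite (antilinear0 lf) (antilinear0 lg).
by rewrite lf lg fgk IH.
Qed.

Lemma attach_linear c : linear (attach (R := R) c).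
Proof. exact: malg_linear. Qed.

Lemma attachU c k : attach c (<< k >> : CSU R) = tz R k c.
Proof. by rewrite /attach malg_linearU. Qed.

Lemma tz_index x : tz R (u_su x) (u_charge x) = << x >>.
Proof. by rewrite /tz /u_su /u_charge -surjective_pairing valK. Qed.

Lemma attach_index x : attach (u_charge x) (<< u_su x >> : CSU R) = << x >>.
Proof. by rewrite attachU tz_index. Qed.

Lemma tz_exists k c : odd (tag k) = oddz c ->
  exists2 x, u_su x = k & u_charge x = c.
Proof.
move=> h; have kc : in_Pplus (tag (k, c).1) (k, c).2 by rewrite /in_Pplus h.
by exists (Sub (k, c) kc); rewrite /u_su /u_charge SubK.
Qed.

Lemma odd_spin x : odd (u_spin x) = oddz (u_charge x).
Proof. exact/eqP/(valP x). Qed.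

Let u_row x b : CU R := \sum_(y <- msupp b) b@_y *:
  attach (u_charge x + u_charge y) (su_mul q << u_su x >> << u_su y >>).

Let u_row_linear x : linear (u_row x). Proof. exact: malg_linear. Qed.

Let u_mulE a b : u_mul q a b = \sum_(x <- msupp a) a@_x *: u_row x b.
Proof.
apply: eq_bigr => x _; rewrite scaler_sumr; apply: eq_bigr => y _.
by rewrite scalerA.
Qed.

Lemma u_mul_linear a : linear (u_mul q a).
Proof.
apply: eq_linear (u_mulE a) _; apply: sum_linear => x; exact: u_row_linear.
Qed.

Lemma u_mul_linearl b : linear (fun a => u_mul q a b).
Proof. exact: eq_linear (fun a => u_mulE a b) (malg_linear (u_row^~ b)). Qed.

Lemma u_mulU x y : u_mul q << x >> << y >> =
  attach (u_charge x + u_charge y) (su_mul q << u_su x >> << u_su y >>).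
Proof.
rewrite /u_mul !msuppU !oner_eq0 !big_seq_fset1 !mcoeffUU mulr1 scale1r.
by [].
Qed.

(** The parity conditions matter: [attach] sends labels outside P_+ to zero, and a product of two
    such elements may return to P_+. *)
Lemma u_mul_attach c d t u : parity (oddz c) t -> parity (oddz d) u ->
  u_mul q (attach c t) (attach d u) = attach (c + d) (su_mul q t u).
Proof.
move=> + hu; move: t; apply: parity_eq_linear => [||k kc].
- exact: comp_linear (u_mul_linearl _) (attach_linear c).
- exact: comp_linear (attach_linear _) (su_mul_linearl hq u).
move: u hu; apply: parity_eq_linear => [||j jd].
- exact: comp_linear (u_mul_linear _) (attach_linear d).
- exact: comp_linear (attach_linear _) (su_mul_linear hq _).
have [x <- <-] := tz_exists kc; have [y <- <-] := tz_exists jd.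
by rewrite 2!attach_index u_mulU.
Qed.

Lemma u_star_antilinear : antilinear (u_star q).
Proof.
move=> z a b; apply: (@malg_semilinear _ _ _ (@conjc R)) => [x y|x y|]; first exact: conjcD.
  exact: conjcM.
exact: conjc0.
Qed.

Lemma u_starU x : u_star q << x >> = attach (- u_charge x) (su_star q << u_su x >>).
Proof. exact: (@malg_semilinearU _ _ _ (@conjc R) _ _ (conjc1 R)). Qed.

Lemma u_star_attach c t : parity (oddz c) t ->
  u_star q (attach c t) = attach (- c) (su_star q t).
Proof.
move: t; apply: parity_eq_antilinear => [||k kc].
- exact: comp_anti_linear u_star_antilinear (attach_linear c).
- exact: comp_linear_anti (attach_linear _) (su_star_semilinear hq).
by have [x <- <-] := tz_exists kc; rewrite attach_index u_starU.
Qed.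

Lemma haar_linear : linear (@haar R : CU R -> R[i]^o).
Proof. exact: malg_linear. Qed.

Lemma haarU x : haar (<< x >> : CU R) = ((u_spin x == 0%N) && (u_charge x == 0))%:R.
Proof.
exact: (malg_linearU (V := R[i]^o) (fun x => ((u_spin x == 0%N) && (u_charge x == 0))%:R)).
Qed.

Lemma haar_attach c t : parity (oddz c) t -> haar (attach c t) = (c == 0)%:R * su_haar t.
Proof.
have lh : linear (fun t => (c == 0)%:R * su_haar t : R[i]^o).
  apply: (@comp_linear _ _ R[i]^o R[i]^o (fun z => (c == 0)%:R * z)).
    by move=> z u v; rewrite mulrDr mulrCA.
  by move=> z u v; exact: su_haar_linear.
move: t; apply: (@parity_eq_linear R[i]^o) => [||k kc].
- exact: comp_linear haar_linear (attach_linear c).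
- exact: lh.
have [x <- <-] := tz_exists kc; rewrite attach_index haarU su_haarU.
by rewrite /u_spin andbC; case: (_ == 0); rewrite ?mul1r ?mul0r.
Qed.

Lemma u_basis_eq (P : CU R -> Prop) :
  (forall l c m n, odd l = oddz c -> (m <= l)%N -> (n <= l)%N -> P (attach c (tsu l m n))) ->
  forall x, P << x >>.
Proof.
by move=> h x; rewrite -attach_index tsuE; apply: h; rewrite ?leq_ord // odd_spin.
Qed.

Lemma u_eq_linear (V : lmodType R[i]) (f g : CU R -> V) : linear f -> linear g ->
  (forall l c m n, odd l = oddz c -> (m <= l)%N -> (n <= l)%N ->
    f (attach c (tsu l m n)) = g (attach c (tsu l m n))) -> f =1 g.
Proof. by move=> lf lg fg; apply: malg_eq_linear => //; exact (@u_basis_eq (fun a => f a = g a) fg). Qed.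

Lemma u_eq_antilinear (V : lmodType R[i]) (f g : CU R -> V) : antilinear f -> antilinear g ->
  (forall l c m n, odd l = oddz c -> (m <= l)%N -> (n <= l)%N ->
    f (attach c (tsu l m n)) = g (attach c (tsu l m n))) -> f =1 g.
Proof. by move=> lf lg fg; apply: malg_eq_antilinear => //; exact (@u_basis_eq (fun a => f a = g a) fg). Qed.

Lemma parity_oddz l c m n : odd l = oddz c -> parity (oddz c) (tsu l m n).
Proof. by move=> <-; exact: parity_tsu. Qed.
Arguments parity_oddz {l c} m n _ : rename.

Lemma u_oneE : u_one R = attach 0 (tsu 0 0 0).
Proof.
by rewrite tsu.unlock attachU /u_one; congr (tz R (sui _ _) 0); exact/val_inj/esym/inordK.
Qed.

Lemma u_mulA : associative (u_mul q).
Proof.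
move=> a b e; move: a; apply: u_eq_linear => [||l c m n lc ml nl].
- exact: u_mul_linearl.
- exact: comp_linear (u_mul_linearl e) (u_mul_linearl b).
move: b; apply: u_eq_linear => [||l' c' m' n' lc' ml' nl'].
- exact: comp_linear (u_mul_linear _) (u_mul_linearl e).
- exact: comp_linear (u_mul_linearl e) (u_mul_linear _).
move: e; apply: u_eq_linear => [||l'' c'' m'' n'' lc'' ml'' nl''].
- exact: comp_linear (u_mul_linear _) (u_mul_linear _).
- exact: u_mul_linear.
have P1 := parity_oddz m n lc; have P2 := parity_oddz m' n' lc'.
have P3 := parity_oddz m'' n'' lc''.
move: (tsu l m n) (tsu l' m' n') (tsu l'' m'' n'') P1 P2 P3 => t1 t2 t3 P1 P2 P3.
apply: etrans (congr1 (u_mul q _) (u_mul_attach P2 P3)) _.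
apply: etrans (esym (congr1 (fun a => u_mul q a _) (u_mul_attach P1 P2))).
apply: etrans (u_mul_attach P1 _) _; first by rewrite oddzD; exact: parity_mul.
apply: etrans (esym (u_mul_attach _ P3)); last by rewrite oddzD; exact: parity_mul.
exact: (congr2 (attach (R := R)) (addrA c c' c'') (su_mulA hq t1 t2 t3)).
Qed.

Lemma u_mul1 : left_id (u_one R) (u_mul q).
Proof.
apply: u_eq_linear => [||l c m n lc ml nl]; [exact: u_mul_linear|by []|].
rewrite u_oneE u_mul_attach ?add0r ?su_mul1 //; first exact: parity_tsu.
exact: parity_oddz.
Qed.

Lemma u_mulr1 : right_id (u_one R) (u_mul q).
Proof.
apply: u_eq_linear => [||l c m n lc ml nl]; [exact: u_mul_linearl|by []|].
rewrite u_oneE u_mul_attach ?addr0 ?su_mulr1 //; last exact: parity_tsu.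
exact: parity_oddz.
Qed.

Lemma u_starK : involutive (u_star q).
Proof.
apply: u_eq_linear => [||l c m n lc ml nl]; [|by []|].
  exact: comp_anti_anti u_star_antilinear u_star_antilinear.
have P1 := parity_oddz m n lc.
apply: etrans (congr1 (u_star q) (u_star_attach P1)) _.
by rewrite u_star_attach ?oddzN ?su_starK ?opprK //; exact: parity_star.
Qed.

Lemma u_star_mul a b : u_star q (u_mul q a b) = u_mul q (u_star q b) (u_star q a).
Proof.
move: a; apply: u_eq_antilinear => [||l c m n lc ml nl].
- exact: comp_anti_linear u_star_antilinear (u_mul_linearl b).
- exact: comp_linear_anti (u_mul_linear _) u_star_antilinear.
move: b; apply: u_eq_antilinear => [||l' c' m' n' lc' ml' nl'].
- exact: comp_anti_linear u_star_antilinear (u_mul_linear _).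
- exact: comp_linear_anti (u_mul_linearl _) u_star_antilinear.
have P1 := parity_oddz m n lc; have P2 := parity_oddz m' n' lc'.
apply: etrans (congr1 (u_star q) (u_mul_attach P1 P2)) _.
apply: etrans (esym (congr2 (u_mul q) (u_star_attach P2) (u_star_attach P1))).
apply: etrans (u_star_attach _) _; first by rewrite oddzD; exact: parity_mul.
apply: etrans (esym (u_mul_attach _ _)); [|rewrite oddzN; exact: parity_star..].
by apply: (congr2 (attach (R := R)) _ (su_star_mul hq _ _)); rewrite opprD addrC.
Qed.

Lemma u_star_algebra : unital_star_algebra (u_mul q) (u_one R) (u_star q).
Proof.
split; split.
- exact: u_mul_linear.
- exact: u_mul_linearl.
- exact: u_mulA.
- exact: u_mul1.
- exact: u_mulr1.
- exact: u_star_antilinear.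
- exact: u_starK.
- exact: u_star_mul.
Qed.

Definition tu (l : nat) c (m n : nat) : CU R :=
  if odd l == oddz c then ((haar_norm q l m)^-1)%:C *: attach c (tsu l m n) else 0.

Lemma tuE l c m n : odd l = oddz c -> tu l c m n = ((haar_norm q l m)^-1)%:C *: attach c (tsu l m n).
Proof. by move=> lc; rewrite /tu lc eqxx. Qed.

Definition tu_valid (l : nat) c (m n : nat) : bool :=
  [&& odd l == oddz c, (m <= l)%N & (n <= l)%N].

Definition u_ip a b : R[i] := haar (u_mul q (u_star q a) b).

Lemma tu_invalid l c m n : ~~ tu_valid l c m n -> tu l c m n = 0.
Proof.
rewrite /tu_valid /tu; case: (odd l == oddz c) => //= mn.
by rewrite tsu.unlock (negbTE mn) (linearE0 (attach_linear c)) scaler0.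
Qed.

Lemma u_ip_linear a : linear (u_ip a : CU R -> R[i]^o).
Proof. exact: (comp_linear haar_linear (u_mul_linear _)). Qed.

Lemma u_ip0r a : u_ip a 0 = 0. Proof. exact: (linearE0 (u_ip_linear a)). Qed.

Lemma u_ip0l a : u_ip 0 a = 0.
Proof.
rewrite /u_ip (antilinear0 u_star_antilinear) (linearE0 (u_mul_linearl a)).
exact: (linearE0 haar_linear).
Qed.

Lemma u_ipZZ (z z' : R[i]) a b : u_ip (z *: a) (z' *: b) = conjc z * z' * u_ip a b.
Proof.
have -> : u_ip (z *: a) (z' *: b) = z' * u_ip (z *: a) b by exact: (linearEZ (u_ip_linear _)).
rewrite /u_ip (antilinearZ _ _ u_star_antilinear) (linearEZ (u_mul_linearl b)).
rewrite (linearEZ haar_linear) mulrCA mulrA.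
by [].
Qed.

Lemma u_ip_attach c d t u : parity (oddz c) t -> parity (oddz d) u ->
  u_ip (attach c t) (attach d u) = (c == d)%:R * su_haar (su_mul q (su_star q t) u).
Proof.
move=> tc ud; rewrite /u_ip u_star_attach // u_mul_attach ?oddzN //; last exact: parity_star.
rewrite haar_attach ?oddzD ?oddzN; last by apply: parity_mul => //; exact: parity_star.
by rewrite addrC subr_eq0 eq_sym.
Qed.

Lemma u_ip_tu l c m n l' c' m' n' : u_ip (tu l c m n) (tu l' c' m' n') =
  (tu_valid l c m n && [&& l == l', c == c', m == m' & n == n'])%:R.
Proof.
have [v|v] := boolP (tu_valid l c m n); last by rewrite (tu_invalid v) u_ip0l.
have [v'|v'] := boolP (tu_valid l' c' m' n'); last first.
  rewrite (tu_invalid v') u_ip0r /=; case: and4P => // -[/eqP e1 /eqP e2 /eqP e3 /eqP e4].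
  by rewrite -e1 -e2 -e3 -e4 v in v'.
have /and3P[lc ml nl] := v; have /and3P[lc' ml' nl'] := v'.
rewrite /tu lc lc' u_ipZZ (u_ip_attach (parity_oddz m n (eqP lc)) (parity_oddz m' n' (eqP lc'))).
rewrite su_haar_orth // conjcR -RcM /=.
case: (eqVneq l l') => [<-|_]; last by rewrite !(mul0r, mulr0).
case: (eqVneq c c') => [_|_]; last by rewrite !(mul0r, mulr0).
case: (eqVneq m m') => [<-|_]; last by rewrite !(mul0r, mulr0).
case: (eqVneq n n') => [_|_]; last by rewrite !(mul0r, mulr0).
rewrite !mul1r -RcM /= -Rc1; congr _%:C.
by have := haar_norm_gt0 hq l m => /lt0r_neq0 n0; field.
Qed.

End CUAlgebra.
Arguments parity_oddz {R l c} m n _.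

Lemma scale_eq (K : nzRingType) (V : lmodType K) (z x n w : K) (u v : V) :
  u = n *: v -> z * x * n = w -> z *: (x *: u) = w *: v.
Proof. by move=> -> <-; rewrite !scalerA. Qed.

Lemma scale_eq0 (K : nzRingType) (V : lmodType K) (z x w : K) (u v : V) :
  x = 0 -> w = 0 -> z *: (x *: u) = w *: v.
Proof. by move=> -> ->; rewrite !scale0r scaler0. Qed.

Lemma sum_linear_image (K : nzRingType) (V W : lmodType K) (f : V -> W) (I : finType)
    (F : I -> V) (G : I -> W) x :
  linear f -> (forall i, G i = f (F i)) -> \sum_i F i = x -> \sum_i G i = f x.
Proof.
by move=> lf GF <-; rewrite (linearE_sum lf); apply: eq_bigr => i _; exact: GF.
Qed.

Lemma linear_comb4 (K : nzRingType) (V W : lmodType K) (f : V -> W) (S : W -> Prop)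
    (x x' y y' z z' : K) (t1 t2 t3 t4 : V) :
  linear f -> (forall u v, S u -> S v -> S (u + v)) ->
  S ((x * y) *: f t1) -> S ((x * z) *: f t2) -> S ((x' * y') *: f t3) -> S ((x' * z') *: f t4) ->
  S (f (x *: (y *: t1 + z *: t2) + x' *: (y' *: t3 + z' *: t4))).
Proof.
move=> lf SD; rewrite (linearE2 lf) !(linearE2 lf _ _ t1) !(linearE2 lf _ _ t3) => s1 s2 s3 s4.
by rewrite !scalerDr !scalerA; exact: (SD _ _ (SD _ _ s1 s2) (SD _ _ s3 s4)).
Qed.

(** * Left multiplication by the generators *)

Section CUProducts.
Variables (R : realType) (q : R).
Hypothesis hq : 0 < q < 1.

Local Notation tsu := (tsu R).
Local Notation cgU := (cgU q).
Local Notation cgD := (cgD q).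
Local Notation tu := (tu q).
Implicit Types (t u : CSU R) (a b : CU R) (c d : int).

(* Left multiplication by t^{1/2} acts on the row index by the Clebsch-Gordan
   coefficients, rescaled by the norms. *)
Definition rowU l (a : bool) m : R[i] := cgU l a m * (haar_norm q l.+1 (a + m) / haar_norm q l m)%:C.
Definition rowD l (a : bool) m : R[i] :=
  cgD l a m * (haar_norm q l.-1 (a + m).-1 / haar_norm q l m)%:C.

Lemma oddz_gen l c d : odd l = oddz c -> oddz d -> odd l.+1 = oddz (d + c).
Proof. by move=> lc od; rewrite oddzD od /= lc. Qed.

Lemma attach_tsu l c m n : odd l = oddz c ->
  attach c (tsu l m n) = (haar_norm q l m)%:C *: tu l c m n.
Proof.
move=> lc; rewrite (tuE q m n lc) scalerA -RcM mulfV ?scale1r //.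
by rewrite gt_eqF // haar_norm_gt0.
Qed.

(** The norm of a matrix coefficient does not depend on its column, so only the row coefficients are
    rescaled. *)
Lemma u_mul_gen d l c (a b : bool) m n : oddz d -> odd l = oddz c -> (m <= l)%N -> (n <= l)%N ->
  u_mul q (attach d (tsu 1 a b)) (tu l c m n) =
  (rowU l a m * cgU l b n) *: tu l.+1 (d + c) (a + m) (b + n)
  + (rowD l a m * cgD l b n) *: tu l.-1 (d + c) (a + m).-1 (b + n).-1.
Proof.
move=> od lc ml nl; have lc1 := oddz_gen lc od.
have N0 k i : (haar_norm q k i)%:C != 0 :> R[i] by rewrite Rc_eq0 gt_eqF // haar_norm_gt0.
have E := etrans (congr1 (attach (R := R) (d + c)) (su_mul1E hq a b ml nl))
  (linearE2 (attach_linear _) _ _ _ _).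
have P1 : parity (oddz d) (tsu 1 a b) by rewrite od; exact: parity_tsu.
have {P1}E := etrans (u_mul_attach hq P1 (parity_oddz m n lc)) E.
have E0 : u_mul q (attach d (tsu 1 a b)) (tu l c m n) = ((haar_norm q l m)^-1)%:C *:
    u_mul q (attach d (tsu 1 a b)) (attach c (tsu l m n)).
  by rewrite /(tu l c m n) lc eqxx; exact: (linearEZ (u_mul_linear q _)).
apply: etrans E0 _; apply: etrans (congr1 _ E) _; apply: etrans (scalerDr _ _ _) _.
apply: (congr2 (fun u v : CU R => u + v)).
  by apply: scale_eq (attach_tsu _ _ lc1) _; rewrite /rowU RcM !RcV; ring.
case: l lc ml nl lc1 {E} => [|l] lc ml nl lc1.
  move: ml nl; rewrite !leqn0 => /eqP -> /eqP ->.
  by apply: scale_eq0; rewrite (cgD0 hq b) mulr0.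
have lc0 : odd l = oddz (d + c) by rewrite -lc1 /= negbK.
have E : rowD l.+1 a m = cgD l.+1 a m * (haar_norm q l (a + m).-1 / haar_norm q l.+1 m)%:C by [].
by apply: scale_eq (attach_tsu _ _ lc0) _; rewrite E RcM !RcV; ring.
Qed.

Lemma u_sum_star l c n : odd l = oddz c -> (n <= l)%N ->
  \sum_(m < l.+1) u_mul q (u_star q (attach c (tsu l m n))) (attach c (tsu l m n)) = u_one R.
Proof.
move=> lc nl; have e (m : 'I_l.+1) : u_mul q (u_star q (attach c (tsu l m n))) (attach c (tsu l m n)) =
    attach 0 (su_mul q (su_star q (tsu l m n)) (tsu l m n)).
  have P := parity_oddz (R := R) m n lc; move: (tsu l m n) P => t P.
  apply: etrans (congr1 (fun a => u_mul q a _) (u_star_attach hq P)) _.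
  apply: etrans (u_mul_attach hq _ P) _; last by rewrite addNr.
  by rewrite oddzN; exact: parity_star.
rewrite u_oneE; apply: (sum_linear_image (attach_linear 0) e).
by rewrite (sum_star_tsu hq nl nl) eqxx scale1r.
Qed.

Lemma u_ip_adj (t a b : CU R) : u_ip q (u_mul q t a) b = u_ip q a (u_mul q (u_star q t) b).
Proof.
apply: (congr1 (@haar R)); apply: (etrans (congr1 (fun x => u_mul q x b) (u_star_mul hq t a))).
by apply/esym; exact: (u_mulA hq).
Qed.

(** The algebra is generated by the coefficients of V_{1/2} of charges 1/2 and -1/2. Unitarity
    provides the integral powers of z, after which [tsu_succ] raises the spin while the charge is
    adjusted by one generator at a time. *)
Lemma u_gen_ind (S : CU R -> Prop) :
  (forall (z : R[i]) a b, S a -> S b -> S (z *: a + b)) ->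
  (forall a b, S a -> S b -> S (u_mul q a b)) -> S (u_one R) ->
  (forall d (a b : bool), (d == 1) || (d == -1) -> S (attach d (tsu 1 a b))) ->
  forall a, S a.
Proof.
move=> Sl Sm S1 Sg.
have S0 : S 0 by have := Sl (-1) _ _ S1 S1; rewrite scaleN1r addNr.
have SZ (z : R[i]) a : S a -> S (z *: a) by move=> Sa; rewrite -[_ *: _]addr0; exact: Sl.
have SD a b : S a -> S b -> S (a + b) by move=> Sa Sb; rewrite -[a]scale1r; exact: Sl.
(* The adjoint of a coefficient of V_{1/2} is a multiple of another one. Giving both factors of the
   unitarity relation the charge [d], instead of opposite charges, produces the power of z of charge
   [d + d]. *)
have S2 d : (d == 1) || (d == -1) -> S (attach (d + d) (tsu 0 0 0)).
  move=> d1; have od : oddz d by case/orP: d1 => /eqP ->.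
  have Ss : forall (F : 'I_2 -> CU R), (forall m, S (F m)) -> S (\sum_m F m).
    by move=> F SF; elim/big_rec: _ => // m x _; exact: SD.
  have := sum_star_tsu hq (leq0n 1) (leq0n 1); rewrite eqxx scale1r => e1.
  rewrite -(sum_linear_image (attach_linear (d + d)) (fun m => erefl) e1).
  apply: Ss => m; have m1 := leq_ord m.
  have P1 : parity (oddz d) (tsu 1 m 0) by rewrite od; exact: parity_tsu.
  rewrite -(u_mul_attach hq (parity_star hq P1) P1).
  apply: Sm; last by case: (val m) m1 => [|[|//]] _; [exact: (Sg d false false)|exact: (Sg d true false)].
  rewrite su_star_tsu // (linearEZ (attach_linear _)); apply: SZ.
  by case: (val m) m1 => [|[|//]] _; [exact: (Sg d true true)|exact: (Sg d false true)].
have Se k : S (attach (k + k) (tsu 0 0 0)).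
  have step e : (e == 1) || (e == -1) -> forall j, S (attach ((e + e) *+ j) (tsu 0 0 0)).
    move=> e1; elim=> [|j IH]; first by rewrite mulr0n -u_oneE.
    rewrite mulrS -(su_mul1 hq (tsu 0 0 0)) -(u_mul_attach hq).
    - exact: Sm (S2 _ e1) IH.
    - by rewrite oddzD addbb; exact: parity_tsu.
    - suff -> : oddz ((e + e) *+ j) = false by exact: parity_tsu.
      by rewrite mulrnDl oddzD addbb.
  case: k => j.
    have -> : Posz j + Posz j = (1 + 1) *+ j by rewrite -mulr_natr natz; ring.
    exact: step.
  have -> : Negz j + Negz j = (-1 + -1) *+ j.+1 by rewrite NegzE -mulr_natr natz; ring.
  exact: step.
have Sall l : forall c m n, odd l = oddz c -> (m <= l)%N -> (n <= l)%N ->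
    S (attach c (tsu l m n)).
  elim: l => [|l IH] c m n lc.
    rewrite !leqn0 => /eqP -> /eqP ->.
    have [k ->] : exists k : int, c = k + k.
      by exists (c %/ 2)%Z; move: lc; rewrite /oddz; lia.
    exact: Se.
  move=> ml nl; rewrite (tsu_succ hq ml nl).
  have lc1 : odd l = oddz (c - 1).
    by rewrite oddzD -lc /= -[oddz (-1)]/true addbT negbK.
  have main (a b : bool) i j : (i <= l)%N -> (j <= l)%N ->
      S (attach c (su_mul q (tsu 1 a b) (tsu l i j))).
    move=> il jl; rewrite (_ : c = 1 + (c - 1)); last by ring.
    rewrite -(u_mul_attach hq); [|exact: parity_tsu|exact: parity_oddz].
    by apply: Sm; [exact: Sg|exact: IH].
  (* A Clebsch-Gordan coefficient vanishes whenever its partner has an index out of range, so only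
     terms with nonzero coefficient need the induction hypothesis. *)
  have term (z : R[i]) (a b : bool) i j : (z != 0 -> (i <= l)%N /\ (j <= l)%N) ->
      S (z *: attach c (su_mul q (tsu 1 a b) (tsu l i j))).
    move=> zij; have [->|/zij[il jl]] := eqVneq z 0; first by rewrite scale0r.
    by apply: SZ; exact: main.
  have A0 j : (cgA (sq_q q)%:C (fun n => (sq_num q n)%:C) l j != 0 -> (0 < j)%N :> Prop).
    by case: j => // /negP; rewrite (cgA0 (cgs_sqr hq)) eqxx.
  have B0 j : (j <= l.+1)%N -> (cgB (sq_q q)%:C (fun n => (sq_num q n)%:C) l j != 0 -> (j <= l)%N :> Prop).
    rewrite leq_eqVlt => /predU1P[->|//]; by rewrite (cgB_top (cgs_sqr hq)) eqxx.
  apply: (linear_comb4 (attach_linear c)) => //; apply: term;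
    rewrite mulf_eq0 negb_or => /andP[x0 y0]; split.
  - by have := A0 _ x0; lia.
  - by have := A0 _ y0; lia.
  - by have := A0 _ x0; lia.
  - by exact: B0 nl y0.
  - by exact: B0 ml x0.
  - by have := A0 _ y0; lia.
  - by exact: B0 ml x0.
  - by exact: B0 nl y0.
elim/malg_ind => [//|z x a Sa]; apply: Sl => //.
by apply: (@u_basis_eq _ S) => l c m n; exact: Sall.
Qed.

End CUProducts.

(** * The completion *)

Lemma fourier_dense (R : realType) (V H : lmodType R[i]) (ip : H -> H -> R[i]) (j : V -> H)
    (I : countType) (e : I -> V) : hilbert_space ip -> linear j ->
  orthonormal ip (fun i => j (e i)) -> complete_family ip (fun i => j (e i)) -> hdense ip (range j).
Proof.
move=> hH lj eON eC x d d0.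
have /(hcvgP ip)/(_ _ d0)[N /(_ N (leqnn N)) hN] := fourier hH eON eC x.
exists (j (\sum_(i <- prefix_enum I N) ip (j (e i)) x *: e i)); first by [].
rewrite (hnorm_subC hH.1) (linearE_sum lj); apply: le_lt_trans hN.
by under eq_bigr do rewrite (linearEZ lj).
Qed.

Lemma fourier_seq (R : realType) (V H : lmodType R[i]) (ip : H -> H -> R[i]) (j : V -> H) x :
  inner_product ip -> hdense ip (range j) -> exists u : nat -> V, hcvg ip (fun n => j (u n)) x.
Proof.
move=> ipP dj.
have hu n : exists u, hnorm ip (x - j u) < n.+1%:R^-1.
  have n0 : 0 < n.+1%:R^-1 :> R by rewrite invr_gt0.
  by have [_ [u _ <-] hu] := dj x _ n0; exists u.
have {hu}[u hu] := choice hu; exists u; apply/hcvgP => e e0.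
have [N hN] := ltr_add_invr (y := 0) (x := e) e0; exists N => n nN.
rewrite (hnorm_subC ipP); apply: lt_trans (hu n) _.
apply: le_lt_trans (_ : N.+1%:R^-1 < e); last by move: hN; rewrite add0r.
by rewrite lef_pV2 ?posrE ?ltr0n // ler_nat.
Qed.

Lemma dense_adjoint (R : realType) (V H : lmodType R[i]) (ip : H -> H -> R[i]) (j : V -> H)
    (S T : H -> H) : inner_product ip -> hdense ip (range j) ->
  bounded_op ip S -> bounded_op ip T ->
  (forall a b, ip (S (j a)) (j b) = ip (j a) (T (j b))) ->
  forall x y, ip (S x) y = ip x (T y).
Proof.
move=> ipP dj bS bT h.
have half x b : ip (j b) (S x) = ip (T (j b)) x.
  have [u hu] := fourier_seq x ipP dj.
  have := ip_lim_eq (c := 1) ipP hu (hcvg_bounded bS hu).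
  rewrite -[RHS]mul1r; apply => n /=.
  by rewrite mul1r (ip_conj ipP) h -(ip_conj ipP).
move=> x y; have [u hu] := fourier_seq y ipP dj.
have := ip_lim_eq (c := 1) ipP (hcvg_bounded bT hu) hu.
rewrite -[RHS]mul1r; apply => n /=.
by rewrite mul1r (ip_conj ipP) half -(ip_conj ipP).
Qed.

Definition u_label := (nat * int * nat * nat)%type.

Section Completion.
Variables (R : realType) (q : R).
Hypothesis hq : 0 < q < 1.
Implicit Types (a b : CU R) (k : u_label).

Definition tl k : CU R := tu q k.1.1.1 k.1.1.2 k.1.2 k.2.
Definition label_valid k : bool := tu_valid k.1.1.1 k.1.1.2 k.1.2 k.2.

Lemma u_ip_tl k k' : u_ip q (tl k) (tl k') = (label_valid k && (k == k'))%:R.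
Proof.
rewrite /tl u_ip_tu //; case: k k' => [[[l c] m] n] [[[l' c'] m'] n'] /=.
by congr ((_ && _)%:R); rewrite !xpair_eqE -!andbA.
Qed.

Lemma u_ip_antilinear b : antilinear (fun a => u_ip q a b : R[i]^o).
Proof.
have lf : linear (fun a => haar (u_mul q a b) : R[i]^o).
  exact: (comp_linear (@haar_linear R) (u_mul_linearl q b)).
exact: (comp_linear_anti lf (u_star_antilinear q)).
Qed.

Lemma u_spanned (x : u_index) : exists2 z : R[i], exists k, label_valid k /\ (<< x >> : CU R) = z *: tl k & True.
Proof.
apply: (@u_basis_eq R (fun a => exists2 z : R[i], exists k, label_valid k /\ a = z *: tl k & True)).
move=> l c m n lc ml nl; exists (haar_norm q l m)%:C => //; exists (l, c, m, n).
split; last exact: (attach_tsu hq).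
by rewrite /label_valid /tu_valid /= lc eqxx ml nl.
Qed.

Lemma u_eq_linear_tl (V : lmodType R[i]) (f g : CU R -> V) : linear f -> linear g ->
  (forall k, label_valid k -> f (tl k) = g (tl k)) -> f =1 g.
Proof.
move=> lf lg fg; apply: malg_eq_linear => // x; have [z [k [kv ->]] _] := u_spanned x.
by rewrite (linearEZ lf) (linearEZ lg) fg.
Qed.

Lemma u_eq_antilinear_tl (V : lmodType R[i]) (f g : CU R -> V) : antilinear f -> antilinear g ->
  (forall k, label_valid k -> f (tl k) = g (tl k)) -> f =1 g.
Proof.
move=> lf lg fg; apply: malg_eq_antilinear => // x; have [z [k [kv ->]] _] := u_spanned x.
by rewrite (antilinearZ _ _ lf) (antilinearZ _ _ lg) fg.
Qed.

(** Each basis element is a nonzero multiple of some [tl q k], so the coefficients of an element are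
    recovered from its inner products. *)
Lemma u_ip_faithful t s : (forall k, u_ip q (tl k) t = u_ip q (tl k) s) -> t = s.
Proof.
move=> ts; apply/malgP => x; have [z [k [kv e]] _] := u_spanned x.
have z0 : z != 0.
  apply/eqP => z0; have := congr1 (mcoeff x) (etrans e (etrans (congr1 (fun w => w *: tl k) z0) (scale0r _))).
  by rewrite mcoeffUU mcoeff0 => /eqP; rewrite oner_eq0.
have ipx (b : CU R) : u_ip q << x >> b = conjc z * u_ip q (tl k) b.
  exact: (etrans (congr1 (fun a => u_ip q a b) e) (antilinearZ z (tl k) (u_ip_antilinear b))).
have l1 : linear (fun b : CU R => u_ip q << x >> b : R[i]^o) by exact: u_ip_linear.
have l2 : linear (fun b : CU R => (nsqc z)%:C * b@_x : R[i]^o).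
  by move=> w a b; rewrite mcoeffD mcoeffZ mulrDr mulrCA.
have main : (fun b : CU R => u_ip q << x >> b) =1 (fun b => (nsqc z)%:C * b@_x).
  apply: (malg_eq_linear l1 l2) => x'; have [z' [k' [kv' e']] _] := u_spanned x'.
  have ipx' : u_ip q (tl k) << x' >> = z' * (k == k')%:R.
    apply: (etrans (etrans (congr1 (u_ip q (tl k)) e') (linearEZ (u_ip_linear q (tl k)) z' (tl k')))).
    by rewrite u_ip_tl kv.
  rewrite ipx mcoeffU ipx'; have [xx'|xx'] := eqVneq x' x.
    have ipz : u_ip q (tl k) << x >> = z.
      apply: (etrans (etrans (congr1 (u_ip q (tl k)) e) (linearEZ (u_ip_linear q (tl k)) z (tl k)))).
      by rewrite u_ip_tl kv eqxx; exact: mulr1.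
    rewrite -xx' ipx' in ipz.
    by rewrite ipz mul_conjc mulr1.
  rewrite mulr0; have [kk'|_] := eqVneq k k'; last by rewrite !mulr0.
  have := congr1 (mcoeff x) e'; rewrite mcoeffU (negbTE xx') mcoeffZ -kk' => /esym/eqP.
  rewrite mulf_eq0 => /orP[/eqP -> |/eqP k0]; first by rewrite mul0r mulr0.
  have := congr1 (mcoeff x) e; rewrite mcoeffUU mcoeffZ k0 mulr0 => /eqP.
  by rewrite oner_eq0.
have h b : b@_x = ((nsqc z)%:C)^-1 * (conjc z * u_ip q (tl k) b).
  by rewrite -ipx main mulKf // Rc_eq0 nsqc_eq0.
by rewrite !h ts.
Qed.

Section Existence.
Let I : countType := {k : u_label | label_valid k}.

Let coef a (i : I) : R[i] := u_ip q (tl (val i)) a.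

Let coef_linear (z : R[i]) a b : coef (z *: a + b) = z *: coef a + coef b.
Proof. by apply/funext => i; exact: u_ip_linear. Qed.

Let coef_tl (i : I) : coef (tl (val i)) = @ell2_delta_fun R I i.
Proof.
apply/funext => i'; rewrite /coef u_ip_tl (valP i') /ell2_delta_fun.
by congr (nat_of_bool _)%:R; rewrite -(inj_eq val_inj).
Qed.

Let coef_ell2 a : coef a \in @ell2_pred R I.
Proof.
have [cl0 cl] := @ell2_submod_closed R I.
have comb z a' b : coef a' \in @ell2_pred R I -> coef b \in @ell2_pred R I ->
    coef (z *: a' + b) \in @ell2_pred R I.
  by move=> ha hb; exact: (eq_ind_r (fun f => f \in @ell2_pred R I) (cl z _ _ ha hb) (coef_linear z a' b)).
have c0 : coef 0 \in @ell2_pred R I.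
  by rewrite (_ : coef 0 = 0) //; apply/funext => i; exact: u_ip0r.
have cb x : coef << x >> \in @ell2_pred R I.
  have [w [k [kv e]] _] := u_spanned x.
  have {}e : << x >> = w *: tl k + 0 by exact: (etrans e (esym (addr0 _))).
  apply: (eq_ind_r (fun b => coef b \in @ell2_pred R I) _ e); apply: (comb _ _ _ _ c0).
  have -> : coef (tl k) = @ell2_delta_fun R I (Sub k kv) by exact: (coef_tl (Sub k kv)).
  exact: ell2_delta_summable.
have step (z : R[i]) x a' : coef a' \in @ell2_pred R I -> coef (z *: << x >> + a') \in @ell2_pred R I.
  by move=> ha; exact: (comb z << x >> a' (cb x) ha).
by move: a; exact: (@malg_ind _ _ (fun a => coef a \in @ell2_pred R I) c0 step).
Qed.

Let Lam a : ell2 R I := Sub (coef a) (coef_ell2 a).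

Let Lam_linear : linear Lam.
Proof. by move=> z a b; apply/val_inj; exact: coef_linear. Qed.

Let Lam_tl (i : I) : Lam (tl (val i)) = ell2_delta R i.
Proof. by apply/val_inj; exact: coef_tl. Qed.

(** The completion is modelled on square summable families over the valid labels: an element goes to
    its coefficients on the normalized matrix coefficients. *)
Lemma L2_exists : exists (L : lmodType R[i]) (ip : L -> L -> R[i]) (Lam : CU R -> L),
  is_L2 q ip Lam.
Proof.
exists (ell2 R I), (@ell2_ip R I), Lam; have hH := ell2_hilbert R I; have ipP := hH.1.
have dC (x : ell2 R I) i : ell2_ip (Lam (tl (val i))) x = ell2_coef x i.
  by rewrite Lam_tl ell2_delta_coef.
split=> // [a b|].
- move: a; apply: (@u_eq_antilinear_tl R[i]^o _ _ _ (u_ip_antilinear b)).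
    by move=> z a a'; rewrite Lam_linear (ipDl ipP) (ipZl ipP).
  by move=> k kv; exact: (dC (Lam b) (Sub k kv : I)).
have eON : orthonormal (@ell2_ip R I) (fun i : I => Lam (tl (val i))).
  split=> [i j ij|i]; first rewrite dC /ell2_coef /= coef_tl /ell2_delta_fun.
    by case: eqP ij.
  by right; rewrite dC /ell2_coef /= coef_tl /ell2_delta_fun eqxx.
have eC : complete_family (@ell2_ip R I) (fun i : I => Lam (tl (val i))).
  by move=> x hx; apply/val_inj/funext => i; rewrite -[LHS]dC hx.
exact: (fourier_dense hH Lam_linear eON eC).
Qed.

End Existence.

Variables (L : lmodType R[i]) (ip : L -> L -> R[i]) (Lam : CU R -> L).
Hypothesis hL : is_L2 q ip Lam.

Lemma L2_hilbert : hilbert_space ip. Proof. by case: hL. Qed.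
Lemma L2_linear : linear Lam. Proof. by case: hL. Qed.
Lemma L2_ip a b : ip (Lam a) (Lam b) = u_ip q a b. Proof. by case: hL => _ _ ->. Qed.
Lemma L2_dense : hdense ip (range Lam). Proof. by case: hL. Qed.

Let ipP : inner_product ip := L2_hilbert.1.

Lemma L2_complete : complete_family ip (fun k => Lam (tl k)).
Proof.
move=> x hx; apply: (hdense_orth ipP L2_dense) => _ [a _ <-].
move: a; apply: (@u_eq_antilinear_tl R[i]^o) => [z a b|z a b|k kv].
- by rewrite L2_linear (ipDl ipP) (ipZl ipP).
- by rewrite scaler0 addr0.
- exact: hx.
Qed.

(* [t] and the other matrix coefficients of its column form an isometry. *)
Lemma left_mul_bounded t : exists2 M : R, 0 <= M &
  forall a, nsq ip (Lam (u_mul q t a)) <= M ^+ 2 * nsq ip (Lam a).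
Proof.
have lM z x t' (M N : R) : 0 <= M -> 0 <= N ->
    (forall a, nsq ip (Lam (u_mul q x a)) <= M ^+ 2 * nsq ip (Lam a)) ->
    (forall a, nsq ip (Lam (u_mul q t' a)) <= N ^+ 2 * nsq ip (Lam a)) ->
    forall a, nsq ip (Lam (u_mul q (z *: x + t') a)) <=
      (Num.sqrt (nsqc z) * M + N) ^+ 2 * nsq ip (Lam a).
  move=> M0 N0 hM hN a.
  have -> : Lam (u_mul q (z *: x + t') a) = z *: Lam (u_mul q x a) + Lam (u_mul q t' a).
    exact: etrans (congr1 Lam (u_mul_linearl q a z x t')) (L2_linear _ _ _).
  have s0 := sqrtr_ge0 (nsqc z).
  have hn (y w : L) (K : R) : 0 <= K -> nsq ip y <= K ^+ 2 * nsq ip w -> hnorm ip y <= K * hnorm ip w.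
    move=> K0; rewrite -!(sqr_hnorm ipP) -exprMn ler_pXn2r ?nnegrE ?mulr_ge0 ?hnorm_ge0 //.
  rewrite -!(sqr_hnorm ipP) -exprMn ler_pXn2r ?nnegrE ?mulr_ge0 ?addr_ge0 ?mulr_ge0 ?hnorm_ge0 //.
  apply: le_trans (hnormD ipP _ _) _; rewrite mulrDl (hnormZ ipP) -mulrA.
  by apply: lerD; [apply: ler_wpM2l => //; exact: hn | exact: hn].
elim/malg_ind: t => [|z x t [N N0 hN]].
  exists 0 => // a; have -> : u_mul q 0 a = 0 by exact: (linearE0 (u_mul_linearl q a)).
  by rewrite (linearE0 L2_linear) (nsq0 ipP) expr0n mul0r.
suff hx : forall a, nsq ip (Lam (u_mul q << x >> a)) <= 1 ^+ 2 * nsq ip (Lam a).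
  exists (Num.sqrt (nsqc z) * 1 + N); first by rewrite addr_ge0 ?mulr_ge0 ?sqrtr_ge0.
  exact: lM.
apply: (@u_basis_eq R (fun y => forall a, nsq ip (Lam (u_mul q y a)) <= 1 ^+ 2 * nsq ip (Lam a))).
move=> l c m n lc ml nl a; rewrite expr1n mul1r.
pose y (i : 'I_l.+1) := attach c (tsu R l i n).
have nE (b : CU R) : nsq ip (Lam b) = complex.Re (u_ip q b b) by rewrite /nsq L2_ip.
have sE : \sum_(i < l.+1) nsq ip (Lam (u_mul q (y i) a)) = nsq ip (Lam a).
  have lf : linear (fun b => u_ip q a (u_mul q b a) : R[i]^o).
    exact: comp_linear (u_ip_linear q a) (u_mul_linearl q a).
  have := sum_linear_image lf (fun i => erefl) (u_sum_star hq lc nl).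
  rewrite (u_mul1 hq) => /(congr1 (@complex.Re R)); rewrite -nE => <-.
  rewrite raddf_sum; apply: eq_bigr => i _; apply: etrans (nE _) _.
  apply: (congr1 (@complex.Re R)); apply: etrans (u_ip_adj hq _ _ _) _.
  exact: (congr1 (u_ip q a) (u_mulA hq _ _ _)).
rewrite -sE (bigD1 (inord m)) //= /y inordK // lerDl.
by apply: sumr_ge0 => i _; exact: nsq_ge0.
Qed.

Lemma left_mulP t : bounded_op ip (left_mul q ip Lam t) /\
  forall a, left_mul q ip Lam t (Lam a) = Lam (u_mul q t a).
Proof.
have [M M0 hM] := left_mul_bounded t.
by have [] := closure_bounded L2_hilbert L2_linear L2_dense (u_mul_linear q t) M0 hM.
Qed.

Lemma left_mul_eq (f g : L -> L) : bounded_op ip f -> bounded_op ip g ->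
  (forall a, f (Lam a) = g (Lam a)) -> f =1 g.
Proof.
move=> bf bg fg x; apply/eqP; rewrite -subr_eq0; apply/eqP.
have bd : bounded_op ip (fun y => (-1) *: g y + f y) by exact: bounded_lin.
have -> : f x - g x = (-1) *: g x + f x by rewrite scaleN1r addrC.
have [_ [M hM]] := bd; apply/eqP; rewrite -(hnorm_eq0 ipP); apply/eqP.
apply: small_eq0 (hnorm_ge0 _ _) => e e0.
have M1 : 0 < `|M| + 1 by have := normr_ge0 M; lra.
have e1 : 0 < e / (`|M| + 1) by rewrite divr_gt0.
have [_ [a _ <-] xa] := L2_dense x e1.
have [lb _] := bd.
have E : (-1) *: g x + f x = (-1) *: g (x - Lam a) + f (x - Lam a).
  have [lf _] := bf; have [lg _] := bg.
  by rewrite (linearEB lf) (linearEB lg) fg !scaleN1r opprB [g _ - g x]addrC addrACA subrr addr0.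
rewrite E; apply: le_trans (hM _) _.
have := ler_norm M; have := hnorm_ge0 ip (x - Lam a).
have eE : e = (`|M| + 1) * (e / (`|M| + 1)) by rewrite mulrC divfK // gt_eqF.
move=> h0 MN; rewrite [leRHS]eE; move: (e / _) xa => d xa.
move: (`|M|) (hnorm ip (x - Lam a)) M1 MN h0 xa => N h N1 MN h0 xa.
nra.
Qed.

Lemma left_mul_linear z s t x :
  left_mul q ip Lam (z *: s + t) x = z *: left_mul q ip Lam s x + left_mul q ip Lam t x.
Proof.
have [b0 h0] := left_mulP (z *: s + t); have [b1 h1] := left_mulP s; have [b2 h2] := left_mulP t.
apply: (left_mul_eq b0 (bounded_lin ipP z b1 b2)) => a; rewrite h0 h1 h2.
exact: etrans (congr1 Lam (u_mul_linearl q a z s t)) (L2_linear _ _ _).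
Qed.

Lemma left_mulM s t x :
  left_mul q ip Lam (u_mul q s t) x = left_mul q ip Lam s (left_mul q ip Lam t x).
Proof.
have [b0 h0] := left_mulP (u_mul q s t); have [b1 h1] := left_mulP s; have [b2 h2] := left_mulP t.
apply: (left_mul_eq b0 (bounded_comp b1 b2)) => a; rewrite h0 h2 h1.
exact: (congr1 Lam (esym (u_mulA hq s t a))).
Qed.

Lemma left_mul1 x : left_mul q ip Lam (u_one R) x = x.
Proof.
have [b0 h0] := left_mulP (u_one R).
apply: (left_mul_eq b0 (bounded_id ip)) => a; rewrite h0.
exact: (congr1 Lam (u_mul1 hq a)).
Qed.

Lemma L2_inj t s : Lam t = Lam s -> t = s.
Proof.
move=> ts; apply: u_ip_faithful => k; rewrite -!L2_ip; exact: (congr1 (ip (Lam (tl k))) ts).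
Qed.

Lemma left_mul_star t x y :
  ip (left_mul q ip Lam (u_star q t) x) y = ip x (left_mul q ip Lam t y).
Proof.
have [[l1 [M1 h1]] e1] := left_mulP (u_star q t); have [[l2 [M2 h2]] e2] := left_mulP t.
have [b1 _] := left_mulP (u_star q t); have [b2 _] := left_mulP t.
apply: (dense_adjoint ipP L2_dense b1 b2) => a b; rewrite e1 e2 2!L2_ip.
apply: etrans (u_ip_adj hq _ _ _) _.
exact: (congr1 (fun s => u_ip q a (u_mul q s b)) (u_starK hq t)).
Qed.

Lemma left_mul_inj t s : (forall x, left_mul q ip Lam t x = left_mul q ip Lam s x) -> t = s.
Proof.
move=> h; have [_ ht] := left_mulP t; have [_ hs] := left_mulP s.
have {}h : Lam t = Lam s.
  have := h (Lam (u_one R)); rewrite ht hs => e.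
  exact: etrans (congr1 Lam (esym (u_mulr1 hq t))) (etrans e (congr1 Lam (u_mulr1 hq s))).
exact: L2_inj.
Qed.

End Completion.

(** * Estimates on Clebsch-Gordan coefficients *)

Section Estimates.
Variables (R : realType) (q : R).
Hypothesis hq : 0 < q < 1.

Local Notation p := (sq_q q).
Local Notation s := (sq_num q).
Let p0 : p != 0. Proof. exact: sq_q_neq0. Qed.
Let s0 n : s n.+1 != 0. Proof. by rewrite gt_eqF ?sq_num_gt0. Qed.
Let pX n : p ^+ n != 0. Proof. by rewrite expf_neq0. Qed.

(* The coefficients for V_{1/2} (x) V_{l/2}, and, primed, for V_{l/2} (x) V_{1/2}. *)
Definition cg1 l n : R := cgA p s l n.
Definition cg2 l n : R := cgB p s l n.
Definition cg1' l n : R := cgA p^-1 s l n.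
Definition cg2' l n : R := cgB p^-1 s l n.

Let s_sqr n : s n ^+ 2 = (p ^+ (2 * n) - p ^- (2 * n)) / (p ^+ 2 - p ^- 2).
Proof. by rewrite sqr_sq_num // qnum_nat. Qed.

Let s_sqrV n : s n ^+ 2 = (p^-1 ^+ (2 * n) - p^-1 ^- (2 * n)) / (p^-1 ^+ 2 - p^-1 ^- 2).
Proof. by rewrite s_sqr !exprVn !invrK -[X in X / _]opprB -[X in _ / X]opprB invrN mulrNN. Qed.

Lemma cg1E l : cgA p%:C (fun n => (s n)%:C) l = (fun n => (cg1 l n)%:C).
Proof. by apply/funext => n; rewrite /cg1 /cgA !(RcM, RcV, RcX). Qed.
Lemma cg2E l : cgB p%:C (fun n => (s n)%:C) l = (fun n => (cg2 l n)%:C).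
Proof. by apply/funext => n; rewrite /cg2 /cgB !(RcM, RcV, RcX). Qed.
Lemma cg1'E l : cgA p%:C^-1 (fun n => (s n)%:C) l = (fun n => (cg1' l n)%:C).
Proof. by apply/funext => n; rewrite /cg1' /cgA !(RcM, RcV, RcX). Qed.
Lemma cg2'E l : cgB p%:C^-1 (fun n => (s n)%:C) l = (fun n => (cg2' l n)%:C).
Proof. by apply/funext => n; rewrite /cg2' /cgB !(RcM, RcV, RcX). Qed.

Lemma cg_norm1 l n : (n <= l.+1)%N -> cg1 l n ^+ 2 + cg2 l n ^+ 2 = 1.
Proof. exact: (cg_norm p0 s_sqr s0). Qed.

Lemma cg_norm1' l n : (n <= l.+1)%N -> cg1' l n ^+ 2 + cg2' l n ^+ 2 = 1.
Proof. by apply: (cg_norm _ s_sqrV s0); rewrite invr_eq0. Qed.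

Lemma cg1_le1 l n : (n <= l.+1)%N -> cg1 l n ^+ 2 <= 1.
Proof. by move=> /cg_norm1 <-; rewrite lerDl sqr_ge0. Qed.

Lemma cg2_le1 l n : (n <= l.+1)%N -> cg2 l n ^+ 2 <= 1.
Proof. by move=> /cg_norm1 <-; rewrite lerDr sqr_ge0. Qed.

Lemma sq_numS n : s n.+1 ^+ 2 = p ^- 2 * s n ^+ 2 + (p ^+ n) ^+ 2.
Proof. exact: (cg_sqrS p0 (sq_q4 hq) s_sqr). Qed.

Lemma sq_numS' n : s n.+1 ^+ 2 = p ^+ 2 * s n ^+ 2 + (p ^+ n) ^- 2.
Proof. exact: (cg_sqrS' p0 (sq_q4 hq) s_sqr). Qed.

(** The two recurrences for [n+1] add up to 2 [n+1] = (q + 1/q) [n] + q^n + q^(-n), which is at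
    least 2 [n] + 2 by the inequality x + 1/x >= 2. *)
Lemma sq_num_ge n : n%:R <= s n ^+ 2.
Proof.
have amgm (x : R) : 0 < x -> 2 <= x + x^-1.
  move=> x0; have : 0 <= (x - 1) ^+ 2 / x by rewrite divr_ge0 ?sqr_ge0 ?ltW.
  have -> : (x - 1) ^+ 2 / x = x + x^-1 - 2 by field; rewrite gt_eqF.
  by rewrite subr_ge0.
elim: n => [|n IH]; first by rewrite sqr_ge0.
have h1 := sq_numS n; have h2 := sq_numS' n.
have /amgm a1 : 0 < p ^+ 2 by rewrite exprn_gt0 // sq_q_gt0.
have /amgm a2 : 0 < (p ^+ n) ^+ 2 by rewrite !exprn_gt0 // sq_q_gt0.
rewrite -natr1; move: (s n.+1 ^+ 2) (s n ^+ 2) IH h1 h2 (sqr_ge0 (s n)) => x y IH h1 h2 y0.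
have : 2 * y <= (p ^+ 2 + p ^- 2) * y by rewrite ler_wpM2r //; lra.
nra.
Qed.

(* The coefficients of the action of t^{1/2} on columns, at the weight of total
   index t of V_{l/2} (x) V_{1/2}, when the spin component has index c. *)
Definition colU l (b c : bool) t : R := if b then cg1 l (t.+1 - c) else cg2 l (t - c).
Definition colD l (b c : bool) t : R := if b then - cg2 l (t.+1 - c) else cg1 l (t - c).

Let E1 l n k : (n + k = l.+1)%N -> cg1 l n = s n / (p ^+ k * s l.+1).
Proof. exact: cgAE. Qed.
Let E2 l n k : (n + k = l.+1)%N -> cg2 l n = p ^+ n * s k / s l.+1.
Proof. exact: cgBE. Qed.
Let E1' l n k : (n + k = l.+1)%N -> cg1' l n = s n * p ^+ k / s l.+1.
Proof. by move=> h; rewrite /cg1' (cgAE _ _ h) exprVn invfM invrK mulrA. Qed.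
Let E2' l n k : (n + k = l.+1)%N -> cg2' l n = s k / (p ^+ n * s l.+1).
Proof. by move=> h; rewrite /cg2' (cgBE _ _ h) exprVn invfM; ring. Qed.

Let sz : s 0 = 0. Proof. exact: sq_num0. Qed.

Ltac fsolve := field; repeat match goal with h : is_true (_ != 0) |- _ => rewrite h; clear h end; rewrite ?p0.

(** An entry of the left action between opposite types. In the names of the four lemmas, the first
    word is the type of the source vector and the second tells whether the spin is raised or
    lowered. A recurrence for q-numbers collapses the difference of two large terms, leaving a
    factor 1/[l+1]. *)
Lemma flip_up_up l (b : bool) t : (t <= l.+1)%N ->
  - (cg1' l t * colU l b true t * cg2' l.+1 (t + b))
  + cg2' l t * colU l b false t * cg1' l.+1 (t + b) =
  (if b then cg2 l.+1 t.+1 else - cg1 l.+1 t) / s l.+1 ^+ 2.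
Proof.
move=> /subnKC tk; move: (l.+1 - t)%N tk => k tk; have sl := s0 l; have sl' := s0 l.+1.
have u0 := pX t; have v0 := pX k.
rewrite (E1' tk) (E2' tk); case: b => /=.
  rewrite subn1 subn0 /= addn1 (E1 tk).
  have tk1 : (t.+1 + k = l.+2)%N by lia.
  rewrite (E1' tk1) (E2' tk1) (E2 tk1); case: k tk v0 tk1 => [|k] tk v0 tk1.
    by rewrite sz !(mul0r, mulr0) oppr0 addr0.
  have tk2 : (t.+1 + k = l.+1)%N by lia.
  have w0 := pX k; rewrite (E1 tk2) ![p ^+ _.+1]exprS.
  transitivity (s k.+1 / (s l.+1 ^+ 2 * s l.+2 * p ^+ t) * (p * s t.+1 ^+ 2 - p^-1 * s t ^+ 2)).
    by fsolve.
  by rewrite (sq_numS t); fsolve.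
rewrite subn0 addn0 (E2 tk).
have tk1 : (t + k.+1 = l.+2)%N by lia.
rewrite (E1' tk1) (E2' tk1) (E1 tk1); case: t tk u0 tk1 => [|t] tk u0 tk1.
  by rewrite sz !(mul0r, mulr0, oppr0, addr0).
have tk2 : (t + k.+1 = l.+1)%N by lia.
have w0 := pX t; rewrite subn1 /= (E2 tk2) ![p ^+ _.+1]exprS.
transitivity (s t.+1 * p ^+ k / (s l.+1 ^+ 2 * s l.+2) * (p * s k ^+ 2 - p^-1 * s k.+1 ^+ 2)).
  by fsolve.
by rewrite (sq_numS' k); fsolve.
Qed.

(** A selection rule: this transition would change the total spin in the tensor product with the
    spinor by 3/2, whereas a generator changes it by 1/2. *)
Lemma flip_down_up l (b : bool) t : (t <= l.+1)%N ->
  - (cg2' l t * colU l b true t * cg1' l.+1 (t + b))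
  + cg1' l t * colU l b false t * cg2' l.+1 (t + b) = 0.
Proof.
move=> /subnKC tk; move: (l.+1 - t)%N tk => k tk; have sl := s0 l; have sl' := s0 l.+1.
have u0 := pX t; have v0 := pX k.
rewrite (E1' tk) (E2' tk); case: b => /=.
  rewrite subn1 subn0 /= addn1 (E1 tk).
  have tk1 : (t.+1 + k = l.+2)%N by lia.
  rewrite (E1' tk1) (E2' tk1); case: k tk v0 tk1 => [|k] tk v0 tk1.
    by rewrite sz !(mul0r, mulr0) oppr0 addr0.
  have tk2 : (t.+1 + k = l.+1)%N by lia.
  have w0 := pX k; rewrite (E1 tk2) ![p ^+ _.+1]exprS.
  by fsolve.
rewrite subn0 addn0 (E2 tk).
have tk1 : (t + k.+1 = l.+2)%N by lia.
rewrite (E1' tk1) (E2' tk1); case: t tk u0 tk1 => [|t] tk u0 tk1.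
  by rewrite sz !(mul0r, mulr0, oppr0, addr0).
have tk2 : (t + k.+1 = l.+1)%N by lia.
have w0 := pX t; rewrite subn1 /= (E2 tk2) ![p ^+ _.+1]exprS.
by fsolve.
Qed.

Lemma flip_up_down l (b : bool) t : (~~ b <= t)%N -> (t + b <= l.+2)%N ->
  - (cg1' l.+1 t * colD l.+1 b true t * cg2' l (t + b).-1)
  + cg2' l.+1 t * colD l.+1 b false t * cg1' l (t + b).-1 = 0.
Proof.
move=> bt tl; have sl := s0 l; have sl' := s0 l.+1.
case: b bt tl => /= bt tl.
  have {}tl : (t + (l.+1 - t) = l.+1)%N by lia.
  move: (l.+1 - t)%N tl => k tk; have tk1 : (t + k.+1 = l.+2)%N by lia.
  have tk2 : (t.+1 + k = l.+2)%N by lia.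
  have u0 := pX t; have v0 := pX k.
  rewrite subn1 subn0 addn1 /= (E1' tk1) (E2' tk1) (E2 tk1) (E2 tk2) (E1' tk) (E2' tk).
  by rewrite ![p ^+ _.+1]exprS; fsolve.
case: t bt tl => [//|t] _; rewrite addn0 subn1 subn0 /= => tl.
have {}tl : (t + (l.+1 - t) = l.+1)%N by lia.
move: (l.+1 - t)%N tl => k tk; have tk1 : (t + k.+1 = l.+2)%N by lia.
have tk2 : (t.+1 + k = l.+2)%N by lia.
have u0 := pX t; have v0 := pX k.
rewrite (E1' tk2) (E2' tk2) (E1 tk1) (E1 tk2) (E1' tk) (E2' tk).
by rewrite ![p ^+ _.+1]exprS; fsolve.
Qed.

Lemma flip_down_down l (b : bool) t : (~~ b <= t)%N -> (t + b <= l.+2)%N ->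
  - (cg2' l.+1 t * colD l.+1 b true t * cg1' l (t + b).-1)
  + cg1' l.+1 t * colD l.+1 b false t * cg2' l (t + b).-1 =
  (if b then cg1 l t else cg2 l t.-1) / s l.+2 ^+ 2.
Proof.
move=> bt tl; have sl := s0 l; have sl' := s0 l.+1.
case: b bt tl => /= bt tl.
  have {}tl : (t + (l.+1 - t) = l.+1)%N by lia.
  move: (l.+1 - t)%N tl => k tk; have tk1 : (t + k.+1 = l.+2)%N by lia.
  have tk2 : (t.+1 + k = l.+2)%N by lia.
  have u0 := pX t; have v0 := pX k.
  rewrite subn1 subn0 addn1 /= (E1' tk1) (E2' tk1) (E2 tk1) (E2 tk2) (E1' tk) (E2' tk) (E1 tk).
  rewrite ![p ^+ _.+1]exprS.
  transitivity (s t * p ^+ k / (s l.+2 ^+ 2 * s l.+1) * (s k.+1 ^+ 2 - p ^+ 2 * s k ^+ 2)).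
    by fsolve.
  by rewrite (sq_numS' k); fsolve.
case: t bt tl => [//|t] _; rewrite addn0 subn1 subn0 /= => tl.
have {}tl : (t + (l.+1 - t) = l.+1)%N by lia.
move: (l.+1 - t)%N tl => k tk; have tk1 : (t + k.+1 = l.+2)%N by lia.
have tk2 : (t.+1 + k = l.+2)%N by lia.
have u0 := pX t; have v0 := pX k.
rewrite (E1' tk2) (E2' tk2) (E1 tk1) (E1 tk2) (E1' tk) (E2' tk) (E2 tk).
rewrite ![p ^+ _.+1]exprS.
transitivity (s k / (p ^+ t * s l.+2 ^+ 2 * s l.+1) * (s t.+1 ^+ 2 - p ^- 2 * s t ^+ 2)).
  by fsolve.
by rewrite (sq_numS t); fsolve.
Qed.

(** After rescaling by the norms the row coefficients are again Clebsch-Gordan coefficients, one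
    level higher, and therefore bounded by 1. *)
Lemma rowUE l (a : bool) m : (m <= l)%N ->
  rowU q l a m = (if a then cg1 l.+1 m.+1 else cg2 l.+1 m.+1)%:C.
Proof.
move=> /subnKC ml; move: (l - m)%N ml => k mk; have sl := s0 l; have sl' := s0 l.+1.
have u0 := pX m; have v0 := pX k.
have mk1 : (m.+1 + k = l.+1)%N by lia. have mk2 : (m + k.+1 = l.+1)%N by lia.
have mk3 : (m.+1 + k.+1 = l.+2)%N by lia.
have sub1 : (l.+1 - m.+1 = k)%N by lia.
have sub2 : (l.+1 - m = k.+1)%N by lia.
have sub3 : (l - m = k)%N by lia.
rewrite /rowU /cgU cg1E cg2E /haar_norm; case: a; rewrite -RcM; congr _%:C.
  rewrite (E1 mk1) (E1 mk3) add1n sub1 sub3 ![p ^+ _.+1]exprS.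
  by fsolve.
rewrite (E2 mk2) (E2 mk3) add0n sub2 sub3 ![p ^+ _.+1]exprS.
by fsolve.
Qed.

Lemma rowDE l (a : bool) m : (~~ a <= m)%N -> (m + a <= l.+1)%N ->
  rowD q l.+1 a m = (if a then - cg2 l m else cg1 l m)%:C.
Proof.
move=> am ml; have sl := s0 l; have sl' := s0 l.+1.
rewrite /rowD /cgD cg1E cg2E /haar_norm; case: a am ml => /= am ml.
  have {}ml : (m + (l - m) = l)%N by lia.
  have [k mk] : exists k, (m + k = l)%N by exists (l - m)%N.
  have kE : (l - m = k)%N by lia.
  have mk1 : (m.+1 + k.+1 = l.+2)%N by lia. have mk2 : (m + k.+1 = l.+1)%N by lia.
  have sub1 : (l.+1 - m = k.+1)%N by lia.
  rewrite -RcN -RcM; congr _%:C; rewrite (E2 mk1) (E2 mk2) kE sub1 ![p ^+ _.+1]exprS.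
  by have u0 := pX m; have v0 := pX k; fsolve.
case: m am ml => [//|m] _ ml; have {}ml : (m + (l - m) = l)%N by lia.
have [k mk] : exists k, (m + k = l)%N by exists (l - m)%N.
  have kE : (l - m = k)%N by lia.
have mk1 : (m.+1 + k.+1 = l.+2)%N by lia. have mk2 : (m.+1 + k = l.+1)%N by lia.
rewrite -RcM; congr _%:C; rewrite (E1 mk1) (E1 mk2) /= subSS kE ![p ^+ _.+1]exprS.
by have u0 := pX m; have v0 := pX k; fsolve.
Qed.

Lemma rowU_le1 l (a : bool) m : (m <= l)%N -> nsqc (rowU q l a m) <= 1.
Proof.
move=> ml; rewrite rowUE // nsqcR.
by case: a; [apply: cg1_le1; lia | apply: cg2_le1; lia].
Qed.

Lemma rowD_le1 l (a : bool) m : (~~ a <= m)%N -> (m + a <= l.+1)%N -> nsqc (rowD q l.+1 a m) <= 1.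
Proof.
move=> am ml; rewrite rowDE // nsqcR; case: a am ml => am ml; rewrite ?sqrrN.
  by apply: cg2_le1; lia.
by apply: cg1_le1; lia.
Qed.

Lemma rowD_eq0 l (a : bool) m : (m <= l)%N -> rowD q l a m != 0 ->
  [/\ (0 < l)%N, (~~ a <= m)%N & (m + a <= l)%N].
Proof.
move=> ml; rewrite /rowD /cgD cg1E cg2E mulf_eq0 negb_or => /andP[h _].
case: a h => /= h.
  have ml' : (m < l)%N.
    rewrite ltn_neqAle ml andbT; apply: contra h => /eqP ->.
    by rewrite (@E2 l l.+1 0) ?addn0 // sz mulr0 mul0r oppr0.
  by split; lia.
have m0 : (0 < m)%N.
  by case: m {ml} h => //; rewrite (@E1 l 0 l.+1) // sz mul0r eqxx.
by split; lia.
Qed.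

End Estimates.

(** * The tensor product with the spinor module *)

(** The coproduct becomes its opposite when k and its inverse are exchanged and p is inverted. The
    product V_{l/2} (x) V_{1/2} is thus treated by the formulas for V_{1/2} (x) V_{l/2};
    [antipode_letter] serves only as the exchange of letters. *)
Lemma is_string_swap (F : fieldType) (p : F) s (M : lmodType F) (op : gen -> M -> M) r v :
  is_string p^-1 s (op \o antipode_letter) r v -> is_string p s op r v.
Proof.
move=> sv n k nk; have [h1 h2 h3 h4] := sv n k nk.
by split; [exact: h1 | exact: h2 | rewrite [LHS]h4 | rewrite [LHS]h3];
  rewrite !exprVn invrK mulrC.
Qed.

Section UnitWords.
Variables (R : realType) (q : R).
Hypothesis hq : 0 < q < 1.
Local Notation p := ((sq_q q)%:C).
Local Notation s := (fun n : nat => (sq_num q n)%:C).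

Definition unit_coef L j : R[i] := rep q L (unit_word L j j) (inord j) (inord j).

Lemma rep_unit_word l L j (a b : 'I_l.+1) : (l <= L)%N -> (j <= L)%N ->
  (rep q l (unit_word L j j) a b != 0) = [&& l == L, (a : nat) == j & (b : nat) == j].
Proof.
move=> lL jL; rewrite -(tfun_unit_word hq (a := a) (b := b) lL _ _ jL jL) -1?ltnS //.
by rewrite /tfun !leq_ord /= !inord_val.
Qed.

Lemma unit_coef_neq0 L j : (j <= L)%N -> unit_coef L j != 0.
Proof. by move=> jL; rewrite /unit_coef rep_unit_word // !inordK ?eqxx. Qed.

Lemma unit_word_sum (V : lmodType R[i]) l L j (v : 'I_l.+1 -> V) n :
  (l <= L)%N -> (j <= L)%N -> \sum_(i < l.+1) rep q l (unit_word L j j) i n *: v i =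
  (if (l == L) && ((n : nat) == j) then unit_coef L j else 0) *: v n.
Proof.
move=> lL jL; rewrite (bigD1 n) //= big1 ?addr0 => [|i ni].
  case: ifP => [/andP[/eqP lE /eqP nj]|lj].
    by rewrite /unit_coef -nj -lE inord_val.
  have -> : rep q l (unit_word L j j) n n = 0; last by [].
  by apply/eqP; rewrite -[_ == _]negbK rep_unit_word // andbb lj.
have -> : rep q l (unit_word L j j) i n = 0; last by rewrite scale0r.
apply/eqP; rewrite -[_ == _]negbK rep_unit_word //; apply/negP => /and3P[_ /eqP i1 /eqP n1].
by case/eqP: ni; apply/val_inj; rewrite /= i1 n1.
Qed.

Lemma unit_word_act (V : lmodType R[i]) (op : gen -> V -> V) (v : nat -> V) l L j n :
  (forall x, linear (op x)) -> is_string p s op l v ->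
  (l <= L)%N -> (j <= L)%N -> (n <= l)%N ->
  word_act op (unit_word L j j) (v n) =
  (if (l == L) && (n == j) then unit_coef L j else 0) *: v n.
Proof.
move=> op_lin sv lL jL nl; have nE : n = (inord n : 'I_l.+1) by rewrite inordK.
rewrite {1}nE (word_act_string hq op_lin) // (unit_word_sum (fun i => v i)) //.
by rewrite -nE.
Qed.

End UnitWords.

Section TensorAction.
Variables (R : realType) (q : R).
Hypothesis hq : 0 < q < 1.
Variables (V : lmodType R[i]) (pt : word -> V -> V).
Hypothesis pt_lin : forall w, linear (pt w).
Hypothesis pt_cat : forall u w a, pt (u ++ w) a = pt u (pt w a).
Hypothesis pt_nil : forall a, pt [::] a = a.

Local Notation p := ((sq_q q)%:C).
Local Notation s := (fun n : nat => (sq_num q n)%:C).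
Local Notation M := {ffun 'I_2 -> V}.

Definition tensor_act (w : word) (u : M) : M :=
  \sum_(x <- coprod w)
    [ffun s' => \sum_(s : 'I_2) rep q 1 x.2 s' s *: pt x.1 (u s)].

Lemma tensor_actE w u i : tensor_act w u i =
  \sum_(x <- coprod w) \sum_(s : 'I_2) rep q 1 x.2 i s *: pt x.1 (u s).
Proof.
rewrite /tensor_act (big_morph (fun v : M => v i) (id1 := 0) (op1 := +%R)).
- by apply: eq_bigr => x _; rewrite ffunE.
- by move=> v v'; rewrite ffunE.
- by rewrite ffunE.
Qed.

Lemma tensor_act_linear w : linear (tensor_act w).
Proof.
move=> z u v; apply/ffunP => i; rewrite ffunE ffunE !tensor_actE.
rewrite scaler_sumr -big_split; apply: eq_bigr => x _ /=.
rewrite scaler_sumr -big_split; apply: eq_bigr => j _ /=.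
by rewrite !ffunE pt_lin scalerDr !scalerA mulrC.
Qed.

Lemma tensor_act_nil u : tensor_act [::] u = u.
Proof.
apply/ffunP => i; rewrite tensor_actE big_seq1 /rep big_nil (bigD1 i) //=.
rewrite big1 ?addr0 => [|j ji]; first by rewrite mxE eqxx scale1r pt_nil.
by rewrite mxE eq_sym (negbTE ji) scale0r.
Qed.

Lemma tensor_act_cons x w u : tensor_act (x :: w) u = tensor_act [:: x] (tensor_act w u).
Proof.
apply/ffunP => i; rewrite !tensor_actE big_coprod_cons big_coprod1.
apply: eq_bigr => a _; under [RHS]eq_bigr do rewrite tensor_actE (linearE_sum (pt_lin _)) scaler_sumr.
rewrite [RHS]exchange_big /=; apply: eq_bigr => b _.
under [RHS]eq_bigr do rewrite (linearE_sum (pt_lin _)) scaler_sumr.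
rewrite [RHS]exchange_big /=; apply: eq_bigr => k _.
rewrite pt_cat /rep big_cat /= -/(rep q 1 a.2) -/(rep q 1 b.2) mxE scaler_suml.
by apply: eq_bigr => j _; rewrite (linearEZ (pt_lin _)) scalerA.
Qed.

Lemma tensor_act_word w u : tensor_act w u = word_act (fun x => tensor_act [:: x]) w u.
Proof.
by elim: w => [|x w IH] /=; [exact: tensor_act_nil | rewrite tensor_act_cons IH].
Qed.

Definition spin_inj (b : nat) (a : V) : M := [ffun i : 'I_2 => if (i : nat) == b then a else 0].

Lemma spin_inj_linear b : linear (spin_inj b).
Proof.
move=> z x y; apply/ffunP => i; rewrite !ffunE; case: (_ == _) => //.
by rewrite scaler0 addr0.
Qed.

Lemma spin_injE (u : M) : u = spin_inj true (u ord_max) + spin_inj false (u ord0).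
Proof.
apply/ffunP => i; rewrite !ffunE.
case: i => -[|[|//]] hi /=; rewrite ?addr0 ?add0r; congr (u _); exact: val_inj.
Qed.

(** The default 0 is never reached: in the coproduct of a generator each second leg is a single
    letter. *)
Lemma tensor_act_inj x (b : bool) a : tensor_act [:: x] (spin_inj b a) =
  \sum_(y <- coprod_gen x) match y with
   | (w, [:: g]) => gen_act q 1 g (spin_inj^~ (pt w a)) b
   | _ => 0 end.
Proof.
have col w (g : gen) : [ffun i => \sum_(j : 'I_2) rep q 1 [:: g] i j *: pt w (spin_inj b a j)] =
    gen_act q 1 g (spin_inj^~ (pt w a)) b.
  have b2 : (b < 2)%N by case: b.
  have := rep_gen_col hq (l := 1) g (spin_inj^~ (pt w a)) (Ordinal b2) => /= <-.
  apply/ffunP => i; rewrite ffunE (big_morph (fun v : M => v i) (id1 := 0) (op1 := +%R)); last first.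
  - by rewrite ffunE.
  - by move=> v v'; rewrite ffunE.
  rewrite (bigD1 (Ordinal b2)) //= big1 ?addr0 => [|j jb]; last first.
    rewrite ffunE (negbTE (_ : (j : nat) != b)) ?(linearE0 (pt_lin _)) ?scaler0 //.
  rewrite (bigD1 i) //= big1 ?addr0 => [|j ji]; last first.
    by rewrite !ffunE eq_sym (negbTE (_ : (j : nat) != i)) ?scaler0.
  by rewrite !ffunE !eqxx /rep big_seq1.
rewrite /tensor_act big_coprod1.
by case: x; rewrite /= !(big_cons, big_nil) !col.
Qed.

Lemma spin_inj_tensor l (v : nat -> V) :
  (forall x n, (n <= l)%N -> pt [:: x] (v n) = gen_act q l x v n) ->
  is_tensor p^-1 s (fun x => tensor_act [:: antipode_letter x]) l (fun b n => spin_inj b (v n)).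
Proof.
move=> hv n k nk; have nl : (n <= l)%N by rewrite -nk leq_addr.
have kE : (l - n)%N = k by rewrite -nk addKn.
have p0 : p != 0 by rewrite Rc_eq0 sq_q_neq0.
have iZ (j : nat) z a : spin_inj j (z *: a) = z *: spin_inj j a by exact: (linearEZ (spin_inj_linear j)).
rewrite !tensor_act_inj /= !(big_cons, big_nil) /= !hv //= kE.
rewrite !(subnn, subn0, expr0, expr1, divr1, mul1r, sq_num0, sq_num1 hq, mul0r, mulr0, iZ).
rewrite !exprVn !invrK.
rewrite !(scale0r, scale1r, add0r, addr0, scalerA).
rewrite ![p ^- n * _]mulrC ![p ^- k * _]mulrC.
by split; [split=> //; exact: addrC | split=> //; split=> //; exact: addrC].
Qed.


Definition cgU' l (b : bool) n : R[i] := if b then cgA p^-1 s l n.+1 else cgB p^-1 s l n.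

Section Components.
Variables (l : nat) (v : nat -> V).
Hypothesis hv : forall x n, (n <= l)%N -> pt [:: x] (v n) = gen_act q l x v n.

Definition spin_up (n : nat) : M := cg_up p^-1 s l (fun b n => spin_inj b (v n)) n.
Definition spin_down (n : nat) : M := cg_down p^-1 s l (fun b n => spin_inj b (v n)) n.

Let op (x : gen) : M -> M := tensor_act [:: x].
Let op_lin x : linear (op x). Proof. exact: tensor_act_linear. Qed.
Let p0 : p^-1 != 0 :> R[i]. Proof. by rewrite invr_eq0 cgp0. Qed.
Let p4 : p^-1 ^+ 4 != 1 :> R[i]. Proof. by rewrite exprVn invr_eq1 cgp4. Qed.
Let s_sqr n : s n ^+ 2 = (p^-1 ^+ (2 * n) - p^-1 ^- (2 * n)) / (p^-1 ^+ 2 - p^-1 ^- 2).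
Proof. by rewrite cgs_sqr // !exprVn !invrK -[p ^- _ - p ^+ (2 * n)]opprB -[p ^- 2 - p ^+ 2]opprB invrN mulrNN. Qed.

Lemma spin_up_string : is_string p s op l.+1 spin_up.
Proof.
apply: is_string_swap.
apply: (cg_up_string p0 p4 s_sqr (cgs_neq0 hq)) (spin_inj_tensor hv) => x.
exact: tensor_act_linear.
Qed.

Lemma spin_down_string : (0 < l)%N -> is_string p s op l.-1 spin_down.
Proof.
move=> l0; apply: is_string_swap.
apply: (cg_down_string p0 p4 s_sqr (cgs_neq0 hq) (cgs1 hq)) (spin_inj_tensor hv) l0 => x.
exact: tensor_act_linear.
Qed.

(** Only the upper coefficient is made explicit: the Dirac operator is a scalar plus a multiple of
    the projection on the upper component, and of the lower part one only needs that it lies in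
    range. *)
Lemma spin_inj_up_down (b : bool) n : (n <= l)%N -> exists (z : R[i]) (k : nat),
  spin_inj b (v n) = cgU' l b n *: spin_up (n + b) + z *: spin_down k /\
  (z != 0 -> (0 < l)%N && (k <= l.-1)%N).
Proof.
move=> nl; case: b.
  exists (- cgB p^-1 s l n.+1), n; rewrite addn1 scaleNr; split.
    by rewrite /spin_up /spin_down -(cg_true p0 s_sqr (cgs_neq0 hq) (fun b n => spin_inj b (v n)) nl).
  rewrite oppr_eq0; case: (ltngtP n l) nl => // [nl _ _|-> _].
    by case: (l) nl.
  by rewrite (cgB_top s_sqr) eqxx.
exists (cgA p^-1 s l n), n.-1; rewrite addn0; split.
  by rewrite /spin_up /spin_down -(cg_false p0 s_sqr (cgs_neq0 hq) (fun b n => spin_inj b (v n)) nl).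
case: n nl => [|n] nl; first by rewrite (cgA0 s_sqr) eqxx.
by move=> _ /=; case: (l) nl.
Qed.

(** Unit words of spin [l.+1] kill the component of type [l.-1]. On the upper component they are
    multiples of the projections on weight vectors. *)
Lemma unit_act_spin (b : bool) n j : (n <= l)%N -> (j <= l.+1)%N ->
  tensor_act (unit_word l.+1 j j) (spin_inj b (v n)) =
  (if (n + b == j)%N then unit_coef q l.+1 j else 0) *: (cgU' l b n *: spin_up (n + b)).
Proof.
move=> nl jl; have [z [k [-> zk]]] := spin_inj_up_down b nl.
rewrite (linearE2 (tensor_act_linear _)) !tensor_act_word.
have nb : (n + b <= l.+1)%N by case: b; rewrite ?addn1 ?addn0 ?ltnS // leqW.
rewrite (unit_word_act hq op_lin spin_up_string) // eqxx /=.
rewrite !scalerA [_ * cgU' _ _ _]mulrC -[RHS]addr0; congr (_ + _).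
have [->|/zk/andP[l0 kl]] := eqVneq z 0; first by rewrite scale0r.
rewrite (unit_word_act hq op_lin (spin_down_string l0)) ?scalerA //; last first.
  by rewrite (leq_trans (leq_pred _)).
by rewrite ltn_eqF ?mulr0 ?scale0r // prednK // leqnSn.
Qed.

End Components.
End TensorAction.

(** * The Dirac operator on finite sums *)

(* An element of a block is determined by its components U_j of the upper type,
   on which the words A_j of the enveloping algebra act as distinct projections. *)
Definition schur_decomp (K : comNzRingType) (V : lmodType K) (f : V -> V) (A : nat -> V -> V)
    (kappa : nat -> K) (a b : K) (N : nat) (u : V) : Prop :=
  exists U : nat -> V, f u = a *: u + b *: (\sum_(j < N) U j) /\
    forall j, (j < N)%N -> A j u = kappa j *: U j.

Lemma schur_decomp_lin (K : comNzRingType) (V : lmodType K) (f : V -> V) A kappa (a b : K) N :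
  linear f -> (forall j, linear (A j)) ->
  schur_decomp f A kappa a b N 0 /\
  forall z u v, schur_decomp f A kappa a b N u -> schur_decomp f A kappa a b N v ->
    schur_decomp f A kappa a b N (z *: u + v).
Proof.
move=> lf lA; split.
  exists (fun=> 0); rewrite big1 // (linearE0 lf) !scaler0 addr0; split=> // j _.
  by rewrite (linearE0 (lA j)) scaler0.
move=> z u v [U [fu AU]] [W [fv AW]]; exists (fun j => z *: U j + W j); split.
  rewrite lf fu fv big_split /= -scaler_sumr !scalerDr !scalerA ![z * _]mulrC.
  by rewrite addrACA.
by move=> j jN; rewrite lA AU // AW // scalerDr !scalerA mulrC.
Qed.

(** The actions of the [A j] determine the components [U j], whose sum is [u] or zero in the two
    cases. This plays the part of Schur's lemma for vectors given only by how words act on them. *)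
Lemma schur_eigen (K : fieldType) (V : lmodType K) (f : V -> V) A kappa (a b : K) N u (n : nat) :
  (forall j, (j < N)%N -> kappa j != 0) -> schur_decomp f A kappa a (b - a) N u ->
  ((n < N)%N -> (forall j, (j < N)%N -> A j u = (if n == j then kappa j else 0) *: u) -> f u = b *: u) /\
  ((forall j, (j < N)%N -> A j u = 0) -> f u = a *: u).
Proof.
move=> k0 [U [-> AU]]; split=> [nN An|A0].
  have E (j : 'I_N) : U j = (if n == j then 1 else 0) *: u.
    apply: (can_inj (scalerK (k0 j (ltn_ord j)))); rewrite -AU // An // scalerA.
    by case: eqP => _; rewrite ?mulr1 ?mulr0.
  rewrite (eq_bigr _ (fun j _ => E j)) (bigD1 (Ordinal nN)) //= eqxx big1 ?addr0 => [|j jn].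
    by rewrite scale1r -scalerDl addrC subrK.
  by rewrite -val_eqE /= eq_sym in jn; rewrite (negbTE jn) scale0r.
rewrite big1 ?scaler0 ?addr0 // => j _.
by apply: (can_inj (scalerK (k0 j (ltn_ord j)))); rewrite -AU // A0 // scaler0.
Qed.

Lemma delta_sum (K : nzRingType) (V : lmodType K) (z y : K) (w : V) N n : (n < N)%N ->
  (z * y) *: w = z *: (\sum_(j < N) (if n == j then 1 else 0) *: (y *: w)).
Proof.
move=> nN; rewrite (bigD1 (Ordinal nN)) //= eqxx big1 ?addr0 => [|j jn].
  by rewrite scale1r scalerA.
by rewrite -val_eqE /= eq_sym in jn; rewrite (negbTE jn) scale0r.
Qed.

Lemma scale_swap (K : comNzRingType) (V : lmodType K) (a b : K) (w : V) :
  a *: (b *: w) = b *: (a *: w).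
Proof. by rewrite !scalerA mulrC. Qed.

Lemma if_scale (K : nzRingType) (V : lmodType K) (b : bool) (k : K) (w : V) :
  (if b then k else 0) *: w = k *: ((if b then 1 else 0) *: w).
Proof. by case: b; rewrite ?scale1r ?scale0r ?scaler0. Qed.

Lemma two_linear (K : nzRingType) (V W : lmodType K) (g g' : V -> W) : linear g -> linear g' ->
  linear (fun u : {ffun 'I_2 -> V} => g (u ord_max) + g' (u ord0)).
Proof.
move=> lg lg' z u v; rewrite !ffunE lg lg' scalerDr; exact: addrACA.
Qed.

Lemma mulmx_col_sum (K : comNzRingType) (V : lmodType K) n (A B : 'M[K]_n) (e : 'I_n -> V) j :
  \sum_i (A *m B) i j *: e i = \sum_k B k j *: (\sum_i A i k *: e i).
Proof.
under [RHS]eq_bigr do rewrite scaler_sumr; rewrite exchange_big /=; apply: eq_bigr => i _.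
by rewrite mxE scaler_suml; apply: eq_bigr => k _; rewrite scalerA mulrC.
Qed.

Section DiracAlg.
Variables (R : realType) (q : R).
Hypothesis hq : 0 < q < 1.
Local Notation tsu := (tsu R).
Implicit Types (l m n : nat) (c : int) (x : u_index).

Definition tvec l c m n : CU R := attach c (tsu l m n).

Lemma tvec_index x :
  << x >> = tvec (u_spin x) (u_charge x) (tagged (u_su x)).1 (tagged (u_su x)).2.
Proof. by rewrite /tvec -tsuE; exact/esym/attach_index. Qed.

Lemma tvec_out l c m n : ~~ ((m <= l) && (n <= l))%N -> tvec l c m n = 0.
Proof. by move=> /negbTE h; rewrite /tvec tsu.unlock h; exact: (linearE0 (attach_linear c)). Qed.

Lemma tvec_exists l c m n : odd l = oddz c -> (m <= l)%N -> (n <= l)%N ->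
  exists2 x, tvec l c m n = << x >> & u_su x = sui (inord m : 'I_l.+1) (inord n) /\ u_charge x = c.
Proof.
move=> lc ml nl; have [x xk xc] := @tz_exists (sui (inord m : 'I_l.+1) (inord n)) c lc.
exists x; last by rewrite xk xc.
by rewrite /tvec tsu.unlock ml nl -xk -xc; exact: attach_index.
Qed.

Lemma partial_linear w : linear (partial q w).
Proof. exact: malg_linear. Qed.

Lemma partial_tvec w l c m n : odd l = oddz c -> (m <= l)%N -> (n <= l)%N ->
  partial q w (tvec l c m n) = \sum_(n' < l.+1) rep q l w n' (inord n) *: tvec l c m n'.
Proof.
move=> lc ml nl; have [x -> [xk xc]] := tvec_exists lc ml nl.
pose G (k : su_index) : CU R := \sum_(n' < (tag k).+1) rep q (tag k) w n' (tagged k).2 *: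
        tz R (sui (tagged k).1 n') (u_charge x).
apply: etrans (_ : G (u_su x) = _); first exact: malg_linearU.
rewrite xk; apply: eq_bigr => n' _; congr (_ *: _); rewrite xc.
by rewrite -attachU tsuE /= inordK.
Qed.

Lemma partial_tvec_ord w l c m (n : 'I_l.+1) : odd l = oddz c -> (m <= l)%N ->
  partial q w (tvec l c m n) = \sum_(n' < l.+1) rep q l w n' n *: tvec l c m n'.
Proof.
move=> lc ml; apply: etrans (partial_tvec w lc ml (leq_ord n)) _.
by apply: eq_bigr => n' _; apply: (congr1 (fun k => rep q l w n' k *: _)); exact: inord_val.
Qed.

Lemma partial_nil a : partial q [::] a = a.
Proof.
move: a; apply: malg_eq_linear => [||x]; [exact: partial_linear | by [] |].
have lc := odd_spin x; rewrite (tvec_index x) partial_tvec ?leq_ord //.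
rewrite inord_val /rep big_nil (bigD1 (tagged (u_su x)).2) //= big1 => [|j jn].
  by rewrite mxE eqxx scale1r addr0.
by rewrite mxE (negbTE jn) scale0r.
Qed.

Lemma partial_cat u w a : partial q (u ++ w) a = partial q u (partial q w a).
Proof.
move: a; apply: malg_eq_linear => [||x]; first exact: partial_linear.
  exact: comp_linear (partial_linear u) (partial_linear w).
have lc := odd_spin x; have ml := leq_ord (tagged (u_su x)).1.
rewrite (tvec_index x); move: (tagged (u_su x)).2 => n.
apply: etrans (partial_tvec_ord (u ++ w) n lc ml) _.
apply: etrans (esym (congr1 (partial q u) (partial_tvec_ord w n lc ml))).
have -> : rep q (u_spin x) (u ++ w) = rep q (u_spin x) u *m rep q (u_spin x) w by rewrite /rep big_cat.
apply: etrans (mulmx_col_sum _ _ _ _) _.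
apply: etrans (esym (linearE_sum (partial_linear u) _ _ _)); apply: eq_bigr => k _.
apply: etrans (esym (linearEZ (partial_linear u) _ _)).
exact: (congr1 (fun z => rep q (u_spin x) w k n *: z) (esym (partial_tvec_ord u k lc ml))).
Qed.

Lemma partial_gen l c m : odd l = oddz c -> (m <= l)%N ->
  forall g n, (n <= l)%N -> partial q [:: g] (tvec l c m n) = gen_act q l g (tvec l c m) n.
Proof.
move=> lc ml g n nl; rewrite partial_tvec // /rep big_seq1.
apply: etrans (rep_gen_col hq g (tvec l c m) _) _.
by rewrite inordK.
Qed.

Lemma act_linear w : linear (act q w).
Proof. exact: (tensor_act_linear q partial_linear). Qed.

Lemma act_string r (v : nat -> CUV R) w (n : 'I_r.+1) :
  is_string (sq_q q)%:C (fun n => (sq_num q n)%:C) (fun g => tensor_act q (partial q) [:: g]) r v ->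
  act q w (v n) = \sum_(n' < r.+1) rep q r w n' n *: v n'.
Proof.
move=> sv; apply: etrans (tensor_act_word q partial_linear partial_cat partial_nil w (v n)) _.
exact: (word_act_string hq (fun g => tensor_act_linear q partial_linear [:: g])).
Qed.

Definition up_eigen l : R[i] := l%:R + 3 / 2.
Definition down_eigen l : R[i] := - (l%:R + 2) + 3 / 2.

Definition up_vec l c m j : CUV R := spin_up q l (tvec l c m) j.
Definition down_vec l c m j : CUV R := spin_down q l (tvec l c m) j.

(** The candidate operator on a basis vector: the lower eigenvalue, plus the gap times the
    projection on the upper component. *)
Let basis_image (b : bool) x : CUV R :=
  let l := u_spin x in let c := u_charge x in
  let m := (tagged (u_su x)).1 : nat in let n := (tagged (u_su x)).2 : nat in
  down_eigen l *: spin_inj b (tvec l c m n)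
  + ((up_eigen l - down_eigen l) * cgU' q l b n) *: up_vec l c m (n + b).

Let g (b : bool) (a : CU R) : CUV R := \sum_(x <- msupp a) a@_x *: basis_image b x.
Let g_linear b : linear (g b). Proof. exact: malg_linear. Qed.

Let f (u : CUV R) : CUV R := g true (u ord_max) + g false (u ord0).
Let f_linear : linear f. Proof. exact: two_linear (g_linear true) (g_linear false). Qed.

Let f_inj (b : bool) a : f (spin_inj b a) = g b a.
Proof.
rewrite /f; case: b; rewrite !ffunE /=.
  by apply: etrans (congr1 (fun y => _ + y) (linearE0 (g_linear false))) _; exact: addr0.
by apply: etrans (congr1 (fun y => y + _) (linearE0 (g_linear true))) _; exact: add0r.
Qed.

Let f_tvec (b : bool) l c m n : odd l = oddz c -> (m <= l)%N -> (n <= l)%N ->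
  f (spin_inj b (tvec l c m n)) = down_eigen l *: spin_inj b (tvec l c m n)
  + ((up_eigen l - down_eigen l) * cgU' q l b n) *: up_vec l c m (n + b).
Proof.
move=> lc ml nl; have [x xE [xk xc]] := tvec_exists lc ml nl.
rewrite f_inj xE; apply: etrans (malg_linearU _ _) _; rewrite /basis_image -tvec_index /u_spin xc.
by rewrite xk /= !inordK.
Qed.

Lemma block_lin l c (z : R[i]) u v : block l c u -> block l c v -> block l c (z *: u + v).
Proof.
move=> hu hv s x; rewrite !ffunE => /(fsubsetP (msuppD_le _ _)).
by rewrite in_fsetU => /orP[/(fsubsetP (msuppZ_le _ _))/hu|/hv].
Qed.

Lemma block0 l c : block l c (0 : CUV R).
Proof. by move=> s x; rewrite ffunE msupp0. Qed.

Lemma block_tvec (b l : nat) c m n : odd l = oddz c -> block l c (spin_inj b (tvec l c m n)).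
Proof.
move=> lc s x; rewrite ffunE; case: (_ == _); last by rewrite msupp0.
have [/andP[ml nl]|mn] := boolP ((m <= l) && (n <= l))%N; last by rewrite tvec_out // msupp0.
have [y -> [yk yc]] := tvec_exists lc ml nl.
by rewrite msuppU oner_eq0 in_fset1 => /eqP ->; rewrite /u_spin yk.
Qed.

Lemma block_ind l c (S : CUV R -> Prop) : S 0 ->
  (forall (z : R[i]) u v, S u -> S v -> S (z *: u + v)) ->
  (odd l = oddz c -> forall (b : bool) m n, (m <= l)%N -> (n <= l)%N -> S (spin_inj b (tvec l c m n))) ->
  forall u, block l c u -> S u.
Proof.
move=> S0 Sl Sb u ub; rewrite [u]spin_injE.
have Sa (b : bool) (a : CU R) : (forall x, x \in msupp a -> u_spin x = l /\ u_charge x = c) -> S (spin_inj b a).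
  move=> ha; rewrite [a]monalgE.
  have : {in enum_fset (msupp a), forall x, u_spin x = l /\ u_charge x = c} by exact: ha.
  elim: (enum_fset (msupp a)) => [|x r IH] h.
    by rewrite big_nil (linearE0 (spin_inj_linear b)).
  rewrite big_cons malgUZ (spin_inj_linear b); apply: Sl.
    have [xl xc] := h x (mem_head _ _); rewrite (tvec_index x).
    have := Sb; rewrite -xl -xc => Sb'; apply: Sb'; rewrite ?leq_ord //; exact: odd_spin.
  by apply: IH => y yr; apply: h; rewrite in_cons yr orbT.
rewrite -[X in S (X + _)]scale1r; apply: Sl; apply: Sa => x; exact: ub.
Qed.

Let decomp l := schur_decomp f (fun j => act q (unit_word l.+1 j j)) (unit_coef q l.+1)
  (down_eigen l) (up_eigen l - down_eigen l) l.+2.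

Let block_decomp l c u : block l c u -> decomp l u.
Proof.
have [d0 dl] := schur_decomp_lin (unit_coef q l.+1) (down_eigen l) (up_eigen l - down_eigen l) l.+2
  f_linear (fun j => act_linear (unit_word l.+1 j j)).
apply: block_ind d0 dl _ u => lc b m n ml nl.
exists (fun j => (if (n + b == j)%N then 1 else 0) *: (cgU' q l b n *: up_vec l c m (n + b))).
have nb : (n + b < l.+2)%N by case: b; rewrite ?addn1 ?addn0 ?ltnS // leqW.
split.
  apply: etrans (f_tvec b lc ml nl) _.
  apply: (congr1 (fun y => down_eigen l *: spin_inj b (tvec l c m n) + y)).
  exact: delta_sum.
move=> j jl; apply: etrans (unit_act_spin hq partial_linear partial_cat partial_nil (partial_gen lc ml) b nl jl) _.
exact: if_scale.
Qed.

(** [is_dirac] concerns the images of all intertwiners, not only the explicit strings. On such an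
    image the unit words act as in the abstract irreducible module, and [schur_eigen] gives the
    eigenvalue. *)
Lemma dirac_alg_exists : exists f0, is_dirac q f0.
Proof.
exists f; split; first exact: f_linear.
move=> l c lc; have k0 j : (j < l.+2)%N -> unit_coef q l.+1 j != 0 by move=> jl; exact: (@unit_coef_neq0 R q hq l.+1 j jl).
have span r (z : R[i]) : (forall phi (n : 'I_r.+1), intertwiner q l c phi -> f (phi n) = z *: phi n) ->
    forall u, isotypic q l c r u -> f u = z *: u.
  move=> h u [N [a [v [hv ->]]]]; rewrite (linearE_sum f_linear) scaler_sumr.
  apply: eq_bigr => k _; rewrite (linearEZ f_linear); have [phi hphi [n ->]] := hv k.
  by apply: etrans (congr1 (fun y => a k *: y) (h phi n hphi)) _; exact: scale_swap.
have col r (phi : 'I_r.+1 -> CUV R) (n : 'I_r.+1) j b : intertwiner q l c phi ->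
    (r <= l.+1)%N -> (j < l.+2)%N -> (r == l.+1) && (n == j :> nat) = b ->
    act q (unit_word l.+1 j j) (phi n) = (if b then unit_coef q l.+1 j else 0) *: phi n.
  by move=> [_ ha] rl jl <-; exact: etrans (ha _ _) (unit_word_sum hq phi n rl jl).
split=> [|l0]; apply: span => phi n hphi.
  have [h1 _] := schur_eigen n k0 (block_decomp (hphi.1 n)).
  by apply: h1 => [|j jl]; [exact: ltn_ord | apply: col => //; rewrite eqxx].
have [_ h2] := schur_eigen n k0 (block_decomp (hphi.1 n)).
apply: h2 => j jl; apply: etrans (scale0r _); apply: (col _ _ _ _ false) => //.
  by rewrite (leq_trans (leq_pred _)).
by rewrite ltn_eqF // prednK // leqnSn.
Qed.

Lemma dirac_algP : is_dirac q (dirac_alg q).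
Proof. by have [f0 hf] := dirac_alg_exists; exact: (xgetPex (fun=> 0) (ex_intro _ f0 hf)). Qed.

Lemma dirac_alg_linear : linear (dirac_alg q). Proof. by case: dirac_algP. Qed.

Let isotypic_vec l c r phi (n : 'I_r.+1) : intertwiner q l c phi -> isotypic q l c r (phi n).
Proof.
move=> h; exists 1%N, (fun=> 1), (fun=> phi n); split=> [_|]; first by exists phi => //; exists n.
by rewrite big_ord1 scale1r.
Qed.

Let block_comb l c (z z' : R[i]) u v : block l c u -> block l c v -> block l c (z *: u + z' *: v).
Proof.
move=> hu hv; apply: block_lin => //; rewrite -[z' *: v]addr0.
exact: block_lin hv (block0 l c).
Qed.

Lemma dirac_alg_up l c m j : odd l = oddz c -> (m <= l)%N -> (j <= l.+1)%N ->
  dirac_alg q (up_vec l c m j) = up_eigen l *: up_vec l c m j.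
Proof.
move=> lc ml jl; have [_ /(_ l c _)[|h _]] := dirac_algP; first exact/eqP.
have /= := isotypic_vec (phi := fun j : 'I_l.+2 => up_vec l c m j) (inord j).
rewrite inordK // => h'; apply/h/h'; split=> [n|w n].
  by rewrite /up_vec /spin_up /cg_up; apply: block_comb; exact: block_tvec.
apply: act_string w n _.
exact: (spin_up_string hq partial_linear (partial_gen lc ml)).
Qed.

Lemma dirac_alg_down l c m j : odd l = oddz c -> (m <= l)%N -> (0 < l)%N -> (j <= l.-1)%N ->
  dirac_alg q (down_vec l c m j) = down_eigen l *: down_vec l c m j.
Proof.
move=> lc ml l0 jl; have [_ /(_ l c _)[|_ /(_ l0) h]] := dirac_algP; first exact/eqP.
have /= := isotypic_vec (phi := fun j : 'I_l.-1.+1 => down_vec l c m j) (inord j).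
rewrite inordK // => h'; apply/h/h'; split=> [n|w n].
  by rewrite /down_vec /spin_down /cg_down; apply: block_comb; exact: block_tvec.
apply: act_string w n _.
exact: (spin_down_string hq partial_linear (partial_gen lc ml)).
Qed.

End DiracAlg.

(** * Commutators with the Dirac operator *)

(** A matrix with bounded entries supported on finitely many partial injections is a finite sum of
    weighted shifts. *)
Lemma finite_band_op (R : realType) (H : lmodType R[i]) (ip : H -> H -> R[i]) (I : countType)
    (e : I -> H) (K : nat) (s : 'I_K -> I -> I) (M : I -> I -> R[i]) (C : R) :
  hilbert_space ip -> orthonormal ip e -> complete_family ip e ->
  (forall g h, e g = 0 -> M g h = 0) -> (forall g h, e h = 0 -> M g h = 0) ->
  (forall g h, M g h != 0 -> exists k, h = s k g) ->
  (forall k g g', M g (s k g) != 0 -> M g' (s k g') != 0 -> s k g = s k g' -> g = g') ->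
  (forall g h, nsqc (M g h) <= C) ->
  exists2 T, bounded_op ip T & forall g h, ip (e g) (T (e h)) = M g h.
Proof.
move=> hH eON eC Ml Mr Ms s_inj MC; have ipP := hH.1.
(* The entry M g h is attributed to the first k such that h = s k g. *)
pose c (k : 'I_K) g := if [forall j : 'I_K, (j < k)%N ==> (s j g != s k g)] then M g (s k g) else 0.
have cM k g : nsqc (c k g) <= C.
  by rewrite /c; case: ifP => // _; rewrite nsqc0; exact: le_trans (nsqc_ge0 _) (MC g g).
have c_inj k g g' : c k g != 0 -> c k g' != 0 -> s k g = s k g' -> g = g'.
  by rewrite /c; case: ifP; case: ifP; rewrite ?eqxx // => _ _; exact: s_inj.
have hT k : exists T, bounded_op ip T /\
    forall x g, e g != 0 -> ip (e g) (T x) = c k g * ip (e (s k g)) x.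
  by have [T [bT _] hT] := weighted_shift hH eON eC (cM k) (c_inj k); exists T.
have [T {}hT] := fin_all_exists hT.
exists (fun x => \sum_(k <- enum 'I_K) T k x).
  by apply: bounded_sum => // k; have [] := hT k.
move=> g h; have [g0|g0] := eqVneq (e g) 0; first by rewrite g0 (ip0l ipP) Ml.
have [h0|h0] := eqVneq (e h) 0.
  rewrite h0 (Mr _ _ h0) big1 ?(ip0r ipP) // => k _.
  by have [[lT _] _] := hT k; rewrite (linearE0 lT).
rewrite (ip_sumr ipP) big_enum /=.
have E k : ip (e g) (T k (e h)) = c k g * (s k g == h)%:R.
  have [_ ->] := hT k => //; congr (_ * _).
  have [->|sh] := eqVneq (s k g) h; last by rewrite (on_orth eON).
  by rewrite (on_ip eON) // eqxx.
under eq_bigr do rewrite E.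
have [/existsP[k1 k1h]|nex] := boolP [exists k, s k g == h]; last first.
  rewrite big1 => [|k _]; last first.
    by rewrite (negbTE (forallP (_ : [forall k, s k g != h]) k)) ?mulr0 // -negb_exists.
  by have [//|/Ms[k hk]] := eqVneq (M g h) 0; case/existsP: nex; exists k; rewrite hk.
have [k0 /eqP k0h k0_min] := @arg_minnP _ k1 (fun k => s k g == h) (@nat_of_ord K) k1h.
rewrite (bigD1 k0) //= k0h eqxx mulr1 big1 ?addr0 => [|k kk0].
  rewrite /c k0h ifT //; apply/forallP => j; apply/implyP => jk0; apply/negP => /k0_min.
  by rewrite leqNgt jk0.
have [kh|_] := eqVneq (s k g) h; last by rewrite mulr0.
rewrite /c ifF ?mul0r //; apply/negP => /forallP/(_ k0)/implyP.
rewrite k0h kh eqxx; have le := k0_min k; rewrite kh eqxx in le.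
by move=> h1; have := h1; rewrite ltn_neqAle le // andbT eq_sym kk0 => /(_ isT).
Qed.

Lemma rotation (K : comNzRingType) (V : lmodType K) (x y : K) (u v : V) :
  x ^+ 2 + y ^+ 2 = 1 ->
  u = x *: (x *: u + y *: v) - y *: ((- y) *: u + x *: v) /\
  v = y *: (x *: u + y *: v) + x *: ((- y) *: u + x *: v).
Proof.
move=> n1; split; rewrite !scalerDr !scalerA.
  rewrite opprD addrACA -!scaleNr -!scalerDl mulrN opprK -!expr2 n1 scale1r.
  by rewrite [y * x]mulrC subrr scale0r addr0.
rewrite addrACA -!scalerDl mulrN [y * x]mulrC subrr scale0r add0r.
by rewrite -!expr2 addrC n1 scale1r.
Qed.

Lemma addb_gt0 (a : bool) m : (~~ a <= m)%N -> (0 < a + m)%N.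
Proof. by case: a. Qed.

Lemma succn_pred l : (l.+1 == l.-1) = false.
Proof. by case: l => //= l; apply/negbTE; rewrite neq_ltn ltnS leqnSn orbT. Qed.

(* As an index of the basis F, (l, c, m, t, s) stands for the normalized vector
   t^{l/2,c/2}_{m,n} (x) |1/2, s> with t = n + s, so that t determines the weight
   for the action on the tensor product. As an index of the eigenbasis, the last
   component tells W^up from W^down. *)
Definition s_label := (nat * int * nat * nat * bool)%type.

Section SpinorHilbert.
Variables (R : realType) (q : R).
Hypothesis hq : 0 < q < 1.
Variables (H : lmodType R[i]) (ip : H -> H -> R[i]).
Hypothesis hH : hilbert_space ip.
Let ipP : inner_product ip := hH.1.

Definition spin_valid (k : s_label) : bool :=
  let: (l, c, m, t, s) := k in [&& odd l == oddz c, (m <= l)%N, (s <= t)%N & (t <= l + s)%N].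

Variable F : s_label -> H.
Hypothesis FON : orthonormal ip F.
Hypothesis FC : complete_family ip F.
Hypothesis F0 : forall k, (F k != 0) = spin_valid k.

(* The rotation of the basis F which diagonalizes the Dirac operator. *)
Definition spin_eigen (k : s_label) : H :=
  let: (l, c, m, t, up) := k in
  if up then (cg1' q l t)%:C *: F (l, c, m, t, true) + (cg2' q l t)%:C *: F (l, c, m, t, false)
  else (- cg2' q l t)%:C *: F (l, c, m, t, true) + (cg1' q l t)%:C *: F (l, c, m, t, false).

(** For given [l], [c] and [m], the upper component has the [l + 2] weights [0 <= t <= l + 1] and
    the lower one the [l] weights [1 <= t <= l]. *)
Definition spin_good (k : s_label) : bool :=
  let: (l, c, m, t, up) := k in
  [&& odd l == oddz c, (m <= l)%N, (~~ up <= t)%N & (t <= l + up)%N].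

Local Notation eps := spin_eigen.

Let F_invalid l c m t s : (l.+1 < t)%N -> F (l, c, m, t, s) = 0.
Proof.
move=> lt; apply/eqP; rewrite -[_ == _]negbK F0 /=.
by apply/negP => /and4P[_ _ _]; case: s; lia.
Qed.

Let normC l t : (t <= l.+1)%N -> (cg1' q l t)%:C ^+ 2 + (cg2' q l t)%:C ^+ 2 = 1 :> R[i].
Proof. by move=> /(cg_norm1' hq) h; rewrite -!RcX -RcD h. Qed.

Lemma spin_F_true l c m t : F (l, c, m, t, true) =
  (cg1' q l t)%:C *: eps (l, c, m, t, true) - (cg2' q l t)%:C *: eps (l, c, m, t, false).
Proof.
have [tl|lt] := leqP t l.+1; last first.
  by rewrite /= !F_invalid // !(scaler0, addr0, subr0).
have [h _] := rotation (F (l, c, m, t, true)) (F (l, c, m, t, false)) (normC tl).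
by rewrite [LHS]h /spin_eigen RcN.
Qed.

Lemma spin_F_false l c m t : F (l, c, m, t, false) =
  (cg2' q l t)%:C *: eps (l, c, m, t, true) + (cg1' q l t)%:C *: eps (l, c, m, t, false).
Proof.
have [tl|lt] := leqP t l.+1; last first.
  by rewrite /= !F_invalid // !(scaler0, addr0).
have [_ h] := rotation (F (l, c, m, t, true)) (F (l, c, m, t, false)) (normC tl).
by rewrite [LHS]h /spin_eigen RcN.
Qed.

Let ipF k k' : ip (F k) (F k') = ((k == k') && spin_valid k)%:R.
Proof.
have [<-|kk'] := eqVneq k k'; last by rewrite (on_orth FON).
have [k0|k0] := eqVneq (F k) 0; first by rewrite -F0 k0 eqxx (ip0l ipP).
by rewrite (on_ip FON) // eqxx -F0 k0.
Qed.

Lemma spin_eigen_ip k k' : ip (eps k) (eps k') = ((k == k') && spin_good k)%:R.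
Proof.
case: k k' => [[[[l c] m] t] u] [[[[l' c'] m'] t'] u'].
have [kk'|kk'] := eqVneq (l, c, m, t) (l', c', m', t'); last first.
  have ne s s' : ((l, c, m, t, s) == (l', c', m', t', s')) = false.
    by apply/negP => /eqP[e1 e2 e3 e4 _]; case/eqP: kk'; rewrite e1 e2 e3 e4.
  rewrite ne /=; case: u u' => -[];
    by rewrite !(ipDl ipP, ipDr ipP, ipZl ipP, ipZr ipP) !ipF !ne !(mulr0, addr0).
case: kk' => <- <- <- <-.
have -> : ((l, c, m, t, u) == (l, c, m, t, u')) = (u == u') by rewrite xpair_eqE eqxx.
set w := (odd l == oddz c) && (m <= l)%N.
have Ett : ip (F (l, c, m, t, true)) (F (l, c, m, t, true)) = w%:R * ((0 < t) && (t <= l.+1))%N%:R.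
  by rewrite ipF eqxx /= addn1 -natrM mulnb /w andbA.
have Eff : ip (F (l, c, m, t, false)) (F (l, c, m, t, false)) = w%:R * (t <= l)%N%:R.
  by rewrite ipF eqxx /= addn0 -natrM mulnb /w andbA.
have Etf : ip (F (l, c, m, t, true)) (F (l, c, m, t, false)) = 0.
  by rewrite ipF xpair_eqE andbF.
have Eft : ip (F (l, c, m, t, false)) (F (l, c, m, t, true)) = 0.
  by rewrite ipF xpair_eqE andbF.
set x := cg1' q l t; set y := cg2' q l t.
have -> : ip (eps (l, c, m, t, u)) (eps (l, c, m, t, u')) =
    w%:R *
    (if u then if u' then (x ^+ 2 * ((0 < t) && (t <= l.+1))%N%:R + y ^+ 2 * (t <= l)%N%:R)%:C
                     else (x * y * ((t <= l)%N%:R - ((0 < t) && (t <= l.+1))%N%:R))%:C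
     else if u' then (x * y * ((t <= l)%N%:R - ((0 < t) && (t <= l.+1))%N%:R))%:C
                else (y ^+ 2 * ((0 < t) && (t <= l.+1))%N%:R + x ^+ 2 * (t <= l)%N%:R)%:C).
  have nE (z : bool) : (z%:R)%:C = z%:R :> R[i] by case: z.
  case: u u' => -[]; rewrite /spin_eigen !(ipDl ipP, ipDr ipP, ipZl ipP, ipZr ipP);
    rewrite !(Ett, Eff, Etf, Eft) !conjcR !(RcD, RcM, RcB, RcN, RcX, nE) -/x -/y; ring.
have nrm : (t <= l.+1)%N -> x ^+ 2 + y ^+ 2 = 1 by exact: cg_norm1'.
(* At the two ends of the weight range one vector of [F] is zero and so is one of the two
   coefficients: the upper combination keeps norm one and the lower one vanishes. *)
have x0 : t = 0%N -> x = 0 by move=> t0; rewrite /x t0 /cg1' /cgA sq_num0 // mul0r.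
have y0 : t = l.+1 -> y = 0 by move=> t0; rewrite /y t0 /cg2' /cgB subnn sq_num0 // mulr0 mul0r.
rewrite /w /=; case: (odd l == _); last by rewrite mul0r andbF.
case: (m <= l)%N; last by rewrite mul0r andbF.
rewrite mul1r /=; case: (ltngtP t l.+1) => tl; last first.
- rewrite tl ltnn y0 //; have := nrm; rewrite tl leqnn y0 // => /(_ isT) xy.
  by case: u u' => -[]; rewrite /= ?addn1 ?addn0 ?leqnn ?ltnn ?andbF -Rc1; congr _%:C; lra.
- have e1 : (t <= l + true)%N = false by lia. have e0 : (t <= l + false)%N = false by lia.
  have e2 : (t <= l)%N = false by lia.
  by case: u u' => -[]; rewrite ?e1 ?e0 ?e2 ?andbF ?mulr0 ?subrr ?mulr0 ?addr0.
have tl1 : (t <= l)%N by lia. have {}nrm := nrm (ltnW tl).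
case: (posnP t) => [t0|t0].
  rewrite x0 // in nrm *; case: u u' => -[]; rewrite /= ?addn1 ?addn0 t0 /= -?Rc1; congr _%:C; lra.
have tl2 := ltnW tl.
by case: u u' => -[]; rewrite /= ?addn1 ?addn0 ?t0 ?tl1 ?tl2 /= ?mulr1n ?mulr0n -?Rc1; congr _%:C; lra.
Qed.

Lemma spin_eigen_neq0 k : (eps k != 0) = spin_good k.
Proof.
have := spin_eigen_ip k k; rewrite eqxx /=; case: (spin_good k) => e.
  by apply/eqP => k0; move/eqP: e; rewrite k0 (ip0l ipP) eq_sym oner_eq0.
by apply/negbTE; rewrite negbK -(nsq_eq0 ipP) /nsq e.
Qed.

Lemma spin_eigen_on : orthonormal ip eps.
Proof.
split=> [k k' /eqP kk'|k]; first by rewrite spin_eigen_ip (negbTE kk').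
have [kg|kg] := boolP (spin_good k); first by right; rewrite spin_eigen_ip eqxx kg.
by left; apply/eqP; rewrite -[_ == _]negbK spin_eigen_neq0.
Qed.

Lemma spin_eigen_complete : complete_family ip eps.
Proof.
move=> x hx; apply: FC => -[[[[l c] m] t] []].
  by rewrite spin_F_true (ipBl ipP) !(ipZl ipP) !hx !mulr0 subrr.
by rewrite spin_F_false (ipDl ipP) !(ipZl ipP) !hx !mulr0 addr0.
Qed.

Definition spin_dirac (k : s_label) : R :=
  let: (l, c, m, t, up) := k in if up then l%:R + 3 / 2 else - (l%:R + 2) + 3 / 2.

Definition spin_charge (k : s_label) : R := let: (l, c, m, t, up) := k in c%:~R / 2.

Variables (d : int) (a b : bool) (T : H -> H).
Hypothesis od : oddz d.
Hypothesis bT : bounded_op ip T.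
Hypothesis TF : forall l c m t s, odd l = oddz c -> (m <= l)%N ->
  T (F (l, c, m, t, s)) =
  (rowU q l a m * (colU q l b s t)%:C) *: F (l.+1, d + c, (a + m)%N, (t + b)%N, s)
  + (rowD q l a m * (colD q l b s t)%:C) *: F (l.-1, d + c, (a + m).-1, (t + b).-1, s).

Let lT : linear T := bT.1.

Let T_comb l c m t (x y : R) : odd l = oddz c -> (m <= l)%N ->
  T (x%:C *: F (l, c, m, t, true) + y%:C *: F (l, c, m, t, false)) =
  rowU q l a m *: ((x * colU q l b true t)%:C *: F (l.+1, d + c, (a + m)%N, (t + b)%N, true)
                   + (y * colU q l b false t)%:C *: F (l.+1, d + c, (a + m)%N, (t + b)%N, false))
  + rowD q l a m *: ((x * colD q l b true t)%:C *: F (l.-1, d + c, (a + m).-1, (t + b).-1, true)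
                   + (y * colD q l b false t)%:C *: F (l.-1, d + c, (a + m).-1, (t + b).-1, false)).
Proof.
move=> lc ml; rewrite (linearE2 lT) !TF // !scalerDr !scalerA addrACA !RcM.
by congr (_ *: _ + _ *: _ + (_ *: _ + _ *: _)); ring.
Qed.

Let F_comb l c m t (x y : R) (z : R[i]) :
  z *: (x%:C *: F (l, c, m, t, true) + y%:C *: F (l, c, m, t, false)) =
  (z * (x * cg1' q l t + y * cg2' q l t)%:C) *: eps (l, c, m, t, true)
  + (z * (- (x * cg2' q l t) + y * cg1' q l t)%:C) *: eps (l, c, m, t, false).
Proof.
rewrite spin_F_true spin_F_false; move: (eps _) (eps _) => g h.
rewrite !scalerDr !scalerN -!scaleNr !scalerA addrACA -!scalerDl.
by rewrite !(RcD, RcM, RcN); congr (_ *: _ + _ *: _); ring.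
Qed.

(** A gap of at most 3 (l+1) against a factor 1/[l+1], which is at most 1/(l+1); the 9 is the square
    of 3. *)
Let bound_flip (l : nat) (z : R[i]) (x : R) (n : nat) : nsqc z <= 1 -> x ^+ 2 <= 1 ->
  (n <= 3 * l.+1)%N -> nsqc (z * (x / sq_num q l.+1 ^+ 2)%:C * n%:R%:C) <= 9.
Proof.
move=> z1 x1 nl; have s2 := sq_num_ge hq l.+1.
have s0 : 0 < sq_num q l.+1 ^+ 2 by rewrite exprn_gt0 ?sq_num_gt0.
rewrite -mulrA -RcM nsqcM nsqcR.
have nl' : n%:R <= 3 * l.+1%:R :> R by rewrite -natrM ler_nat.
have r3 : (0 : R) <= n%:R / sq_num q l.+1 ^+ 2 <= 3.
  rewrite divr_ge0 ?ler0n ?(ltW s0) //= ler_pdivrMr //; apply: le_trans nl' _.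
  by rewrite ler_pM2l.
have -> : x / sq_num q l.+1 ^+ 2 * n%:R = x * (n%:R / sq_num q l.+1 ^+ 2) by rewrite mulrAC mulrA.
move: r3; move: (n%:R / _) => r /andP[r0 r3]; rewrite exprMn.
have z0 := nsqc_ge0 z; have x0 := sqr_ge0 x.
have : r ^+ 2 <= 9 by nra.
have : 0 <= r ^+ 2 by exact: sqr_ge0.
move: (nsqc z) (x ^+ 2) (r ^+ 2) z1 x1 z0 x0 => u v w u1 v1 u0 v0 w0 w9.
have : u * v <= 1 by nra.
have : 0 <= u * v by nra.
rewrite mulrA; move: (u * v) => e e0 e1; nra.
Qed.

(* The components of T (eps k) of the other type are small compared with the gap
   between the eigenvalues: this is why the commutator is bounded. *)
Lemma spin_T l c m t (u : bool) : spin_good (l, c, m, t, u) -> exists x y z w : R[i],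
  [/\ T (eps (l, c, m, t, u)) =
        x *: eps (l.+1, d + c, (a + m)%N, (t + b)%N, u)
        + y *: eps (l.+1, d + c, (a + m)%N, (t + b)%N, ~~ u)
        + (z *: eps (l.-1, d + c, (a + m).-1, (t + b).-1, u)
           + w *: eps (l.-1, d + c, (a + m).-1, (t + b).-1, ~~ u)),
      nsqc (y * (2 * l + 3)%N%:R%:C) <= 9,
      nsqc (w * (2 * l + 1)%N%:R%:C) <= 9,
      z != 0 \/ w != 0 -> [/\ (0 < l)%N, (0 < a + m)%N & (0 < t + b)%N]
    & if u then w = 0 else y = 0].
Proof.
move=> /and4P[/eqP lc ml ut tl].
pose X : R := if u then cg1' q l t else - cg2' q l t.
pose Y : R := if u then cg2' q l t else cg1' q l t.
have epsE : eps (l, c, m, t, u) = X%:C *: F (l, c, m, t, true) + Y%:C *: F (l, c, m, t, false).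
  by rewrite /X /Y; case: (u).
have tl1 : (t <= l.+1)%N by case: (u) tl; lia.
have [DP DPdef] : exists DP, DP = rowD q l a m *: ((X * colD q l b true t)%:C *: F (l.-1, d + c, (a + m).-1, (t + b).-1, true)
                   + (Y * colD q l b false t)%:C *: F (l.-1, d + c, (a + m).-1, (t + b).-1, false)) by eexists.
have [z [w [DPE w9 zw w0]]] : exists z w : R[i],
    [/\ DP = z *: eps (l.-1, d + c, (a + m).-1, (t + b).-1, u)
           + w *: eps (l.-1, d + c, (a + m).-1, (t + b).-1, ~~ u),
      nsqc (w * (2 * l + 1)%N%:R%:C) <= 9,
      z != 0 \/ w != 0 -> [/\ (0 < l)%N, (0 < a + m)%N & (0 < t + b)%N]
    & u -> w = 0].
  (* Where the lowering part vanishes, at the ends of the index ranges, zero coefficients avoid any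
     statement about truncated predecessors. *)
  have triv : DP = 0 -> exists z w : R[i],
    [/\ DP = z *: eps (l.-1, d + c, (a + m).-1, (t + b).-1, u)
           + w *: eps (l.-1, d + c, (a + m).-1, (t + b).-1, ~~ u),
      nsqc (w * (2 * l + 1)%N%:R%:C) <= 9,
      z != 0 \/ w != 0 -> [/\ (0 < l)%N, (0 < a + m)%N & (0 < t + b)%N]
    & u -> w = 0].
    move=> ->; exists 0, 0; split=> //; first by rewrite !scale0r addr0.
      by rewrite mul0r nsqc0 ler0n.
    by rewrite eqxx; case.
  have [rD|/(rowD_eq0 hq ml)[l0 am ma]] := eqVneq (rowD q l a m) 0.
    by apply: triv; rewrite DPdef rD scale0r.
  have [bt|bt] := leqP (~~ b) t; last first.
    have {bt} [b0 t0] : b = false /\ t = 0%N by case: (b) bt; lia.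
    have u1 : u = true by rewrite t0 in ut; case: (u) ut.
    apply: triv; rewrite DPdef /X /Y u1 b0 t0 /colD /= /cg1' /cg1 /cgA sq_num0 // !(mul0r, mulr0).
    by rewrite !scale0r addr0 scaler0.
  have [tb|tb] := leqP (t + b)%N l.+1; last first.
    apply: triv; rewrite DPdef !F_invalid ?scaler0 ?addr0 ?scaler0 //; first by case: (b) tb; lia.
    by case: (b) tb; lia.
  case: l lc ml tl tl1 l0 ma tb @X @Y epsE DPdef {triv} => [//|l] lc ml tl tl1 _ ma tb X Y epsE DPdef.
  have rD1 := rowD_le1 hq am ma.
  have E := F_comb l (d + c) (a + m).-1 (t + b).-1 (X * colD q l.+1 b true t) (Y * colD q l.+1 b false t) (rowD q l.+1 a m).
  have conds : [/\ (0 < l.+1)%N, (0 < a + m)%N & (0 < t + b)%N].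
    by split=> //; [exact: addb_gt0 | rewrite addnC; exact: addb_gt0].
  case: u ut tl @X @Y epsE DPdef E => ut tl X Y epsE DPdef E.
    exists (rowD q l.+1 a m * (X * colD q l.+1 b true t * cg1' q l (t + b).-1 + Y * colD q l.+1 b false t * cg2' q l (t + b).-1)%:C), 0.
    split=> //; last by rewrite mul0r nsqc0 ler0n.
    by rewrite DPdef E /X /Y flip_up_down // mulr0.
  exists (rowD q l.+1 a m * (- (X * colD q l.+1 b true t * cg2' q l (t + b).-1) + Y * colD q l.+1 b false t * cg1' q l (t + b).-1)%:C).
  exists (rowD q l.+1 a m * ((if b then cg1 q l t else cg2 q l t.-1) / sq_num q l.+2 ^+ 2)%:C).
  split=> //; first by rewrite DPdef E addrC /X /Y !mulNr flip_down_down.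
  apply: bound_flip => //; last by lia.
  by case: (b) tb bt => tb bt; [apply: cg1_le1 | apply: cg2_le1] => //; lia.
have E := F_comb l.+1 (d + c) (a + m)%N (t + b)%N (X * colU q l b true t) (Y * colU q l b false t) (rowU q l a m).
have rU1 := rowU_le1 hq a ml.
have TE : T (eps (l, c, m, t, u)) = rowU q l a m *: ((X * colU q l b true t)%:C *: F (l.+1, d + c, (a + m)%N, (t + b)%N, true)
                   + (Y * colU q l b false t)%:C *: F (l.+1, d + c, (a + m)%N, (t + b)%N, false)) + DP.
  by rewrite epsE T_comb // DPdef.
case: u ut tl @X @Y epsE DPdef DPE w0 E TE => ut tl X Y epsE DPdef DPE w0 E TE.
  exists (rowU q l a m * (X * colU q l b true t * cg1' q l.+1 (t + b) + Y * colU q l b false t * cg2' q l.+1 (t + b))%:C).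
  exists (rowU q l a m * ((if b then cg2 q l.+1 t.+1 else - cg1 q l.+1 t) / sq_num q l.+1 ^+ 2)%:C), z, w.
  split=> //.
  - by rewrite TE DPE E /X /Y flip_up_up.
  - apply: bound_flip => //; last by lia.
    by case: (b); rewrite ?sqrrN; [apply: cg2_le1 | apply: cg1_le1] => //; lia.
  - exact: w0.
exists (rowU q l a m * (- (X * colU q l b true t * cg2' q l.+1 (t + b)) + Y * colU q l b false t * cg1' q l.+1 (t + b))%:C).
exists 0, z, w; split=> //; last by rewrite mul0r nsqc0 ler0n.
rewrite TE DPE E; congr (_ + _); rewrite addrC; congr (_ *: _ + _ *: _).
by rewrite /X /Y !mulNr flip_down_up // mulr0.
Qed.

Definition shift (v f : bool) (k : s_label) : s_label :=
  let: (l, c, m, t, u) := k in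
  if v then (l.+1, d + c, (a + m)%N, (t + b)%N, u (+) f)
  else (l.-1, d + c, (a + m).-1, (t + b).-1, u (+) f).

(** The column is recovered from the row because [finite_band_op] enumerates the entries of a matrix
    row by row. *)
Definition unshift (v f : bool) (k : s_label) : s_label :=
  let: (l, c, m, t, u) := k in
  if v then (l.-1, c - d, (m - a)%N, (t - b)%N, u (+) f)
  else (l.+1, c - d, (m.+1 - a)%N, (t.+1 - b)%N, u (+) f).

Lemma shift_inj v f v' f' k : shift v f k = shift v' f' k -> v = v' /\ f = f'.
Proof.
case: k => -[[[l c] m] t] u.
case: v v' => -[] /= [].
- by move=> /addbI ->.
- by move/eqP; rewrite 1?[_.-1 == _]eq_sym succn_pred.
- by move/eqP; rewrite 1?[_.-1 == _]eq_sym succn_pred.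
- by move=> /addbI ->.
Qed.

Lemma unshift_inj v f v' f' k : unshift v f k = unshift v' f' k -> v = v' /\ f = f'.
Proof.
case: k => -[[[l c] m] t] u.
case: v v' => -[] /= [].
- by move=> /addbI ->.
- by move/eqP; rewrite 1?[_.-1 == _]eq_sym succn_pred.
- by move/eqP; rewrite 1?[_.-1 == _]eq_sym succn_pred.
- by move=> /addbI ->.
Qed.

Lemma shiftK v f (k : s_label) :
  (v || let: (l, c, m, t, u) := k in [&& (0 < l)%N, (0 < a + m)%N & (0 < t + b)%N]) ->
  unshift v f (shift v f k) = k.
Proof.
move: k => -[[[[l c] m] t] u].
have dc : d + c - d = c by rewrite addrAC subrr add0r.
case: v => /= [_|/and3P[l0 m0 t0]]; rewrite dc addbK.
  by rewrite addKn addnK.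
by rewrite !prednK // addKn addnK.
Qed.

Lemma unshift_spin f k l c m t u :
  (l, c, m, t, u) = unshift false f k -> exists l', l = l'.+1.
Proof. by case: k => [[[[l' c'] m'] t'] u'] /= [-> _ _ _ _]; exists l'. Qed.

(** The clause [f -> v = h.2] records the selection rule: a change of type raises the spin from the
    upper component and lowers it from the lower one. *)
Lemma spin_T_coef g h : ip (eps g) (T (eps h)) != 0 -> exists v f : bool,
  [/\ g = shift v f h, h = unshift v f g, f -> v = h.2 &
   f -> nsqc (ip (eps g) (T (eps h)) * (2 * h.1.1.1.1 + (if v then 3 else 1))%N%:R%:C) <= 9].
Proof.
move=> z0; have hh : spin_good h.
  by rewrite -spin_eigen_neq0; apply: contra_neq z0 => ->; rewrite (linearE0 lT) (ip0r ipP).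
case: h hh z0 => [[[[l c] m] t] u] hh.
have [x [y [z [w [-> y9 w9 zw yw]]]]] := spin_T hh.
rewrite !(ipDr ipP, ipZr ipP) !spin_eigen_ip.
pose h : s_label := (l, c, m, t, u).
have E v f : (g == shift v f h) = ((g == shift v f h) && true) by rewrite andbT.
have ne (v f v' f' : bool) : (v, f) != (v', f') -> g == shift v f h -> (g == shift v' f' h) = false.
  by move=> vf /eqP ->; apply/negP => /eqP/shift_inj[vv ff]; rewrite vv ff eqxx in vf.
have s1 : (l.+1, d + c, (a + m)%N, (t + b)%N, u) = shift true false h by rewrite /= addbF.
have s2 : (l.+1, d + c, (a + m)%N, (t + b)%N, ~~ u) = shift true true h by rewrite /= addbT.
have s3 : (l.-1, d + c, (a + m).-1, (t + b).-1, u) = shift false false h by rewrite /= addbF.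
have s4 : (l.-1, d + c, (a + m).-1, (t + b).-1, ~~ u) = shift false true h by rewrite /= addbT.
rewrite s1 s2 s3 s4; clear s1 s2 s3 s4 E; move: (spin_good g) => sg.
have [/[dup] gs|g1] := boolP (g == shift true false h).
  move=> /eqP gE _; exists true, false; split=> //.
  by rewrite gE shiftK.
have [gs|g2] := boolP (g == shift true true h).
  have gE := eqP gs; rewrite !(ne _ _ _ _ _ gs) //= !(mulr0n, mulr0, addr0, add0r); case: sg => /=; last by rewrite mulr0n mulr0 eqxx.
  rewrite mulr1n mulr1 => y0; exists true, true; split=> //.
  - by rewrite gE shiftK.
  - by move=> _; case: (u) yw y0 => // ->; rewrite eqxx.
have [gs|g3] := boolP (g == shift false false h).
  have gE := eqP gs; rewrite !(ne _ _ _ _ _ gs) //= !(mulr0n, mulr0, addr0, add0r); case: sg => /=; last by rewrite mulr0n mulr0 eqxx.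
  rewrite mulr1n mulr1 => y0; exists false, false; split=> //.
  by rewrite gE shiftK //=; apply/and3P/zw; left.
have [gs|g4] := boolP (g == shift false true h).
  rewrite /= !(mulr0n, mulr0, addr0, add0r); case: sg => /=; last by rewrite mulr0n mulr0 eqxx.
  rewrite mulr1n mulr1 => y0; exists false, true; split=> //.
  - exact/eqP.
  - by rewrite (eqP gs) shiftK //=; apply/and3P/zw; right.
  - by move=> _; case: (u) yw y0 => // ->; rewrite eqxx.
by rewrite /= !(mulr0n, mulr0, addr0) eqxx.
Qed.

Lemma spin_charge_comm g h : ip (eps g) (T (eps h)) != 0 ->
  spin_charge g - spin_charge h = d%:~R / 2.
Proof.
move=> /spin_T_coef[v [f [-> _ _ _]]]; case: h => [[[[l c] m] t] u] /=.
by case: v; rewrite /= rmorphD /= -mulrBl addrK.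
Qed.

Lemma spin_dirac_abs k : `|spin_dirac k| = k.1.1.1.1%:R + k.2%:R + 1 / 2.
Proof.
case: k => [[[[l c] m] t] u] /=; have l0 : 0 <= l%:R :> R by rewrite ler0n.
by case: u => /=; [rewrite ger0_norm | rewrite ler0_norm]; rewrite ?mulr0n; lra.
Qed.

(** When the type changes, the change of spin compensates it exactly and the absolute eigenvalue is
    preserved; otherwise it moves by one with the spin. *)
Lemma spin_dirac_band g h : ip (eps g) (T (eps h)) != 0 ->
  `| `|spin_dirac g| - `|spin_dirac h| | <= 1.
Proof.
rewrite !spin_dirac_abs => /spin_T_coef[v [f [-> hE uv _]]].
have lv : ~~ v -> h.1.1.1.1 = (shift v f h).1.1.1.1.+1.
  by rewrite [in LHS]hE; case: (shift v f h) => [[[[? ?] ?] ?] ?]; case: (v).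
case: h hE uv lv => [[[[l c] m] t] u] /= _ uv lv; rewrite ler_norml.
case: v uv lv => uv lv /=.
  rewrite -[l.+1%:R]natr1; clear lv.
  by case: f uv => [/(_ isT) <-|_]; rewrite ?addbT ?addbF /=; [|case: (u) => /=]; rewrite ?mulr0n; lra.
have [l' ->] : exists l', l = l'.+1 by exists l.-1; exact: lv.
clear lv; rewrite /= -[l'.+1%:R]natr1.
by case: f uv => [/(_ isT) <-|_]; rewrite ?addbT ?addbF /=; [|case: (u) => /=]; rewrite ?mulr0n; lra.
Qed.

(** An entry preserving the type is multiplied by 1 or -1 and is bounded by the norm of [T]; an
    entry changing it is multiplied by [2 * l + 3] or [2 * l + 1] up to sign, and [spin_T_coef]
    bounds the result. Four shifts cover all entries. *)
Lemma spin_dirac_comm : exists2 B, bounded_op ip B &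
  forall g h, ip (eps g) (B (eps h)) =
    (spin_dirac g - spin_dirac h)%:C * ip (eps g) (T (eps h)).
Proof.
have [C C0 hC] := bounded_nsqP ipP bT.
pose s (k : 'I_4) := unshift (k < 2)%N (odd k).
have nsq1 k : nsq ip (eps k) <= 1.
  by rewrite /nsq spin_eigen_ip eqxx /=; case: (spin_good k); rewrite /= ?ler01.
apply: (@finite_band_op _ _ _ _ _ 4 s _ (C + 9) hH spin_eigen_on spin_eigen_complete).
- by move=> g h ->; rewrite (ip0l ipP) mulr0.
- by move=> g h ->; rewrite (linearE0 lT) (ip0r ipP) mulr0.
- move=> g h; rewrite mulf_eq0 negb_or => /andP[_ /spin_T_coef[v [f [_ hE _ _]]]].
  have k4 : ((if v then 0 else 2) + f < 4)%N by case: (v); case: (f).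
  by exists (Ordinal k4); rewrite hE /s /=; case: (v); case: (f).
- move=> k g g'; rewrite !mulf_eq0 !negb_or.
  move=> /andP[_ /spin_T_coef[v [f [gE sE _ _]]]] /andP[_ /spin_T_coef[v' [f' [gE' sE' _ _]]]].
  have [vk fk] := unshift_inj sE; have [vk' fk'] := unshift_inj sE'.
  by move=> ss; rewrite gE gE' ss -vk -vk' -fk -fk'.
move=> g h; have [->|z0] := eqVneq (ip (eps g) (T (eps h))) 0.
  by rewrite mulr0 nsqc0 addr_ge0.
have [v [f [gE hE fv f9]]] := spin_T_coef z0.
case: f f9 fv gE hE => [/(_ isT) f9 /(_ isT) fv|_ _] gE hE.
  apply: le_trans (_ : 9 <= _); last by rewrite lerDr.
  apply: le_trans f9; rewrite !nsqcM mulrC ler_wpM2l ?nsqc_ge0 // !nsqcR.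
  rewrite gE; case: h fv {z0 gE} hE => [[[[l c] m] t] u] /= -> hE.
  case: u hE => /= hE.
    rewrite -[l.+1%:R]natr1 natrD natrM.
    by rewrite [X in X ^+ 2 <= _](_ : _ = - (2 * l%:R + 3)) ?sqrrN //; lra.
  have [l' ->] : exists l', l = l'.+1 := unshift_spin hE.
  rewrite /= natrD natrM -[l'.+1%:R]natr1.
  by rewrite [X in X ^+ 2 <= _](_ : _ = 2 * (l'%:R + 1) + 1) //; lra.
have -> : nsqc ((spin_dirac g - spin_dirac h)%:C * ip (eps g) (T (eps h))) = nsqc (ip (eps g) (T (eps h))).
  rewrite nsqcM nsqcR; apply: etrans (mul1r _); congr (_ * _).
  rewrite gE; case: h {z0 gE} hE => [[[[l c] m] t] u]; rewrite /= addbF.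
  case: v => /= hE; first by case: (u) => /=; rewrite -[l.+1%:R]natr1; field.
  have [l' ->] : exists l', l = l'.+1 := unshift_spin hE.
  by case: (u) => /=; rewrite -[l'.+1%:R]natr1; field.
apply: le_trans (cauchy_schwarz ipP _ _) _.
have h1 := hC (eps h); have n1 := nsq1 g; have n2 := nsq1 h.
have p1 := nsq_ge0 ipP (eps g); have p2 := nsq_ge0 ipP (eps h); have p3 := nsq_ge0 ipP (T (eps h)).
by nra.
Qed.

End SpinorHilbert.

(** * The eigenbasis of the Dirac operator *)

Lemma spin_eigen_linear (R : realType) (q : R) (V W : lmodType R[i]) (j : V -> W)
    (F : s_label -> V) k : linear j -> j (spin_eigen q F k) = spin_eigen q (j \o F) k.
Proof.
by move=> lj; case: k => [[[[l c] m] t] [] ] /=; rewrite (linearE2 lj).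
Qed.

Lemma ffun_map_linear (K : nzRingType) (V W : lmodType K) (f : V -> W) : linear f ->
  linear (fun u : {ffun 'I_2 -> V} => [ffun i => f (u i)] : {ffun 'I_2 -> W}).
Proof. by move=> lf z u v; apply/ffunP => i; rewrite !ffunE lf. Qed.

Lemma map_spin_inj (K : nzRingType) (R : realType) (V W : lmodType R[i]) (f : V -> W) b a : linear f ->
  [ffun i => f (spin_inj b a i)] = spin_inj b (f a).
Proof.
by move=> lf; apply/ffunP => i; rewrite !ffunE; case: (_ == _); rewrite ?(linearE0 lf).
Qed.

Lemma spin_inj_eq_linear (R : realType) (V : lmodType R[i]) (W : lmodType R[i])
    (f g : {ffun 'I_2 -> V} -> W) : linear f -> linear g ->
  (forall (b : bool) a, f (spin_inj b a) = g (spin_inj b a)) -> f =1 g.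
Proof.
by move=> lf lg fg u; rewrite [u]spin_injE (linearED lf) (linearED lg) !fg.
Qed.

Section LinearEq.
Variables (K : nzRingType) (V W : lmodType K) (f g : V -> W) (x y : K) (u v : V).
Hypotheses (lf : linear f) (lg : linear g).

Lemma linear_eqD : f u = g u -> f v = g v -> f (x *: u + y *: v) = g (x *: u + y *: v).
Proof. by move=> fu fv; rewrite (linearE2 lf) (linearE2 lg) fu fv. Qed.

Lemma linear_eqB : f u = g u -> f v = g v -> f (x *: u - y *: v) = g (x *: u - y *: v).
Proof.
by move=> fu fv; rewrite (linearEB lf) (linearEB lg) !(linearEZ lf) !(linearEZ lg) fu fv.
Qed.

End LinearEq.

Section EigenBasis.
Variables (R : realType) (q : R).
Hypothesis hq : 0 < q < 1.
Implicit Types (l m n t : nat) (c : int).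
Local Notation tsu := (tsu R).

Definition f_index (k : s_label) : u_label := let: (l, c, m, t, s) := k in (l, c, m, (t - s)%N).
(** Guards the truncated subtraction in [f_index]. *)
Definition f_on (k : s_label) : bool := (k.2 <= k.1.2)%N.
Definition f_comp k : CU R := if f_on k then tl q (f_index k) else 0.
Definition f_vec (k : s_label) : CUV R := spin_inj k.2 (f_comp k).
Definition e_vec : s_label -> CUV R := spin_eigen q f_vec.

Lemma spin_validE k : spin_valid k = f_on k && label_valid (f_index k).
Proof.
case: k => [[[[l c] m] t] s]; rewrite /spin_valid /f_on /label_valid /tu_valid /=.
rewrite leq_subLR [(s + l)%N]addnC; case: (odd l == _); last by rewrite andbF.
by case: (m <= l)%N; rewrite ?andbF.
Qed.

Section LeftMul.
Variables (d : int) (a b : bool).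
Hypothesis od : oddz d.

Lemma tu_out l c m n : (l < n)%N -> tu q l c m n = 0.
Proof. by move=> ln; apply: tu_invalid; rewrite /tu_valid [(n <= l)%N]leqNgt ln !andbF. Qed.

Lemma tu_odd l c m n : odd l != oddz c -> tu q l c m n = 0.
Proof. by move=> lc; apply: tu_invalid; rewrite /tu_valid (negbTE lc). Qed.

Lemma comb_eq0 (V : lmodType R[i]) (x y z w : R[i]) (u v : V) :
  u = 0 \/ y = 0 -> v = 0 \/ w = 0 -> (x * y) *: u + (z * w) *: v = 0.
Proof. by case=> -> []->; rewrite ?mulr0 ?scaler0 ?scale0r ?scaler0 addr0. Qed.

Lemma u_mul_gen_tu l c m n : odd l = oddz c -> (m <= l)%N ->
  u_mul q (attach d (tsu 1 a b)) (tu q l c m n) =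
  (rowU q l a m * cgU q l b n) *: tu q l.+1 (d + c) (a + m) (b + n)
  + (rowD q l a m * cgD q l b n) *: tu q l.-1 (d + c) (a + m).-1 (b + n).-1.
Proof.
move=> lc ml; have [nl|ln] := leqP n l; first exact: (u_mul_gen hq a b od lc ml nl).
apply: etrans (congr1 (u_mul q _) (tu_out c m ln)) _.
apply: etrans (linearE0 (u_mul_linear q _)) _; apply/esym/comb_eq0.
  case: (b); first by left; apply: tu_out; rewrite add1n ltnS.
  have [ln1|] := leqP l.+2 n; first by left; apply: tu_out.
  rewrite ltnS => nl; have {nl ln} -> : n = l.+1 by apply/eqP; rewrite eqn_leq nl.
  by right; rewrite /cgU /cgB subnn sq_num0 mulr0 mul0r.
left; case: l lc ml ln => [|l] lc ml ln.
  by apply: tu_odd; rewrite oddzD od -lc.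
by apply: tu_out; case: (b) => /=; [exact: ltnW | rewrite add0n; case: n ln].
Qed.

Lemma u_mul_f_comp l c m t (s : bool) : odd l = oddz c -> (m <= l)%N ->
  u_mul q (attach d (tsu 1 a b)) (f_comp (l, c, m, t, s)) =
  (rowU q l a m * (colU q l b s t)%:C) *: f_comp (l.+1, d + c, (a + m)%N, (t + b)%N, s)
  + (rowD q l a m * (colD q l b s t)%:C) *: f_comp (l.-1, d + c, (a + m).-1, (t + b).-1, s).
Proof.
move=> lc ml; rewrite /f_comp /f_on /=; have [st|ts] := leqP s t; last first.
  have [s1 t0] : s = true /\ t = 0%N by case: (s) ts => //; case: (t).
  apply: etrans (linearE0 (u_mul_linear q _)) _; apply/esym/comb_eq0; rewrite s1 t0; case: (b) => /=.
  - by right; rewrite /colU /cg1 /cgA sq_num0 mul0r.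
  - by left.
  - by left.
  - by left.
have stb : (s <= t + b)%N by rewrite (leq_trans st) // leq_addr.
have e1 : (t + b - s = b + (t - s))%N by rewrite addnC addnBA.
apply: etrans (u_mul_gen_tu (t - s) lc ml) _; rewrite stb.
apply: (f_equal2 +%R).
  have -> : (colU q l b s t)%:C = cgU q l b (t - s).
    by rewrite /cgU /colU cg1E cg2E subSn //; case: (b).
  by rewrite /tl /= e1.
have [stb'|stb'] := leqP s (t + b).-1.
  have -> : (colD q l b s t)%:C = cgD q l b (t - s).
    by rewrite /cgD /colD cg1E cg2E subSn //; case: (b); rewrite ?RcN.
  rewrite /tl /= (_ : ((t + b).-1 - s = (b + (t - s)).-1)%N) //.
  by rewrite -e1 -!subn1 subnAC.
(* The only case where the lowered label falls below its spin index; the coefficient vanishes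
   there. *)
have [s1 [t1 b0]] : s = true /\ t = 1%N /\ b = false.
  by case: (s) (b) stb' st => -[]; rewrite ?addn1 ?addn0 //; case: (t) => // -[].
rewrite s1 t1 b0 /cgD /= /cgA subn1 sq_num0 mul0r mulr0 scale0r; exact/esym/scaler0.
Qed.

End LeftMul.

Let f_vec_tvec l c m t (s : bool) n : odd l = oddz c -> (s <= t)%N -> (t - s)%N = n ->
  f_vec (l, c, m, t, s) = ((haar_norm q l m)^-1)%:C *: spin_inj s (tvec R l c m n).
Proof.
move=> lc st <-; apply: etrans (linearEZ (spin_inj_linear s) _ _).
by rewrite /f_vec /= /f_comp /f_on /= st /tl /tu lc eqxx.
Qed.

Lemma comb_scale (V : lmodType R[i]) (x y z : R[i]) (u v : V) :
  x *: (z *: u) + y *: (z *: v) = z *: (x *: u + y *: v).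
Proof. by rewrite scalerDr !scalerA ![z * _]mulrC. Qed.

Lemma e_vec_up l c m t : odd l = oddz c ->
  e_vec (l, c, m, t, true) = ((haar_norm q l m)^-1)%:C *: up_vec q l c m t.
Proof.
move=> lc; rewrite /up_vec /spin_up /cg_up cg1'E cg2'E; apply: etrans (comb_scale _ _ _ _ _).
apply: (f_equal2 +%R); last first.
  exact: (congr1 (fun v => _ *: v) (f_vec_tvec (s := false) m lc (leq0n t) (subn0 t))).
case: t => [|t]; first by rewrite /cg1' /cgA sq_num0 mul0r; exact: etrans (scale0r _) (esym (scale0r _)).
exact: (congr1 (fun v => _ *: v) (f_vec_tvec (s := true) m lc (ltn0Sn t) (subn1 t.+1))).
Qed.

Lemma e_vec_down l c m t : odd l = oddz c ->
  e_vec (l, c, m, t.+1, false) = ((haar_norm q l m)^-1)%:C *: down_vec q l c m t.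
Proof.
move=> lc; rewrite /down_vec /spin_down /cg_down cg1'E cg2'E; apply: etrans (comb_scale _ _ _ _ _).
apply: (f_equal2 +%R); apply: (f_equal2 (fun z v => z *: v)).
- exact: RcN.
- exact: (f_vec_tvec (s := true) m lc (ltn0Sn t) (subn1 t.+1)).
- by [].
- exact: (f_vec_tvec (s := false) m lc (leq0n t.+1) (subn0 t.+1)).
Qed.

Lemma partial_x0E (a : CU R) : partial_x0 a =
  \sum_(x <- msupp a) a@_x *: (((u_charge x)%:~R / 2) *: << x >>).
Proof. by apply: eq_bigr => x _; rewrite scalerA. Qed.

Lemma partial_x0_linear : linear (@partial_x0 R).
Proof. exact: eq_linear partial_x0E (malg_linear _). Qed.

Lemma partial_x0_tvec l c m n : odd l = oddz c ->
  partial_x0 (tvec R l c m n) = (c%:~R / 2) *: tvec R l c m n.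
Proof.
move=> lc; have [/andP[ml nl]|mn] := boolP ((m <= l) && (n <= l))%N; last first.
  apply: etrans (congr1 _ (tvec_out R c mn)) _; apply: etrans (linearE0 partial_x0_linear) _.
  by apply: etrans (esym (scaler0 _ _)) _; apply: (congr1 (fun v => _ *: v)); exact/esym/tvec_out.
have [x -> [_ xc]] := tvec_exists R lc ml nl; apply: etrans (partial_x0E _) _.
by apply: etrans (malg_linearU _ _) _; rewrite xc.
Qed.

Lemma partial_x0_f_comp k : partial_x0 (f_comp k) = (spin_charge R k)%:C *: f_comp k.
Proof.
have z0 : partial_x0 0 = (spin_charge R k)%:C *: 0 :> CU R.
  by apply: etrans (linearE0 partial_x0_linear) (esym (scaler0 _ _)).
rewrite /f_comp; case: (f_on k); last exact: z0.
case: k z0 => [[[[l c] m] t] s] z0.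
have -> : tl q (f_index (l, c, m, t, s)) = tu q l c m (t - s) by [].
rewrite /tu; have [/eqP lc|_] := boolP (odd l == oddz c); last exact: z0.
clear z0; have e : (c%:~R / 2)%:C = c%:~R / 2 :> R[i] by rewrite RcM RcV rmorph_int rmorph_nat.
apply: etrans (linearEZ partial_x0_linear _ _) _.
apply: etrans (congr1 (fun v => _ *: v) (partial_x0_tvec m (t - s) lc)) _.
by apply: etrans (scale_swap _ _ _) _; rewrite e.
Qed.

Section HilbertSpace.
Variables (L : lmodType R[i]) (ip : L -> L -> R[i]) (Lam : CU R -> L).
Hypothesis hL : is_L2 q ip Lam.
Let hH := L2_hilbert hL.
Let ipP : inner_product ip := hH.1.
Let lLam := L2_linear hL.

Definition F_vec (k : s_label) : HV L := LamV Lam (f_vec k).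

Lemma LamV_linear : linear (LamV Lam).
Proof. exact: (ffun_map_linear lLam). Qed.

Lemma F_vecE k : F_vec k = spin_inj k.2 (Lam (f_comp k)).
Proof. exact: (map_spin_inj R _ _ lLam). Qed.

Lemma ipV_spin_inj (b : bool) a x : ipV ip (spin_inj b a) x =
  ip a (x (if b then ord_max else ord0)).
Proof.
rewrite /ipV big_ord_recl big_ord1 !ffunE; case: b => /=.
  by rewrite (ip0l ipP) add0r; congr (ip _ (x _)); exact: val_inj.
by rewrite (ip0l ipP) addr0.
Qed.

Lemma hilbert_V : hilbert_space (ipV ip).
Proof. exact: (hilbert_ffun hH 2). Qed.

Lemma f_comp_ip k k' : k.2 = k'.2 -> ip (Lam (f_comp k)) (Lam (f_comp k')) = ((k == k') && spin_valid k)%:R.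
Proof.
have z0 : ip (Lam 0) (Lam 0) = 0 by rewrite (linearE0 lLam) (ip0l ipP).
rewrite spin_validE /f_comp.
case: k k' => [[[[l c] m] t] s] [[[[l' c'] m'] t'] s'] /= <-; rewrite /f_on /=.
have [st|ts] := leqP s t; last first.
  by rewrite (linearE0 lLam) (ip0l ipP) andbF.
have [st'|ts'] := leqP s t'; last first.
  rewrite (linearE0 lLam) (ip0r ipP); case: eqP => // -[_ _ _ tt].
  by rewrite tt leqNgt ts' in st.
apply: etrans (L2_ip hL _ _) _; apply: etrans (u_ip_tl hq _ _) _.
rewrite andbC; congr ((_ && _)%:R); rewrite !xpair_eqE eqxx andbT; congr (_ && _).
by rewrite -(eqn_add2r s) !subnK.
Qed.

Lemma F_vec_ip k k' : ipV ip (F_vec k) (F_vec k') = ((k == k') && spin_valid k)%:R.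
Proof.
rewrite !F_vecE ipV_spin_inj ffunE.
have -> : ((if k.2 then ord_max else ord0 : 'I_2) == k'.2 :> nat) = (k.2 == k'.2).
  by case: (k.2); case: (k'.2).
have [kk|kk] := eqVneq k.2 k'.2; first by rewrite f_comp_ip.
by rewrite (ip0r ipP); case: eqP => // e; rewrite e eqxx in kk.
Qed.

Lemma F_vec_neq0 k : (F_vec k != 0) = spin_valid k.
Proof.
have := F_vec_ip k k; rewrite eqxx /=; case: (spin_valid k) => e.
  by apply/eqP => k0; move/eqP: e; rewrite k0 (ip0l hilbert_V.1) eq_sym oner_eq0.
by apply/negbTE; rewrite negbK -(nsq_eq0 hilbert_V.1) /nsq e.
Qed.

Lemma F_vec_on : orthonormal (ipV ip) F_vec.
Proof.
split=> [k k' /eqP kk'|k]; first by rewrite F_vec_ip (negbTE kk').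
have [kg|kg] := boolP (spin_valid k); first by right; rewrite F_vec_ip eqxx kg.
by left; apply/eqP; rewrite -[_ == _]negbK F_vec_neq0.
Qed.

Lemma F_vec_complete : complete_family (ipV ip) F_vec.
Proof.
move=> x hx; apply/ffunP => i; rewrite ffunE; apply: (L2_complete hq hL) => -[[[l c] m] n].
pose s : bool := i == ord_max.
have <- : (if s then ord_max else ord0) = i.
  by rewrite /s; case: i {s} => -[|[|//]] hi /=; apply: val_inj.
rewrite -ipV_spin_inj; have := hx (l, c, m, (n + s)%N, s); rewrite F_vecE.
by rewrite /f_comp /f_on /= leq_addl addnK.
Qed.

Lemma left_mul_F d (a b : bool) : oddz d -> forall l c m t (s : bool), odd l = oddz c -> (m <= l)%N ->
  [ffun i => left_mul q ip Lam (attach d (tsu 1 a b)) (F_vec (l, c, m, t, s) i)] =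
  (rowU q l a m * (colU q l b s t)%:C) *: F_vec (l.+1, d + c, (a + m)%N, (t + b)%N, s)
  + (rowD q l a m * (colD q l b s t)%:C) *: F_vec (l.-1, d + c, (a + m).-1, (t + b).-1, s).
Proof.
move=> od l c m t s lc ml; have [[lT _] TE] := left_mulP hq hL (attach d (tsu 1 a b)).
rewrite !F_vecE /= (map_spin_inj R _ _ lT) TE.
apply: etrans (linearE2 (spin_inj_linear s) _ _ _ _); apply: (congr1 (spin_inj s)).
apply: etrans (linearE2 lLam _ _ _ _); apply: (congr1 Lam).
exact: (u_mul_f_comp a b od t s lc ml).
Qed.

Definition E_vec : s_label -> HV L := spin_eigen q F_vec.

Lemma LamV_e_vec k : LamV Lam (e_vec k) = E_vec k.
Proof. exact: (spin_eigen_linear q f_vec k LamV_linear). Qed.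

Lemma LamV_inj u : LamV Lam u = 0 -> u = 0.
Proof.
move=> h; apply/ffunP => i; have := congr1 (fun y : HV L => y i) h; rewrite !ffunE => hi.
by apply: (L2_inj hq hL); exact: etrans hi (esym (linearE0 lLam)).
Qed.

Lemma E_vec_on : orthonormal (ipV ip) E_vec.
Proof. exact: (spin_eigen_on hq hilbert_V F_vec_on F_vec_neq0). Qed.

Lemma E_vec_complete : complete_family (ipV ip) E_vec.
Proof. by move=> x hx; exact: (spin_eigen_complete hq hilbert_V F_vec_complete F_vec_neq0 hx). Qed.

Lemma E_vec_neq0 k : (E_vec k != 0) = spin_good k.
Proof. exact: (spin_eigen_neq0 hq hilbert_V F_vec_on F_vec_neq0). Qed.

Lemma e_vec_eq0 k : ~~ spin_good k -> e_vec k = 0.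
Proof.
by move=> kg; apply: LamV_inj; rewrite LamV_e_vec; apply/eqP; rewrite -[_ == _]negbK E_vec_neq0.
Qed.

Lemma dirac_e_vec k : dirac_alg q (e_vec k) = (spin_dirac R k)%:C *: e_vec k.
Proof.
have ldir := dirac_alg_linear hq.
have [kg|/e_vec_eq0 ->] := boolP (spin_good k); last first.
  exact: etrans (linearE0 ldir) (esym (scaler0 _ _)).
have n1 (l : nat) : (l%:R)%:C = l%:R :> R[i] by exact: rmorph_nat.
have n2 : (3 / 2)%:C = 3 / 2 :> R[i] by rewrite RcM RcV !rmorph_nat.
have n3 : 2%:C = 2 :> R[i] by rewrite rmorph_nat.
case: k kg => [[[[l c] m] t] [] ] /and4P[/eqP lc ml t0 tl].
  rewrite addn1 in tl; rewrite e_vec_up //; apply: etrans (linearEZ ldir _ _) _.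
  apply: etrans (congr1 (fun v => _ *: v) (dirac_alg_up hq lc ml tl)) _.
  by apply: etrans (scale_swap _ _ _) _; rewrite /spin_dirac RcD n1 n2.
rewrite addn0 in tl; case: t t0 tl => [//|t] _ tl; rewrite e_vec_down //.
apply: etrans (linearEZ ldir _ _) _.
have l0 : (0 < l)%N by case: (l) tl.
have tl' : (t <= l.-1)%N by rewrite -ltnS prednK.
apply: etrans (congr1 (fun v => _ *: v) (dirac_alg_down hq lc ml l0 tl')) _.
by apply: etrans (scale_swap _ _ _) _; rewrite /spin_dirac RcD RcN RcD n1 n2 n3.
Qed.

Definition charge_alg (u : CUV R) : CUV R := [ffun i => partial_x0 (u i)].

Lemma charge_alg_linear : linear charge_alg.
Proof. exact: (ffun_map_linear partial_x0_linear). Qed.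

Lemma charge_f_vec k : charge_alg (f_vec k) = (spin_charge R k)%:C *: f_vec k.
Proof.
apply: etrans (map_spin_inj R _ _ partial_x0_linear) _; rewrite partial_x0_f_comp.
exact: (linearEZ (spin_inj_linear k.2)).
Qed.

Lemma charge_e_vec k : charge_alg (e_vec k) = (spin_charge R k)%:C *: e_vec k.
Proof.
case: k => [[[[l c] m] t] up].
have h s : charge_alg (f_vec (l, c, m, t, s)) = (c%:~R / 2)%:C *: f_vec (l, c, m, t, s).
  exact: charge_f_vec.
have comb (x y : R[i]) : charge_alg (x *: f_vec (l, c, m, t, true) + y *: f_vec (l, c, m, t, false)) =
    (c%:~R / 2)%:C *: (x *: f_vec (l, c, m, t, true) + y *: f_vec (l, c, m, t, false)).
  apply: etrans (linearE2 charge_alg_linear _ _ _ _) _.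
  apply: etrans (f_equal2 (fun u v => x *: u + y *: v) (h true) (h false)) _.
  exact: comb_scale.
by case: up; exact: comb.
Qed.

Lemma e_vec_span (W : lmodType R[i]) (f g : CUV R -> W) : linear f -> linear g ->
  (forall k, f (e_vec k) = g (e_vec k)) -> f =1 g.
Proof.
move=> lf lg fg; have f0 k : (f_vec k != 0) = spin_valid k.
  rewrite -F_vec_neq0; congr (~~ _); apply/eqP/eqP => [fk|]; last exact: LamV_inj.
  by rewrite /F_vec fk; exact: (linearE0 LamV_linear).
have fE k : f (f_vec k) = g (f_vec k).
  case: k => [[[[l c] m] t] s].
  have ft := fg (l, c, m, t, true); have ff := fg (l, c, m, t, false).
  have Et := spin_F_true hq f0 l c m t; have Ef := spin_F_false hq f0 l c m t.
  rewrite -/e_vec in Et Ef; move: (e_vec _) (e_vec _) ft ff Et Ef => u v fu fv Et Ef.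
  case: s; [rewrite Et | rewrite Ef]; [exact: (linear_eqB _ _ lf lg fu fv) | exact: (linear_eqD _ _ lf lg fu fv)].
apply: (spin_inj_eq_linear lf lg) => b; apply: (u_eq_linear_tl hq).
- exact: (comp_linear lf (spin_inj_linear b)).
- exact: (comp_linear lg (spin_inj_linear b)).
move=> [[[l c] m] n] _; have := fE (l, c, m, (n + b)%N, b).
by rewrite /f_vec /f_comp /f_on /= leq_addl addnK.
Qed.

(** The eigenvectors already belong to the algebraic tensor product, so the closure of the algebraic
    operator is the maximal diagonal one. *)
Lemma dirac_diag : is_diag (ipV ip) E_vec (spin_dirac R) (Defs.dirac q ip Lam).
Proof.
have E : LamV Lam \o e_vec = E_vec by apply/funext => k; exact: LamV_e_vec.
have := @closure_diag R (CUV R) (HV L) (ipV ip) (LamV Lam) hilbert_V LamV_linear s_label e_vec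
  (spin_dirac R) (dirac_alg q) (dirac_alg_linear hq).
rewrite E => /(_ E_vec_on E_vec_complete (@e_vec_span R[i]^o) dirac_e_vec); exact.
Qed.

Lemma charge_diag : is_diag (ipV ip) E_vec (spin_charge R) (charge_op ip Lam).
Proof.
have E : LamV Lam \o e_vec = E_vec by apply/funext => k; exact: LamV_e_vec.
have := @closure_diag R (CUV R) (HV L) (ipV ip) (LamV Lam) hilbert_V LamV_linear s_label e_vec
  (spin_charge R) charge_alg charge_alg_linear.
rewrite E => /(_ E_vec_on E_vec_complete (@e_vec_span R[i]^o) charge_e_vec); exact.
Qed.

End HilbertSpace.
End EigenBasis.

(** * The even operator built from two commuting diagonal operators *)

Section Commutators.
Variables (R : realType) (H : lmodType R[i]) (ip : H -> H -> R[i]).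
Hypothesis ipP : inner_product ip.
Variable D : operator H.
Hypothesis lD : linear_on_dom D.

Lemma commutator_ext_lin a S T BS BT : commutator_ext ip D S BS -> commutator_ext ip D T BT ->
  commutator_ext ip D (fun x => a *: S x + T x) (fun x => a *: BS x + BT x).
Proof.
move=> [bS hS] [bT hT]; split=> [|x xD]; first exact: (bounded_lin ipP).
have [SD <-] := hS x xD; have [TD <-] := hT x xD.
have [? ->] := lD.2 a _ _ SD TD; split=> //.
by rewrite scalerBr opprD addrACA.
Qed.

Lemma commutator_ext_comp S T BS BT : bounded_op ip S -> bounded_op ip T ->
  commutator_ext ip D S BS -> commutator_ext ip D T BT ->
  commutator_ext ip D (fun x => S (T x)) (fun x => BS (T x) + S (BT x)).
Proof.
move=> bS bT [bBS hS] [bBT hT]; split=> [|x xD].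
  by apply: (bounded_D ipP); exact: bounded_comp.
have [TD <-] := hT x xD; have [SD <-] := hS _ TD; split=> //.
by rewrite (linearEB bS.1) addrA subrK.
Qed.

Lemma commutator_ext_id : commutator_ext ip D id (fun=> 0).
Proof. by split=> [|x xD]; [exact: (bounded_0 ipP) | rewrite subrr]. Qed.

Lemma opp_on_dom x : opdom D x -> opdom D (- x) /\ D (- x) = - D x.
Proof.
move=> xD; have [] := lD.2 (- 1) x 0 xD lD.1; rewrite !scaleN1r !addr0 => h ->; split=> //.
have [_] := lD.2 0 0 0 lD.1 lD.1; rewrite scaler0 addr0 scale0r add0r => _.
have [_] := lD.2 1 0 0 lD.1 lD.1; rewrite scale1r addr0 scale1r => /eqP.
by rewrite -subr_eq0 opprD addrA subrr sub0r oppr_eq0 => /eqP ->; rewrite addr0.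
Qed.

End Commutators.

Definition double_op (R : realType) (H : lmodType R[i]) (D C : operator H) : operator (H * H)%type :=
  Operator [set x | [/\ opdom D x.1, opdom C x.1, opdom D x.2 & opdom C x.2]]
    (fun x => ('i *: D x.2 + C x.2, - ('i *: D x.1) + C x.1)).

Section Double.
Variables (R : realType) (H : lmodType R[i]) (ip : H -> H -> R[i]).
Hypothesis hH : hilbert_space ip.
Let ipP : inner_product ip := hH.1.

Lemma double_commutator D C T B B' : bounded_op ip T ->
  commutator_ext ip D T B -> commutator_ext ip C T B' ->
  commutator_ext (ip_pair ip) (double_op D C) (fun x => (T x.1, T x.2))
    (fun x => ('i *: B x.2 + B' x.2, - ('i *: B x.1) + B' x.1)).
Proof.
move=> [lT _] [bB hB] [bB' hB']; split.
  have b1 : bounded_op ip (fun x => 'i *: B x + B' x) by exact: (bounded_lin ipP).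
  have b2 : bounded_op ip (fun x => - 'i *: B x + B' x) by exact: (bounded_lin ipP).
  have := bounded_pair hH (bounded_0 ipP) b1 b2 (bounded_0 ipP).
  by congr bounded_op; apply/funext => x; rewrite add0r addr0 scaleNr.
move=> [x y] [/= xD xC yD yC].
have [TxD <-] := hB x xD; have [TxC <-] := hB' x xC.
have [TyD <-] := hB y yD; have [TyC <-] := hB' y yC; split=> //.
rewrite !(linearED lT) (linearEN lT) !(linearEZ lT).
congr pair; rewrite /= ?scalerBr ?opprD ?opprK; first by rewrite addrACA.
by rewrite addrACA.
Qed.

Variables (I : countType) (e : I -> H).
Hypothesis eON : orthonormal ip e.
Hypothesis eC : complete_family ip e.
Variables (lam gam : I -> R) (D C : operator H).
Hypothesis lam0 : forall k, lam k != 0.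
Hypothesis hD : is_diag ip e lam D.
Hypothesis hC : is_diag ip e gam C.

Definition modulus (k : I) : R := Num.sqrt (lam k ^+ 2 + gam k ^+ 2).

Lemma modulus_gt0 k : 0 < modulus k.
Proof. by rewrite sqrtr_gt0 ltr_pwDl ?sqr_ge0 // exprn_even_gt0 //= lam0. Qed.

Lemma sqr_modulus k : modulus k ^+ 2 = lam k ^+ 2 + gam k ^+ 2.
Proof. by rewrite sqr_sqrtr // addr_ge0 ?sqr_ge0. Qed.

Let z k : R[i] := (gam k)%:C + 'i * (lam k)%:C.
Let zc k : R[i] := (gam k)%:C - 'i * (lam k)%:C.
Let r k : R[i] := (modulus k)%:C.

Let zE k : z k = (gam k +i* lam k)%C.
Proof. by rewrite /z; apply/eqP; rewrite eq_complex /= !(mul0r, mul1r, subr0, sub0r, addr0, add0r, oppr0) !eqxx. Qed.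

Let zcE k : conjc (z k) = zc k.
Proof.
rewrite zE /zc; apply/eqP.
by rewrite eq_complex /= !(mul0r, mul1r, subr0, sub0r, addr0, add0r, oppr0) !eqxx.
Qed.

Let zz k : zc k * z k = r k ^+ 2.
Proof. by rewrite -zcE mul_conjc zE /nsqc /= /r -RcX sqr_modulus addrC. Qed.

Let r0 k : r k != 0. Proof. by rewrite Rc_eq0 gt_eqF // modulus_gt0. Qed.
Let z0 k : z k != 0.
Proof. by apply/eqP => h; have := zz k; rewrite h mulr0 => /esym/eqP; rewrite sqrf_eq0 (negbTE (r0 k)). Qed.

Let kap : R[i] := (Num.sqrt 2)^-1%:C.
Let kap2 : kap * kap = 2^-1.
Proof. by rewrite /kap -RcM -invfM -expr2 sqr_sqrtr // RcV rmorph_nat. Qed.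
Let kap0 : kap != 0.
Proof. by rewrite Rc_eq0 invr_eq0 gt_eqF // sqrtr_gt0. Qed.
Let kapJ : conjc kap = kap. Proof. exact: conjcR. Qed.

Let sg (b : bool) : R[i] := if b then 1 else -1.

(** On two copies of the line of [e k] the double operator has the off-diagonal entries [z k] and
    its conjugate. Its eigenvectors are (z/|z|, 1) and (z/|z|, -1) over the square root of 2, with
    eigenvalues |z| and -|z|. *)
Definition double_basis (k : I * bool) : (H * H)%type :=
  ((kap * z k.1 / r k.1) *: e k.1, (kap * sg k.2) *: e k.1).

Definition double_eigen (k : I * bool) : R := (if k.2 then 1 else -1) * modulus k.1.

Lemma double_basis_ip k y : ip_pair ip (double_basis k) y =
  kap * (zc k.1 / r k.1 * ip (e k.1) y.1 + sg k.2 * ip (e k.1) y.2).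
Proof.
rewrite /ip_pair /= !(ipZl ipP) !conjcM kapJ zcE.
have -> : conjc (r k.1)^-1 = (r k.1)^-1 by rewrite /r -RcV conjcR.
have -> : conjc (sg k.2) = sg k.2 by rewrite /sg; case: (k.2); rewrite ?conjcN conjc1.
by ring.
Qed.

Lemma double_basis_ip2 k k' : ip_pair ip (double_basis k) (double_basis k') =
  (k == k')%:R * ip (e k.1) (e k.1).
Proof.
rewrite double_basis_ip /= !(ipZr ipP); case: k k' => [k b] [k' b'] /=.
have [<-|kk'] := eqVneq k k'; last first.
  rewrite (on_orth eON) // !(mulr0, addr0) xpair_eqE (negbTE kk') /=.
  by rewrite mul0r.
rewrite xpair_eqE eqxx /=; set E := ip _ _.
have E1 : zc k / r k * (kap * z k / r k * E) = kap * E.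
  transitivity (zc k * z k / r k ^+ 2 * (kap * E)); last by rewrite zz divff ?mul1r // expf_neq0.
  by move: (r0 k); move: (r k) (z k) (zc k) (kap) => ? ? ? ? ?; field.
rewrite E1 (_ : _ * _ = (kap * kap) * (1 + sg b * sg b') * E); last by ring.
by rewrite kap2 /sg; case: b b' => -[]; rewrite /= ?mul1r ?mulr1 ?mulrNN ?mulr1 ?subrr ?mulr0 ?mul0r //;
  rewrite -[1 + 1]/(2%:R) mulVf ?mul1r // pnatr_eq0.
Qed.

Lemma double_on : orthonormal (ip_pair ip) double_basis.
Proof.
split=> [k k' /eqP kk'|k]; first by rewrite double_basis_ip2 (negbTE kk') mul0r.
have [k0|k0] := eqVneq (e k.1) 0.
  by left; rewrite /double_basis k0 !scaler0.
by right; rewrite double_basis_ip2 eqxx mul1r (on_ip eON) ?eqxx.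
Qed.

Lemma double_neq0 k : (double_basis k != 0) = (e k.1 != 0).
Proof.
congr (~~ _); apply/eqP/eqP => [h|k0]; last by rewrite /double_basis k0 !scaler0.
apply: (scalerI (_ : kap * sg k.2 != 0)); last by rewrite scaler0; exact: (congr1 snd h).
by rewrite mulf_neq0 // /sg; case: (k.2); rewrite ?oppr_eq0 oner_eq0.
Qed.

(** The relations for the two signs are equivalent to their sum and difference, which are the two
    components of the operator. *)
Let both k (a b a' b' : R[i]) :
  (forall s, kap * (zc k / r k * a + sg s * b) =
     (double_eigen (k, s))%:C * (kap * (zc k / r k * a' + sg s * b'))) <->
  a = z k * b' /\ b = zc k * a'.
Proof.
have eE s : (double_eigen (k, s))%:C = sg s * r k.
  by rewrite /double_eigen /sg /=; case: s; rewrite ?mul1r ?mulN1r ?RcN.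
have zrr : zc k * z k = r k * r k by rewrite zz expr2.
split=> [h|[-> ->] s]; last first.
  have -> : zc k / r k * (z k * b') = r k * b'.
    transitivity (zc k * z k / r k * b'); first by move: (r0 k); move: (r k) (z k) (zc k) => ? ? ? ?; field.
    by rewrite zrr mulfK.
  rewrite eE /sg; move: (r0 k); move: (r k) (zc k) (kap) => u v w u0.
  by case: s; field.
have h1 := h true; have h2 := h false; rewrite !eE in h1 h2.
have {}h1 : zc k / r k * a + b = r k * (zc k / r k * a' + b').
  by apply: (mulfI kap0); rewrite /sg !mul1r in h1; rewrite h1 mulrCA.
have {}h2 : zc k / r k * a - b = - r k * (zc k / r k * a' - b').
  by apply: (mulfI kap0); rewrite /sg !mulN1r in h2; rewrite h2 mulrCA.
have two : 2 != 0 :> R[i] by rewrite pnatr_eq0.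
have zc0 : zc k != 0 by rewrite -zcE conjc_eq0.
split.
  apply: (mulfI zc0); rewrite mulrA zrr; apply: (mulfI (invr_neq0 (r0 k))).
  apply: (mulfI two); transitivity (zc k / r k * a + b + (zc k / r k * a - b)); first by ring.
  by rewrite h1 h2; move: (r0 k); move: (r k) (zc k) => u v u0; field.
apply: (mulfI two); transitivity (zc k / r k * a + b - (zc k / r k * a - b)); first by ring.
by rewrite h1 h2; move: (r0 k); move: (r k) (zc k) => u v u0; field.
Qed.

Lemma double_complete : complete_family (ip_pair ip) double_basis.
Proof.
move=> [x y] h; have xy k : ip (e k) x = 0 /\ ip (e k) y = 0.
  have [|] := (both k (ip (e k) x) (ip (e k) y) 0 0).1; last by rewrite !mulr0.
  by move=> s; have := h (k, s); rewrite double_basis_ip => ->; rewrite !mulr0 addr0 !mulr0.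
by congr pair; apply: eC => k; have [] := xy k.
Qed.

Lemma double_diag : is_diag (ip_pair ip) double_basis double_eigen (double_op D C).
Proof.
move=> [x1 x2] [y1 y2].
have eqv : (forall i, ip_pair ip (double_basis i) (y1, y2) =
    (double_eigen i)%:C * ip_pair ip (double_basis i) (x1, x2)) <->
  forall k, ip (e k) y1 = z k * ip (e k) x2 /\ ip (e k) y2 = zc k * ip (e k) x1.
  split=> [h k|h [k s]]; last by rewrite !double_basis_ip; apply: (both _ _ _ _ _).2 (h k) s.
  by apply/both => s; have := h (k, s); rewrite !double_basis_ip.
rewrite eqv; split=> [[[/= D1 C1 D2 C2] [<- <-]] k|h].
  rewrite !(ipDr ipP) (ipNr ipP) !(ipZr ipP) !(diag_coef hD) // !(diag_coef hC) //.
  by rewrite /z /zc; split; ring.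
have nz k : nsqc (z k) = modulus k ^+ 2 by rewrite zE /nsqc /= sqr_modulus addrC.
have M0 k : 0 < modulus k ^+ 2 by rewrite exprn_gt0 // modulus_gt0.
have nzc k : nsqc (zc k) = modulus k ^+ 2 by rewrite -zcE nsqcJ.
have nV (w : R[i]) : w != 0 -> nsqc w^-1 = (nsqc w)^-1.
  move=> w0; apply: (mulfI (_ : nsqc w != 0)); rewrite ?nsqc_eq0 //.
  rewrite -nsqcM !divff ?nsqc_eq0 // /nsqc /= expr1n expr0n addr0 //.
have zc0 k : zc k != 0 by rewrite -zcE conjc_eq0.
(* The quotients lam / z and gam / z are bounded, so that x1 and x2 lie in both domains. *)
have dom (w : I -> R[i]) (x y : H) (mu : I -> R) (E : operator H) : is_diag ip e mu E ->
    (forall k, mu k ^+ 2 <= modulus k ^+ 2) -> (forall k, w k != 0) ->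
    (forall k, nsqc (w k) = modulus k ^+ 2) ->
    (forall k, ip (e k) y = w k * ip (e k) x) -> opdom E x.
  move=> hE muM w0 wM hy.
  have b1 k : nsqc ((mu k)%:C / w k) <= 1.
    by rewrite nsqcM nsqcR nV // wM ler_pdivrMr // mul1r.
  have [B _ hB] := diag_op hH eON eC b1.
  have [] // := (hE x (B y)).2 _ => k; rewrite hB hy.
  by rewrite mulrA divfK.
have lM k : lam k ^+ 2 <= modulus k ^+ 2 by rewrite sqr_modulus lerDl sqr_ge0.
have gM k : gam k ^+ 2 <= modulus k ^+ 2 by rewrite sqr_modulus lerDr sqr_ge0.
have D1 : opdom D x1 by apply: (dom zc x1 y2 lam D) => // k; have [] := h k.
have D2 : opdom D x2 by apply: (dom z x2 y1 lam D) => // k; have [] := h k.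
have C1 : opdom C x1 by apply: (dom zc x1 y2 gam C) => // k; have [] := h k.
have C2 : opdom C x2 by apply: (dom z x2 y1 gam C) => // k; have [] := h k.
split=> //=; congr pair; apply: (coef_inj hH eC) => k; have [h1 h2] := h k.
  by rewrite (ipDr ipP) (ipZr ipP) (diag_coef hD) // (diag_coef hC) // h1 /z; ring.
by rewrite (ipDr ipP) (ipNr ipP) (ipZr ipP) (diag_coef hD) // (diag_coef hC) // h2 /zc; ring.
Qed.

Lemma double_eigen_abs k : `|double_eigen k| = modulus k.1.
Proof.
rewrite /double_eigen normrM (ger0_norm (ltW (modulus_gt0 _))).
by case: (k.2); rewrite ?normrN normr1 mul1r.
Qed.

Lemma modulus_le k : modulus k <= `|lam k| + `|gam k|.
Proof.
rewrite -(ler_pXn2r (n := 2)) ?nnegrE ?addr_ge0 ?sqrtr_ge0 // sqr_modulus.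
rewrite -[lam k ^+ 2]real_normK ?num_real // -[gam k ^+ 2]real_normK ?num_real //.
by have := normr_ge0 (lam k); have := normr_ge0 (gam k); nra.
Qed.

Lemma modulus_ge k : `|lam k| <= modulus k /\ `|gam k| <= modulus k.
Proof.
by split; rewrite -(ler_pXn2r (n := 2)) ?nnegrE ?normr_ge0 ?sqrtr_ge0 // sqr_modulus
  real_normK ?num_real // ?lerDl ?lerDr sqr_ge0.
Qed.

(** The Euclidean norm is Lipschitz. Only absolute values of [lam] enter, so the sign changes of the
    eigenvalue of D_q between the two types do no harm. *)
Lemma modulus_dist g h :
  `|modulus g - modulus h| <= `| `|lam g| - `|lam h| | + `|gam g - gam h|.
Proof.
have half g' h' : modulus g' - modulus h' <= `| `|lam g'| - `|lam h'| | + `|gam g' - gam h'|.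
  rewrite lerBlDr; set a := `| _ - _|; set b := `|gam g' - gam h'|.
  have a0 : 0 <= a by exact: normr_ge0. have b0 : 0 <= b by exact: normr_ge0.
  have r0' : 0 <= modulus h' by exact: sqrtr_ge0.
  have la : `|lam g'| <= `|lam h'| + a by rewrite -lerBlDl ler_norm.
  have ga : `|gam g'| <= `|gam h'| + b.
    by rewrite -lerBlDl; apply: le_trans (ler_dist_dist _ _); exact: ler_norm.
  have [lh gh] := modulus_ge h'.
  rewrite -(ler_pXn2r (n := 2)) ?nnegrE ?addr_ge0 ?sqrtr_ge0 // sqr_modulus.
  have sq := sqr_modulus h'.
  rewrite -[lam h' ^+ 2]real_normK ?num_real // -[gam h' ^+ 2]real_normK ?num_real // in sq.
  rewrite -[lam g' ^+ 2]real_normK ?num_real // -[gam g' ^+ 2]real_normK ?num_real //.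
  have := normr_ge0 (lam g'); have := normr_ge0 (gam g').
  have := normr_ge0 (lam h'); have := normr_ge0 (gam h').
  move: sq lh gh la ga; move: (`|lam g'|) (`|gam g'|) (`|lam h'|) (`|gam h'|) (modulus h') r0' a b a0 b0.
  move=> u v x y m m0 a b a0 b0 sq lh gh la ga y0 x0 v0 u0.
  have : u ^+ 2 <= (x + a) ^+ 2 by rewrite ler_pXn2r ?nnegrE // addr_ge0.
  have : v ^+ 2 <= (y + b) ^+ 2 by rewrite ler_pXn2r ?nnegrE // addr_ge0.
  have : 0 <= a * (m - x) by rewrite mulr_ge0 // subr_ge0.
  have : 0 <= b * (m - y) by rewrite mulr_ge0 // subr_ge0.
  have : 0 <= a * b by rewrite mulr_ge0.
  by nra.
rewrite ler_norml half lerNl opprB andbT.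
by rewrite distrC [X in _ <= _ + X]distrC half.
Qed.

Lemma double_band T : band_op ip e (fun k => `|lam k|) T -> band_op ip e gam T ->
  band_op (ip_pair ip) double_basis (fun k => `|double_eigen k|) (fun x => (T x.1, T x.2)).
Proof.
move=> [bT [N hN]] [_ [M hM]]; split.
  have := bounded_pair hH bT (bounded_0 ipP) (bounded_0 ipP) bT.
  by congr bounded_op; apply/funext => x; rewrite addr0 add0r.
exists (N + M)%N => g h; rewrite double_basis_ip /= !(linearEZ bT.1) !(ipZr ipP) !double_eigen_abs.
have [->|gh _] := eqVneq (ip (e g.1) (T (e h.1))) 0.
  by rewrite !mulr0 addr0 mulr0 eqxx.
apply: le_trans (modulus_dist _ _) _; rewrite natrD lerD ?hM //.
exact: hN gh.
Qed.

End Double.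

(** * The spectral triple *)

Definition count_index (x : s_label * bool) : nat := x.1.1.1.1.1.

Section LabelCounting.
Variables (L : nat).
Let box : finType := ('I_L.+1 * 'I_(4 * L).+1 * 'I_L.+1 * 'I_L.+2 * bool * bool)%type.
Let of_box (x : box) : s_label * bool :=
  let: (l, c, m, t, u, v) := x in
  (l : nat, (c : nat)%:Z - (2 * L)%N%:Z, m : nat, t : nat, u, v).

(** The box has (L+1) (4L+1) (L+1) (L+2) times 4 elements; bounding 4L+1 by 4 (L+1) and L+2 by 2
    (L+1) gives the constant 32. *)
Lemma label_count (s : seq (s_label * bool)) : uniq s ->
  (forall k, k \in s -> let: (l, c, m, t, u, v) := k in
     [/\ (l <= L)%N, (`|c| <= 2 * L)%N, (m <= L)%N & (t <= L.+1)%N]) ->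
  (size s <= 32 * L.+1 ^ 4)%N.
Proof.
move=> us hs; have sub : {subset s <= [seq of_box x | x <- enum box]}.
  move=> [[[[[l c] m] t] u] v] /hs[ll cl ml tl].
  have cb : (absz (c + (2 * L)%N%:Z)%R < (4 * L).+1)%N by lia.
  apply/mapP; exists (inord l, Ordinal cb, inord m, inord t, u, v); first by rewrite mem_enum.
  rewrite /of_box /= !inordK // gez0_abs ?addrK //; lia.
apply: leq_trans (uniq_leq_size us sub) _.
rewrite size_map -cardE !card_prod !card_ord !card_bool.
by rewrite !expnS expn0; nia.
Qed.

End LabelCounting.

Section LabelBox.
Variables (M : nat).
Hypothesis M0 : (0 < M)%N.

(** Even spins and even charges satisfy the parity condition, and spins at least [2 * M] leave room
    for [M] rows and [M] weights, independently. *)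
Let of_box (x : 'I_M * 'I_M * 'I_M * 'I_M) : s_label * bool :=
  let: (a, b, i, j) := x in
  ((2 * M + 2 * a)%N, ((2 * b)%N : int), i : nat, j : nat, true, true).

Lemma label_box : exists s : seq (s_label * bool), [/\ uniq s, size s = (M ^ 4)%N &
  forall k, k \in s -> spin_good k.1 /\ [/\ k.1.2, (k.1.1.1.1.1 <= 4 * M)%N & (`|k.1.1.1.1.2| <= 2 * M)%N]].
Proof.
exists [seq of_box x | x <- enum {: 'I_M * 'I_M * 'I_M * 'I_M}]; split.
- rewrite map_inj_uniq ?enum_uniq // => -[[[a b] i] j] [[[a' b'] i'] j'] [].
  move=> /eqP; rewrite eqn_add2l eqn_mul2l /= => /eqP/val_inj ->.
  by move=> /eqP; rewrite eqn_mul2l /= => /eqP/val_inj -> /val_inj -> /val_inj ->.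
- by rewrite size_map -cardE !card_prod !card_ord !expnS expn0; ring.
move=> k /mapP[[[[a b] i] j] _ ->]; rewrite /of_box /spin_good /oddz /=.
have := ltn_ord a; have := ltn_ord b; have := ltn_ord i; have := ltn_ord j.
rewrite !mul2n oddD !odd_double /= => *; split; last by split=> //; lia.
by apply/andP; split; lia.
Qed.

End LabelBox.

Lemma ffun_comb (K : nzRingType) (V : lmodType K) (z : K) (u v : {ffun 'I_2 -> V}) i :
  (z *: u + v) i = z *: u i + v i.
Proof. by rewrite !ffunE. Qed.

Section SpectralTriple.
Variables (R : realType) (q : R).
Hypothesis hq : 0 < q < 1.
Variables (L : lmodType R[i]) (ip : L -> L -> R[i]) (Lam : CU R -> L).
Hypothesis hL : is_L2 q ip Lam.

Let hH : hilbert_space (ipV ip) := hilbert_V hL.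
Let ipP : inner_product (ipV ip) := hH.1.
Local Notation E := (E_vec q Lam).
Let eON : orthonormal (ipV ip) E := E_vec_on hq hL.
Let eC : complete_family (ipV ip) E. Proof. by move=> x; exact: (E_vec_complete hq hL). Qed.
Let hD := dirac_diag hq hL.
Let hC := charge_diag hq hL.
Local Notation D := (Defs.dirac q ip Lam).
Local Notation C := (charge_op ip Lam).
Let lD : linear_on_dom D := diag_linear hH hD.
Let lC : linear_on_dom C := diag_linear hH hC.

Definition mul_V (t : CU R) (x : HV L) : HV L := [ffun i => left_mul q ip Lam t (x i)].

(** The properties are chosen to be stable under linear combinations and products, so that
    generators suffice. The bounded commutator with [D] is a separate condition, since the band
    condition only concerns its absolute value. *)
Definition smooth_op (T : HV L -> HV L) : Prop :=
  [/\ exists B, commutator_ext (ipV ip) D T B, exists B, commutator_ext (ipV ip) C T B,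
      band_op (ipV ip) E (fun k => `|spin_dirac R k|) T & band_op (ipV ip) E (spin_charge R) T].

Lemma smooth_lin a S T : smooth_op S -> smooth_op T -> smooth_op (fun x => a *: S x + T x).
Proof.
move=> [[B1 h1] [B2 h2] h3 h4] [[B1' h1'] [B2' h2'] h3' h4']; split.
- by eexists; exact: (commutator_ext_lin ipP lD a h1 h1').
- by eexists; exact: (commutator_ext_lin ipP lC a h2 h2').
- exact: (band_lin hH).
- exact: (band_lin hH).
Qed.

Lemma smooth_comp S T : smooth_op S -> smooth_op T -> smooth_op (fun x => S (T x)).
Proof.
move=> [[B1 h1] [B2 h2] h3 h4] [[B1' h1'] [B2' h2'] h3' h4']; split.
- by eexists; exact: (commutator_ext_comp ipP h3.1 h3'.1 h1 h1').
- by eexists; exact: (commutator_ext_comp ipP h3.1 h3'.1 h2 h2').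
- exact: (band_comp hH eON eC).
- exact: (band_comp hH eON eC).
Qed.

Lemma band_id r : band_op (ipV ip) E r id.
Proof.
split=> [|]; first exact: bounded_id.
exists 0%N => g h; have [->|gh] := eqVneq g h; first by rewrite subrr normr0.
by rewrite (on_orth eON gh) eqxx.
Qed.

Lemma smooth_id : smooth_op id.
Proof.
by split; try (by eexists; exact: (commutator_ext_id ipP)); exact: band_id.
Qed.

Lemma smooth_gen d (a b : bool) : (d == 1) || (d == -1) ->
  smooth_op (mul_V (attach d (tsu R 1 a b))).
Proof.
move=> d1; have od : oddz d by case/orP: d1 => /eqP ->.
set T := mul_V _; have bT : bounded_op (ipV ip) T.
  exact: (bounded_ffun (L2_hilbert hL) 2 (left_mulP hq hL _).1).
have TF := left_mul_F hq hL a b od.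
have dr : `|d%:~R / 2| <= 1 :> R.
  by case/orP: d1 => /eqP ->; rewrite ?rmorphN ?mulNr ?normrN /= normrM normr1 mul1r normfV ger0_norm //;
    rewrite invf_le1 ?ler1n.
have chg g h : ipV ip (E g) (T (E h)) != 0 -> spin_charge R g - spin_charge R h = d%:~R / 2.
  exact: (spin_charge_comm hq hH (F_vec_on hq hL) (F_vec_neq0 hq hL) od bT TF).
split.
- have [B bB hB] := spin_dirac_comm hq hH (F_vec_on hq hL) (F_vec_complete hq hL) (F_vec_neq0 hq hL) od bT TF.
  by exists B; exact: (commutator_ext_coef hH eON eC hD bT bB hB).
- exists (fun x => (d%:~R / 2)%:C *: T x); apply: (commutator_ext_coef hH eON eC hC bT).
    exact: (bounded_Z ipP).
  move=> g h; rewrite (ipZr ipP).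
  by have [->|/chg ->] := eqVneq (ipV ip (E g) (T (E h))) 0; rewrite ?mulr0.
- split=> //; exists 1%N => g h.
  exact: (spin_dirac_band hq hH (F_vec_on hq hL) (F_vec_neq0 hq hL) od bT TF).
- by split=> //; exists 1%N => g h /chg ->.
Qed.

Let mul_VE t x i : mul_V t x i = left_mul q ip Lam t (x i).
Proof. exact: ffunE. Qed.

Lemma mul_V_lin z s t : mul_V (z *: s + t) = (fun x => z *: mul_V s x + mul_V t x).
Proof.
apply/funext => x; apply/ffunP => i.
apply: etrans (mul_VE _ _ _) (etrans (left_mul_linear hq hL z s t (x i)) _).
apply: etrans (esym (ffun_comb _ _ _ _)).
exact: (f_equal2 (fun u v => z *: u + v) (esym (mul_VE s x i)) (esym (mul_VE t x i))).
Qed.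

Lemma mul_VM s t : mul_V (u_mul q s t) = (fun x => mul_V s (mul_V t x)).
Proof.
apply/funext => x; apply/ffunP => i.
apply: etrans (mul_VE _ _ _) (etrans (left_mulM hq hL s t (x i)) _).
apply: etrans (esym (mul_VE s _ i)).
exact: (congr1 (left_mul q ip Lam s) (esym (mul_VE t x i))).
Qed.

Lemma mul_V1 : mul_V (u_one R) = id.
Proof.
apply/funext => x; apply/ffunP => i.
exact: etrans (ffunE _ _) (left_mul1 hq hL (x i)).
Qed.

Lemma smooth_mul t : smooth_op (mul_V t).
Proof.
move: t; apply: (u_gen_ind hq) => [z s t hs ht|s t hs ht||d a b d1].
- by rewrite mul_V_lin; exact: smooth_lin.
- by rewrite mul_VM; exact: smooth_comp.
- by rewrite mul_V1; exact: smooth_id.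
- exact: smooth_gen.
Qed.

Let lam0 k : spin_dirac R k != 0.
Proof.
by rewrite -normr_gt0 spin_dirac_abs -addrA ltr_wpDl // ltr_wpDl //; lra.
Qed.

Local Notation Eh := (double_basis E (spin_dirac R) (spin_charge R)).
Local Notation lamh := (double_eigen (spin_dirac R) (spin_charge R)).
Local Notation Dh := (dirac_hat q ip Lam).

Let hHh : hilbert_space (ip_hat ip) := hilbert_pair hH.
Let hON : orthonormal (ip_hat ip) Eh. Proof. exact: (double_on hH eON _ lam0). Qed.
Let hCmp : complete_family (ip_hat ip) Eh.
Proof. by move=> x; exact: (double_complete hH eC lam0). Qed.
Let hDh : is_diag (ip_hat ip) Eh lamh Dh.
Proof. exact: (double_diag hH eON eC lam0 hD hC). Qed.

Let rhoE t : rho_hat q ip Lam t = (fun x => (mul_V t x.1, mul_V t x.2)).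
Proof. by []. Qed.

Lemma rho_commutator t : exists B, commutator_ext (ip_hat ip) Dh (rho_hat q ip Lam t) B.
Proof.
have [[B hB] [B' hB'] [bT _] _] := smooth_mul t.
by eexists; exact: (double_commutator hH bT hB hB').
Qed.

Lemma rho_band t : band_op (ip_hat ip) Eh (fun k => `|lamh k|) (rho_hat q ip Lam t).
Proof. by have [_ _ h1 h2] := smooth_mul t; exact: (double_band hH lam0 h1 h2). Qed.

Lemma rho_star_representation :
  faithful_star_representation (u_mul q) (u_one R) (u_star q) (ip_hat ip) (rho_hat q ip Lam).
Proof.
split; first split.
- by move=> t; have [] := rho_band t.
- by move=> a s t x; rewrite !rhoE !mul_V_lin.
- by move=> s t x; rewrite !rhoE !mul_VM.
- by move=> [x y]; rewrite rhoE mul_V1.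
- move=> t x y; apply: (f_equal2 +%R); apply: eq_bigr => i _;
    rewrite [X in ip X _ = _]ffunE [X in _ = ip _ X]ffunE; exact: (left_mul_star hq hL t).
move=> s t st; apply: (left_mul_inj hq hL) => x.
pose y : HV L := [ffun=> x]; have yE : y ord0 = x by rewrite ffunE.
have := congr1 (fun f : Hhat L -> Hhat L => (f (y, y)).1 ord0) st.
by move=> h; have := etrans (esym (mul_VE s y ord0)) (etrans h (mul_VE t y ord0)); rewrite yE.
Qed.

(** An entry of a commutator with the Dirac operator is a multiple of the corresponding entry of
    [rho_hat], so the commutators lie in the same band and need no estimate of their own. *)
Lemma generated_band T : generated_op (ip_hat ip) (rho_hat q ip Lam) Dh T ->
  band_op (ip_hat ip) Eh (fun k => `|lamh k|) T.
Proof.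
elim=> {T} [t|t B hB|a S T _ hS _ hT|S T _ hS _ hT].
- exact: rho_band.
- have [bT [N hN]] := rho_band t; split; first by case: hB.
  exists N => g h; rewrite (commutator_coef hHh hON g h hDh bT hB) mulf_eq0 negb_or => /andP[_].
  exact: hN.
- exact: (band_lin hHh).
- exact: (band_comp hHh hON hCmp).
Qed.

Lemma dirac_hat_regular : regular_triple (ip_hat ip) (rho_hat q ip Lam) Dh.
Proof.
have [P hP] := diag_exists hHh hCmp (fun k => `|lamh k|).
exists P; first exact: (diag_abs hHh hON hCmp hDh hP).
move=> k T /generated_band; exact: (band_in_dom_delta hHh hON hCmp k hP).
Qed.

Lemma gamma_chirality : is_chirality (ip_hat ip) (rho_hat q ip Lam) Dh (@gamma_hat R L).
Proof.
split.
- have bN : bounded_op (ipV ip) (fun x => (-1) *: id x) by apply: (bounded_Z ipP); exact: bounded_id.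
  have := bounded_pair hH (bounded_id (ipV ip)) (bounded_0 ipP) (bounded_0 ipP) bN.
  by congr bounded_op; apply/funext => x; rewrite /gamma_hat addr0 add0r scaleN1r.
- by move=> x y; rewrite /ip_hat /gamma_hat /= (ipNl ipP) (ipNr ipP).
- by move=> [x y]; rewrite /gamma_hat /= opprK.
- move=> [x y] [/= x1 x2 y1 y2].
  have [y1' e1] := opp_on_dom lD y1; have [y2' e2] := opp_on_dom lC y2; split=> //.
  apply: (f_equal2 pair); last exact: addNr.
  change ('i *: D y + C y + ('i *: D (- y) + C (- y)) = 0).
  by rewrite e1 e2 scalerN -opprD subrr.
- move=> t [x y]; rewrite /gamma_hat !rhoE; congr pair.
  have [_ _ [[lT _] _] _] := smooth_mul t; exact/esym/(linearEN lT).
Qed.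

Let Eh_neq0 k : (Eh k != 0) = spin_good k.1.
Proof. by rewrite double_neq0 (E_vec_neq0 hq hL). Qed.

Lemma dirac_hat_dixmier : in_dixmier (ip_hat ip) Dh 4.
Proof.
apply: (dixmier4 hHh hON hCmp hDh (C := 32)).
  move=> N s us hs; rewrite -natrX -natrM ler_nat; apply: label_count => // -[[[[[l c] m] t] u] v].
  move=> /hs; rewrite Eh_neq0 /= => -[/and4P[_ ml _ tl]].
  rewrite (double_eigen_abs _ lam0) => rN.
  have [h1 h2] := modulus_ge (spin_dirac R) (spin_charge R) (l, c, m, t, u).
  have := le_trans h1 rN; have := le_trans h2 rN; rewrite spin_dirac_abs /= => cN lN.
  have u0 : 0 <= u%:R :> R by rewrite ler0n.
  have ll : (l <= N)%N by rewrite -(ler_nat R); lra.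
  have uN : (l + u <= N)%N by rewrite -(ler_nat R) natrD; lra.
  split=> //.
  - rewrite -(ler_nat R) natrM; move: cN; rewrite normrM normfV (ger0_norm (ler0n R 2)).
    rewrite ler_pdivrMr // [_ * 2]mulrC natr_absz; by rewrite -intr_norm.
  - exact: leq_trans ml ll.
  - by apply: leq_trans tl _; rewrite leqW.
move=> s; pose n := (\max_(k <- s) count_index k).+1.
exists (n.*2, 0, 0%N, 0%N, true, true); first by rewrite Eh_neq0; apply/and4P; split=> //; rewrite odd_double.
apply/negP => ks; have := @leq_bigmax_seq _ s xpredT count_index _ ks isT.
by rewrite [count_index _]/= leqNgt -addnn /n addSn ltnS leq_addr.
Qed.

Lemma dirac_hat_dixmier_ge (m : int) : in_dixmier (ip_hat ip) Dh m -> 4 <= m.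
Proof.
(* On the box the modulus is at most 4M + 3/2 from D_q plus M from the charge, hence at most 7M for
   M >= 1. *)
apply: (dixmier_ge4 hHh hON hCmp hDh (c := 7)) => // M M0.
have [s [us ss hs]] := label_box M0; exists s; split=> // k /hs[kg [ku kl kc]].
rewrite Eh_neq0 kg; split=> //; rewrite (double_eigen_abs _ lam0).
apply: le_trans (modulus_le _ _ _) _; rewrite spin_dirac_abs ku.
move: kl kc; case: k {kg ku} => [[[[[l c] m'] t] u] v] /= kl kc.
have cM : `|c%:~R / 2| <= M%:R :> R.
  rewrite normrM normfV (ger0_norm (ler0n R 2)) ler_pdivrMr // -intr_norm -natr_absz.
  by rewrite -natrM ler_nat mulnC.
have lM : l%:R <= 4 * M%:R :> R by rewrite -natrM ler_nat.
have M1 : 1 <= M%:R :> R by rewrite ler1n.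
by rewrite mulr1n; lra.
Qed.

Lemma dirac_hat_triple :
  even_regular_spectral_triple (u_mul q) (u_one R) (u_star q)
      (ip_hat ip) (rho_hat q ip Lam) (dirac_hat q ip Lam) 4
      (@gamma_hat R L).
Proof.
split; last exact: dirac_hat_regular.
- split.
  + exact: (u_star_algebra hq).
  + by split; [exact: hHh | exact: (complete_separable hHh hON hCmp)].
  + exact: rho_star_representation.
  + exact: (diag_self_adjoint hHh hON hCmp hDh).
  + exact: rho_commutator.
- by split; [exact: dirac_hat_dixmier | exact: dirac_hat_dixmier_ge].
- exact: gamma_chirality.
Qed.

End SpectralTriple.

(* The first conjunct records that the completion L^2(U_q(2)) exists; it is
   unique up to unitary isomorphism, and the second one is about all of its
   realizations. *)
Theorem mainTheorem3 (R : realType) (q : R) (hq : 0 < q < 1) :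
  (exists (L : lmodType R[i]) (ip : L -> L -> R[i]) (Lam : CU R -> L),
     is_L2 q ip Lam) /\
  forall (L : lmodType R[i]) (ip : L -> L -> R[i]) (Lam : CU R -> L),
    is_L2 q ip Lam ->
    even_regular_spectral_triple (u_mul q) (u_one R) (u_star q)
      (ip_hat ip) (rho_hat q ip Lam) (dirac_hat q ip Lam) 4
      (@gamma_hat R L).
Proof.
split; first exact: (L2_exists hq).
move=> L ip Lam hL; exact: (dirac_hat_triple hq hL).
Qed.
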